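(* The generalized character $W(\tau_1,\tau_3,\tau_5,\ldots)$ of $W=M(1)\otimes F$, given by $$W(\tau_1,\tau_3,\ldots)=\left(\prod_{j\ge1}q_{2j-1}^{\frac12\zeta(1-2j)-\frac12\zeta(1-2j,\frac12)}\right)\prod_{n=1}^{\infty}\frac{1+q_1^{\,n-\frac12}q_3^{(n-\frac12)^3}q_5^{(n-\frac12)^5}\cdots}{1-q_1^{\,n}q_3^{\,n^3}q_5^{\,n^5}\cdots},\qquad q_i=e^{2\pi i\tau_i},$$ is a quasimodular form of weight $-\frac12$ (with respect to $\Gamma(4)$).
   Context: $M(1)=\mathbb{C}[h(-1),h(-2),\dots]$ is the Fock module of the Heisenberg algebra $[h(m),h(n)]=m\delta_{m+n,0}$, and $F=\bigwedge(\varphi(-1/2),\varphi(-3/2),\dots)$ is the Fock module of $\varphi(m)\varphi(n)+\varphi(n)\varphi(m)=\delta_{m+n,0}$, $m,n\in\mathbb{Z}+\frac12$. The generalized character is $\mathrm{tr}|_W\, q_1^{L_1}q_3^{L_3}q_5^{L_5}\cdots$, where $$L_{2j-1}=\sum_{n\ge1}n^{2j-2}h(-n)h(n)+\tfrac12\zeta(1-2j)+\sum_{k\in\frac12+\mathbb{Z}_{\ge0}}k^{2j-1}\varphi(-k)\varphi(k)-\tfrac12\zeta(1-2j,\tfrac12),$$ and it equals the product displayed in the claim. Here $\zeta(s)$ is the Riemann zeta function and $\zeta(s,u)$ the Hurwitz zeta function. The series is expanded as a formal power series in $\tau_3,\tau_5,\dots$ with coefficients that are analytic functions of $\tau_1$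 in the upper half plane $\mathbb{H}$: $$W(\tau_1,\tau_3,\ldots)=\sum_{I}m_I(\tau_1)\,\frac{\tau_3^{a_3}\tau_5^{a_5}\cdots}{|I|!},$$ where $I$ runs over multi-indices $(a_3,a_5,\ldots)$ of nonnegative integers with finitely many nonzero entries and $|I|=\sum_i a_i$. Put $\mathrm{wt}(I)=4a_3+6a_5+8a_7+\cdots=\sum_i(i+1)a_i$. For $\Gamma\subset SL(2,\mathbb{Z})$ of finite index, quasimodular forms form the ring $\mathcal{M}(\Gamma)\otimes\mathbb{C}[G_2]$, where $\mathcal{M}(\Gamma)$ is the ring of modular forms and $G_2=\frac{\zeta(-1)}2+\sum_{n\ge1}(\sum_{d\mid n}d)q^n$ is given weight 2. In half-integral weight $k$ this is understood as follows: $\mathcal{QM}_k(\Gamma)$ consists of finite sums $\sum_j f_jG_2^j$, where $f_j$ is holomorphic on $\mathbb{H}$, meromorphic at the cusps, and transforms under $\Gamma$ as a modular form of weight $k-2j$, with one multiplier system common to all $f_j$ (up to the integral-weight automorphy factors). The series $W$ is called a quasimodular form of weight $n$ with respect to $\Gamma$ if $m_I\in\mathcal{QM}_{n+\mathrm{wt}(I)}(\Gamma)$ for every $I$. *)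

(* Defs.v *)
From Stdlib Require Import Reals ZArith List Lia ClassicalEpsilon.
From Coquelicot Require Import Coquelicot.
Import ListNotations.

Open Scope C_scope.

(** * Complex functions *)

Definition Cexp (z : C) : C :=
  RtoC (exp (Re z)) * (cos (Im z), sin (Im z)).

(** [e2pi z] is exp(2 pi i z). *)
Definition e2pi (z : C) : C := Cexp (2 * PI * Ci * z).

(** Principal argument, with values in (-pi, pi]. *)
Definition Carg (z : C) : R :=
  if Rle_dec 0 (Im z) then acos (Re z / Cmod z) else (- acos (Re z / Cmod z))%R.

(** Principal branch of z^k, for z <> 0 and a real exponent k. *)
Definition Crpow (z : C) (k : R) : C :=
  RtoC (Rpower (Cmod z) k) * (cos (k * Carg z), sin (k * Carg z)).

Definition CSeries (a : nat -> C) : C :=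
  (Series (fun n => Re (a n)), Series (fun n => Im (a n))).

Definition CLim_seq (a : nat -> C) : C :=
  (real (Lim_seq (fun n => Re (a n))), real (Lim_seq (fun n => Im (a n)))).

Definition upper_half_plane (tau : C) : Prop := (0 < Im tau)%R.

Definition holomorphic_on (U : C -> Prop) (f : C -> C) : Prop :=
  forall z, U z -> ex_derive (K := C_AbsRing) (V := C_NormedModule) f z.

(** * The Riemann and Hurwitz zeta functions *)

Definition analytic_at (f : C -> C) (z0 : C) : Prop :=
  exists (a : nat -> C) (r : R), (0 < r)%R /\
    forall z, (Cmod (z - z0) < r)%R ->
      is_series (V := C_NormedModule) (fun n => a n * Cpow (z - z0) n) (f z).

Definition is_hurwitz_zeta (a : R) (Z : C -> C) : Prop :=
  (forall s, s <> RtoC 1 -> analytic_at Z s) /\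
  (forall s, (1 < Re s)%R ->
     is_series (V := C_NormedModule)
       (fun n => Cexp (- s * RtoC (ln (INR n + a)))) (Z s)).

(** The analytic continuation to C \ {1}; the value at s = 1 is unspecified. *)
Definition hurwitz_zeta (s : C) (a : R) : C :=
  epsilon (inhabits (fun _ : C => RtoC 0)) (is_hurwitz_zeta a) s.

Definition zeta (s : C) : C := hurwitz_zeta s 1.

(** * Formal power series in tau_3, tau_5, tau_7, ... *)

(** The list [[a_3; a_5; ...; a_(2l+1)]] stands for the multi-index
    (a_3, a_5, ..., a_(2l+1), 0, 0, ...); lists that differ by trailing zeros
    stand for the same multi-index, and all series below have the same
    coefficient at them. *)
Definition multi_index := list nat.

Definition mi_size (I : multi_index) : nat := list_sum I.

Fixpoint mi_wt_from (i : nat) (I : multi_index) : nat :=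
  match I with
  | [] => 0
  | a :: I' => (i + 1) * a + mi_wt_from (i + 2) I'
  end.

(** 4 a_3 + 6 a_5 + 8 a_7 + ... *)
Definition mi_wt (I : multi_index) : nat := mi_wt_from 3 I.

Definition mi_is_zero (I : multi_index) : bool := forallb (Nat.eqb 0) I.

(** All pairs (J, K) with J + K = I. *)
Fixpoint mi_splits (I : multi_index) : list (multi_index * multi_index) :=
  match I with
  | [] => [([], [])]
  | a :: I' =>
      flat_map (fun j => map (fun p => (j :: fst p, (a - j)%nat :: snd p))
                             (mi_splits I'))
               (seq 0 (S a))
  end.

Definition mps := multi_index -> C.

Definition mps_one : mps := fun I => if mi_is_zero I then RtoC 1 else RtoC 0.
Definition mps_add (f g : mps) : mps := fun I => f I + g I.
Definition mps_sub (f g : mps) : mps := fun I => f I - g I.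
Definition mps_scale (c : C) (f : mps) : mps := fun I => c * f I.
Definition mps_mul (f g : mps) : mps := fun I =>
  fold_right Cplus (RtoC 0) (map (fun p => f (fst p) * g (snd p)) (mi_splits I)).

Fixpoint mps_pow (f : mps) (k : nat) : mps :=
  match k with
  | O => mps_one
  | S k' => mps_mul f (mps_pow f k')
  end.

(** Multiplicative inverse of a series with constant term f0 <> 0: writing
    f = f0 (1 - v), it is f0^-1 (1 + v + v^2 + ...), and v^k does not
    contribute to the coefficient at I when k > |I|. *)
Definition mps_inv (f : mps) : mps := fun I =>
  let f0 := f [] in
  let v := mps_sub mps_one (mps_scale (/ f0) f) in
  / f0 * sum_n (fun k => mps_pow v k I : C) (mi_size I).

(** * The generalized character *)

(** Coefficient of tau^I in the product over l of
    exp(2 pi i (c l) tau_(2l+3)). *)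
Fixpoint exp_coeff (c : nat -> C) (I : multi_index) : C :=
  match I with
  | [] => 1
  | a :: I' => Cpow (2 * PI * Ci * c O) a / RtoC (INR (fact a))
               * exp_coeff (fun l => c (S l)) I'
  end.

(** q_1^(c 0) q_3^(c 1) q_5^(c 2) ... *)
Definition q_monomial (c : nat -> C) (tau1 : C) : mps := fun I =>
  e2pi (c O * tau1) * exp_coeff (fun l => c (S l)) I.

Definition odd_powers (x : R) : nat -> C := fun l => RtoC (x ^ (2 * l + 1)).

(** The exponent of q_(2j-1) in the prefactor, with j = l + 1. *)
Definition vacuum_exponents : nat -> C := fun l =>
  let j := INR (S l) in
  / 2 * zeta (RtoC (1 - 2 * j)) - / 2 * hurwitz_zeta (RtoC (1 - 2 * j)) (1 / 2).

Definition character_factor (n : nat) (tau1 : C) : mps :=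
  mps_mul
    (mps_add mps_one (q_monomial (odd_powers (INR n - 1 / 2)) tau1))
    (mps_inv (mps_sub mps_one (q_monomial (odd_powers (INR n)) tau1))).

(** The prefactor times the factors with 1 <= n <= N. *)
Fixpoint character_partial (N : nat) (tau1 : C) : mps :=
  match N with
  | O => q_monomial vacuum_exponents tau1
  | S N' => mps_mul (character_partial N' tau1) (character_factor N tau1)
  end.

(** The infinite product, taken coefficientwise. *)
Definition generalized_character (tau1 : C) : mps := fun I =>
  CLim_seq (fun N => character_partial N tau1 I).

(** The functions m_I, normalized by W = sum_I m_I(tau_1) tau^I / |I|!. *)
Definition character_coeff (I : multi_index) (tau1 : C) : C :=
  RtoC (INR (fact (mi_size I))) * generalized_character tau1 I.

(** * Quasimodular forms *)

Record SL2Z := mkSL2Z {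
  sa : Z; sb : Z; sc : Z; sd : Z;
  sdet : (sa * sd - sb * sc = 1)%Z }.

Lemma SL2Z_mul_det (g h : SL2Z) :
  ((sa g * sa h + sb g * sc h) * (sc g * sb h + sd g * sd h)
   - (sa g * sb h + sb g * sd h) * (sc g * sa h + sd g * sc h) = 1)%Z.
Proof.
  transitivity ((sa g * sd g - sb g * sc g) * (sa h * sd h - sb h * sc h))%Z.
  - ring.
  - now rewrite !sdet.
Qed.

Definition SL2Z_mul (g h : SL2Z) : SL2Z :=
  {| sa := sa g * sa h + sb g * sc h; sb := sa g * sb h + sb g * sd h;
     sc := sc g * sa h + sd g * sc h; sd := sc g * sb h + sd g * sd h;
     sdet := SL2Z_mul_det g h |}.

(** The principal congruence subgroup of level N. *)
Definition Gamma (N : Z) (g : SL2Z) : Prop :=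
  (N | sa g - 1)%Z /\ (N | sb g)%Z /\ (N | sc g)%Z /\ (N | sd g - 1)%Z.

Definition denom (g : SL2Z) (tau : C) : C :=
  RtoC (IZR (sc g)) * tau + RtoC (IZR (sd g)).

Definition moebius (g : SL2Z) (tau : C) : C :=
  (RtoC (IZR (sa g)) * tau + RtoC (IZR (sb g))) / denom g tau.

Definition multiplier_system (G : SL2Z -> Prop) (k : R) (v : SL2Z -> C) : Prop :=
  (forall g, G g -> Cmod (v g) = 1%R) /\
  (forall g h tau, G g -> G h -> upper_half_plane tau ->
     v (SL2Z_mul g h) * Crpow (denom (SL2Z_mul g h) tau) k
     = v g * v h * Crpow (denom g (moebius h tau)) k * Crpow (denom h tau) k).

Definition slash (f : C -> C) (k : R) (g : SL2Z) (tau : C) : C :=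
  Crpow (denom g tau) (- k) * f (moebius g tau).

(** At every cusp the Fourier expansion has a finite principal part.  The real
    shift [kappa], which may be negative, accounts both for the order of the
    pole and for the fractional exponents caused by a multiplier system. *)
Definition meromorphic_at_cusps (k : R) (f : C -> C) : Prop :=
  forall g : SL2Z, exists (h : nat) (kappa : R) (a : nat -> C),
    (0 < h)%nat /\
    forall tau, upper_half_plane tau ->
      is_series (V := C_NormedModule)
        (fun n => a n * e2pi (RtoC ((INR n + kappa) / INR h) * tau))
        (slash f k g tau).

(** Holomorphic on the upper half plane, meromorphic at the cusps, and
    transforming under G with weight k and multiplier v. *)
Definition modular_form (G : SL2Z -> Prop) (k : R) (v : SL2Z -> C) (f : C -> C)
    : Prop :=
  holomorphic_on upper_half_plane f /\
  (forall g tau, G g -> upper_half_plane tau ->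
     f (moebius g tau) = v g * Crpow (denom g tau) k * f tau) /\
  meromorphic_at_cusps k f.

Definition sigma1 (n : nat) : nat :=
  list_sum (filter (fun d => Nat.eqb (n mod d) 0) (seq 1 n)).

(** The term n = 0 of the series vanishes, since [sigma1 0 = 0]. *)
Definition G2 (tau : C) : C :=
  zeta (RtoC (-1)) / 2
  + CSeries (fun n => RtoC (INR (sigma1 n)) * e2pi (RtoC (INR n) * tau)).

(** The space QM_k(G), for half-integral k.  The multiplier system [v] of
    weight k is also one of weight k - 2j, as z^(k - 2j) = z^k z^(-2j) with
    principal branches. *)
Definition quasimodular_form (G : SL2Z -> Prop) (k : R) (f : C -> C) : Prop :=
  exists (v : SL2Z -> C) (d : nat) (F : nat -> C -> C),
    multiplier_system G k v /\
    (forall j, (j <= d)%nat -> modular_form G (k - 2 * INR j) v (F j)) /\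
    (forall tau, upper_half_plane tau ->
       f tau = sum_n (fun j => F j tau * Cpow (G2 tau) j : C) d).

Definition quasimodular_series (G : SL2Z -> Prop) (n : R)
    (m : multi_index -> C -> C) : Prop :=
  forall I : multi_index, quasimodular_form G (n + INR (mi_wt I)) (m I).

(* Main.v *)
Require Import Defs.
From Stdlib Require Import Reals ZArith List Lia Lra Psatz ClassicalEpsilon FunctionalExtensionality.
From Stdlib Require Ranalysis5.
From Coquelicot Require Import Coquelicot.
Import ListNotations.

(** Write q = e(tau_1) and y = e((tau_1 + 1)/2), so that y^2 = q.  The proof takes the logarithm of the
    product: the Taylor coefficients of log W are derivatives of Eisenstein series, and those of W are
    recovered from them by a recursion on the degree.

    Let theta multiply the term of a series at the multi-index K by |K|.  For one factor
    1 - x q_3^(n^3) q_5^(n^5)..., the coefficient of theta log at K is, up to a constant depending on K only,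
    the sum of n^s r^t x^r over r, where t = |K| - 1 and s is the sum of the entries of K weighted by the
    exponents 3, 5, 7, ... ([dlog_spec]).  The denominator has x = q^n; the numerator has x = y^(2n-1) with
    n - 1/2 in place of n, so it gives 2^(-s) times a sum over odd integers, which is the sum over all
    integers minus the sum over even ones.  Regrouping by N = n r, the total is 2 A(q) - 2^(-s) A(y), where
    A(x) is the sum of N^t sigma_(s-t)(N) x^N.  As s - t is odd, A is the t-th derivative of the Eisenstein
    series of the even weight k = s - t + 1, up to its constant term.  That term matters only for |K| = 1,
    and there the prefactor supplies it, its exponents being values of zeta(s) and zeta(s,1/2) at negative
    odd integers ([zeta_neg], [hurwitz_half_neg], [Lam_limit]).

    Hence theta W = W Lambda, where Lambda_K is the t-th derivative of a modular form of weight k, of total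
    weight k + 2t = wt(K).  Solving for the coefficients of W by induction on |I| shows that m_I is m_0 times
    a polynomial in such derivatives, isobaric of weight wt(I) ([coefficient_limit]).  Polynomials in G_2 over
    the modular forms are closed under differentiation ([qm_D]), because G_2 is modular up to the
    explicit anomaly of [Gk_2_inv_neg]; so m_I / m_0 is quasimodular of weight wt(I).

    The function m_0 is a constant times eta((tau+1)/2)/eta(tau)^2, which has weight -1/2.  All cusps are
    treated at once: the functions f(tau), f(2 tau), f(tau/2), f((tau+1)/2) form a family indexed by row
    vectors modulo 2, permuted by the modular group ([hecke_cov], [cov_sl2]).  The group Gamma(4) fixes the
    index (1,1), and the expansions of all members in powers of e(tau/2) are the expansions at the cusps.  For
    m_0 this applies to the squares; extracting the square root costs a constant of modulus 1, as the upper
    half plane is connected ([mhalf_sl2]), and these constants form the multiplier system.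

    The transformation laws of the G_k come from lattice sums over squares, which are invariant under the
    quarter turn (m,n) -> (n,-m); the Lipschitz formula ([lipschitz]) turns the rows of the lattice into
    q-series.  The same formula evaluates the regularized power sums [ell], which are the coefficients of the
    Euler-Maclaurin continuation of the zeta function ([zcont]). *)

Open Scope C_scope.

(** * Limits of complex functions along filters *)

(** By epsilons in the distance of C, so that one notion serves sequences, punctured neighbourhoods and
    families of partial sums. *)
Definition flim {T} (F : (T -> Prop) -> Prop) (f : T -> C) (l : C) : Prop :=
  forall eps : R, (0 < eps)%R -> F (fun t => (Cmod (f t - l) < eps)%R).

Lemma C_ext (x y : C) : Re x = Re y -> Im x = Im y -> x = y.
Proof. destruct x, y; simpl; intros; subst; auto. Qed.

Lemma Cmod_minus_sym (x y : C) : Cmod (x - y) = Cmod (y - x).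
Proof. rewrite <- Cmod_opp. f_equal. ring. Qed.

Lemma Cmod_minus_le (x y : C) : (Cmod (x - y) <= Cmod x + Cmod y)%R.
Proof. unfold Cminus. rewrite <- (Cmod_opp y). apply Cmod_triangle. Qed.

Lemma im_le_Cmod (c : C) : (Rabs (Im c) <= Cmod c)%R.
Proof.
  destruct c as [x y]. eapply Rle_trans; [|apply (Rmax_Cmod (x, y))].
  apply Rmax_r.
Qed.

Lemma Cmod_le_ReIm (c : C) : (Cmod c <= Rabs (Re c) + Rabs (Im c))%R.
Proof.
  destruct c as [x y].
  replace (x, y) with (RtoC x + Ci * RtoC y).
  2:{ apply C_ext; simpl; ring. }
  eapply Rle_trans; [apply Cmod_triangle|].
  rewrite Cmod_mult, Cmod_Ci, !Cmod_R. simpl.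
  replace (x + (0 * y - 1 * 0))%R with x by ring.
  replace (0 + (0 * 0 + 1 * y))%R with y by ring. lra.
Qed.

Lemma Cmod_triangle_rev (x y : C) : (Cmod x - Cmod y <= Cmod (x - y))%R.
Proof.
  generalize (Cmod_triangle (x - y) y). replace (x - y + y) with x by ring. lra.
Qed.

Section FilterLimits.
Context {T : Type} (F : (T -> Prop) -> Prop) {FF : Filter F}.

Lemma flim_const c : flim F (fun _ => c) c.
Proof.
  intros e He. apply filter_forall. intros _.
  replace (c - c) with (RtoC 0) by ring. now rewrite Cmod_0.
Qed.

Lemma flim_ext_loc f g l : F (fun t => f t = g t) -> flim F f l -> flim F g l.
Proof.
  intros H1 H2 e He. generalize (filter_and _ _ H1 (H2 e He)).
  apply filter_imp. intros t [E H]. now rewrite <- E.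
Qed.

Lemma flim_ext f g l : (forall t, f t = g t) -> flim F f l -> flim F g l.
Proof. intros H. apply flim_ext_loc. now apply filter_forall. Qed.

Lemma flim_plus f g a b : flim F f a -> flim F g b -> flim F (fun t => f t + g t) (a + b).
Proof.
  intros H1 H2 e He. assert (He2 : (0 < e / 2)%R) by lra.
  generalize (filter_and _ _ (H1 _ He2) (H2 _ He2)).
  apply filter_imp. intros t [A B].
  replace (f t + g t - (a + b)) with ((f t - a) + (g t - b)) by ring.
  eapply Rle_lt_trans; [apply Cmod_triangle|]. lra.
Qed.

Lemma flim_bounded f a : flim F f a -> F (fun t => (Cmod (f t) < Cmod a + 1)%R).
Proof.
  intros H. generalize (H 1%R Rlt_0_1). apply filter_imp. intros t Ht.
  generalize (Cmod_triangle_rev (f t) a). lra.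
Qed.

Lemma flim_0_mult_bounded f g M :
  F (fun t => (Cmod (g t) <= M)%R) -> flim F f 0 -> flim F (fun t => f t * g t) 0.
Proof.
  intros H1 H2 e He.
  assert (HM : (0 < Rabs M + 1)%R) by (generalize (Rabs_pos M); lra).
  assert (He2 : (0 < e / (Rabs M + 1))%R) by (apply Rdiv_lt_0_compat; lra).
  generalize (filter_and _ _ H1 (H2 _ He2)). apply filter_imp. intros t [A B].
  replace (f t - 0) with (f t) in B by ring.
  replace (f t * g t - 0) with (f t * g t) by ring. rewrite Cmod_mult.
  generalize (Rle_abs M) (Cmod_ge_0 (f t)) (Cmod_ge_0 (g t)). intros.
  apply Rle_lt_trans with (Cmod (f t) * (Rabs M + 1))%R.
  - apply Rmult_le_compat_l; lra.
  - replace e with (e / (Rabs M + 1) * (Rabs M + 1))%R by (field; lra).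
    apply Rmult_lt_compat_r; lra.
Qed.

Lemma flim_shift0 f a : flim F f a <-> flim F (fun t => f t - a) 0.
Proof.
  split; intros H e He; generalize (H e He); apply filter_imp; intros t;
  now replace (f t - a - 0) with (f t - a) by ring.
Qed.

Lemma flim_mult f g a b : flim F f a -> flim F g b -> flim F (fun t => f t * g t) (a * b).
Proof.
  intros H1 H2. apply flim_shift0.
  apply flim_ext with (fun t => (f t - a) * g t + (g t - b) * a).
  { intros t; ring. }
  replace (RtoC 0) with (0 + 0) by ring.
  apply flim_plus.
  - apply flim_0_mult_bounded with (Cmod b + 1)%R; [|now apply flim_shift0 in H1].
    generalize (flim_bounded _ _ H2). apply filter_imp. intros; lra.
  - apply flim_0_mult_bounded with (Cmod a); [|now apply flim_shift0 in H2].
    apply filter_forall. intros; lra.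
Qed.

Lemma flim_scal c f a : flim F f a -> flim F (fun t => c * f t) (c * a).
Proof. intros; apply flim_mult; auto. apply flim_const. Qed.

Lemma flim_opp f a : flim F f a -> flim F (fun t => - f t) (- a).
Proof.
  intros H. replace (- a) with (- (1) * a) by ring.
  apply flim_ext with (fun t => - (1) * f t); [intros; ring|]. now apply flim_scal.
Qed.

Lemma flim_minus f g a b : flim F f a -> flim F g b -> flim F (fun t => f t - g t) (a - b).
Proof. intros H1 H2. apply flim_plus; auto. now apply flim_opp. Qed.

Lemma flim_inv f (a : C) : a <> 0 -> flim F f a -> flim F (fun t => / f t) (/ a).
Proof.
  intros Ha H. assert (Hm : (0 < Cmod a)%R) by (apply Cmod_gt_0; exact Ha).
  apply flim_shift0.
  apply flim_ext_loc with (fun t => (f t - a) * (- (/ (f t * a)))).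
  - assert (Hm2 : (0 < Cmod a / 2)%R) by lra.
    generalize (H _ Hm2). apply filter_imp. intros t Ht.
    assert (f t <> 0).
    { apply Cmod_gt_0. generalize (Cmod_triangle_rev a (a - f t)).
      replace (a - (a - f t)) with (f t) by ring.
      rewrite (Cmod_minus_sym a (f t)). lra. }
    field. auto.
  - apply flim_0_mult_bounded with (2 / (Cmod a * Cmod a))%R.
    2: now apply flim_shift0 in H.
    assert (Hm2 : (0 < Cmod a / 2)%R) by lra.
    generalize (H _ Hm2). apply filter_imp. intros t Ht.
    assert (Hf : (Cmod a / 2 < Cmod (f t))%R).
    { generalize (Cmod_triangle_rev a (a - f t)).
      replace (a - (a - f t)) with (f t) by ring.
      rewrite (Cmod_minus_sym a (f t)). lra. }
    assert (f t <> 0) by (apply Cmod_gt_0; lra).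
    rewrite Cmod_opp, Cmod_inv by (apply Cmult_neq_0; auto). rewrite Cmod_mult.
    replace (2 / (Cmod a * Cmod a))%R with (/ (Cmod a / 2 * Cmod a))%R by (field; lra).
    apply Rinv_le_contravar.
    + apply Rmult_lt_0_compat; lra.
    + apply Rmult_le_compat_r; lra.
Qed.

End FilterLimits.

Lemma flim_unique {T} (F : (T -> Prop) -> Prop) {FF : ProperFilter F} f (a b : C) :
  flim F f a -> flim F f b -> a = b.
Proof.
  intros H1 H2. destruct (Ceq_dec a b) as [|N]; auto. exfalso.
  assert (P : (0 < Cmod (a - b) / 2)%R).
  { assert (0 < Cmod (a - b))%R by (apply Cmod_gt_0, Cminus_eq_contra; exact N). lra. }
  destruct (filter_ex _ (filter_and _ _ (H1 _ P) (H2 _ P))) as [t [A B]].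
  generalize (Cmod_triangle (a - f t) (f t - b)).
  replace (a - f t + (f t - b)) with (a - b) by ring.
  rewrite (Cmod_minus_sym a (f t)). lra.
Qed.

(** * Finite sums and series *)

Definition Clim (u : nat -> C) (l : C) := flim eventually u l.

Fixpoint csum (f : nat -> C) (n : nat) : C :=
  match n with O => 0 | S n => csum f n + f n end.

Fixpoint rsum (f : nat -> R) (n : nat) : R :=
  match n with O => 0%R | S n => (rsum f n + f n)%R end.

Definition CS (a : nat -> C) (l : C) := Clim (csum a) l.

Lemma csum_ext f g n : (forall i, (i < n)%nat -> f i = g i) -> csum f n = csum g n.
Proof. induction n; simpl; intros; auto. rewrite IHn, H; auto. Qed.

Lemma csum_plus f g n : csum (fun i => f i + g i) n = csum f n + csum g n.
Proof. induction n; simpl. ring. rewrite IHn. ring. Qed.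

Lemma csum_minus f g n : csum (fun i => f i - g i) n = csum f n - csum g n.
Proof. induction n; simpl. ring. rewrite IHn. ring. Qed.

Lemma csum_scal c f n : csum (fun i => c * f i) n = c * csum f n.
Proof. induction n; simpl. ring. rewrite IHn. ring. Qed.

Lemma csum_zero n : csum (fun _ => 0) n = 0.
Proof. induction n; simpl; auto. rewrite IHn. ring. Qed.

Lemma csum_add f n m : csum f (n + m) = csum f n + csum (fun i => f (n + i)%nat) m.
Proof.
  induction m; simpl. { rewrite Nat.add_0_r. ring. }
  rewrite Nat.add_succ_r. simpl. rewrite IHm. ring.
Qed.

Lemma csum_Sl f n : csum f (S n) = f O + csum (fun i => f (S i)) n.
Proof. change (S n) with (1 + n)%nat. rewrite csum_add. simpl. ring. Qed.

Lemma csum_rev f n : csum f n = csum (fun i => f (n - 1 - i)%nat) n.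
Proof.
  induction n; auto. rewrite (csum_Sl (fun i => f (S n - 1 - i)%nat)). simpl csum at 1.
  rewrite IHn. replace (S n - 1 - 0)%nat with n by lia. rewrite Cplus_comm. f_equal.
  apply csum_ext. intros. f_equal. lia.
Qed.

Lemma csum_swap (f : nat -> nat -> C) n m :
  csum (fun i => csum (f i) m) n = csum (fun j => csum (fun i => f i j) n) m.
Proof.
  induction n; simpl. { now rewrite csum_zero. } rewrite IHn, <- csum_plus. auto.
Qed.

Lemma csum_telescope (u : nat -> C) n : csum (fun i => u (S i) - u i) n = u n - u O.
Proof. induction n; simpl. ring. rewrite IHn. ring. Qed.

Lemma rsum_ext f g n : (forall i, (i < n)%nat -> f i = g i) -> rsum f n = rsum g n.
Proof. induction n; simpl; intros; auto. rewrite IHn, H; auto. Qed.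

Lemma rsum_le f g n : (forall i, (i < n)%nat -> (f i <= g i)%R) -> (rsum f n <= rsum g n)%R.
Proof.
  induction n; simpl; intros. lra. generalize (IHn (fun i Hi => H i ltac:(lia))) (H n ltac:(lia)). lra.
Qed.

Lemma rsum_scal c f n : rsum (fun i => c * f i)%R n = (c * rsum f n)%R.
Proof. induction n; simpl. ring. rewrite IHn. ring. Qed.

Lemma rsum_plus f g n : rsum (fun i => f i + g i)%R n = (rsum f n + rsum g n)%R.
Proof. induction n; simpl. ring. rewrite IHn. ring. Qed.

Lemma rsum_const c n : rsum (fun _ => c) n = (INR n * c)%R.
Proof. induction n. simpl; ring. rewrite S_INR. simpl. rewrite IHn. ring. Qed.

Lemma rsum_nonneg f n : (forall i, 0 <= f i)%R -> (0 <= rsum f n)%R.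
Proof. induction n; simpl; intros. lra. generalize (IHn H) (H n). lra. Qed.

Lemma rsum_mono f n m : (forall i, 0 <= f i)%R -> (n <= m)%nat -> (rsum f n <= rsum f m)%R.
Proof. intros H L. induction L; simpl. lra. generalize (H m). lra. Qed.

Lemma Cmod_csum f n : (Cmod (csum f n) <= rsum (fun i => Cmod (f i)) n)%R.
Proof.
  induction n; simpl. rewrite Cmod_0; lra.
  eapply Rle_trans; [apply Cmod_triangle|]. lra.
Qed.

Lemma RtoC_rsum f n : RtoC (rsum f n) = csum (fun i => RtoC (f i)) n.
Proof. induction n; simpl; auto. now rewrite RtoC_plus, IHn. Qed.

Lemma csum_sum_n (f : nat -> C) n : csum f (S n) = sum_n (fun k => f k : C) n.
Proof.
  induction n. { rewrite sum_O. simpl. ring. }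
  rewrite sum_Sn. rewrite <- IHn. reflexivity.
Qed.

Lemma Clim_S u l : Clim u l <-> Clim (fun n => u (S n)) l.
Proof.
  split; intros H e He; destruct (H e He) as [N HN].
  - exists N. intros n Hn. apply HN. lia.
  - exists (S N). intros [|n] Hn; [lia|]. apply HN. lia.
Qed.

Lemma CS_is_series a l : CS a l <-> is_series (V := C_NormedModule) a l.
Proof.
  unfold CS. rewrite Clim_S. split; intros H.
  - intros P [eps HP]. 
    assert (He : (0 < eps)%R) by apply cond_pos.
    destruct (H eps He) as [N HN]. exists N. intros n Hn. apply HP.
    rewrite <- csum_sum_n. specialize (HN n Hn).
    apply C_NormedModule_mixin_compat1. exact HN.
  - intros e He.
    assert (Hs : (0 < e / sqrt 2)%R) by (apply Rdiv_lt_0_compat; auto; apply Rlt_sqrt2_0).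
    destruct (H (ball l (mkposreal _ Hs))) as [N HN].
    { now exists (mkposreal _ Hs). }
    exists N. intros n Hn. specialize (HN n Hn). rewrite <- csum_sum_n in HN.
    apply C_NormedModule_mixin_compat2 in HN. simpl in HN.
    replace e with (sqrt 2 * (e / sqrt 2))%R. exact HN.
    field. apply Rgt_not_eq, Rlt_sqrt2_0.
Qed.

Lemma CS_ext a b l : (forall n, a n = b n) -> CS a l -> CS b l.
Proof. intros H. apply flim_ext. apply eventually_filter. intros; now apply csum_ext. Qed.

Lemma CS_eq a l l' : CS a l -> l = l' -> CS a l'.
Proof. now intros H <-. Qed.

Lemma CS_plus a b la lb : CS a la -> CS b lb -> CS (fun n => a n + b n) (la + lb).
Proof.
  intros. apply flim_ext with (fun n => csum a n + csum b n). apply eventually_filter.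
  intros; now rewrite csum_plus. now apply flim_plus; [apply eventually_filter|..].
Qed.

Lemma CS_scal c a l : CS a l -> CS (fun n => c * a n) (c * l).
Proof.
  intros. apply flim_ext with (fun n => c * csum a n). apply eventually_filter.
  intros; now rewrite csum_scal. now apply flim_scal; [apply eventually_filter|..].
Qed.

Lemma CS_minus a b la lb : CS a la -> CS b lb -> CS (fun n => a n - b n) (la - lb).
Proof.
  intros. apply CS_ext with (fun n => a n + - (1) * b n). intros; ring.
  replace (la - lb) with (la + - (1) * lb) by ring. apply CS_plus; auto. now apply CS_scal.
Qed.

Lemma CS_unique a l l' : CS a l -> CS a l' -> l = l'.
Proof. apply flim_unique. apply eventually_filter. Qed.

Lemma Clim_unique u l l' : Clim u l -> Clim u l' -> l = l'.
Proof. apply flim_unique. apply eventually_filter. Qed.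

Lemma CS_finite (a : nat -> C) n : (forall i, (n <= i)%nat -> a i = 0) -> CS a (csum a n).
Proof.
  intros H e He. exists n. intros m Hm.
  replace m with (n + (m - n))%nat by lia. rewrite csum_add.
  rewrite (csum_ext (fun i => a (n + i)%nat) (fun _ => 0)), csum_zero.
  2: intros; apply H; lia.
  replace (csum a n + 0 - csum a n) with (RtoC 0) by ring. now rewrite Cmod_0.
Qed.

Lemma CS_zero : CS (fun _ => 0) 0.
Proof. apply (CS_finite (fun _ => 0) 0). auto. Qed.

Lemma Clim_shift u k l : Clim u l <-> Clim (fun n => u (k + n)%nat) l.
Proof.
  split; intros H e He; destruct (H e He) as [N HN].
  - exists N. intros n Hn. apply HN. lia.
  - exists (k + N)%nat. intros n Hn. replace n with (k + (n - k))%nat by lia. apply HN. lia.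
Qed.

Lemma CS_shift a k l : CS a l <-> CS (fun n => a (k + n)%nat) (l - csum a k).
Proof.
  unfold CS. rewrite (Clim_shift (csum a) k). split; intros H.
  - apply flim_ext with (fun n => csum a (k + n) - csum a k). apply eventually_filter.
    intros; rewrite csum_add; ring.
    apply flim_minus; auto. apply eventually_filter. apply flim_const, eventually_filter.
  - apply flim_ext with (fun n => csum (fun i => a (k + i)%nat) n + csum a k).
    apply eventually_filter. intros; rewrite csum_add; ring.
    replace l with (l - csum a k + csum a k) by ring.
    apply flim_plus; auto. apply eventually_filter. apply flim_const, eventually_filter.
Qed.

Lemma CS_S a l : CS (fun n => a (S n)) l -> CS a (a O + l).
Proof.
  intros. apply (CS_shift a 1). simpl.
  replace (a O + l - (0 + a O)) with l by ring. auto.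
Qed.

Lemma CS_S_inv a l : CS a l -> CS (fun n => a (S n)) (l - a O).
Proof.
  intros H. apply (CS_shift a 1) in H. simpl in H.
  replace (l - a O) with (l - (0 + a O)) by ring. auto.
Qed.

Lemma Clim_real (u : nat -> R) (l : C) :
  Clim (fun n => RtoC (u n)) l -> l = RtoC (Re l).
Proof.
  intros H. apply C_ext; auto. simpl. destruct (Req_dec (Im l) 0) as [|N]; auto. exfalso.
  destruct (H (Rabs (Im l)) (Rabs_pos_lt _ N)) as [K HK]. specialize (HK K (le_n _)).
  generalize (im_le_Cmod (RtoC (u K) - l)). unfold Cminus. rewrite im_plus, im_opp, im_RtoC.
  replace (0 + - Im l)%R with (- Im l)%R by ring. rewrite Rabs_Ropp. unfold Cminus in HK. lra.
Qed.

(** * Nonnegative majorants *)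

Definition majorant (m : nat -> R) (B : R) : Prop :=
  (forall n, 0 <= m n)%R /\ forall n, (rsum m n <= B)%R.

Lemma majorant_le m m' B :
  (forall n, 0 <= m' n <= m n)%R -> majorant m B -> majorant m' B.
Proof.
  intros H [H1 H2]. split. apply H. intros n. eapply Rle_trans; [|apply (H2 n)].
  apply rsum_le. intros; apply H.
Qed.

Lemma majorant_tail m B :
  majorant m B -> forall eps, (0 < eps)%R ->
  exists N, forall k, (rsum (fun i => m (N + i)%nat) k < eps)%R.
Proof.
  intros [H1 H2] eps He.
  destruct (completeness (fun x => exists n, x = rsum m n)) as [s [Hs1 Hs2]].
  - exists B. intros x [n ->]. auto.
  - exists 0%R. now exists O.
  - destruct (classic (exists N, (s - eps < rsum m N)%R)) as [[N HN]|Hno].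
    + exists N. intros k. assert (E : rsum m (N + k) = (rsum m N + rsum (fun i => m (N + i)%nat) k)%R).
      { induction k; simpl. rewrite Nat.add_0_r; ring. rewrite Nat.add_succ_r. simpl. rewrite IHk. ring. }
      assert (rsum m (N + k) <= s)%R by (apply Hs1; eauto). lra.
    + exfalso. assert (s <= s - eps)%R; [|lra]. apply Hs2. intros x [n ->].
      destruct (Rle_lt_dec (rsum m n) (s - eps)); auto. exfalso; eauto.
Qed.

Lemma CS_of_majorant a m B :
  (forall n, Cmod (a n) <= m n)%R -> majorant m B -> exists l, CS a l.
Proof.
  intros H1 H2.
  assert (E : ex_series (K := C_AbsRing) (V := C_CompleteNormedModule) a).
  { apply (ex_series_le (K := C_AbsRing) (V := C_CompleteNormedModule) a m).
    - intros n. exact (H1 n).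
    - apply (ex_series_Cauchy (K := R_AbsRing) (V := R_CompleteNormedModule)). intros eps.
      destruct (majorant_tail m B H2 eps (cond_pos eps)) as [N HN].
      exists N. intros n k Hn Hk.
      assert (P : forall d s, (N <= s)%nat -> (sum_n_m m s (s + d) <= rsum (fun i => m (N + i)%nat) (s + d - N + 1))%R).
      { intros d s Hs. induction d.
        - rewrite Nat.add_0_r, sum_n_n. rewrite Nat.add_1_r. simpl.
          replace (N + (s - N))%nat with s by lia.
          assert (0 <= rsum (fun i => m (N + i)%nat) (s - N))%R by (apply rsum_nonneg; intros; apply H2).
          lra.
        - rewrite Nat.add_succ_r. rewrite sum_n_Sm by lia.
          replace (S (s + d) - N + 1)%nat with (S (s + d - N + 1)) by lia.
          simpl. replace (N + (s + d - N + 1))%nat with (S (s + d)) by lia.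
          apply Rplus_le_compat_r. exact IHd. }
      assert (Q : (0 <= sum_n_m m n k)%R).
      { clear -H2. apply Rle_trans with (sum_n_m (fun _ => 0%R) n k).
        rewrite sum_n_m_const. rewrite Rmult_0_r. lra. apply sum_n_m_le. apply H2. }
      change (norm (sum_n_m m n k)) with (Rabs (sum_n_m m n k)).
      rewrite Rabs_right by lra.
      destruct (le_lt_dec n k) as [L|L].
      + replace k with (n + (k - n))%nat by lia. eapply Rle_lt_trans; [apply P; auto|]. apply HN.
      + rewrite sum_n_m_zero by lia. apply cond_pos. }
  destruct E as [l Hl]. exists l. apply CS_is_series. exact Hl.
Qed.

Lemma CS_bound a l m B :
  (forall n, Cmod (a n) <= m n)%R -> majorant m B -> CS a l -> (Cmod l <= B)%R.
Proof.
  intros H1 H2 H3. destruct (Rle_lt_dec (Cmod l) B); auto. exfalso.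
  destruct (H3 (Cmod l - B)%R ltac:(lra)) as [N HN]. specialize (HN N (le_n _)).
  generalize (Cmod_triangle_rev l (csum a N)). rewrite Cmod_minus_sym.
  assert (Cmod (csum a N) <= B)%R.
  { eapply Rle_trans; [apply Cmod_csum|]. eapply Rle_trans; [|apply (proj2 H2 N)].
    apply rsum_le. auto. }
  lra.
Qed.

Lemma CS_tail_bound a l N (e : R) :
  (forall k, (rsum (fun i => Cmod (a (N + i)%nat)) k <= e)%R) -> CS a l ->
  (Cmod (l - csum a N) <= e)%R.
Proof.
  intros H1 H2. apply (CS_shift a N) in H2.
  eapply CS_bound; [intros; apply Rle_refl| |exact H2].
  split; auto. intros; apply Cmod_ge_0.
Qed.

(** Dominated convergence: the majorant makes the tails small uniformly in t, and the finitely many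
    remaining terms converge one by one. *)
Lemma tannery {T} (F : (T -> Prop) -> Prop) {FF : Filter F}
  (b : T -> nat -> C) (bl : nat -> C) (m : nat -> R) B (St : T -> C) Sl :
  majorant m B ->
  F (fun t => forall n, (Cmod (b t n) <= m n)%R) ->
  (forall n, flim F (fun t => b t n) (bl n)) ->
  F (fun t => CS (b t) (St t)) -> CS bl Sl ->
  flim F St Sl.
Proof.
  intros HM Hb Hl Hs Hsl e He.
  destruct (majorant_tail m B HM (e / 4) ltac:(lra)) as [N0 HN0].
  destruct (Hsl (e / 4)%R ltac:(lra)) as [N1 HN1].
  set (N := max N0 N1).
  assert (HN : forall k, (rsum (fun i => m (N + i)%nat) k <= e / 4)%R).
  { intros k. eapply Rle_trans; [|left; apply (HN0 (N - N0 + k)%nat)].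
    assert (E : forall p k, rsum (fun i => m (N0 + i)%nat) (p + k) =
       (rsum (fun i => m (N0 + i)%nat) p + rsum (fun i => m (N0 + p + i)%nat) k)%R).
    { intros p q. induction q; simpl. rewrite Nat.add_0_r; ring.
      rewrite Nat.add_succ_r; simpl. rewrite IHq. rewrite Nat.add_assoc. ring. }
    rewrite E. replace (N0 + (N - N0))%nat with N by lia.
    assert (0 <= rsum (fun i => m (N0 + i)%nat) (N - N0))%R by (apply rsum_nonneg; intros; apply HM).
    lra. }
  assert (Hfin : flim F (fun t => csum (b t) N) (csum bl N)).
  { generalize N. intros n. induction n; simpl. apply flim_const; auto. apply flim_plus; auto. }
  generalize (filter_and _ _ Hb (filter_and _ _ Hs (Hfin (e / 4)%R ltac:(lra)))).
  apply filter_imp. intros t [A [B' D]].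
  assert (X : (Cmod (St t - csum (b t) N) <= e / 4)%R).
  { apply CS_tail_bound; auto. intros k. eapply Rle_trans; [|apply (HN k)]. apply rsum_le. auto. }
  assert (Y : (Cmod (csum bl N - Sl) < e / 4)%R) by (apply HN1; unfold N; lia).
  replace (St t - Sl) with ((St t - csum (b t) N) + ((csum (b t) N - csum bl N) + (csum bl N - Sl))) by ring.
  generalize (Cmod_triangle (St t - csum (b t) N) ((csum (b t) N - csum bl N) + (csum bl N - Sl)))
   (Cmod_triangle (csum (b t) N - csum bl N) (csum bl N - Sl)). lra.
Qed.

Definition dbl_majorant (a : nat -> nat -> C) (B : R) :=
  forall n k, (rsum (fun i => rsum (fun j => Cmod (a i j)) k) n <= B)%R.

Lemma rsum_swap (f : nat -> nat -> R) n m :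
  rsum (fun i => rsum (f i) m) n = rsum (fun j => rsum (fun i => f i j) n) m.
Proof.
  induction n; simpl. { rewrite rsum_const. ring. } rewrite IHn, <- rsum_plus. auto.
Qed.

Lemma dbl_majorant_swap a B : dbl_majorant a B -> dbl_majorant (fun i j => a j i) B.
Proof. intros H n k. rewrite rsum_swap. apply H. Qed.

Lemma dbl_row a B : dbl_majorant a B -> forall i, majorant (fun j => Cmod (a i j)) B.
Proof.
  intros H i. split. intros; apply Cmod_ge_0. intros n.
  eapply Rle_trans; [|apply (H (S i) n)]. simpl.
  assert (0 <= rsum (fun i => rsum (fun j => Cmod (a i j)) n) i)%R.
  { apply rsum_nonneg. intros; apply rsum_nonneg; intros; apply Cmod_ge_0. } lra.
Qed.

Lemma rsum_limit_le a n (r : nat -> C) B :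
  dbl_majorant a B -> (forall i, CS (a i) (r i)) -> (rsum (fun i => Cmod (r i)) n <= B)%R.
Proof.
  intros H Hr. destruct (Rle_lt_dec (rsum (fun i => Cmod (r i)) n) B); auto. exfalso.
  set (e := (rsum (fun i => Cmod (r i)) n - B)%R) in *.
  assert (P : forall m, exists K, forall k, (K <= k)%nat ->
     (rsum (fun i => Cmod (r i)) m < rsum (fun i => rsum (fun j => Cmod (a i j)) k) m + (INR m + 1) * (e / (INR n + 1)))%R).
  { assert (Hp : (0 < e / (INR n + 1))%R).
    { apply Rdiv_lt_0_compat. unfold e; lra. generalize (pos_INR n); lra. }
    induction m.
    - exists O. intros. simpl. lra.
    - destruct IHm as [K HK]. destruct (Hr m (e / (INR n + 1))%R Hp) as [K2 HK2].
      exists (max K K2). intros k Hk. specialize (HK k ltac:(lia)). specialize (HK2 k ltac:(lia)).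
      simpl rsum. rewrite S_INR.
      generalize (Cmod_csum (a m) k) (Cmod_triangle_rev (r m) (csum (a m) k)).
      rewrite Cmod_minus_sym. lra. }
  destruct (P n) as [K HK]. specialize (HK K (le_n _)).
  assert (X : ((INR n + 1) * (e / (INR n + 1)) = e)%R) by (field; generalize (pos_INR n); lra).
  rewrite X in HK. specialize (H n K). unfold e in HK. lra.
Qed.

(** The sums of the first M columns, row by row, are dominated by the absolute row sums, so dominated
    convergence applies as M grows. *)
Theorem fubini a B (r c : nat -> C) :
  dbl_majorant a B -> (forall i, CS (a i) (r i)) -> (forall j, CS (fun i => a i j) (c j)) ->
  exists s, CS r s /\ CS c s.
Proof.
  intros H Hr Hc.
  assert (HM : majorant (fun i => Cmod (r i)) B).
  { split. intros; apply Cmod_ge_0. intros n. eapply rsum_limit_le; eauto. }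
  destruct (CS_of_majorant r _ B (fun n => Rle_refl _) HM) as [s Hs].
  exists s. split; auto.
  (* the partial row sums of absolute values dominate *)
  assert (HA : forall i, exists l : R, CS (fun j => RtoC (Cmod (a i j))) (RtoC l) /\ (forall k, rsum (fun j => Cmod (a i j)) k <= l)%R).
  { intros i. destruct (dbl_row a B H i) as [D1 D2].
    destruct (CS_of_majorant (fun j => RtoC (Cmod (a i j))) (fun j => Cmod (a i j)) B) as [l Hl].
    { intros n. rewrite Cmod_R, Rabs_right. lra. apply Rle_ge, D1. } { split; auto. }
    exists (Re l). assert (El : RtoC (Re l) = l).
    { symmetry. apply (Clim_real (rsum (fun j => Cmod (a i j)))). eapply flim_ext; [apply eventually_filter| |exact Hl]. intros n. symmetry. apply RtoC_rsum. }
    rewrite El. split; auto.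
    intros k. destruct (Rle_lt_dec (rsum (fun j => Cmod (a i j)) k) (Re l)); auto. exfalso.
    destruct (Hl (rsum (fun j => Cmod (a i j)) k - Re l)%R ltac:(lra)) as [N HN].
    specialize (HN (max N k) ltac:(lia)). rewrite <- RtoC_rsum in HN.
    generalize (re_le_Cmod (RtoC (rsum (fun j => Cmod (a i j)) (max N k)) - l)).
    generalize (rsum_mono (fun j => Cmod (a i j)) k (max N k) (fun j => Cmod_ge_0 _) ltac:(lia)).
    intros X1. generalize (Rle_abs (Re (RtoC (rsum (fun j => Cmod (a i j)) (max N k)) - l))).
    simpl. unfold Re in *. lra. }
  assert (HAc : exists ab : nat -> R, forall i, CS (fun j => RtoC (Cmod (a i j))) (RtoC (ab i)) /\ (forall k, rsum (fun j => Cmod (a i j)) k <= ab i)%R).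
  { exists (fun i => proj1_sig (constructive_indefinite_description _ (HA i))).
    intros i. exact (proj2_sig (constructive_indefinite_description _ (HA i))). }
  destruct HAc as [ab Hab].
  assert (Hab0 : forall i, (0 <= ab i)%R) by (intros i; apply (proj2 (Hab i) O)).
  assert (HMab : majorant ab B).
  { split; auto. intros n.
    eapply Rle_trans; [|apply (rsum_limit_le (fun i j => RtoC (Cmod (a i j))) n (fun i => RtoC (ab i)) B)].
    - apply rsum_le. intros. rewrite Cmod_R. apply Rle_abs.
    - intros p q. eapply Rle_trans; [|apply (H p q)]. apply rsum_le. intros. apply rsum_le. intros.
      rewrite Cmod_R, Rabs_right. lra. apply Rle_ge, Cmod_ge_0.
    - intros i; apply Hab. }
  apply tannery with (b := fun M i => csum (a i) M) (bl := r) (m := ab) (B := B); auto.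
  - apply eventually_filter.
  - apply filter_forall. intros M n. eapply Rle_trans; [apply Cmod_csum|]. apply Hab.
  - apply filter_forall. intros M. induction M; simpl.
    + apply CS_zero.
    + apply CS_plus; auto.
Qed.

Lemma dbl_majorant_of_rows a (m : nat -> R) B :
  (forall i, majorant (fun j => Cmod (a i j)) (m i)) -> majorant m B -> dbl_majorant a B.
Proof.
  intros H1 H2 n k. eapply Rle_trans; [|apply (proj2 H2 n)]. apply rsum_le. intros; apply H1.
Qed.

(** * Complex differentiation *)

Definition CD (f : C -> C) (z l : C) : Prop :=
  is_derive (K := C_AbsRing) (V := C_NormedModule) f z l.

Definition punctured (z : C) : (C -> Prop) -> Prop := fun P =>
  exists d : R, (0 < d)%R /\ forall w, w <> z -> (Cmod (w - z) < d)%R -> P w.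

Lemma punctured_filter z : Filter (punctured z).
Proof.
  split.
  - exists 1%R. split; auto. lra.
  - intros P Q [d [Hd HP]] [d' [Hd' HQ]]. exists (Rmin d d'). split. now apply Rmin_pos.
    intros w Hw Hm. split; [apply HP|apply HQ]; auto; eapply Rlt_le_trans; eauto;
    [apply Rmin_l|apply Rmin_r].
  - intros P Q H [d [Hd HP]]. exists d. split; auto.
Qed.

Lemma Cmod_nz (z : C) : z <> 0 -> (0 < Cmod z)%R.
Proof. apply Cmod_gt_0. Qed.

Lemma Cminus_nz (a b : C) : a <> b -> a - b <> 0.
Proof. intros H E. apply H. replace a with (a - b + b) by ring. rewrite E. ring. Qed.

Lemma CD_eps (f : C -> C) z l :
  CD f z l <-> forall eps, (0 < eps)%R -> exists d, (0 < d)%R /\ forall w, (Cmod (w - z) < d)%R ->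
    (Cmod (f w - f z - l * (w - z)) <= eps * Cmod (w - z))%R.
Proof.
  split.
  - intros [_ H] e He. specialize (H z (fun P HP => HP)).
    specialize (H (mkposreal e He)). destruct H as [d Hd]. exists d. split. apply cond_pos.
    intros w Hw. specialize (Hd w Hw). simpl in Hd.
    replace (l * (w - z)) with ((w - z) * l) by ring. exact Hd.
  - intros H. split. apply is_linear_scal_l.
    intros x Hx. assert (E : z = x).
    { apply (is_filter_lim_locally_unique (V:=AbsRing_NormedModule C_AbsRing) z x) in Hx. exact Hx. }
    subst x. intros [e He]. destruct (H e He) as [d [Hd HH]].
    exists (mkposreal d Hd). intros w Hw. specialize (HH w Hw). simpl.
    replace (l * (w - z)) with ((w - z) * l) in HH by ring. exact HH.
Qed.

Lemma CD_quot (f : C -> C) (z l : C) :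
  CD f z l <-> flim (punctured z) (fun w => (f w - f z) / (w - z)) l.
Proof.
  rewrite CD_eps. split; intros H e He.
  - destruct (H (e / 2)%R ltac:(lra)) as [d [Hd HH]]. exists d. split; auto.
    intros w Hw Hm. specialize (HH w Hm). assert (N := Cminus_nz _ _ Hw).
    replace ((f w - f z) / (w - z) - l) with ((f w - f z - l * (w - z)) / (w - z)) by (field; auto).
    rewrite Cmod_div by auto. assert (P := Cmod_nz _ N).
    apply Rle_lt_trans with (e / 2)%R; [|lra].
    apply Rle_div_l; auto.
  - destruct (H e He) as [d [Hd HH]]. exists d. split; auto.
    intros w Hm. destruct (Ceq_dec w z) as [->|Hw].
    { replace (f z - f z - l * (z - z)) with (RtoC 0) by ring.
      replace (z - z) with (RtoC 0) by ring. rewrite Cmod_0. lra. }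
    specialize (HH w Hw Hm). assert (N := Cminus_nz _ _ Hw). assert (P := Cmod_nz _ N).
    replace (f w - f z - l * (w - z)) with (((f w - f z) / (w - z) - l) * (w - z)) by (field; auto).
    rewrite Cmod_mult. apply Rmult_le_compat_r; lra.
Qed.

Lemma CD_abs (f : C -> C) (z l : C) :
  CD f z l <-> is_derive (K := C_AbsRing) (V := AbsRing_NormedModule C_AbsRing) f z l.
Proof.
  rewrite CD_eps. split.
  - intros H. split. apply is_linear_scal_l.
    intros x Hx. apply (is_filter_lim_locally_unique (V:=AbsRing_NormedModule C_AbsRing) z x) in Hx.
    subst x. intros [e He]. destruct (H e He) as [d [Hd HH]].
    exists (mkposreal d Hd). intros w Hw. specialize (HH w Hw). simpl.
    replace (l * (w - z)) with ((w - z) * l) in HH by ring. exact HH.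
  - intros [_ H] e He. specialize (H z (fun P HP => HP)).
    specialize (H (mkposreal e He)). destruct H as [d Hd]. exists d. split. apply cond_pos.
    intros w Hw. specialize (Hd w Hw). simpl in Hd.
    replace (l * (w - z)) with ((w - z) * l) by ring. exact Hd.
Qed.

Lemma CD_const c z : CD (fun _ => c) z 0.
Proof. apply (is_derive_const (K := C_AbsRing) (V := C_NormedModule)). Qed.

Lemma CD_id z : CD (fun w => w) z 1.
Proof. apply CD_abs. apply (is_derive_id (K := C_AbsRing)). Qed.

Lemma CD_eq (f : C -> C) z (l l' : C) : CD f z l -> l = l' -> CD f z l'.
Proof. now intros H <-. Qed.

Lemma CD_plus (f g : C -> C) z a b : CD f z a -> CD g z b -> CD (fun w => f w + g w) z (a + b).
Proof. apply (is_derive_plus (K := C_AbsRing) (V := C_NormedModule)). Qed.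

Lemma CD_mult (f g : C -> C) z a b :
  CD f z a -> CD g z b -> CD (fun w => f w * g w) z (a * g z + f z * b).
Proof.
  rewrite !CD_abs. intros H1 H2. apply (is_derive_mult (K := C_AbsRing)); auto. intros; apply Cmult_comm.
Qed.

Lemma CD_scal c (f : C -> C) z a : CD f z a -> CD (fun w => c * f w) z (c * a).
Proof.
  intros H. eapply CD_eq. exact (CD_mult _ _ _ _ _ (CD_const c z) H). cbv beta. ring.
Qed.

Lemma CD_comp (f g : C -> C) z a b : CD f (g z) a -> CD g z b -> CD (fun w => f (g w)) z (a * b).
Proof.
  intros H1 H2. eapply CD_eq.
  apply (is_derive_comp (K := C_AbsRing) (V := C_NormedModule)). exact H1. apply CD_abs in H2. exact H2.
  apply Cmult_comm.
Qed.

Lemma CD_opp (f : C -> C) z a : CD f z a -> CD (fun w => - f w) z (- a).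
Proof. apply (is_derive_opp (K := C_AbsRing) (V := C_NormedModule)). Qed.

Lemma CD_minus (f g : C -> C) z a b : CD f z a -> CD g z b -> CD (fun w => f w - g w) z (a - b).
Proof. intros. apply CD_plus; auto. now apply CD_opp. Qed.

Lemma CD_pow (f : C -> C) (z a : C) n : CD f z a -> CD (fun w => f w ^ n) z (INR n * a * f z ^ (n - 1)).
Proof.
  intros H. induction n.
  - eapply CD_eq. apply (CD_const 1). simpl. ring.
  - simpl Cpow. eapply CD_eq. exact (CD_mult _ _ _ _ _ H IHn).
    rewrite S_INR, RtoC_plus. replace (S n - 1)%nat with n by lia.
    destruct n; simpl; [ring|]. replace (n - 0)%nat with n by lia. ring.
Qed.

Lemma CD_ext_loc (f g : C -> C) z l d :
  (0 < d)%R -> (forall w, (Cmod (w - z) < d)%R -> f w = g w) -> CD f z l -> CD g z l.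
Proof.
  intros Hd H. rewrite !CD_eps. intros HH e He. destruct (HH e He) as [d' [Hd' K]].
  exists (Rmin d d'). split. now apply Rmin_pos. intros w Hw.
  rewrite <- !H. apply K. eapply Rlt_le_trans; eauto. apply Rmin_r.
  replace (z - z) with (RtoC 0) by ring. now rewrite Cmod_0.
  eapply Rlt_le_trans; eauto. apply Rmin_l.
Qed.

Lemma CD_ext (f g : C -> C) z l : (forall w, f w = g w) -> CD f z l -> CD g z l.
Proof. intros H. apply CD_ext_loc with 1%R; auto. lra. Qed.

Lemma CD_unique (f : C -> C) z l l' : CD f z l -> CD f z l' -> l = l'.
Proof.
  rewrite !CD_quot. apply flim_unique. split. 2: apply punctured_filter.
  intros P [d [Hd H]]. exists (z + RtoC (d / 2)). apply H.
  - intros E. assert (X : RtoC (d/2) = 0). { replace (RtoC (d/2)) with (z + RtoC (d / 2) - z) by ring. rewrite E. ring. }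
    apply RtoC_inj in X. lra.
  - replace (z + RtoC (d / 2) - z) with (RtoC (d / 2)) by ring.
    rewrite Cmod_R, Rabs_right; lra.
Qed.

Lemma CD_flim (f : C -> C) z l : CD f z l -> flim (punctured z) f (f z).
Proof.
  rewrite CD_eps. intros H e He. destruct (H 1%R Rlt_0_1) as [d [Hd K]].
  assert (Hp : (0 < Cmod l + 2)%R) by (generalize (Cmod_ge_0 l); lra).
  exists (Rmin d (e / (Cmod l + 2))). split.
  { apply Rmin_pos; auto. apply Rdiv_lt_0_compat; lra. }
  intros w _ Hw. specialize (K w (Rlt_le_trans _ _ _ Hw (Rmin_l _ _))).
  assert (Hw2 := Rlt_le_trans _ _ _ Hw (Rmin_r _ _)).
  replace (f w - f z) with ((f w - f z - l * (w - z)) + l * (w - z)) by ring.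
  eapply Rle_lt_trans; [apply Cmod_triangle|]. rewrite Cmod_mult.
  assert (X : (Cmod (w - z) * (Cmod l + 2) < e)%R) by (apply Rlt_div_r; auto).
  generalize (Cmod_ge_0 (w - z)). nra.
Qed.

Lemma CD_inv_id (z : C) : z <> 0 -> CD (fun w => / w) z (- / (z * z)).
Proof.
  intros Hz. apply CD_quot.
  assert (FF := punctured_filter z).
  apply flim_ext_loc with (fun w => - (/ w * / z)).
  - apply punctured_filter.
  - exists (Cmod z). split. now apply Cmod_nz. intros w Hw Hm.
    assert (w <> 0). { intros ->. replace (0 - z) with (- z) in Hm by ring. rewrite Cmod_opp in Hm. lra. }
    assert (N := Cminus_nz _ _ Hw). field. auto.
  - replace (/ (z * z)) with (/ z * / z) by (field; auto).
    apply flim_opp; auto. apply flim_mult; auto. 2: now apply flim_const.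
    apply flim_inv; auto. apply (CD_flim (fun w => w) z 1). apply CD_id.
Qed.

Lemma CD_inv (f : C -> C) z a : f z <> 0 -> CD f z a -> CD (fun w => / f w) z (- a / (f z * f z)).
Proof.
  intros Hn H. eapply CD_eq. apply (CD_comp (fun w => / w) f). now apply CD_inv_id. exact H.
  field. auto.
Qed.

(** The real and the imaginary part along the segment are real functions with zero derivative. *)
Lemma CD_zero_segment (f : C -> C) z0 z1 :
  (forall t : R, (0 <= t <= 1)%R -> CD f (z0 + t * (z1 - z0)) 0) -> f z1 = f z0.
Proof.
  intros H.
  assert (G : forall p : C -> R, (forall a b, p (a - b) = (p a - p b)%R) ->
     (forall a, (Rabs (p a) <= Cmod a)%R) -> p (f z1) = p (f z0)).
  { intros p Hp1 Hp2.
    set (g := fun t : R => p (f (z0 + t * (z1 - z0)))).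
    assert (E : g 0%R = g 1%R).
    { apply (eq_is_derive (V := R_NormedModule)); [|lra]. intros t Ht.
      specialize (H t Ht). rewrite CD_eps in H. 
      split. apply is_linear_scal_l. intros x Hx.
      apply (is_filter_lim_locally_unique (V:=R_NormedModule) t x) in Hx. subst x.
      intros [e He].
      set (M := (Cmod (z1 - z0) + 1)%R). assert (HM : (0 < M)%R) by (unfold M; generalize (Cmod_ge_0 (z1 - z0)); lra).
      destruct (H (e / M)%R ltac:(now apply Rdiv_lt_0_compat)) as [d [Hd K]].
      assert (HdM : (0 < d / M)%R) by now apply Rdiv_lt_0_compat.
      exists (mkposreal _ HdM). intros y Hy.
      assert (Hy' : (Rabs (y - t) < d / M)%R) by exact Hy.
      change (Rabs ((g y - g t) - (y - t) * 0) <= e * Rabs (y - t))%R.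
      replace (g y - g t - (y - t) * 0)%R with (g y - g t)%R by ring.
      unfold g. rewrite <- Hp1. eapply Rle_trans; [apply Hp2|].
      assert (E1 : z0 + y * (z1 - z0) - (z0 + t * (z1 - z0)) = RtoC (y - t) * (z1 - z0)) by (rewrite RtoC_minus; ring).
      specialize (K (z0 + y * (z1 - z0))). rewrite E1 in K. rewrite Cmod_mult, Cmod_R in K.
      replace (f (z0 + y * (z1 - z0)) - f (z0 + t * (z1 - z0)) - 0 * (RtoC (y - t) * (z1 - z0)))
        with (f (z0 + y * (z1 - z0)) - f (z0 + t * (z1 - z0))) in K by ring.
      assert (HL : (Rabs (y - t) * Cmod (z1 - z0) <= Rabs (y - t) * M)%R).
      { apply Rmult_le_compat_l. apply Rabs_pos. unfold M; lra. }
      eapply Rle_trans; [apply K|].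
      - eapply Rle_lt_trans; [exact HL|]. replace d with (d / M * M)%R by (field; lra).
        apply Rmult_lt_compat_r; auto.
      - replace (e * Rabs (y - t))%R with (e / M * (Rabs (y - t) * M))%R by (field; lra).
        apply Rmult_le_compat_l; auto. left. now apply Rdiv_lt_0_compat. }
    unfold g in E. replace (z0 + RtoC 0 * (z1 - z0)) with z0 in E by ring.
    replace (z0 + RtoC 1 * (z1 - z0)) with z1 in E by ring. auto. }
  apply C_ext; apply G.
  - intros; unfold Cminus. rewrite re_plus, re_opp. ring.
  - apply re_le_Cmod.
  - intros; unfold Cminus. rewrite im_plus, im_opp. ring.
  - apply im_le_Cmod.
Qed.

(** Dominated convergence for the difference quotients, which the Lipschitz constants [K n] dominate. *)
Lemma CD_series (f : nat -> C -> C) (f' : nat -> C) S (z0 l : C) (d : R) K B :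
  (0 < d)%R -> (forall n, CD (f n) z0 (f' n)) -> majorant K B ->
  (forall n w, (Cmod (w - z0) < d)%R -> (Cmod (f n w - f n z0) <= K n * Cmod (w - z0))%R) ->
  (forall w, (Cmod (w - z0) < d)%R -> CS (fun n => f n w) (S w)) ->
  CS f' l -> CD S z0 l.
Proof.
  intros Hd Hf HK HL HS Hl. apply CD_quot.
  apply tannery with (b := fun w n => (f n w - f n z0) / (w - z0)) (bl := f') (m := K) (B := B); auto.
  - apply punctured_filter.
  - exists d. split; auto. intros w Hw Hm n. assert (N := Cminus_nz _ _ Hw).
    rewrite Cmod_div by auto. apply Rle_div_l. now apply Cmod_nz. auto.
  - intros n. apply CD_quot. apply Hf.
  - exists d. split; auto. intros w Hw Hm.
    apply CS_ext with (fun n => / (w - z0) * (f n w - f n z0)).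
    { intros n. unfold Cdiv. ring. }
    unfold Cdiv. rewrite Cmult_comm. apply CS_scal, CS_minus; auto.
    apply HS. replace (z0 - z0) with (RtoC 0) by ring. now rewrite Cmod_0.
Qed.

(** * The exponential *)

Lemma Cexp_add a b : Cexp (a + b) = Cexp a * Cexp b.
Proof.
  unfold Cexp. rewrite re_plus, im_plus, exp_plus, cos_plus, sin_plus.
  apply C_ext; simpl; ring.
Qed.

Lemma Cexp_0 : Cexp 0 = 1.
Proof. unfold Cexp. simpl. rewrite exp_0, cos_0, sin_0. apply C_ext; simpl; ring. Qed.

Lemma Cmod_Cexp z : Cmod (Cexp z) = exp (Re z).
Proof.
  unfold Cexp. rewrite Cmod_mult, Cmod_R, Rabs_right by (left; apply exp_pos).
  replace (Cmod (cos (Im z), sin (Im z))) with 1%R. ring.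
  unfold Cmod. simpl. rewrite !Rmult_1_r. rewrite Rplus_comm. 
  generalize (sin2_cos2 (Im z)). unfold Rsqr. intros ->. now rewrite sqrt_1.
Qed.

Lemma Cexp_nz z : Cexp z <> 0.
Proof. apply Cmod_gt_0. rewrite Cmod_Cexp. apply exp_pos. Qed.

Lemma Cexp_opp z : Cexp (- z) = / Cexp z.
Proof.
  assert (H : Cexp (- z) * Cexp z = 1).
  { rewrite <- Cexp_add. replace (- z + z) with (RtoC 0) by ring. apply Cexp_0. }
  replace (Cexp (-z)) with (Cexp (-z) * Cexp z / Cexp z) by (field; apply Cexp_nz).
  rewrite H. unfold Cdiv. ring.
Qed.

Lemma Cexp_nat n z : Cexp (INR n * z) = Cexp z ^ n.
Proof.
  induction n. { simpl. rewrite <- Cexp_0. f_equal. ring. }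
  rewrite S_INR, RtoC_plus. replace ((RtoC (INR n) + 1) * z) with (INR n * z + z) by ring.
  rewrite Cexp_add, IHn. simpl. ring.
Qed.

Lemma Cexp_RtoC (x : R) : Cexp x = RtoC (exp x).
Proof. unfold Cexp. simpl. rewrite cos_0, sin_0. apply C_ext; simpl; ring. Qed.

Lemma R_deriv_eps (f : R -> R) x l : is_derive f x l -> forall e, (0 < e)%R ->
  exists d, (0 < d)%R /\ forall y, (Rabs (y - x) < d)%R -> (Rabs (f y - f x - l * (y - x)) <= e * Rabs (y - x))%R.
Proof.
  intros [_ H] e He. specialize (H x (fun P HP => HP) (mkposreal e He)).
  destruct H as [d Hd]. exists d. split. apply cond_pos. intros y Hy.
  specialize (Hd y Hy). simpl in Hd. rewrite (Rmult_comm l). exact Hd.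
Qed.

(** The complex derivative at 0 is read off from the real derivatives of exp, cos and sin there; the
    functional equation moves it to any other point. *)
Lemma CD_Cexp_0 : CD Cexp 0 1.
Proof.
  apply CD_eps. intros e He.
  destruct (R_deriv_eps exp 0 1 ltac:(replace 1%R with (exp 0) by apply exp_0; apply is_derive_exp) (Rmin 1 (e/8)) ltac:(apply Rmin_pos; lra)) as [d1 [Hd1 H1]].
  destruct (R_deriv_eps cos 0 0 ltac:(replace 0%R with (- sin 0)%R at 2 by (rewrite sin_0; ring); apply is_derive_cos) (e / 16) ltac:(lra)) as [d2 [Hd2 H2]].
  destruct (R_deriv_eps sin 0 1 ltac:(replace 1%R with (cos 0) by apply cos_0; apply is_derive_sin) (e / 16) ltac:(lra)) as [d3 [Hd3 H3]].
  set (d := Rmin (Rmin d1 d2) (Rmin d3 (Rmin (1/4) (e / 16)))).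
  assert (Hd : (0 < d)%R) by (unfold d; repeat apply Rmin_pos; lra).
  assert (L1 : (d <= d1)%R) by (unfold d; eapply Rle_trans; apply Rmin_l).
  assert (L2 : (d <= d2)%R) by (unfold d; eapply Rle_trans; [apply Rmin_l|apply Rmin_r]).
  assert (L3 : (d <= d3)%R) by (unfold d; eapply Rle_trans; [apply Rmin_r|apply Rmin_l]).
  assert (L4 : (d <= Rmin (1/4) (e/16))%R) by (unfold d; eapply Rle_trans; [apply Rmin_r|apply Rmin_r]).
  assert (L5 := Rle_trans _ _ _ L4 (Rmin_l _ _)).
  assert (L6 := Rle_trans _ _ _ L4 (Rmin_r _ _)).
  exists d. split; auto. intros w Hw.
  rewrite Cexp_0. replace (w - 0) with w in * by ring.
  assert (Hx := re_le_Cmod w). assert (Hy := im_le_Cmod w).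
  specialize (H1 (Re w)). specialize (H2 (Im w)). specialize (H3 (Im w)).
  rewrite ?Rminus_0_r, ?exp_0, ?cos_0, ?sin_0 in *.
  specialize (H1 ltac:(lra)). specialize (H2 ltac:(lra)). specialize (H3 ltac:(lra)).
  unfold Cexp. set (x := Re w) in *. set (y := Im w) in *. set (m := Cmod w) in *.
  assert (Hm : (0 <= m)%R) by apply Cmod_ge_0.
  assert (M1 := Rmin_l 1 (e/8)). assert (M2 := Rmin_r 1 (e/8)).
  set (r := Rmin 1 (e/8)) in *.
  assert (A1 : (Rabs (exp x - 1 - x) <= Rabs x)%R).
  { replace (1 * x)%R with x in H1 by ring. eapply Rle_trans; [apply H1|]. generalize (Rabs_pos x). nra. }
  assert (A2 : (Rabs (exp x - 1 - x) <= e / 8 * m)%R).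
  { replace (1 * x)%R with x in H1 by ring. eapply Rle_trans; [apply H1|]. generalize (Rabs_pos x). nra. }
  assert (B1 : (Rabs (exp x - 1) <= 2 * Rabs x)%R).
  { replace (exp x - 1)%R with ((exp x - 1 - x) + x)%R by ring. eapply Rle_trans; [apply Rabs_triang|]. lra. }
  assert (B2 : (Rabs (exp x) <= 2)%R).
  { replace (exp x)%R with ((exp x - 1) + 1)%R by ring. eapply Rle_trans; [apply Rabs_triang|]. rewrite Rabs_R1. lra. }
  assert (C1 : (Rabs (cos y - 1) <= e / 16 * m)%R).
  { replace (cos y - 1 - 0 * y)%R with (cos y - 1)%R in H2 by ring. eapply Rle_trans; [apply H2|]. apply Rmult_le_compat_l; lra. }
  assert (S1 : (Rabs (sin y - y) <= e / 16 * m)%R).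
  { replace (sin y - 0 - 1 * y)%R with (sin y - y)%R in H3 by ring. replace (1 * y)%R with y in H3 by ring. eapply Rle_trans; [apply H3|]. apply Rmult_le_compat_l; lra. }
  eapply Rle_trans; [apply Cmod_le_ReIm|].
  replace (Re (RtoC (exp x) * (cos y, sin y) - 1 - 1 * w)) with ((exp x - 1 - x) + exp x * (cos y - 1))%R
    by (unfold x, y, Re, Im; simpl; unfold Re, Im; ring).
  replace (Im (RtoC (exp x) * (cos y, sin y) - 1 - 1 * w)) with (exp x * (sin y - y) + (exp x - 1) * y)%R
    by (unfold x, y, Re, Im; simpl; unfold Re, Im; ring).
  assert (T1 := Rabs_triang (exp x - 1 - x) (exp x * (cos y - 1))).
  assert (T2 := Rabs_triang (exp x * (sin y - y)) ((exp x - 1) * y)).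
  rewrite Rabs_mult in T1. rewrite !Rabs_mult in T2.
  assert (U1 : (Rabs (exp x) * Rabs (cos y - 1) <= 2 * (e / 16 * m))%R) by (apply Rmult_le_compat; auto using Rabs_pos).
  assert (U2 : (Rabs (exp x) * Rabs (sin y - y) <= 2 * (e / 16 * m))%R) by (apply Rmult_le_compat; auto using Rabs_pos).
  assert (U3 : (Rabs (exp x - 1) * Rabs y <= (2 * (e / 16)) * m)%R).
  { apply Rmult_le_compat; auto using Rabs_pos. lra. }
  nra.
Qed.

Lemma CD_Cexp z : CD Cexp z (Cexp z).
Proof.
  apply CD_ext with (fun w => Cexp z * Cexp (w - z)).
  { intros w. rewrite <- Cexp_add. f_equal. ring. }
  eapply CD_eq. apply CD_scal. apply (CD_comp Cexp (fun w => w - z)).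
  - replace (z - z) with (RtoC 0) by ring. apply CD_Cexp_0.
  - apply CD_minus. apply CD_id. apply CD_const.
  - ring.
Qed.

Lemma CD_Cexp_comp (f : C -> C) z a : CD f z a -> CD (fun w => Cexp (f w)) z (Cexp (f z) * a).
Proof. intros. apply (CD_comp Cexp); auto. apply CD_Cexp. Qed.

(** * Power series *)

Lemma Clim_Re u l : Clim u l -> is_lim_seq (fun n => Re (u n)) (Re l).
Proof.
  intros H. apply is_lim_seq_spec. intros e. destruct (H e (cond_pos e)) as [N HN].
  exists N. intros n Hn. eapply Rle_lt_trans; [|apply (HN n Hn)].
  replace (Re (u n) - Re l)%R with (Re (u n - l)). apply re_le_Cmod.
  unfold Cminus. rewrite re_plus, re_opp. ring.
Qed.

Lemma Clim_Im u l : Clim u l -> is_lim_seq (fun n => Im (u n)) (Im l).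
Proof.
  intros H. apply is_lim_seq_spec. intros e. destruct (H e (cond_pos e)) as [N HN].
  exists N. intros n Hn. eapply Rle_lt_trans; [|apply (HN n Hn)].
  replace (Im (u n) - Im l)%R with (Im (u n - l)). apply im_le_Cmod.
  unfold Cminus. rewrite im_plus, im_opp. ring.
Qed.

Lemma Clim_CLim_seq u l : Clim u l -> CLim_seq u = l.
Proof.
  intros H. unfold CLim_seq. apply C_ext; simpl.
  - now rewrite (is_lim_seq_unique _ _ (Clim_Re _ _ H)).
  - now rewrite (is_lim_seq_unique _ _ (Clim_Im _ _ H)).
Qed.

Lemma csum_Re u n : Re (csum u (S n)) = sum_n (fun k => Re (u k)) n.
Proof.
  induction n. { rewrite sum_O. change (csum u 1) with (0 + u O). now rewrite Cplus_0_l. }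
  rewrite sum_Sn, <- IHn. simpl csum. rewrite !re_plus. reflexivity.
Qed.

Lemma csum_Im u n : Im (csum u (S n)) = sum_n (fun k => Im (u k)) n.
Proof.
  induction n. { rewrite sum_O. change (csum u 1) with (0 + u O). now rewrite Cplus_0_l. }
  rewrite sum_Sn, <- IHn. simpl csum. rewrite !im_plus. reflexivity.
Qed.

Lemma CS_CSeries a l : CS a l -> CSeries a = l.
Proof.
  intros H. unfold CSeries, Series. apply Clim_S in H.
  apply C_ext; simpl.
  - apply Clim_Re in H. erewrite Lim_seq_ext; [|intros n; symmetry; apply csum_Re].
    now rewrite (is_lim_seq_unique _ _ H).
  - apply Clim_Im in H. erewrite Lim_seq_ext; [|intros n; symmetry; apply csum_Im].
    now rewrite (is_lim_seq_unique _ _ H).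
Qed.

Definition absr (a : nat -> C) (r : R) : Prop :=
  exists B, majorant (fun n => Cmod (a n) * r ^ n)%R B.

Definition psum (a : nat -> C) (x : C) : C := CSeries (fun n => a n * x ^ n).

Definition PS (a : nat -> C) : Prop := forall r, (0 < r < 1)%R -> absr a r.

Lemma psum_CS a r x : absr a r -> (Cmod x <= r)%R -> CS (fun n => a n * x ^ n) (psum a x).
Proof.
  intros [B HB] Hx.
  destruct (CS_of_majorant (fun n => a n * x ^ n) (fun n => Cmod (a n) * r ^ n)%R B) as [l Hl]; auto.
  - intros n. rewrite Cmod_mult, Cmod_pow. apply Rmult_le_compat_l. apply Cmod_ge_0.
    apply pow_incr. split; auto. apply Cmod_ge_0.
  - unfold psum. now rewrite (CS_CSeries _ _ Hl).
Qed.

Lemma between_1 x : (Cmod x < 1)%R -> exists r, (0 < r < 1)%R /\ (Cmod x < r)%R.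
Proof. intros. exists ((Cmod x + 1) / 2)%R. generalize (Cmod_ge_0 x). lra. Qed.

Lemma PS_CS a x : PS a -> (Cmod x < 1)%R -> CS (fun n => a n * x ^ n) (psum a x).
Proof.
  intros H Hx. destruct (between_1 x Hx) as [r [Hr L]]. apply psum_CS with r; auto. lra.
Qed.

Lemma majorant_scal c m B : (0 <= c)%R -> majorant m B -> majorant (fun n => c * m n)%R (c * B).
Proof.
  intros Hc [H1 H2]. split.
  - intros. apply Rmult_le_pos; auto.
  - intros. rewrite rsum_scal. apply Rmult_le_compat_l; auto.
Qed.

Lemma majorant_plus m m' B B' : majorant m B -> majorant m' B' -> majorant (fun n => m n + m' n)%R (B + B').
Proof.
  intros [H1 H2] [H3 H4]. split.
  - intros. generalize (H1 n) (H3 n). lra.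
  - intros. rewrite rsum_plus. generalize (H2 n) (H4 n). lra.
Qed.

Lemma n_pow_bound rho r : (0 < rho < r)%R ->
  exists K, (0 <= K)%R /\ forall n, (INR n * rho ^ n <= K * r ^ n)%R.
Proof.
  intros [H1 H2]. set (x := (r / rho - 1)%R).
  assert (Hx : (0 < x)%R).
  { unfold x. assert (1 < r / rho)%R; [|lra]. apply Rlt_div_r; lra. }
  exists (/ x)%R. split. left; now apply Rinv_0_lt_compat.
  intros n. assert (Hb : (1 + INR n * x <= (1 + x) ^ n)%R) by (apply poly; auto).
  replace (1 + x)%R with (r / rho)%R in Hb by (unfold x; ring).
  assert (E : (r ^ n = (r / rho) ^ n * rho ^ n)%R).
  { rewrite <- Rpow_mult_distr. f_equal. field. lra. }
  rewrite E, <- Rmult_assoc. apply Rmult_le_compat_r. apply pow_le; lra.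
  apply Rmult_le_reg_l with x; auto. rewrite <- Rmult_assoc, Rinv_r, Rmult_1_l by lra. lra.
Qed.

Definition pder (a : nat -> C) : nat -> C := fun n => INR (S n) * a (S n).

Lemma majorant_S m B : majorant m B -> majorant (fun n => m (S n)) B.
Proof.
  intros [H1 H2]. split. auto. intros n.
  assert (E : rsum m (S n) = (m O + rsum (fun i => m (S i)) n)%R).
  { clear. induction n. simpl; ring. simpl in *. rewrite IHn. ring. }
  generalize (H2 (S n)) (H1 O). rewrite E. lra.
Qed.

Lemma absr_n a rho r : (0 < rho < r)%R -> absr a r -> absr (fun n => INR n * a n) rho.
Proof.
  intros Hr [B HB]. destruct (n_pow_bound rho r Hr) as [K [HK1 HK2]].
  exists (K * B)%R. apply majorant_le with (2 := majorant_scal K _ B HK1 HB).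
  intros n. rewrite Cmod_mult, Cmod_R, Rabs_right by (apply Rle_ge, pos_INR). split.
  - apply Rmult_le_pos. apply Rmult_le_pos. apply pos_INR. apply Cmod_ge_0. apply pow_le; lra.
  - generalize (HK2 n) (Cmod_ge_0 (a n)). nra.
Qed.

Lemma absr_pder a rho r : (0 < rho < r)%R -> absr a r -> absr (pder a) rho.
Proof.
  intros Hr H. destruct (absr_n a rho r Hr H) as [B HB].
  exists (/ rho * B)%R. apply majorant_S in HB.
  apply majorant_le with (2 := majorant_scal (/ rho) _ B (Rlt_le _ _ (Rinv_0_lt_compat _ (proj1 Hr))) HB).
  intros n. unfold pder. split.
  - apply Rmult_le_pos. apply Cmod_ge_0. apply pow_le; lra.
  - right. simpl. field. lra.
Qed.

Lemma PS_n a : PS a -> PS (fun n => INR n * a n).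
Proof. intros H r Hr. apply absr_n with ((r + 1) / 2)%R. lra. apply H. lra. Qed.

Lemma PS_pder a : PS a -> PS (pder a).
Proof. intros H r Hr. apply absr_pder with ((r + 1) / 2)%R. lra. apply H. lra. Qed.

Lemma Cmod_pow_diff w z rho n : (Cmod w <= rho)%R -> (Cmod z <= rho)%R ->
  (Cmod (w ^ n - z ^ n) <= INR n * rho ^ (n - 1) * Cmod (w - z))%R.
Proof.
  intros Hw Hz. assert (Hr : (0 <= rho)%R) by (eapply Rle_trans; [apply Cmod_ge_0|exact Hw]).
  induction n.
  - simpl. replace (RtoC 1 - 1) with (RtoC 0) by ring. rewrite Cmod_0. lra.
  - simpl Cpow. replace (w * w ^ n - z * z ^ n) with (w * (w ^ n - z ^ n) + (w - z) * z ^ n) by ring.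
    eapply Rle_trans; [apply Cmod_triangle|]. rewrite !Cmod_mult.
    replace (S n - 1)%nat with n by lia. rewrite S_INR.
    assert (X : (Cmod w * Cmod (w ^ n - z ^ n) <= INR n * rho ^ n * Cmod (w - z))%R).
    { eapply Rle_trans. apply Rmult_le_compat; [apply Cmod_ge_0|apply Cmod_ge_0|exact Hw|exact IHn].
      destruct n. simpl; lra. replace (S n - 1)%nat with n by lia. simpl. right. ring. }
    assert (Y : (Cmod (z ^ n) <= rho ^ n)%R).
    { rewrite Cmod_pow. apply pow_incr. split; auto. apply Cmod_ge_0. }
    generalize (Cmod_ge_0 (w - z)). nra.
Qed.

Lemma CD_psum a r z : absr a r -> (Cmod z < r)%R -> CD (psum a) z (psum (pder a) z).
Proof.
  intros H Hz. set (rho := ((Cmod z + r) / 2)%R).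
  assert (G0 := Cmod_ge_0 z).
  assert (Hr : (0 < rho < r)%R) by (unfold rho; lra).
  assert (Hd := absr_pder a rho r Hr H). destruct (absr_n a rho r Hr H) as [B HB].
  apply CD_series with (f := fun n w => a n * w ^ n) (f' := fun n => a n * (INR n * 1 * z ^ (n - 1)))
     (d := ((r - Cmod z) / 2)%R) (K := fun n => (/ rho * (Cmod (INR n * a n) * rho ^ n))%R) (B := (/ rho * B)%R).
  - lra.
  - intros n. apply CD_scal. apply CD_pow. apply CD_id.
  - apply majorant_scal; auto. left. apply Rinv_0_lt_compat. lra.
  - intros n w Hw. replace (a n * w ^ n - a n * z ^ n) with (a n * (w ^ n - z ^ n)) by ring.
    rewrite !Cmod_mult, Cmod_R, Rabs_right by (apply Rle_ge, pos_INR).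
    assert (Hw' : (Cmod w <= rho)%R).
    { generalize (Cmod_triangle_rev w z). unfold rho. lra. }
    eapply Rle_trans. apply Rmult_le_compat_l. apply Cmod_ge_0.
    apply (Cmod_pow_diff w z rho); auto. unfold rho; lra.
    right. destruct n; simpl. ring. replace (n - 0)%nat with n by lia. field. lra.
  - intros w Hw. apply psum_CS with r; auto. generalize (Cmod_triangle_rev w z). lra.
  - replace (psum (pder a) z) with (a O * (RtoC (INR 0) * 1 * z ^ (0 - 1)) + psum (pder a) z) by (simpl; ring).
    apply (CS_S (fun n => a n * (RtoC (INR n) * 1 * z ^ (n - 1)))).
    eapply CS_ext; [|apply psum_CS with (1 := Hd); unfold rho; lra].
    intros n. cbv beta. unfold pder. replace (S n - 1)%nat with n by lia. ring.
Qed.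

Lemma PS_CD a z : PS a -> (Cmod z < 1)%R -> CD (psum a) z (psum (pder a) z).
Proof. intros H Hz. destruct (between_1 z Hz) as [r [Hr L]]. apply CD_psum with r; auto. Qed.

(** * Cauchy products *)

Definition cconv (a b : nat -> C) : nat -> C := fun n => csum (fun i => a i * b (n - i)%nat) (S n).

Lemma rsum_triangle (u v : nat -> R) N Bu Bv :
  majorant u Bu -> majorant v Bv ->
  (rsum (fun n => rsum (fun i => u i * v (n - i)%nat)%R (S n)) N <= Bu * Bv)%R.
Proof.
  intros [U1 U2] [V1 V2].
  assert (E : forall n m, (n < m)%nat -> rsum (fun i => if (i <=? n)%nat then (u i * v (n - i)%nat)%R else 0%R) m
     = rsum (fun i => u i * v (n - i)%nat)%R (S n)).
  { intros n m L. induction L.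
    - apply rsum_ext. intros i Hi. destruct (Nat.leb_spec i n); auto. lia.
    - simpl rsum at 1. rewrite IHL. destruct (Nat.leb_spec m n); [lia|]. ring. }
  rewrite (rsum_ext _ (fun n => rsum (fun i => if (i <=? n)%nat then (u i * v (n - i)%nat)%R else 0%R) N)).
  2: intros n Hn; symmetry; now apply E.
  rewrite rsum_swap.
  apply Rle_trans with (rsum (fun i => Bv * u i)%R N).
  2:{ rewrite rsum_scal, Rmult_comm. apply Rmult_le_compat_r. apply (V2 O). apply U2. }
  apply rsum_le. intros i _.
  apply Rle_trans with (u i * rsum v N)%R.
  2:{ rewrite Rmult_comm. apply Rmult_le_compat_r; auto. }
  assert (G : forall M, rsum (fun n => if (i <=? n)%nat then (u i * v (n - i)%nat)%R else 0%R) M = (u i * rsum v (M - i))%R).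
  { induction M. simpl. ring. simpl rsum at 1. rewrite IHM.
    destruct (Nat.leb_spec i M).
    - replace (S M - i)%nat with (S (M - i)) by lia. simpl. ring.
    - replace (S M - i)%nat with O by lia. replace (M - i)%nat with O by lia. ring. }
  rewrite G. apply Rmult_le_compat_l; auto. apply rsum_mono; auto. lia.
Qed.

Lemma majorant_cconv a b r Ba Bb : (0 <= r)%R ->
  majorant (fun n => Cmod (a n) * r ^ n)%R Ba -> majorant (fun n => Cmod (b n) * r ^ n)%R Bb ->
  majorant (fun n => Cmod (cconv a b n) * r ^ n)%R (Ba * Bb)%R.
Proof.
  intros Hr Ha Hb. split.
  - intros. apply Rmult_le_pos. apply Cmod_ge_0. now apply pow_le.
  - intros N. eapply Rle_trans; [|apply (rsum_triangle _ _ N _ _ Ha Hb)].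
    apply rsum_le. intros n _.
    apply Rle_trans with (rsum (fun i => Cmod (a i * b (n - i)%nat)) (S n) * r ^ n)%R.
    { apply Rmult_le_compat_r. now apply pow_le. apply Cmod_csum. }
    rewrite Rmult_comm, <- rsum_scal. apply rsum_le. intros i Hi. right.
    rewrite Cmod_mult. replace (r ^ n)%R with (r ^ i * r ^ (n - i))%R. ring.
    rewrite <- pow_add. f_equal. lia.
Qed.

Lemma absr_cconv a b r : (0 <= r)%R -> absr a r -> absr b r -> absr (cconv a b) r.
Proof. intros Hr [Ba Ha] [Bb Hb]. exists (Ba * Bb)%R. now apply majorant_cconv. Qed.

Lemma PS_cconv a b : PS a -> PS b -> PS (cconv a b).
Proof. intros Ha Hb r Hr. apply absr_cconv; auto. lra. Qed.

Lemma CS_cconv (u v : nat -> C) U V Bu Bv :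
  majorant (fun n => Cmod (u n)) Bu -> majorant (fun n => Cmod (v n)) Bv ->
  CS u U -> CS v V -> CS (cconv u v) (U * V).
Proof.
  intros Mu Mv HU HV.
  set (c := fun i n => if (i <=? n)%nat then u i * v (n - i)%nat else 0).
  assert (Hrow : forall i, CS (c i) (u i * V)).
  { intros i. apply (CS_shift _ i).
    rewrite (csum_ext _ (fun _ => 0)), csum_zero.
    2:{ intros j Hj. unfold c. destruct (Nat.leb_spec i j); auto. lia. }
    replace (u i * V - 0) with (u i * V) by ring.
    apply CS_ext with (fun n => u i * v n). 2: now apply CS_scal.
    intros n. unfold c. destruct (Nat.leb_spec i (i + n)); [|lia]. do 2 f_equal. lia. }
  assert (Hm : dbl_majorant c (Bu * Bv)).
  { apply dbl_majorant_of_rows with (fun i => Bv * Cmod (u i))%R.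
    - intros i. split. intros; apply Cmod_ge_0. intros N.
      assert (G : (rsum (fun j => Cmod (c i j)) N = Cmod (u i) * rsum (fun n => Cmod (v n)) (N - i))%R).
      { induction N. simpl. ring. simpl rsum at 1. rewrite IHN. unfold c at 1.
        destruct (Nat.leb_spec i N).
        - replace (S N - i)%nat with (S (N - i)) by lia. simpl. rewrite Cmod_mult. ring.
        - replace (S N - i)%nat with O by lia. replace (N - i)%nat with O by lia. rewrite Cmod_0. ring. }
      rewrite G, Rmult_comm. apply Rmult_le_compat_r. apply Cmod_ge_0. apply Mv.
    - rewrite Rmult_comm. apply majorant_scal; auto. apply (proj2 Mv O). }
  destruct (fubini c _ (fun i => u i * V) (cconv u v) Hm Hrow) as [s [S1 S2]].
  - intros n. unfold cconv.
    replace (csum (fun i => u i * v (n - i)%nat) (S n)) with (csum (fun i => c i n) (S n)).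
    + apply CS_finite. intros i Hi. unfold c. destruct (Nat.leb_spec i n); auto. lia.
    + apply csum_ext. intros i Hi. unfold c. destruct (Nat.leb_spec i n); auto. lia.
  - replace (U * V) with s; auto. eapply CS_unique; [exact S1|].
    apply CS_ext with (fun i => V * u i). intros; ring. rewrite Cmult_comm. now apply CS_scal.
Qed.

Lemma absr_pt a r x : absr a r -> (Cmod x <= r)%R -> exists B, majorant (fun n => Cmod (a n * x ^ n)) B.
Proof.
  intros [B HB] Hx. exists B. apply majorant_le with (2 := HB). intros n. split. apply Cmod_ge_0.
  rewrite Cmod_mult, Cmod_pow. apply Rmult_le_compat_l. apply Cmod_ge_0.
  apply pow_incr. split; auto. apply Cmod_ge_0.
Qed.

Lemma psum_cconv a b r x : absr a r -> absr b r -> (Cmod x <= r)%R ->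
  psum (cconv a b) x = psum a x * psum b x.
Proof.
  intros Ha Hb Hx. apply CS_CSeries.
  destruct (absr_pt a r x Ha Hx) as [Ba Ma]. destruct (absr_pt b r x Hb Hx) as [Bb Mb].
  eapply CS_ext; [|apply (CS_cconv _ _ _ _ _ _ Ma Mb (psum_CS a r x Ha Hx) (psum_CS b r x Hb Hx))].
  intros n. unfold cconv. rewrite Cmult_comm, <- csum_scal. apply csum_ext. intros i Hi.
  replace (x ^ n) with (x ^ i * x ^ (n - i)). ring. rewrite <- Cpow_add_r. f_equal. lia.
Qed.

Lemma PS_psum_cconv a b x : PS a -> PS b -> (Cmod x < 1)%R -> psum (cconv a b) x = psum a x * psum b x.
Proof.
  intros Ha Hb Hx. destruct (between_1 x Hx) as [r [Hr L]].
  apply psum_cconv with r; auto. lra.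
Qed.

Lemma PS_plus a b : PS a -> PS b -> PS (fun n => a n + b n).
Proof.
  intros Ha Hb r Hr. destruct (Ha r Hr) as [Ba Ma], (Hb r Hr) as [Bb Mb].
  exists (Ba + Bb)%R. apply majorant_le with (2 := majorant_plus _ _ _ _ Ma Mb).
  intros n. assert (0 <= r ^ n)%R by (apply pow_le; lra). split.
  apply Rmult_le_pos; auto. apply Cmod_ge_0. generalize (Cmod_triangle (a n) (b n)). nra.
Qed.

Lemma PS_scal c a : PS a -> PS (fun n => c * a n).
Proof.
  intros Ha r Hr. destruct (Ha r Hr) as [Ba Ma]. exists (Cmod c * Ba)%R.
  apply majorant_le with (2 := majorant_scal (Cmod c) _ _ (Cmod_ge_0 _) Ma).
  intros n. assert (0 <= r ^ n)%R by (apply pow_le; lra). rewrite Cmod_mult. split.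
  repeat apply Rmult_le_pos; auto; apply Cmod_ge_0. right; ring.
Qed.

Lemma psum_plus a b x : PS a -> PS b -> (Cmod x < 1)%R -> psum (fun n => a n + b n) x = psum a x + psum b x.
Proof.
  intros. apply CS_CSeries. apply CS_ext with (fun n => a n * x ^ n + b n * x ^ n).
  intros; ring. apply CS_plus; now apply PS_CS.
Qed.

Lemma psum_scal c a x : PS a -> (Cmod x < 1)%R -> psum (fun n => c * a n) x = c * psum a x.
Proof.
  intros. apply CS_CSeries. apply CS_ext with (fun n => c * (a n * x ^ n)).
  intros; ring. apply CS_scal; now apply PS_CS.
Qed.

(** * The exponential series *)

Definition expc : nat -> C := fun n => / INR (fact n).

Lemma fact_pos n : (0 < INR (fact n))%R.
Proof. apply lt_0_INR, lt_O_fact. Qed.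

Lemma RtoC_fact_nz n : RtoC (INR (fact n)) <> 0.
Proof. intros H. apply RtoC_inj in H. generalize (fact_pos n). lra. Qed.

Lemma Cmod_expc n : Cmod (expc n) = (/ INR (fact n))%R.
Proof.
  unfold expc. rewrite Cmod_inv by apply RtoC_fact_nz. rewrite Cmod_R, Rabs_right; auto.
  generalize (fact_pos n); lra.
Qed.

Lemma exp_majorant r : (0 <= r)%R -> majorant (fun n => / INR (fact n) * r ^ n)%R (exp r).
Proof.
  intros Hr. split.
  - intros. apply Rmult_le_pos. left. apply Rinv_0_lt_compat, fact_pos. now apply pow_le.
  - intros [|n]. simpl. left; apply exp_pos.
    assert (E : rsum (fun n => / INR (fact n) * r ^ n)%R (S n) = sum_f_R0 (fun n => / INR (fact n) * r ^ n)%R n).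
    { induction n. simpl. ring. simpl sum_f_R0. rewrite <- IHn. reflexivity. }
    rewrite E. apply sum_incr.
    + unfold exp. destruct (exist_exp r) as [l Hl]. simpl. exact Hl.
    + intros k. apply Rmult_le_pos. left. apply Rinv_0_lt_compat, fact_pos. now apply pow_le.
Qed.

Lemma absr_expc r : (0 <= r)%R -> absr expc r.
Proof.
  intros Hr. exists (exp r). apply majorant_le with (2 := exp_majorant r Hr).
  intros n. rewrite Cmod_expc. split; [|lra]. apply Rmult_le_pos. left. apply Rinv_0_lt_compat, fact_pos. now apply pow_le.
Qed.

Lemma psum_0 a : psum a 0 = a O.
Proof.
  apply CS_CSeries. replace (a O) with (csum (fun n => a n * 0 ^ n) 1) by (simpl; ring).
  apply CS_finite. intros [|i] Hi; [lia|]. simpl. ring.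
Qed.

Lemma psum_expc z : psum expc z = Cexp z.
Proof.
  assert (H : psum expc z * Cexp (- z) = psum expc 0 * Cexp (- 0)).
  { apply (CD_zero_segment (fun w => psum expc w * Cexp (- w))). intros t Ht.
    set (w := 0 + t * (z - 0)). eapply CD_eq.
    - apply CD_mult. apply CD_psum with (r := (Cmod w + 1)%R). apply absr_expc. generalize (Cmod_ge_0 w); lra. lra.
      apply CD_Cexp_comp. apply CD_opp, CD_id.
    - replace (psum (pder expc) w) with (psum expc w). ring.
      unfold psum. f_equal. apply FunctionalExtensionality.functional_extensionality. intros n.
      f_equal. unfold pder, expc. change (fact (S n)) with (S n * fact n)%nat. rewrite mult_INR, RtoC_mult.
      field. split. apply RtoC_fact_nz. intros E. apply RtoC_inj in E. generalize (pos_INR n); rewrite S_INR in E; lra. }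
  rewrite psum_0 in H. replace (- 0) with (RtoC 0) in H by ring. rewrite Cexp_0, Cexp_opp in H.
  unfold expc at 2 in H. simpl in H.
  replace (psum expc z) with (psum expc z * / Cexp z * Cexp z) by (field; apply Cexp_nz).
  rewrite H. field.
Qed.

Lemma CS_exp z : CS (fun n => expc n * z ^ n) (Cexp z).
Proof. rewrite <- psum_expc. apply psum_CS with (Cmod z). apply absr_expc, Cmod_ge_0. lra. Qed.

Lemma Cexp_remainder (w : C) (k : nat) :
  (Cmod (Cexp w - csum (fun n => (expc n * w ^ n)%C) k) <= Cmod w ^ k * exp (Cmod w))%R.
Proof.
  apply CS_tail_bound; [|apply CS_exp]. intros n.
  rewrite (rsum_ext _ (fun i => Cmod w ^ k * (/ INR (fact (k + i)) * Cmod w ^ i))%R).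
  - rewrite rsum_scal. apply Rmult_le_compat_l. apply pow_le, Cmod_ge_0.
    eapply Rle_trans; [|apply (proj2 (exp_majorant (Cmod w) (Cmod_ge_0 _)) n)].
    apply rsum_le. intros i _. apply Rmult_le_compat_r. apply pow_le, Cmod_ge_0.
    apply Rinv_le_contravar. apply fact_pos. apply le_INR, fact_le. lia.
  - intros i _. rewrite Cmod_mult, Cmod_expc, Cmod_pow, pow_add. ring.
Qed.

(** * Exponential of a power series *)

Fixpoint cpow (a : nat -> C) (m : nat) : nat -> C :=
  match m with
  | O => fun n => match n with O => 1 | _ => 0 end
  | S m => cconv a (cpow a m)
  end.

(** The coefficients of the exponential of a power series, by collecting like powers in the exponential
    series. *)
Definition pexp (a : nat -> C) : nat -> C := fun n => CSeries (fun m => expc m * cpow a m n).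

Lemma majorant_cpow a r B m : (0 <= r)%R ->
  majorant (fun n => Cmod (a n) * r ^ n)%R B -> majorant (fun n => Cmod (cpow a m n) * r ^ n)%R (B ^ m).
Proof.
  intros Hr H. induction m; simpl.
  - split.
    + intros. apply Rmult_le_pos. apply Cmod_ge_0. now apply pow_le.
    + intros n. apply Rle_trans with (match n with O => 0%R | _ => 1%R end).
      2: destruct n; lra.
      induction n. simpl; lra. simpl rsum. destruct n.
      * simpl. rewrite Cmod_1. lra.
      * rewrite Cmod_0. lra.
  - now apply majorant_cconv.
Qed.

Lemma psum_cpow a r x m : absr a r -> (Cmod x <= r)%R -> psum (cpow a m) x = psum a x ^ m.
Proof.
  intros H Hx. assert (Hr : (0 <= r)%R) by (eapply Rle_trans; [apply Cmod_ge_0|exact Hx]).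
  induction m; simpl.
  - apply CS_CSeries. eapply CS_eq; [apply (CS_finite _ 1)|simpl; ring]. intros [|i] Hi; [lia|]. ring.
  - destruct (H) as [B HB]. rewrite (psum_cconv a (cpow a m) r); auto. now rewrite IHm.
    exists (B ^ m)%R. now apply majorant_cpow.
Qed.

Lemma pexp_spec a r x : absr a r -> (Cmod x <= r)%R ->
  CS (fun n => pexp a n * x ^ n) (Cexp (psum a x)) /\ 
  exists B, forall N, (rsum (fun n => Cmod (pexp a n * x ^ n)) N <= B)%R.
Proof.
  intros H Hx. assert (Hr : (0 <= r)%R) by (eapply Rle_trans; [apply Cmod_ge_0|exact Hx]).
  destruct (H) as [B HB]. assert (HB0 : (0 <= B)%R) by apply (proj2 HB O).
  set (c := fun m n => expc m * cpow a m n * x ^ n).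
  assert (Hm : dbl_majorant c (exp B)).
  { apply dbl_majorant_of_rows with (fun m => / INR (fact m) * B ^ m)%R.
    2: now apply exp_majorant.
    intros m. apply majorant_le with (fun n => / INR (fact m) * (Cmod (cpow a m n) * r ^ n))%R.
    - intros n. split. apply Cmod_ge_0. unfold c. rewrite !Cmod_mult, Cmod_expc, Cmod_pow, Rmult_assoc.
      apply Rmult_le_compat_l. left. apply Rinv_0_lt_compat, fact_pos.
      apply Rmult_le_compat_l. apply Cmod_ge_0. apply pow_incr. split; auto. apply Cmod_ge_0.
    - apply majorant_scal. left. apply Rinv_0_lt_compat, fact_pos. now apply majorant_cpow. }
  assert (Hrow : forall m, CS (c m) (expc m * psum a x ^ m)).
  { intros m. rewrite <- (psum_cpow a r x m H Hx).
    apply CS_ext with (fun n => expc m * (cpow a m n * x ^ n)). intros; unfold c; ring.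
    apply CS_scal. apply psum_CS with r; auto. exists (B ^ m)%R. now apply majorant_cpow. }
  assert (Hcol : forall n, CS (fun m => c m n) (pexp a n * x ^ n)).
  { intros n. destruct (Ceq_dec (x ^ n) 0) as [E|E].
    - rewrite E. apply CS_ext with (fun _ => 0). intros; unfold c; rewrite E; ring.
      replace (pexp a n * 0) with (RtoC 0) by ring. apply CS_zero.
    - destruct (CS_of_majorant (fun m => c m n) (fun m => Cmod (c m n)) (exp B)) as [l Hl].
      + intros; lra.
      + apply (dbl_row (fun n m => c m n)). now apply dbl_majorant_swap in Hm.
      + replace (pexp a n * x ^ n) with l; auto. unfold pexp.
        rewrite (CS_CSeries _ (l / x ^ n)). field; auto.
        apply CS_ext with (fun m => / x ^ n * c m n). intros; unfold c; field; auto.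
        unfold Cdiv. rewrite Cmult_comm. now apply CS_scal. }
  destruct (fubini c _ _ _ Hm Hrow Hcol) as [s [S1 S2]]. split.
  - replace (Cexp (psum a x)) with s; auto. eapply CS_unique; [exact S1|]. apply CS_exp.
  - exists (exp B). intros N. apply (rsum_limit_le (fun n m => c m n)); auto. now apply dbl_majorant_swap in Hm.
Qed.

Lemma PS_pexp a : PS a -> PS (pexp a).
Proof.
  intros H r Hr. destruct (pexp_spec a r (RtoC r)) as [_ [B HB]]; auto.
  rewrite Cmod_R, Rabs_right; lra. exists B.
  assert (E : forall n, Cmod (pexp a n * RtoC r ^ n) = (Cmod (pexp a n) * r ^ n)%R).
  { intros n. rewrite Cmod_mult, Cmod_pow, Cmod_R, Rabs_right; lra. }
  split. intros; rewrite <- E; apply Cmod_ge_0.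
  intros n. eapply Rle_trans; [|apply (HB n)]. right. apply rsum_ext. intros; now rewrite E.
Qed.

Lemma psum_pexp a x : PS a -> (Cmod x < 1)%R -> psum (pexp a) x = Cexp (psum a x).
Proof.
  intros H Hx. destruct (between_1 x Hx) as [r [Hr L]].
  apply CS_CSeries. apply (pexp_spec a r x); auto. lra.
Qed.

(** * Geometric series and the logarithm *)

Lemma geom_majorant r : (0 <= r < 1)%R -> majorant (fun n => r ^ n)%R (/ (1 - r)).
Proof.
  intros Hr. split. intros; apply pow_le; lra. intros n.
  assert (E : (rsum (fun n => r ^ n)%R n = (1 - r ^ n) / (1 - r))%R).
  { induction n; simpl. field; lra. rewrite IHn. field. lra. }
  rewrite E. apply Rle_div_l. lra. rewrite Rinv_l by lra.
  assert (0 <= r ^ n)%R by (apply pow_le; lra). lra.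
Qed.

Lemma PS_const c : PS (fun _ => c).
Proof.
  intros r Hr. exists (Cmod c * / (1 - r))%R. apply majorant_scal. apply Cmod_ge_0.
  apply geom_majorant. lra.
Qed.

Lemma PS_bounded (a : nat -> C) K k : (forall n, Cmod (a n) <= K * INR n ^ k + K)%R -> PS a.
Proof.
  intros H.
  assert (G : PS (fun n => K * INR n ^ k + K)).
  { apply PS_plus.
    - apply PS_scal. clear H. induction k; simpl.
      + apply PS_const.
      + apply (PS_n (fun n => INR n ^ k)). exact IHk.
    - apply PS_const. }
  intros r Hr. destruct (G r Hr) as [B HB]. exists B. apply majorant_le with (2 := HB).
  intros n. assert (0 <= r ^ n)%R by (apply pow_le; lra). split.
  - apply Rmult_le_pos; auto. apply Cmod_ge_0.
  - apply Rmult_le_compat_r; auto. eapply Rle_trans; [apply H|].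
    rewrite <- RtoC_pow, <- RtoC_mult, <- RtoC_plus, Cmod_R. apply Rle_abs.
Qed.

Lemma PS_one : PS (fun _ => 1).
Proof. apply PS_bounded with 1%R 0%nat. intros; rewrite Cmod_1; simpl; lra. Qed.

Lemma one_minus_nz x : (Cmod x < 1)%R -> 1 - x <> 0.
Proof. intros H E. replace x with (1 - (1 - x)) in H by ring. rewrite E in H. replace (1 - 0) with (RtoC 1) in H by ring. rewrite Cmod_1 in H. lra. Qed.

Lemma psum_geom x : (Cmod x < 1)%R -> psum (fun _ => 1) x = / (1 - x).
Proof.
  intros Hx. assert (N := one_minus_nz x Hx). assert (S1 := PS_CS _ x PS_one Hx). assert (S2 := S1).
  apply CS_S_inv in S2. 
  assert (S3 : CS (fun n => 1 * x ^ (S n)) (x * psum (fun _ => 1) x)).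
  { apply CS_ext with (fun n => x * (1 * x ^ n)). intros; simpl; ring. now apply CS_scal. }
  generalize (CS_unique _ _ _ S2 S3). simpl. intros E.
  replace (psum (fun _ => 1) x) with ((psum (fun _ => 1) x - x * psum (fun _ => 1) x) / (1 - x)) by (field; auto).
  rewrite <- E. field. auto.
Qed.

Lemma CS_geom x : (Cmod x < 1)%R -> CS (fun n => x ^ n) (/ (1 - x)).
Proof.
  intros Hx. rewrite <- psum_geom by auto. eapply CS_ext; [|apply PS_CS; auto; apply PS_one].
  intros; simpl; ring.
Qed.

(** The coefficients of - log (1 - x). *)
Definition linv (n : nat) : C := match n with O => 0 | _ => / INR n end.

Lemma Cmod_linv n : (Cmod (linv n) <= 1)%R.
Proof.
  destruct n. simpl. rewrite Cmod_0; lra. unfold linv.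
  assert (1 <= INR (S n))%R by (rewrite S_INR; generalize (pos_INR n); lra).
  rewrite Cmod_inv, Cmod_R, Rabs_right by (try (intros E; apply RtoC_inj in E); lra).
  rewrite <- Rinv_1. apply Rinv_le_contravar; lra.
Qed.

Lemma PS_linv : PS linv.
Proof. apply PS_bounded with 1%R 0%nat. intros n. generalize (Cmod_linv n). simpl. lra. Qed.

Lemma RtoC_INR_S_nz n : RtoC (INR (S n)) <> 0.
Proof. intros E. apply RtoC_inj in E. rewrite S_INR in E. generalize (pos_INR n). lra. Qed.

Lemma CD_linv x : (Cmod x < 1)%R -> CD (psum linv) x (/ (1 - x)).
Proof.
  intros Hx. eapply CD_eq. now apply PS_CD; [apply PS_linv|]. rewrite <- psum_geom by auto.
  unfold psum. f_equal. apply FunctionalExtensionality.functional_extensionality. intros n.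
  f_equal. unfold pder, linv. field. apply RtoC_INR_S_nz.
Qed.

Lemma Cmod_segment_0 x t : (0 <= t <= 1)%R -> (Cmod (0 + RtoC t * (x - 0)) <= Cmod x)%R.
Proof.
  intros Ht. replace (0 + RtoC t * (x - 0)) with (RtoC t * x) by ring.
  rewrite Cmod_mult, Cmod_R, Rabs_right by lra. generalize (Cmod_ge_0 x). nra.
Qed.

(** The function (1 - w) exp(- log(1 - w)) has zero derivative on the segment from 0 to x. *)
Lemma Cexp_log x : (Cmod x < 1)%R -> Cexp (- psum linv x) = 1 - x.
Proof.
  intros Hx.
  assert (E : (1 - x) * Cexp (psum linv x) = (1 - 0) * Cexp (psum linv 0)).
  { apply (CD_zero_segment (fun w => (1 - w) * Cexp (psum linv w))). intros t Ht.
    assert (Hw := Cmod_segment_0 x t Ht). set (w := 0 + t * (x - 0)) in *.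
    assert (Hw1 : (Cmod w < 1)%R) by lra. assert (N := one_minus_nz w Hw1). eapply CD_eq.
    - apply CD_mult. apply CD_minus. apply (CD_const 1). apply CD_id.
      apply CD_Cexp_comp. now apply CD_linv.
    - cbv beta. change (RtoC 0 - 1) with (RtoC 0 - RtoC 1). field. auto. }
  rewrite psum_0 in E. simpl linv in E. rewrite Cexp_0 in E. rewrite Cexp_opp.
  assert (N := Cexp_nz (psum linv x)).
  replace (1 - x) with ((1 - x) * Cexp (psum linv x) / Cexp (psum linv x)) by (field; auto).
  rewrite E. field. auto.
Qed.

(** * The Lipschitz formula *)

Notation UH := upper_half_plane.

Lemma e2pi_add a b : e2pi (a + b) = e2pi a * e2pi b.
Proof. unfold e2pi. rewrite <- Cexp_add. f_equal. ring. Qed.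

Lemma e2pi_nz a : e2pi a <> 0.
Proof. apply Cexp_nz. Qed.

Lemma e2pi_nat n a : e2pi (INR n * a) = e2pi a ^ n.
Proof. unfold e2pi. rewrite <- Cexp_nat. f_equal. ring. Qed.

Lemma Re_2PiCi z : Re (2 * PI * Ci * z) = (- 2 * PI * Im z)%R.
Proof. destruct z. simpl. ring. Qed.

Lemma Im_2PiCi z : Im (2 * PI * Ci * z) = (2 * PI * Re z)%R.
Proof. destruct z. simpl. ring. Qed.

Lemma Cmod_e2pi z : Cmod (e2pi z) = exp (- 2 * PI * Im z).
Proof. unfold e2pi. rewrite Cmod_Cexp. f_equal. apply Re_2PiCi. Qed.

Lemma Cmod_e2pi_lt z : UH z -> (Cmod (e2pi z) < 1)%R.
Proof.
  intros H. rewrite Cmod_e2pi, <- exp_0. apply exp_increasing.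
  generalize PI_RGT_0. unfold UH in H. nra.
Qed.

Lemma e2pi_1 : e2pi 1 = 1.
Proof.
  unfold e2pi, Cexp. rewrite Re_2PiCi, Im_2PiCi. simpl.
  replace (-2 * PI * 0)%R with 0%R by ring. replace (2 * PI * 1)%R with (2 * PI)%R by ring.
  rewrite exp_0, cos_2PI, sin_2PI. apply C_ext; simpl; ring.
Qed.

Lemma e2pi_half : e2pi (1 / 2) = - (1).
Proof.
  unfold e2pi. replace (2 * PI * Ci * (1 / 2)) with (RtoC PI * Ci) by field.
  unfold Cexp. simpl.
  replace (PI * 0 - 0 * 1)%R with 0%R by ring. replace (PI * 1 + 0 * 0)%R with PI by ring.
  rewrite exp_0, cos_PI, sin_PI. apply C_ext; simpl; ring.
Qed.

Lemma CD_e2pi_comp (f : C -> C) z a : CD f z a -> CD (fun w => e2pi (f w)) z (2 * PI * Ci * a * e2pi (f z)).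
Proof.
  intros H. eapply CD_eq. apply (CD_Cexp_comp (fun w => 2 * PI * Ci * f w)). apply CD_scal. exact H.
  unfold e2pi. ring.
Qed.

Lemma CD_e2pi z : CD e2pi z (2 * PI * Ci * e2pi z).
Proof. eapply CD_eq. apply (CD_e2pi_comp (fun w => w)). apply CD_id. ring. Qed.

Lemma TwoPiCi_nz : 2 * PI * Ci <> 0.
Proof.
  apply Cmult_neq_0; [|apply Ci_nz]. rewrite <- RtoC_mult. intros E. apply RtoC_inj in E.
  generalize PI_RGT_0. lra.
Qed.

(** * Symmetric sums over the integers *)

(** Symmetric partial sums over the integers: the order in which the conditionally convergent lattice sums
    of weight 2 are taken. *)
Definition zsum (f : Z -> C) (N : nat) : C :=
  f 0%Z + csum (fun n => f (Z.of_nat (S n)) + f (- Z.of_nat (S n))%Z) N.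

Definition ZS (f : Z -> C) (l : C) : Prop := Clim (zsum f) l.

Lemma ZS_CS f l : ZS f l <-> CS (fun n => f (Z.of_nat (S n)) + f (- Z.of_nat (S n))%Z) (l - f 0%Z).
Proof.
  unfold ZS, CS. split; intros H.
  - apply flim_ext with (fun n => zsum f n - f 0%Z). apply eventually_filter. intros; unfold zsum; ring.
    apply flim_minus; auto. apply eventually_filter. apply flim_const, eventually_filter.
  - apply flim_ext with (fun n => f 0%Z + csum (fun n => f (Z.of_nat (S n)) + f (- Z.of_nat (S n))%Z) n).
    apply eventually_filter. intros; unfold zsum; ring.
    replace l with (f 0%Z + (l - f 0%Z)) by ring.
    apply flim_plus; auto. apply eventually_filter. apply flim_const, eventually_filter.
Qed.

Lemma zsum_ext f g N : (forall n, (Z.abs n <= Z.of_nat N)%Z -> f n = g n) -> zsum f N = zsum g N.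
Proof.
  intros H. unfold zsum. f_equal. apply H; lia. apply csum_ext. intros i Hi. f_equal; apply H; lia.
Qed.

Lemma zsum_S f N : zsum f (S N) = zsum f N + (f (Z.of_nat (S N)) + f (- Z.of_nat (S N))%Z).
Proof. unfold zsum. cbn [csum]. ring. Qed.

Definition row (k : nat) (z : C) (n : Z) : C := / (z + IZR n) ^ k.

Lemma majorant_inv_sq : majorant (fun n => / (INR (S n)) ^ 2)%R 2.
Proof.
  assert (P : forall n, (0 < INR (S n))%R) by (intros; apply lt_0_INR; lia).
  split. intros n. left. apply Rinv_0_lt_compat, pow_lt, P.
  (* sum_(i<=n) 1/i^2 <= 2 - 1/n *)
  assert (E : forall n, (rsum (fun n => / (INR (S n)) ^ 2) (S n) <= 2 - / INR (S n))%R).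
  { induction n. { simpl. lra. }
    assert (Hx := P n). assert (Hx1 := P (S n)). change (rsum (fun n0 => / INR (S n0) ^ 2) (S (S n)))%R
      with (rsum (fun n0 => / INR (S n0) ^ 2)%R (S n) + / INR (S (S n)) ^ 2)%R.
    rewrite (S_INR (S n)) in *. set (x := INR (S n)) in *.
    assert (/ (x + 1) ^ 2 <= / x - / (x + 1))%R; [|lra].
    replace (/ x - / (x + 1))%R with (/ (x * (x + 1)))%R by (field; lra).
    apply Rinv_le_contravar; nra. }
  intros [|n]. simpl; lra. eapply Rle_trans; [apply E|].
  generalize (Rinv_0_lt_compat _ (P n)). lra.
Qed.

Lemma UH_nz z : UH z -> z <> 0.
Proof. intros H ->. unfold UH in H. simpl in H. lra. Qed.

Lemma UH_plus_real z (x : R) : UH z -> UH (z + x).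
Proof. unfold UH. rewrite im_plus, im_RtoC. intros; lra. Qed.

Lemma UH_mult_real z (x : R) : (0 < x)%R -> UH z -> UH (x * z).
Proof. unfold UH. rewrite im_scal_l. intros; nra. Qed.

Lemma row_bound z (n : R) : UH z -> (Rabs n * Im z <= Cmod (z + n) * Cmod z)%R.
Proof.
  intros H. rewrite <- (Cmod_conj z), <- Cmod_mult.
  eapply Rle_trans; [|apply im_le_Cmod].
  replace (Im ((z + n) * Cconj z)) with (- (n * Im z))%R.
  - rewrite Rabs_Ropp, Rabs_mult, (Rabs_right (Im z)); unfold UH in H; lra.
  - destruct z; simpl; ring.
Qed.

Lemma inv_row_bound z (n : Z) : UH z -> n <> 0%Z -> (Cmod (/ (z + IZR n)) <= Cmod z / Im z / Rabs (IZR n))%R.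
Proof.
  intros H Hn. assert (N := UH_nz _ (UH_plus_real z (IZR n) H)).
  assert (Hr : (0 < Rabs (IZR n))%R) by (apply Rabs_pos_lt; now apply not_0_IZR).
  rewrite Cmod_inv by auto. assert (Hp := Cmod_nz _ N).
  generalize (row_bound z (IZR n) H). intros E. unfold UH in H.
  set (a := Cmod (z + IZR n)) in *. set (b := Rabs (IZR n)) in *.
  replace (Cmod z / Im z / b)%R with (/ a * (a * Cmod z) / (b * Im z))%R by (field; lra).
  apply Rle_div_r. apply Rmult_lt_0_compat; lra.
  apply Rmult_le_compat_l; auto. left; now apply Rinv_0_lt_compat.
Qed.

Lemma IZR_of_nat_S n : IZR (Z.of_nat (S n)) = INR (S n).
Proof. now rewrite INR_IZR_INZ. Qed.

Lemma IZR_opp_of_nat_S n : IZR (- Z.of_nat (S n)) = (- INR (S n))%R.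
Proof. now rewrite opp_IZR, INR_IZR_INZ. Qed.

Lemma Rabs_INR_S n : Rabs (INR (S n)) = INR (S n).
Proof. apply Rabs_right, Rle_ge, pos_INR. Qed.

Lemma inv_row_bound_nat z n s : UH z -> s = Z.of_nat (S n) \/ s = (- Z.of_nat (S n))%Z ->
  (Cmod (/ (z + IZR s)) <= Cmod z / Im z * / INR (S n))%R.
Proof.
  intros H [->| ->]; eapply Rle_trans; try (apply inv_row_bound; auto; lia); right; unfold Rdiv; f_equal; f_equal.
  - rewrite IZR_of_nat_S. apply Rabs_INR_S.
  - rewrite IZR_opp_of_nat_S, Rabs_Ropp. apply Rabs_INR_S.
Qed.

Lemma pow_ge_sq (x : R) k : (0 <= x <= 1)%R -> (2 <= k)%nat -> (x ^ k <= x ^ 2)%R.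
Proof.
  intros Hx Hk. replace k with (2 + (k - 2))%nat by lia. rewrite pow_add.
  assert (H : (x ^ (k - 2) <= 1)%R).
  { rewrite <- (pow1 (k - 2)). apply pow_incr. lra. }
  assert (H2 : (0 <= x ^ 2)%R) by (apply pow_le; lra). nra.
Qed.

Lemma Rinv_INR_S_le n : (0 <= / INR (S n) <= 1)%R.
Proof.
  assert (P : (1 <= INR (S n))%R) by (rewrite S_INR; generalize (pos_INR n); lra).
  split. left. apply Rinv_0_lt_compat; lra. rewrite <- Rinv_1. apply Rinv_le_contravar; lra.
Qed.

Lemma row_term_bound k z n s K : UH z -> (2 <= k)%nat -> (Cmod z / Im z <= K)%R ->
  s = Z.of_nat (S n) \/ s = (- Z.of_nat (S n))%Z ->
  (Cmod (row k z s) <= K ^ k * / INR (S n) ^ 2)%R.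
Proof.
  intros H Hk HK Hs. unfold row.
  assert (N := UH_nz _ (UH_plus_real z (IZR s) H)).
  rewrite <- Cpow_inv by auto. rewrite Cmod_pow.
  assert (B := inv_row_bound_nat z n s H Hs).
  assert (D := Rinv_INR_S_le n).
  assert (HK0 : (0 <= K)%R).
  { eapply Rle_trans; [|exact HK]. apply Rdiv_le_0_compat. apply Cmod_ge_0. exact H. }
  apply Rle_trans with ((K * / INR (S n)) ^ k)%R.
  - apply pow_incr. split. apply Cmod_ge_0. eapply Rle_trans; [exact B|].
    apply Rmult_le_compat_r; lra.
  - rewrite Rpow_mult_distr. apply Rmult_le_compat_l. now apply pow_le.
    rewrite <- pow_inv. now apply pow_ge_sq.
Qed.

Lemma row_pair_majorant k z K : UH z -> (2 <= k)%nat -> (Cmod z / Im z <= K)%R -> forall n,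
  (Cmod (row k z (Z.of_nat (S n)) + row k z (- Z.of_nat (S n))) <= 2 * K ^ k * / INR (S n) ^ 2)%R.
Proof.
  intros. eapply Rle_trans; [apply Cmod_triangle|].
  generalize (row_term_bound k z n (Z.of_nat (S n)) K H H0 H1 (or_introl eq_refl))
   (row_term_bound k z n (- Z.of_nat (S n)) K H H0 H1 (or_intror eq_refl)). lra.
Qed.

Lemma ZS_row_ex k z : UH z -> (2 <= k)%nat -> exists l, ZS (row k z) l.
Proof.
  intros H Hk. set (K := (Cmod z / Im z)%R).
  assert (HK0 : (0 <= K)%R) by (apply Rdiv_le_0_compat; [apply Cmod_ge_0|exact H]).
  destruct (CS_of_majorant _ _ _ (row_pair_majorant k z K H Hk (Rle_refl _))
     (majorant_scal (2 * K ^ k) _ _ ltac:(apply Rmult_le_pos; [lra|now apply pow_le]) majorant_inv_sq)) as [l Hl].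
  exists (l + row k z 0). apply ZS_CS. replace (l + row k z 0 - row k z 0) with l by ring. exact Hl.
Qed.

(** * The formula in weight 2 *)

(** The constant (-2 pi i)^k / (k-1)! of the Lipschitz formula. *)
Definition lipc (k : nat) : C := (- (2 * PI * Ci)) ^ k / INR (fact (k - 1)).

Definition npow (k : nat) : nat -> C := fun r => RtoC (INR r) ^ k.

(** The right-hand side of the Lipschitz formula. *)
Definition lip (k : nat) (z : C) : C := lipc k * psum (npow (k - 1)) (e2pi z).

Lemma PS_npow k : PS (npow k).
Proof.
  apply PS_bounded with 1%R k. intros n. unfold npow.
  rewrite Cmod_pow, Cmod_R, Rabs_right by (apply Rle_ge, pos_INR). lra.
Qed.

Lemma CS_S' (a : nat -> C) l : a O = 0 -> CS (fun n => a (S n)) l -> CS a l.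
Proof. intros H1 H2. eapply CS_eq. apply CS_S. exact H2. rewrite H1. ring. Qed.

Lemma psum_npow_1 x : (Cmod x < 1)%R -> psum (npow 1) x = x / ((1 - x) * (1 - x)).
Proof.
  intros Hx. assert (N := one_minus_nz x Hx).
  assert (E : CS (fun n => INR (S n) * x ^ n) (/ (1 - x) * / (1 - x))).
  { rewrite <- !psum_geom, <- PS_psum_cconv by auto using PS_one.
    eapply CS_ext; [|apply PS_CS; auto; apply PS_cconv; apply PS_one].
    intros n. cbv beta. f_equal. unfold cconv.
    induction n. simpl. ring. rewrite S_INR, RtoC_plus, <- IHn. simpl. ring. }
  apply CS_CSeries. apply CS_S'. unfold npow. simpl. ring.
  eapply CS_eq. eapply CS_ext; [|exact (CS_scal x _ _ E)].
  intros n. unfold npow. change (RtoC (INR (S n)) ^ 1) with (RtoC (INR (S n)) * 1).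
  change (x ^ S n) with (x * x ^ n). ring. field. auto.
Qed.

Lemma lip_2 z : UH z -> lip 2 z = (2 * PI * Ci) ^ 2 * (e2pi z / ((1 - e2pi z) * (1 - e2pi z))).
Proof.
  intros H. unfold lip. rewrite psum_npow_1 by now apply Cmod_e2pi_lt.
  unfold lipc. simpl. field. apply one_minus_nz. now apply Cmod_e2pi_lt.
Qed.

Definition row_sum (k : nat) (z : C) : C :=
  row k z 0 + CSeries (fun n => row k z (Z.of_nat (S n)) + row k z (- Z.of_nat (S n))).

Lemma ZS_row_sum k z : UH z -> (2 <= k)%nat -> ZS (row k z) (row_sum k z).
Proof.
  intros H Hk. destruct (ZS_row_ex k z H Hk) as [l Hl]. assert (Hl' := Hl). apply ZS_CS in Hl'.
  replace (row_sum k z) with l; auto. unfold row_sum. rewrite (CS_CSeries _ _ Hl'). ring.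
Qed.

Lemma UH_half z : UH z -> UH (z / 2).
Proof. intros H. replace (z / 2) with (RtoC (/ 2) * z) by (rewrite RtoC_inv by lra; field). apply UH_mult_real; auto; lra. Qed.

Lemma UH_half1 z : UH z -> UH ((z + 1) / 2).
Proof. intros H. apply UH_half. now apply UH_plus_real. Qed.

Lemma UH_plus_nz z (x : R) : UH z -> z + x <> 0.
Proof. intros. now apply UH_nz, UH_plus_real. Qed.

Lemma row_lim0 k z (s : nat -> Z) : UH z -> (1 <= k)%nat ->
  (forall n, s n = Z.of_nat n \/ s n = (- Z.of_nat n)%Z) -> Clim (fun N => row k z (s N)) 0.
Proof.
  intros H Hk Hs. intros e He. 
  set (K := (Cmod z / Im z)%R).
  assert (HK0 : (0 <= K)%R) by (apply Rdiv_le_0_compat; [apply Cmod_ge_0|exact H]).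
  destruct (nfloor_ex ((K + 1) * (1 / e + 1))%R ltac:(apply Rmult_le_pos; [lra|]; generalize (Rdiv_lt_0_compat 1 e Rlt_0_1 He); lra)) as [N [HN HN']].
  exists (S N). intros [|n] Hn; [lia|].
  replace (row k z (s (S n)) - 0) with (row k z (s (S n))) by ring. unfold row.
  rewrite <- Cpow_inv by now apply UH_plus_nz. rewrite Cmod_pow.
  assert (B := inv_row_bound_nat z n _ H (Hs (S n))). fold K in B.
  assert (L : (INR N + 1 <= INR (S n))%R) by (rewrite <- S_INR; apply le_INR; lia).
  assert (Hie := Rdiv_lt_0_compat 1 e Rlt_0_1 He).
  assert (X : (K * / INR (S n) < Rmin 1 e)%R).
  { assert (0 < INR (S n))%R by (apply lt_0_INR; lia).
    apply Rmin_glb_lt; apply Rlt_div_l; auto.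
    - nra.
    - assert (e * (1/e) = 1)%R by (field; lra). nra. }
  assert (X1 := Rlt_le_trans _ _ _ X (Rmin_l _ _)). assert (X2 := Rlt_le_trans _ _ _ X (Rmin_r _ _)).
  set (t := Cmod (/ (z + IZR (s (S n))))) in *.
  assert (T : (0 <= t)%R) by apply Cmod_ge_0.
  apply Rle_lt_trans with t; [|lra].
  replace k with (S (k - 1)) by lia. simpl. 
  assert (t ^ (k - 1) <= 1)%R by (rewrite <- (pow1 (k - 1)); apply pow_incr; lra).
  nra.
Qed.

(** The translates of z/2 and of (z+1)/2 by integers become, when doubled, the translates of z by even and
    by odd integers. *)
Lemma zsum_dup z N : UH z ->
  zsum (row 2 (z / 2)) N + zsum (row 2 ((z + 1) / 2)) N
  = 4 * (zsum (row 2 z) (2 * N) + row 2 z (Z.of_nat (2 * N + 1))).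
Proof.
  intros H.
  assert (R1 : forall n, row 2 (z / 2) n = 4 * row 2 z (2 * n)).
  { intros n. unfold row. rewrite mult_IZR, RtoC_mult. simpl.
    assert (NN : z + 2 * IZR n <> 0) by (rewrite <- RtoC_mult; now apply UH_plus_nz).
    field. exact NN. }
  assert (R2 : forall n, row 2 ((z + 1) / 2) n = 4 * row 2 z (2 * n + 1)).
  { intros n. unfold row. rewrite plus_IZR, mult_IZR, RtoC_plus, RtoC_mult. simpl.
    assert (z + 1 + 2 * IZR n <> 0).
    { replace (z + 1 + 2 * IZR n) with (z + RtoC (1 + 2 * IZR n)) by (rewrite RtoC_plus, RtoC_mult; ring). now apply UH_plus_nz. }
    assert (z + (2 * IZR n + 1) <> 0) by (replace (z + (2 * IZR n + 1)) with (z + 1 + 2 * IZR n) by ring; auto).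
    field. auto. }
  induction N.
  - unfold zsum. simpl csum. rewrite R1, R2. simpl Z.of_nat.
    change (2 * 0)%Z with 0%Z. change (0 + 1)%Z with 1%Z. ring.
  - replace (2 * S N)%nat with (S (S (2 * N))) by lia.
    rewrite !zsum_S, !R1, !R2.
    replace (zsum (row 2 (z / 2)) N + (4 * row 2 z (2 * Z.of_nat (S N)) + 4 * row 2 z (2 * - Z.of_nat (S N))) +
     (zsum (row 2 ((z + 1) / 2)) N + (4 * row 2 z (2 * Z.of_nat (S N) + 1) + 4 * row 2 z (2 * - Z.of_nat (S N) + 1))))
    with (zsum (row 2 (z / 2)) N + zsum (row 2 ((z + 1) / 2)) N +
     4 * (row 2 z (2 * Z.of_nat (S N)) + row 2 z (2 * - Z.of_nat (S N)) +
      row 2 z (2 * Z.of_nat (S N) + 1) + row 2 z (2 * - Z.of_nat (S N) + 1))) by ring.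
    rewrite IHN.
    replace (Z.of_nat (2 * N + 1)) with (Z.of_nat (S (2 * N))) by lia.
    replace (2 * Z.of_nat (S N))%Z with (Z.of_nat (S (S (2 * N)))) by lia.
    replace (2 * - Z.of_nat (S N))%Z with (- Z.of_nat (S (S (2 * N))))%Z by lia.
    replace (Z.of_nat (S (S (2 * N))) + 1)%Z with (Z.of_nat (S (S (2 * N)) + 1)) by lia.
    replace (- Z.of_nat (S (S (2 * N))) + 1)%Z with (- Z.of_nat (S (2 * N)))%Z by lia.
    ring.
Qed.

Lemma Clim_sub u l (g : nat -> nat) : (forall n, (n <= g n)%nat) -> Clim u l -> Clim (fun n => u (g n)) l.
Proof.
  intros Hg H e He. destruct (H e He) as [N HN]. exists N. intros n Hn. apply HN. specialize (Hg n). lia.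
Qed.

Lemma row_sum_dup z : UH z -> row_sum 2 (z / 2) + row_sum 2 ((z + 1) / 2) = 4 * row_sum 2 z.
Proof.
  intros H.
  apply (Clim_unique (fun N => zsum (row 2 (z / 2)) N + zsum (row 2 ((z + 1) / 2)) N)).
  - apply flim_plus. apply eventually_filter.
    apply ZS_row_sum; auto. now apply UH_half. apply ZS_row_sum; auto. now apply UH_half1.
  - apply flim_ext with (fun N => 4 * (zsum (row 2 z) (2 * N) + row 2 z (Z.of_nat (2 * N + 1)))).
    apply eventually_filter. intros; now rewrite zsum_dup.
    apply flim_scal. apply eventually_filter.
    replace (row_sum 2 z) with (row_sum 2 z + 0) by ring.
    apply flim_plus. apply eventually_filter.
    + apply (Clim_sub (zsum (row 2 z)) _ (fun N => (2 * N)%nat)). intros; lia. now apply ZS_row_sum.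
    + apply (Clim_sub (fun N => row 2 z (Z.of_nat N)) 0 (fun N => (2 * N + 1)%nat)). intros; lia. now apply (row_lim0 2 z Z.of_nat); auto.
Qed.

(** With x = e(z/2) this is x/(1-x)^2 - x/(1+x)^2 = 4 x^2/(1-x^2)^2. *)
Lemma lip_2_dup z : UH z -> lip 2 (z / 2) + lip 2 ((z + 1) / 2) = 4 * lip 2 z.
Proof.
  intros H. rewrite !lip_2; auto using UH_half, UH_half1.
  assert (T : (Cmod (e2pi (z / 2)) < 1)%R) by now apply Cmod_e2pi_lt, UH_half.
  set (t := e2pi (z / 2)) in *.
  replace (e2pi ((z + 1) / 2)) with (- t).
  2:{ replace ((z + 1) / 2) with (z / 2 + 1 / 2) by field. rewrite e2pi_add, e2pi_half. unfold t; ring. }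
  replace (e2pi z) with (t * t).
  2:{ unfold t. rewrite <- e2pi_add. f_equal. field. }
  assert (N1 := one_minus_nz t T).
  assert (N2 : 1 + t <> 0).
  { replace (1 + t) with (1 - - t) by ring. apply one_minus_nz. now rewrite Cmod_opp. }
  field. repeat split; auto.
  - replace (1 - t * t) with ((1 - t) * (1 + t)) by ring. now apply Cmult_neq_0.
  - replace (1 - - t) with (1 + t) by ring. auto.
Qed.

Lemma sin_lower a : (0 <= a <= PI / 2)%R -> (a / 4 <= sin a)%R.
Proof.
  intros Ha. generalize PI_4 PI_RGT_0. intros P4 P0.
  destruct (SIN a) as [H _]; try lra. eapply Rle_trans; [|exact H].
  unfold sin_lb, sin_approx, sin_term. simpl.
  assert (Hs : (0 <= a * a <= 4)%R) by nra.
  set (s := (a * a)%R) in *.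
  replace (-1 * 1)%R with (-1)%R by ring.
  match goal with |- (_ <= ?X)%R => replace X with (a * (1 - s / 6 + s * s / 120 - s * s * s / 5040))%R end.
  2:{ unfold s. field. }
  unfold Rdiv at 1. apply Rmult_le_compat_l. lra.
  assert (s * s * s <= 4 * (s * s))%R by nra. nra.
Qed.

(** A lower bound of the order of z for 2 sinh(pi i z) in the strip |Re z| <= 1/2: for large Im z by the
    exponentials, otherwise by the sine of the real part. *)
Lemma two_sinh_lower z : UH z -> (Rabs (Re z) <= 1 / 2)%R ->
  let u := RtoC PI * Ci * z in (PI / 4 * Cmod z <= Cmod (Cexp u - Cexp (- u)))%R.
Proof.
  intros H Hx u. generalize PI_RGT_0. intros P0. unfold UH in H.
  set (x := Re z) in *. set (y := Im z) in *.
  assert (Ru : Re u = (- (PI * y))%R) by (unfold u, y; destruct z; simpl; ring).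
  assert (Iu : Im u = (PI * x)%R) by (unfold u, x; destruct z; simpl; ring).
  assert (L1 : (PI * y <= Cmod (Cexp u - Cexp (- u)))%R).
  { rewrite Cmod_minus_sym. eapply Rle_trans; [|apply Cmod_triangle_rev].
    rewrite !Cmod_Cexp, re_opp, Ru, Ropp_involutive.
    assert (P1 : (0 < PI * y)%R) by nra. generalize (exp_ineq1 (PI * y) ltac:(lra)).
    assert (exp (- (PI * y)) <= 1)%R by (rewrite <- exp_0; left; apply exp_increasing; lra). lra. }
  assert (L2 : (PI / 2 * Rabs x <= Cmod (Cexp u - Cexp (- u)))%R).
  { eapply Rle_trans; [|apply im_le_Cmod].
    replace (Im (Cexp u - Cexp (- u))) with ((exp (Re u) + exp (- Re u)) * sin (Im u))%R.
    2:{ unfold Cexp, Cminus. rewrite im_plus, im_opp, re_opp, im_opp. rewrite cos_neg, sin_neg. simpl. ring. }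
    rewrite Rabs_mult.
    assert (S1 : (PI / 4 * Rabs x <= Rabs (sin (Im u)))%R).
    { rewrite Iu. assert (G : forall t, (0 <= t <= 1/2)%R -> (PI / 4 * t <= sin (PI * t))%R).
      { intros t Ht. replace (PI / 4 * t)%R with (PI * t / 4)%R by field. apply sin_lower. nra. }
      destruct (Rle_lt_dec 0 x) as [Hp|Hn].
      - rewrite (Rabs_right x) in * by lra. eapply Rle_trans; [apply G; lra|]. apply Rle_abs.
      - rewrite (Rabs_left x) in * by lra. rewrite <- Rabs_Ropp, <- sin_neg.
        replace (- (PI * x))%R with (PI * - x)%R by ring. eapply Rle_trans; [apply G; lra|]. apply Rle_abs. }
    assert (S2 : (2 <= Rabs (exp (Re u) + exp (- Re u)))%R).
    { generalize (exp_pos (Re u)) (exp_pos (- Re u)). intros E1 E2. rewrite Rabs_right by lra.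
      assert (exp (Re u) * exp (- Re u) = 1)%R by (rewrite <- exp_plus, Rplus_opp_r; apply exp_0).
      assert (0 <= (exp (Re u) - exp (- Re u)) * (exp (Re u) - exp (- Re u)))%R by apply Rle_0_sqr. nra. }
    assert (0 <= PI / 4 * Rabs x)%R by (apply Rmult_le_pos; [lra|apply Rabs_pos]). nra. }
  assert (L3 := Cmod_le_ReIm z). fold x y in L3. rewrite (Rabs_right y) in L3 by lra.
  nra.
Qed.

(** In the strip the only singularity of lip 2 is the double pole at 0, whose principal part is 1/z^2; near
    it the Taylor remainder of the exponential bounds the difference, away from it both terms are bounded. *)
Lemma lip_2_pole z : UH z -> (Rabs (Re z) <= 1 / 2)%R ->
  (Cmod (lip 2 z - / z ^ 2) <= 300 * (PI * PI))%R.
Proof.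
  intros H Hx. generalize PI_RGT_0. intros P0. assert (Nz := UH_nz z H).
  set (u := RtoC PI * Ci * z). set (E := Cexp u - Cexp (- u)).
  assert (LE := two_sinh_lower z H Hx). fold u in LE. cbv zeta in LE. fold E in LE.
  assert (Hz := Cmod_nz z Nz).
  assert (NE : E <> 0) by (apply Cmod_gt_0; nra).
  assert (Npi : RtoC PI <> 0) by (intros X; apply RtoC_inj in X; lra).
  assert (L : lip 2 z = (2 * PI * Ci) ^ 2 / E ^ 2).
  { rewrite lip_2 by auto.
    replace (e2pi z) with (Cexp u * Cexp u).
    2:{ unfold e2pi, u. rewrite <- Cexp_add. f_equal. ring. }
    assert (EE : 1 - Cexp u * Cexp u = - Cexp u * E).
    { unfold E. replace (- Cexp u * (Cexp u - Cexp (- u))) with (Cexp u * Cexp (- u) - Cexp u * Cexp u) by ring.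
      rewrite <- (Cexp_add u (- u)). replace (u + - u) with (RtoC 0) by ring. now rewrite Cexp_0. }
    rewrite EE. simpl. field. split; auto. apply Cexp_nz. }
  set (w := 2 * PI * Ci * z).
  assert (Lz : / z ^ 2 = (2 * PI * Ci) ^ 2 / w ^ 2).
  { unfold w. simpl. field. split; [|split]; auto. apply Ci_nz. }
  assert (Cw : Cmod w = (2 * PI * Cmod z)%R).
  { unfold w. rewrite !Cmod_mult, Cmod_Ci, !Cmod_R, !Rabs_right by lra. ring. }
  assert (Cu : Cmod u = (Cmod w / 2)%R).
  { unfold u. rewrite Cw, !Cmod_mult, Cmod_Ci, !Cmod_R, !Rabs_right by lra. field. }
  assert (LE2 : (Cmod w / 8 <= Cmod E)%R) by (rewrite Cw; lra).
  assert (Hw : (0 < Cmod w)%R) by (rewrite Cw; nra).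
  assert (HE : (0 < Cmod E)%R) by lra.
  assert (C2 : Cmod ((2 * PI * Ci) ^ 2) = (4 * (PI * PI))%R).
  { rewrite Cmod_pow, !Cmod_mult, Cmod_Ci, !Cmod_R, !Rabs_right by lra. simpl. ring. }
  (* E = w + O(w^3) settles the case of small w; for large w both terms are bounded. *)
  destruct (Rle_lt_dec (Cmod w) 1) as [Hs|Hl].
  - assert (Nw : w <> 0) by now apply Cmod_gt_0.
    assert (D : (Cmod (w - E) <= 3 / 4 * Cmod w ^ 3)%R).
    { replace (w - E) with ((Cexp (- u) - csum (fun n => expc n * (- u) ^ n) 3) - (Cexp u - csum (fun n => expc n * u ^ n) 3)).
      2:{ unfold E. cbn [csum]. unfold expc. replace (INR (fact 2)) with 2%R by (simpl; ring).
          change (INR (fact 0)) with 1%R. change (INR (fact 1)) with 1%R. simpl. unfold w, u. field. }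
      eapply Rle_trans; [apply Cmod_minus_le|].
      assert (R1 := Cexp_remainder (- u) 3). assert (R2 := Cexp_remainder u 3).
      rewrite Cmod_opp in R1. rewrite Cu in R1, R2.
      assert (X : (exp (Cmod w / 2) <= 3)%R).
      { eapply Rle_trans; [|apply exp_le_3]. left. apply exp_increasing. lra. }
      assert (0 <= (Cmod w / 2) ^ 3)%R by (apply pow_le; lra).
      assert ((Cmod w / 2) ^ 3 * exp (Cmod w / 2) <= (Cmod w / 2) ^ 3 * 3)%R by (apply Rmult_le_compat_l; auto).
      replace (3 / 4 * Cmod w ^ 3)%R with ((Cmod w / 2) ^ 3 * 3 + (Cmod w / 2) ^ 3 * 3)%R by field.
      lra. }
    rewrite L, Lz.
    replace ((2 * PI * Ci) ^ 2 / E ^ 2 - (2 * PI * Ci) ^ 2 / w ^ 2) with ((2 * PI * Ci) ^ 2 * ((w - E) * (w + E) / (w ^ 2 * E ^ 2))) by (field; auto).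
    rewrite Cmod_mult, C2.
    assert (Y : (Cmod ((w - E) * (w + E) / (w ^ 2 * E ^ 2)) <= 54)%R).
    { rewrite Cmod_div by (apply Cmult_neq_0; apply Cpow_nz; auto).
      rewrite !Cmod_mult, !Cmod_pow.
      apply Rle_div_l. apply Rmult_lt_0_compat; apply pow_lt; auto.
      assert (T := Cmod_triangle w E).
      assert (T2 : (Cmod (w + E) <= 9 * Cmod E)%R) by lra.
      apply Rle_trans with ((3 / 4 * Cmod w ^ 3) * (9 * Cmod E))%R.
      { apply Rmult_le_compat; auto; apply Cmod_ge_0. }
      simpl. set (a := Cmod w) in *. set (b := Cmod E) in *.
      assert (0 < a * a * b)%R by (apply Rmult_lt_0_compat; nra).
      replace (3 / 4 * (a * (a * (a * 1))) * (9 * b))%R with (27 / 4 * (a * a * b) * a)%R by field.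
      replace (54 * (a * (a * 1) * (b * (b * 1))))%R with (54 * (a * a * b) * b)%R by ring.
      nra. }
    assert (0 < PI * PI)%R by nra. nra.
  - assert (A : (Cmod (lip 2 z) <= 256 * (PI * PI))%R).
    { rewrite L, Cmod_div by now apply Cpow_nz. rewrite C2, Cmod_pow.
      apply Rle_div_l. now apply pow_lt. simpl.
      assert (1 / 8 < Cmod E)%R by lra. assert (1/64 <= Cmod E * Cmod E)%R by nra.
      assert (0 < PI * PI)%R by nra. rewrite Rmult_1_r. nra. }
    assert (B' : (Cmod (/ z ^ 2) <= 4 * (PI * PI))%R).
    { rewrite Lz, Cmod_div. rewrite C2, Cmod_pow. apply Rle_div_l. now apply pow_lt. simpl.
      assert (1 <= Cmod w * Cmod w)%R by nra. assert (0 < PI * PI)%R by nra. nra.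
      apply Cpow_nz. now apply Cmod_gt_0. }
    eapply Rle_trans; [apply Cmod_minus_le|]. nra.
Qed.

(** In the strip the terms with n <> 0 stay away from their poles. *)
Lemma row_sum_2_pole z : UH z -> (Rabs (Re z) <= 1 / 2)%R ->
  (Cmod (row_sum 2 z - / z ^ 2) <= 16)%R.
Proof.
  intros H Hx. assert (Nz := UH_nz z H).
  assert (S0 := ZS_row_sum 2 z H (le_n _)). apply ZS_CS in S0.
  replace (row 2 z 0) with (/ z ^ 2) in S0.
  2:{ unfold row. now rewrite Cplus_0_r. }
  apply CS_bound with (3 := S0) (m := fun n => (8 * / INR (S n) ^ 2)%R).
  2:{ replace 16%R with (8 * 2)%R by ring. apply majorant_scal. lra. exact majorant_inv_sq. }
  intros n. assert (P : (1 <= INR (S n))%R) by (rewrite S_INR; generalize (pos_INR n); lra).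
  assert (G : forall s, Rabs (IZR s) = INR (S n) -> (Cmod (row 2 z s) <= 4 * / INR (S n) ^ 2)%R).
  { intros s Hs. unfold row. assert (N := UH_plus_nz z (IZR s) H).
    assert (A : (INR (S n) / 2 <= Cmod (z + IZR s))%R).
    { eapply Rle_trans; [|apply re_le_Cmod]. rewrite re_plus, re_RtoC.
      generalize (Rabs_triang (Re z + IZR s) (- Re z)). replace (Re z + IZR s + - Re z)%R with (IZR s) by ring.
      rewrite Hs, Rabs_Ropp. lra. }
    rewrite Cmod_inv by now apply Cpow_nz. rewrite Cmod_pow.
    replace (4 * / INR (S n) ^ 2)%R with (/ (INR (S n) / 2) ^ 2)%R by (field; lra).
    apply Rinv_le_contravar. apply pow_lt; lra. apply pow_incr. lra. }
  eapply Rle_trans; [apply Cmod_triangle|].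
  assert (G1 := G (Z.of_nat (S n)) ltac:(rewrite IZR_of_nat_S; apply Rabs_INR_S)).
  assert (G2 := G (- Z.of_nat (S n))%Z ltac:(rewrite IZR_opp_of_nat_S, Rabs_Ropp; apply Rabs_INR_S)).
  lra.
Qed.

Lemma row_sum_periodic z : UH z -> row_sum 2 (z + 1) = row_sum 2 z.
Proof.
  intros H. assert (H1 := UH_plus_real z 1 H).
  assert (E : forall N, zsum (row 2 (z + 1)) N = zsum (row 2 z) N + row 2 z (Z.of_nat (S N)) - row 2 (z + 1) (- Z.of_nat (S N))).
  { assert (R1 : forall n, row 2 (z + 1) n = row 2 z (n + 1)).
    { intros n. unfold row. rewrite plus_IZR, RtoC_plus. do 2 f_equal. ring. }
    induction N.
    - unfold zsum. cbn [csum]. rewrite !R1. simpl Z.of_nat. change (- (1) + 1)%Z with 0%Z. change (0 + 1)%Z with 1%Z. ring.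
    - rewrite !zsum_S, IHN, !R1.
      replace (Z.of_nat (S N) + 1)%Z with (Z.of_nat (S (S N))) by lia.
      replace (- Z.of_nat (S (S N)) + 1)%Z with (- Z.of_nat (S N))%Z by lia. ring. }
  apply (Clim_unique (zsum (row 2 (z + 1)))). now apply ZS_row_sum.
  apply flim_ext with (fun N => zsum (row 2 z) N + row 2 z (Z.of_nat (S N)) - row 2 (z + 1) (- Z.of_nat (S N))).
  apply eventually_filter. intros; now rewrite E.
  replace (row_sum 2 z) with (row_sum 2 z + 0 - 0) by ring.
  assert (FF := eventually_filter).
  apply flim_minus. apply eventually_filter. apply flim_plus. apply eventually_filter.
  - now apply ZS_row_sum.
  - apply (Clim_S (fun N => row 2 z (Z.of_nat N))). now apply (row_lim0 2 z Z.of_nat); auto.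
  - apply (Clim_S (fun N => row 2 (z + 1) (- Z.of_nat N))). now apply (row_lim0 2 (z + 1) (fun n => (- Z.of_nat n)%Z)); auto.
Qed.

Lemma lip_periodic k z : lip k (z + 1) = lip k z.
Proof. unfold lip. now rewrite e2pi_add, e2pi_1, Cmult_1_r. Qed.

(** Both sides have the same poles and the same period, so their difference is bounded on a strip of width
    1, hence everywhere. *)
Lemma lipschitz_2_bounded : exists M, forall z, UH z -> (Cmod (row_sum 2 z - lip 2 z) <= M)%R.
Proof.
  exists (300 * (PI * PI) + 16)%R.
  assert (Strip : forall z, UH z -> (Rabs (Re z) <= 1 / 2)%R -> (Cmod (row_sum 2 z - lip 2 z) <= 300 * (PI * PI) + 16)%R).
  { intros z H Hx. replace (row_sum 2 z - lip 2 z) with ((row_sum 2 z - / z ^ 2) - (lip 2 z - / z ^ 2)) by ring.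
    eapply Rle_trans; [apply Cmod_minus_le|].
    generalize (row_sum_2_pole z H Hx) (lip_2_pole z H Hx). lra. }
  assert (Nat1 : forall n z, UH z -> row_sum 2 (z + INR n) - lip 2 (z + INR n) = row_sum 2 z - lip 2 z).
  { induction n; intros z H. simpl. now rewrite Cplus_0_r.
    rewrite S_INR, RtoC_plus, Cplus_assoc, row_sum_periodic, lip_periodic by now apply UH_plus_real. auto. }
  intros z H. destruct (archimed (Re z + 1 / 2)) as [A1 A2].
  set (m := (up (Re z + 1/2) - 1)%Z). assert (Em : IZR m = (IZR (up (Re z + 1/2)) - 1)%R) by (unfold m; now rewrite minus_IZR).
  set (w := z - IZR m).
  assert (Hw : UH w). { unfold w, Cminus. rewrite <- RtoC_opp. now apply UH_plus_real. }
  assert (Hr : (Rabs (Re w) <= 1/2)%R).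
  { unfold w, Cminus. rewrite re_plus, re_opp, re_RtoC. apply Rabs_le. lra. }
  replace (row_sum 2 z - lip 2 z) with (row_sum 2 w - lip 2 w). now apply Strip.
  destruct (Z_le_dec 0 m) as [L|L].
  - rewrite <- (Nat1 (Z.to_nat m) w Hw). rewrite INR_IZR_INZ, Z2Nat.id by auto.
    unfold w. now replace (z - IZR m + IZR m) with z by ring.
  - rewrite <- (Nat1 (Z.to_nat (- m)) z H). rewrite INR_IZR_INZ, Z2Nat.id by lia.
    unfold w. rewrite opp_IZR, RtoC_opp. reflexivity.
Qed.

(** Herglotz's trick: the difference h of the two sides is bounded and satisfies 4 h(z) = h(z/2) +
    h((z+1)/2), so every bound for |h| can be halved. *)
Lemma lipschitz_2 z : UH z -> row_sum 2 z = lip 2 z.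
Proof.
  destruct lipschitz_2_bounded as [M HM].
  assert (G : forall p z, UH z -> (Cmod (row_sum 2 z - lip 2 z) <= M * (/ 2) ^ p)%R).
  { induction p; intros w H. simpl. rewrite Rmult_1_r. auto.
    assert (E : row_sum 2 w - lip 2 w = / 4 * ((row_sum 2 (w / 2) - lip 2 (w / 2)) + (row_sum 2 ((w + 1) / 2) - lip 2 ((w + 1) / 2)))).
    { replace (row_sum 2 (w / 2) - lip 2 (w / 2) + (row_sum 2 ((w + 1) / 2) - lip 2 ((w + 1) / 2))) with
      ((row_sum 2 (w / 2) + row_sum 2 ((w + 1) / 2)) - (lip 2 (w / 2) + lip 2 ((w + 1) / 2))) by ring.
      rewrite row_sum_dup, lip_2_dup by auto. field. }
    rewrite E, Cmod_mult. replace (Cmod (/ 4)) with (/4)%R.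
    2:{ rewrite <- RtoC_inv by lra. rewrite Cmod_R, Rabs_right; lra. }
    assert (T := Cmod_triangle (row_sum 2 (w / 2) - lip 2 (w / 2)) (row_sum 2 ((w + 1) / 2) - lip 2 ((w + 1) / 2))).
    assert (I1 := IHp _ (UH_half w H)). assert (I2 := IHp _ (UH_half1 w H)). simpl. lra. }
  intros H. destruct (Ceq_dec (row_sum 2 z) (lip 2 z)) as [|N]; auto. exfalso.
  assert (P := Cmod_nz _ (Cminus_nz _ _ N)). set (e := Cmod (row_sum 2 z - lip 2 z)) in *.
  assert (M0 : (0 <= M)%R) by (eapply Rle_trans; [apply Cmod_ge_0|apply (HM z H)]).
  destruct (pow_lt_1_zero (/2) ltac:(rewrite Rabs_right; lra) (e / (M + 1)) ltac:(apply Rdiv_lt_0_compat; lra)) as [K HK].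
  specialize (HK K (le_n _)). rewrite Rabs_right in HK by (apply Rle_ge, pow_le; lra).
  specialize (G K z H). fold e in G.
  apply Rlt_div_r in HK; [|lra].
  assert (0 < (/2)^K)%R by (apply pow_lt; lra). nra.
Qed.

Lemma CD_row k z n : UH z -> CD (fun w => row k w n) z (- INR k * row (S k) z n).
Proof.
  intros H. assert (N := UH_plus_nz z (IZR n) H). unfold row.
  eapply CD_eq.
  - apply (CD_inv (fun w => (w + IZR n) ^ k)). now apply Cpow_nz.
    apply CD_pow. apply CD_plus. apply CD_id. apply CD_const.
  - destruct k. { change (RtoC (INR 0)) with (RtoC 0). simpl. field. auto. }
    replace (S k - 1)%nat with k by lia. rewrite Cplus_0_r.
    change ((z + IZR n) ^ S (S k)) with ((z + IZR n) * ((z + IZR n) * (z + IZR n) ^ k)).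
    change ((z + IZR n) ^ S k) with ((z + IZR n) * (z + IZR n) ^ k).
    field. split; auto. now apply Cpow_nz.
Qed.

Lemma row_lipschitz k z w n s K : UH z -> UH w -> (1 <= k)%nat ->
  (Cmod z / Im z <= K)%R -> (Cmod w / Im w <= K)%R ->
  s = Z.of_nat (S n) \/ s = (- Z.of_nat (S n))%Z ->
  (Cmod (row k w s - row k z s) <= INR k * K ^ (k + 1) * / INR (S n) ^ 2 * Cmod (w - z))%R.
Proof.
  intros Hz Hw Hk K1 K2 Hs. unfold row.
  assert (N1 := UH_plus_nz z (IZR s) Hz). assert (N2 := UH_plus_nz w (IZR s) Hw).
  rewrite <- !Cpow_inv by auto.
  assert (HK0 : (0 <= K)%R).
  { eapply Rle_trans; [|exact K1]. apply Rdiv_le_0_compat. apply Cmod_ge_0. exact Hz. }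
  assert (D := Rinv_INR_S_le n). set (r := (/ INR (S n))%R) in *.
  assert (B1 : (Cmod (/ (z + IZR s)) <= K * r)%R).
  { eapply Rle_trans; [apply (inv_row_bound_nat z n s Hz Hs)|]. apply Rmult_le_compat_r; lra. }
  assert (B2 : (Cmod (/ (w + IZR s)) <= K * r)%R).
  { eapply Rle_trans; [apply (inv_row_bound_nat w n s Hw Hs)|]. apply Rmult_le_compat_r; lra. }
  eapply Rle_trans; [apply (Cmod_pow_diff _ _ (K * r)); auto|].
  replace (/ (w + IZR s) - / (z + IZR s)) with ((z - w) * (/ (w + IZR s) * / (z + IZR s))) by (field; auto).
  rewrite !Cmod_mult, (Cmod_minus_sym z w).
  assert (P : (Cmod (/ (w + IZR s)) * Cmod (/ (z + IZR s)) <= (K * r) * (K * r))%R).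
  { apply Rmult_le_compat; auto using Cmod_ge_0. }
  assert (HKr : (0 <= K * r)%R) by (apply Rmult_le_pos; lra).
  assert (HA : (0 <= INR k * (K * r) ^ (k - 1))%R) by (apply Rmult_le_pos; [apply pos_INR|now apply pow_le]).
  apply Rle_trans with (INR k * (K * r) ^ (k - 1) * (Cmod (w - z) * ((K * r) * (K * r))))%R.
  { apply Rmult_le_compat_l; auto. apply Rmult_le_compat_l; auto using Cmod_ge_0. }
  replace (INR k * (K * r) ^ (k - 1) * (Cmod (w - z) * (K * r * (K * r))))%R
    with (INR k * Cmod (w - z) * (K * r) ^ (k + 1))%R.
  2:{ replace (k + 1)%nat with (S (S (k - 1))) by lia. simpl. ring. }
  rewrite Rpow_mult_distr.
  assert (Q : (r ^ (k + 1) <= / INR (S n) ^ 2)%R).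
  { rewrite <- pow_inv. fold r. apply pow_ge_sq; auto. lia. }
  assert (HB : (0 <= INR k * Cmod (w - z) * K ^ (k + 1))%R).
  { repeat apply Rmult_le_pos; auto using pos_INR, Cmod_ge_0. now apply pow_le. }
  replace (INR k * K ^ (k + 1) * / INR (S n) ^ 2 * Cmod (w - z))%R with (INR k * Cmod (w - z) * K ^ (k + 1) * / INR (S n) ^ 2)%R by ring.
  rewrite <- Rmult_assoc. apply Rmult_le_compat_l; auto.
Qed.

Lemma UH_near z w : UH z -> (Cmod (w - z) < Im z / 2)%R -> UH w /\ (Im z / 2 < Im w)%R.
Proof.
  unfold UH. intros H Hw. generalize (im_le_Cmod (w - z)). unfold Cminus. rewrite im_plus, im_opp.
  intros G. generalize (Rle_abs (- (Im w + - Im z))). rewrite Rabs_Ropp. unfold Cminus in *. lra.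
Qed.

Lemma near_ratio z w : UH z -> (Cmod (w - z) < Im z / 2)%R -> (Cmod w / Im w <= (Cmod z + Im z) / (Im z / 2))%R.
Proof.
  intros H Hw. destruct (UH_near z w H Hw) as [H1 H2]. unfold UH in *.
  assert (Cmod w <= Cmod z + Im z)%R by (generalize (Cmod_triangle_rev w z); lra).
  unfold Rdiv. apply Rmult_le_compat; auto using Cmod_ge_0. left; now apply Rinv_0_lt_compat.
  apply Rinv_le_contravar; lra.
Qed.

Lemma CD_row_sum k z : UH z -> (2 <= k)%nat -> CD (row_sum k) z (- INR k * row_sum (S k) z).
Proof.
  intros H Hk. unfold row_sum. set (K := ((Cmod z + Im z) / (Im z / 2))%R).
  assert (K0 : (0 <= K)%R).
  { unfold UH in H. unfold K. apply Rdiv_le_0_compat; [generalize (Cmod_ge_0 z)|]; lra. }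
  assert (Hself : (Cmod (z - z) < Im z / 2)%R).
  { replace (z - z) with (RtoC 0) by ring. rewrite Cmod_0. unfold UH in H; lra. }
  eapply CD_eq.
  - apply CD_plus. apply CD_row; auto.
    apply CD_series with (f := fun n w => row k w (Z.of_nat (S n)) + row k w (- Z.of_nat (S n)))
      (f' := fun n => - INR k * (row (S k) z (Z.of_nat (S n)) + row (S k) z (- Z.of_nat (S n))))
      (d := (Im z / 2)%R) (K := fun n => (2 * (INR k * K ^ (k + 1)) * / INR (S n) ^ 2)%R)
      (B := (2 * (INR k * K ^ (k + 1)) * 2)%R)
      (l := - INR k * (row_sum (S k) z - row (S k) z 0)).
    + unfold UH in H; lra.
    + intros n. eapply CD_eq. apply CD_plus; apply CD_row; auto. ring.
    + apply majorant_scal; [|exact majorant_inv_sq].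
      repeat apply Rmult_le_pos; auto using pos_INR. lra. now apply pow_le.
    + intros n w Hw. destruct (UH_near z w H Hw) as [H1 H2].
      replace (row k w (Z.of_nat (S n)) + row k w (- Z.of_nat (S n)) - (row k z (Z.of_nat (S n)) + row k z (- Z.of_nat (S n))))
      with ((row k w (Z.of_nat (S n)) - row k z (Z.of_nat (S n))) + (row k w (- Z.of_nat (S n)) - row k z (- Z.of_nat (S n)))) by ring.
      eapply Rle_trans; [apply Cmod_triangle|].
      generalize (row_lipschitz k z w n _ K H H1 ltac:(lia) (near_ratio z z H Hself) (near_ratio z w H Hw) (or_introl eq_refl))
        (row_lipschitz k z w n _ K H H1 ltac:(lia) (near_ratio z z H Hself) (near_ratio z w H Hw) (or_intror eq_refl)). lra.
    + intros w Hw. destruct (UH_near z w H Hw) as [H1 H2].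
      assert (X := ZS_row_sum k w H1 Hk). apply ZS_CS in X.
      rewrite (CS_CSeries _ _ X). exact X.
    + apply CS_scal. apply (proj1 (ZS_CS _ _)). now apply ZS_row_sum; auto.
  - fold (row_sum (S k) z). ring.
Qed.

Lemma CD_lip k z : UH z -> (2 <= k)%nat -> CD (lip k) z (- INR k * lip (S k) z).
Proof.
  intros H Hk. unfold lip. assert (Q := Cmod_e2pi_lt z H).
  eapply CD_eq.
  - apply CD_scal. apply (CD_comp (psum (npow (k - 1))) e2pi). apply PS_CD; auto. apply PS_npow. apply CD_e2pi.
  - replace (psum (npow (S k - 1)) (e2pi z)) with (e2pi z * psum (pder (npow (k - 1))) (e2pi z)).
    + unfold lipc. replace (S k - 1)%nat with (S (k - 1)) by lia. 
      change (fact (S (k - 1))) with (S (k - 1) * fact (k - 1))%nat. rewrite mult_INR, RtoC_mult.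
      replace (S (k - 1)) with k by lia. rewrite Cpow_S.
      field. split. apply RtoC_fact_nz. replace k with (S (k - 1)) by lia. apply RtoC_INR_S_nz.
    + symmetry. apply CS_CSeries. apply CS_S'.
      { unfold npow. replace (S k - 1)%nat with (S (k - 1)) by lia. simpl. ring. }
      eapply CS_ext; [|apply CS_scal, PS_CS; [apply PS_pder, PS_npow|exact Q]].
      intros n. unfold pder, npow. replace (S k - 1)%nat with (S (k - 1)) by lia. rewrite !Cpow_S. ring.
Qed.

(** The case k = 2, differentiated k - 2 times: d/dz takes the sum of (z+n)^(-k) to -k times the next one,
    and acts in the same way on the right-hand side. *)
Theorem lipschitz k z : UH z -> (2 <= k)%nat -> row_sum k z = lip k z.
Proof.
  intros H Hk. revert z H. induction Hk; intros z H. now apply lipschitz_2.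
  assert (D := CD_row_sum m z H Hk). assert (D' := CD_lip m z H Hk).
  assert (D2 : CD (row_sum m) z (- INR m * lip (S m) z)).
  { apply CD_ext_loc with (f := lip m) (d := (Im z / 2)%R); auto. unfold UH in H; lra.
    intros w Hw. symmetry. apply IHHk. now apply (UH_near z w). }
  assert (E := CD_unique _ _ _ _ D D2).
  assert (N : - INR m <> 0).
  { intros X. assert (Y : RtoC (INR m) = 0) by (replace (RtoC (INR m)) with (- - INR m) by ring; rewrite X; ring).
    replace m with (S (m - 1)) in Y by lia. now apply RtoC_INR_S_nz in Y. }
  replace (row_sum (S m) z) with (/ (- INR m) * (- INR m * row_sum (S m) z)) by (field; intros X; apply N; rewrite X; ring).
  rewrite E. field. intros X; apply N; rewrite X; ring.
Qed.

Lemma ZS_lipschitz k z : UH z -> (2 <= k)%nat -> ZS (row k z) (lip k z).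
Proof. intros. rewrite <- lipschitz by auto. now apply ZS_row_sum. Qed.

(** * Lambert series *)

(** Dirichlet convolution: the factorizations N = d r are found by letting d run from 1 to N. *)
Definition dsum (c : nat -> nat -> C) (N : nat) : C :=
  csum (fun i => if (N mod S i =? 0)%nat then c (S i) (N / S i)%nat else 0) N.

Lemma csum_multiples (u : nat -> C) d n : (0 < d)%nat ->
  csum (fun N => if (N mod d =? 0)%nat then u (N / d)%nat else 0) n = csum u ((n + d - 1) / d).
Proof.
  intros Hd. induction n.
  - simpl. rewrite Nat.div_small by lia. reflexivity.
  - cbn [csum]. rewrite IHn.
    generalize (Nat.div_mod n d ltac:(lia)) (Nat.mod_upper_bound n d ltac:(lia)).
    intros E B. set (q := (n / d)%nat) in *. set (r := (n mod d)%nat) in *.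
    destruct (Nat.eqb_spec r 0) as [R|R].
    + replace ((n + d - 1) / d)%nat with q.
      2:{ apply Nat.div_unique with (d - 1)%nat; lia. }
      replace ((S n + d - 1) / d)%nat with (S q). reflexivity.
      apply Nat.div_unique with 0%nat; lia.
    + replace ((n + d - 1) / d)%nat with (S q).
      2:{ apply Nat.div_unique with (r - 1)%nat; lia. }
      replace ((S n + d - 1) / d)%nat with (S q). ring.
      apply Nat.div_unique with r; lia.
Qed.

Lemma rsum_multiples (u : nat -> C) d n : (0 < d)%nat ->
  rsum (fun N => Cmod (if (N mod d =? 0)%nat then u (N / d)%nat else 0)) n = rsum (fun r => Cmod (u r)) ((n + d - 1) / d).
Proof.
  intros Hd.
  assert (E : RtoC (rsum (fun N => Cmod (if (N mod d =? 0)%nat then u (N / d)%nat else 0)) n) = RtoC (rsum (fun r => Cmod (u r)) ((n + d - 1) / d))).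
  { rewrite !RtoC_rsum, <- csum_multiples by auto. apply csum_ext. intros i _.
    destruct (Nat.eqb (i mod d) 0); auto. now rewrite Cmod_0. }
  now apply RtoC_inj in E.
Qed.

Lemma CS_multiples (u : nat -> C) d l : (0 < d)%nat -> CS u l ->
  CS (fun N => if (N mod d =? 0)%nat then u (N / d)%nat else 0) l.
Proof.
  intros Hd H e He. destruct (H e He) as [K HK]. exists (d * K)%nat. intros n Hn.
  rewrite csum_multiples by auto. apply HK.
  apply Nat.div_le_lower_bound; lia.
Qed.

Lemma pow_nat_geom p rho : (0 < rho < 1)%R -> exists M t, (0 <= M)%R /\ (0 < t < 1)%R /\
  forall n, (INR n ^ p * rho ^ n <= M * t ^ n)%R.
Proof.
  intros Hr. set (s := ((rho + 1) / 2)%R). assert (Hs : (rho < s < 1)%R) by (unfold s; lra).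
  destruct (PS_npow p s ltac:(lra)) as [B [H1 H2]].
  exists B, (rho / s)%R. split; [|split].
  - apply (H2 O).
  - split. apply Rdiv_lt_0_compat; lra. apply Rlt_div_l; lra.
  - intros n.
    assert (E : (rho ^ n = s ^ n * (rho / s) ^ n)%R).
    { rewrite <- Rpow_mult_distr. f_equal. field. lra. }
    rewrite E, <- Rmult_assoc. apply Rmult_le_compat_r. apply pow_le. left. apply Rdiv_lt_0_compat; lra.
    eapply Rle_trans; [|apply (H2 (S n))]. cbn [rsum].
    assert (0 <= rsum (fun n => Cmod (npow p n) * s ^ n)%R n)%R by (apply rsum_nonneg; auto).
    unfold npow at 2. rewrite Cmod_pow, Cmod_R, (Rabs_right (INR n)) by (apply Rle_ge, pos_INR). lra.
Qed.

Lemma majorant_geom_S t : (0 < t < 1)%R -> majorant (fun n => t ^ S n)%R (/ (1 - t)).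
Proof. intros Ht. apply (majorant_S (fun n => t ^ n)%R). apply geom_majorant. lra. Qed.

(** Absolute convergence allows the double series to be summed along the hyperbolas d r = N. The polynomial
    bound on the coefficients gives absolute convergence. *)
Theorem lambert (c : nat -> nat -> C) p x (Rv : nat -> C) :
  (forall d r, (Cmod (c (S d) (S r)) <= INR (S d * S r) ^ p)%R) -> (Cmod x < 1)%R ->
  (forall d, CS (fun r => c (S d) (S r) * x ^ (S d * S r)) (Rv d)) ->
  CS Rv (psum (dsum c) x).
Proof.
  intros Hc Hx HR. destruct (between_1 x Hx) as [rho [Hr L]].
  destruct (pow_nat_geom p rho Hr) as [M [t [HM [Ht HMt]]]].
  set (u := fun d r => match r with O => RtoC 0 | _ => c (S d) r * x ^ (S d * r) end).
  set (a := fun d N => if (N mod S d =? 0)%nat then u d (N / S d)%nat else 0).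
  assert (Hu : forall d r, (Cmod (u d r) <= M * (t ^ S d) ^ r)%R).
  { intros d r. assert (P : (0 <= M * (t ^ S d) ^ r)%R) by (apply Rmult_le_pos; auto; apply pow_le, pow_le; lra).
    destruct r; unfold u. rewrite Cmod_0; auto. rewrite Cmod_mult, Cmod_pow, <- pow_mult.
    eapply Rle_trans; [|apply HMt]. apply Rmult_le_compat; auto using Cmod_ge_0.
    apply pow_le, Cmod_ge_0. apply pow_incr. split; [apply Cmod_ge_0|lra]. }
  assert (HuM : forall d, majorant (fun r => Cmod (u d r)) (M * / (1 - t) * t ^ S d)%R).
  { intros d. set (y := (t ^ S d)%R).
    assert (Hy : (0 < y <= t)%R).
    { unfold y. split. apply pow_lt; lra. simpl. assert (t ^ d <= 1)%R by (rewrite <- (pow1 d); apply pow_incr; lra).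
      assert (0 < t ^ d)%R by (apply pow_lt; lra). nra. }
    assert (Q : majorant (fun r => match r with O => 0 | S r => M * y * y ^ r end)%R (M * / (1 - t) * y)).
    { assert (P0 : (0 <= / (1 - t))%R) by (left; apply Rinv_0_lt_compat; lra).
      assert (P1 : (0 <= M * / (1 - t) * y)%R) by (apply Rmult_le_pos; [apply Rmult_le_pos; [exact HM|exact P0]|lra]).
      assert (P2 : forall r, (0 <= M * y * y ^ r)%R).
      { intros r. apply Rmult_le_pos. { apply Rmult_le_pos; lra. } apply pow_le; lra. }
      split. { intros r. destruct r as [|r]. lra. apply P2. }
      intros n. destruct n as [|n]. { exact P1. }
      assert (E : forall m, rsum (fun r => match r with O => 0 | S r => M * y * y ^ r end)%R (S m) = (M * y * rsum (fun r => y ^ r) m)%R).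
      { induction m. simpl. ring. change (rsum (fun r : nat => match r with
          | 0%nat => 0%R | S r0 => (M * y * y ^ r0)%R end) (S (S m))) with
          (rsum (fun r : nat => match r with | 0%nat => 0%R | S r0 => (M * y * y ^ r0)%R end) (S m) + M * y * y ^ m)%R.
        rewrite IHm. simpl. ring. }
      rewrite E. replace (M * / (1 - t) * y)%R with (M * y * / (1 - t))%R by ring.
      apply Rmult_le_compat_l. apply Rmult_le_pos; lra.
      eapply Rle_trans; [|apply (proj2 (geom_majorant t ltac:(lra)) n)]. apply rsum_le.
      intros i _. apply pow_incr. lra. }
    apply majorant_le with (2 := Q). intros n. split. apply Cmod_ge_0.
    destruct n. simpl. rewrite Cmod_0; lra. eapply Rle_trans; [apply Hu|]. fold y. simpl. lra. }
  assert (Hm : dbl_majorant a (M * / (1 - t) * / (1 - t))).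
  { apply dbl_majorant_of_rows with (fun d => M * / (1 - t) * t ^ S d)%R.
    - intros d. split. intros; apply Cmod_ge_0. intros n. unfold a. rewrite rsum_multiples by lia. apply HuM.
    - apply majorant_scal. apply Rmult_le_pos; auto. left; apply Rinv_0_lt_compat; lra. now apply majorant_geom_S. }
  assert (Hrow : forall d, CS (a d) (Rv d)).
  { intros d. unfold a. apply CS_multiples. lia. apply CS_S'. reflexivity. exact (HR d). }
  assert (Hcol : forall N, CS (fun d => a d N) (dsum c N * x ^ N)).
  { intros N. replace (dsum c N * x ^ N) with (csum (fun d => a d N) N).
    - apply CS_finite. intros d Hd. unfold a, u. rewrite Nat.mod_small, Nat.div_small by lia.
      destruct N; reflexivity.
    - unfold dsum. rewrite Cmult_comm, <- csum_scal. apply csum_ext. intros d Hd. unfold a, u.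
      destruct (Nat.eqb_spec (N mod S d) 0) as [E|E]; [|ring].
      assert (E2 : N = (S d * (N / S d))%nat) by (generalize (Nat.div_mod N (S d) ltac:(lia)); lia).
      destruct (N / S d)%nat eqn:Q; [lia|]. rewrite <- E2. ring. }
  destruct (fubini a _ _ _ Hm Hrow Hcol) as [s [S1 S2]].
  unfold psum. now rewrite (CS_CSeries _ _ S2).
Qed.

Lemma dsum_bound (c : nat -> nat -> C) p N :
  (forall d r, (Cmod (c (S d) (S r)) <= INR (S d * S r) ^ p)%R) -> (Cmod (dsum c N) <= INR N ^ (p + 1))%R.
Proof.
  intros Hc. unfold dsum. eapply Rle_trans; [apply Cmod_csum|].
  apply Rle_trans with (rsum (fun _ => INR N ^ p)%R N).
  - apply rsum_le. intros i Hi. assert (0 <= INR N ^ p)%R by apply pow_le, pos_INR.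
    destruct (Nat.eqb_spec (N mod S i) 0) as [E|E]; [|now rewrite Cmod_0].
    assert (E2 : (S i * (N / S i) = N)%nat) by (generalize (Nat.div_mod N (S i) ltac:(lia)); lia).
    destruct (N / S i)%nat eqn:Q; [lia|]. rewrite <- E2. apply Hc.
  - rewrite rsum_const, pow_add. simpl. right; ring.
Qed.

Lemma PS_dsum (c : nat -> nat -> C) p :
  (forall d r, (Cmod (c (S d) (S r)) <= INR (S d * S r) ^ p)%R) -> PS (dsum c).
Proof. intros H. apply PS_bounded with 1%R (p + 1)%nat. intros n. generalize (dsum_bound c p n H). lra. Qed.

(** The divisor sums sigma_s. *)
Definition sig (s : nat) : nat -> C := dsum (fun d _ => RtoC (INR d) ^ s).

Lemma pow_prod_bound s t d r :
  (Cmod (RtoC (INR (S d)) ^ s * RtoC (INR (S r)) ^ t) <= INR (S d * S r) ^ (s + t))%R.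
Proof.
  assert (G : forall n, (1 <= INR (S n))%R) by (intros n; rewrite S_INR; generalize (pos_INR n); lra).
  rewrite Cmod_mult, !Cmod_pow, !Cmod_R, !Rabs_INR_S, mult_INR, pow_add.
  generalize (G d) (G r). intros. apply Rmult_le_compat; try (apply pow_le; lra); apply pow_incr; nra.
Qed.

Lemma PS_sig s : PS (sig s).
Proof.
  apply PS_dsum with (s + 0)%nat. intros d r. eapply Rle_trans; [|apply (pow_prod_bound s 0)]. simpl. rewrite Cmult_1_r. lra.
Qed.

Lemma csum_single (f : nat -> C) n k :
  (forall i, (i < n)%nat -> i <> k -> f i = 0) -> (k < n)%nat -> csum f n = f k.
Proof.
  induction n; intros H Hk; [lia|]. cbn [csum]. destruct (Nat.eq_dec k n) as [->|N].
  - rewrite (csum_ext f (fun _ => 0)), csum_zero. ring. intros i Hi. apply H; lia.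
  - rewrite IHn, (H n) by (try lia; intros; apply H; lia). ring.
Qed.

Lemma dsum_dbl c N : dsum c N =
  csum (fun i => csum (fun j => if (S i * S j =? N)%nat then c (S i) (S j) else 0) N) N.
Proof.
  apply csum_ext. intros i Hi.
  destruct (Nat.eqb_spec (N mod S i) 0) as [E|E].
  - assert (E2 : (S i * (N / S i) = N)%nat) by (generalize (Nat.div_mod N (S i) ltac:(lia)); lia).
    destruct (N / S i)%nat as [|k] eqn:Q; [lia|].
    rewrite (csum_single _ N k).
    + destruct (Nat.eqb_spec (S i * S k) N); [auto|lia].
    + intros j Hj Hjk. destruct (Nat.eqb_spec (S i * S j) N) as [F|F]; auto. exfalso. apply Hjk.
      assert (F2 : (S i * S j = S i * S k)%nat) by congruence. clear F. rename F2 into F. apply Nat.mul_cancel_l in F; [congruence|lia].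
    + assert (S i * S k = N)%nat by lia. nia.
  - rewrite (csum_ext _ (fun _ => 0)), csum_zero; auto. intros j Hj.
    destruct (Nat.eqb_spec (S i * S j) N) as [F|F]; auto. exfalso. apply E. rewrite <- F, Nat.mul_comm.
    apply Nat.Div0.mod_mul.
Qed.

Lemma dsum_swap c N : dsum c N = dsum (fun d r => c r d) N.
Proof.
  rewrite !dsum_dbl, csum_swap. apply csum_ext. intros i _. apply csum_ext. intros j _.
  now rewrite Nat.mul_comm.
Qed.

Lemma sigma1_sig n : RtoC (INR (sigma1 n)) = sig 1 n.
Proof.
  unfold sigma1, sig, dsum.
  assert (G : forall m, RtoC (INR (list_sum (filter (fun d => (n mod d =? 0)%nat) (seq 1 m)))) =
    csum (fun i => if (n mod S i =? 0)%nat then RtoC (INR (S i)) ^ 1 else 0) m).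
  { induction m. reflexivity. rewrite seq_S, filter_app, list_sum_app, plus_INR, RtoC_plus, IHm.
    cbn [csum]. f_equal. change (1 + m)%nat with (S m). cbn [filter].
    destruct (n mod S m =? 0)%nat; [|reflexivity].
    cbn [list_sum fold_right]. rewrite Nat.add_0_r, Cpow_1_r. reflexivity. }
  apply G.
Qed.

Lemma dsum_powers s t N : dsum (fun d r => RtoC (INR d) ^ (s + t) * RtoC (INR r) ^ t) N = RtoC (INR N) ^ t * sig s N.
Proof.
  unfold sig, dsum. rewrite <- csum_scal. apply csum_ext. intros i Hi.
  destruct (Nat.eqb_spec (N mod S i) 0) as [E|E]; [|ring].
  assert (E2 : (N = S i * (N / S i))%nat) by (generalize (Nat.div_mod N (S i) ltac:(lia)); lia).
  rewrite E2 at 2. rewrite mult_INR, RtoC_mult, Cpow_mult_l, Cpow_add_r. ring.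
Qed.

(** * Lattice sums over squares *)

Lemma zsum_plus f g N : zsum (fun n => f n + g n) N = zsum f N + zsum g N.
Proof.
  unfold zsum. rewrite (csum_ext _ (fun n => (f (Z.of_nat (S n)) + f (- Z.of_nat (S n))%Z) + (g (Z.of_nat (S n)) + g (- Z.of_nat (S n))%Z))).
  rewrite csum_plus. ring. intros; ring.
Qed.

Lemma zsum_scal c f N : zsum (fun n => c * f n) N = c * zsum f N.
Proof.
  unfold zsum. rewrite (csum_ext _ (fun n => c * (f (Z.of_nat (S n)) + f (- Z.of_nat (S n))%Z))).
  rewrite csum_scal. ring. intros; ring.
Qed.

Lemma zsum_minus f g N : zsum (fun n => f n - g n) N = zsum f N - zsum g N.
Proof.
  rewrite (zsum_ext _ (fun n => f n + - (1) * g n)) by (intros; ring).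
  rewrite zsum_plus, zsum_scal. ring.
Qed.

Lemma zsum_reflect f N : zsum (fun n => f (- n)%Z) N = zsum f N.
Proof.
  unfold zsum. f_equal. apply csum_ext. intros i _. rewrite Z.opp_involutive. ring.
Qed.

Lemma zsum_csum (f : nat -> Z -> C) n N :
  zsum (fun m => csum (fun i => f i m) n) N = csum (fun i => zsum (f i) N) n.
Proof.
  induction n; cbn [csum].
  - rewrite (zsum_ext _ (fun _ => 0 * 0)) by (intros; ring). rewrite zsum_scal. ring.
  - rewrite zsum_plus, IHn. reflexivity.
Qed.

Lemma zsum_swap (f : Z -> Z -> C) N M :
  zsum (fun m => zsum (f m) M) N = zsum (fun n => zsum (fun m => f m n) N) M.
Proof.
  change (zsum (fun m => f m 0%Z + csum (fun i => f m (Z.of_nat (S i)) + f m (- Z.of_nat (S i))%Z) M) N =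
    zsum (fun m => f m 0%Z) N + csum (fun i => zsum (fun m => f m (Z.of_nat (S i))) N + zsum (fun m => f m (- Z.of_nat (S i))%Z) N) M).
  rewrite zsum_plus, (zsum_csum (fun i m => f m (Z.of_nat (S i)) + f m (- Z.of_nat (S i))%Z)). f_equal.
  apply csum_ext. intros i _. apply (zsum_plus (fun m => f m (Z.of_nat (S i))) (fun m => f m (- Z.of_nat (S i))%Z)).
Qed.

Lemma Cmod_zsum f N B : (forall n, (Z.abs n <= Z.of_nat N)%Z -> Cmod (f n) <= B)%R ->
  (Cmod (zsum f N) <= (2 * INR N + 1) * B)%R.
Proof.
  intros H. unfold zsum. eapply Rle_trans; [apply Cmod_triangle|].
  assert (H0 := H 0%Z ltac:(lia)).
  assert (H1 : (Cmod (csum (fun n => (f (Z.of_nat (S n)) + f (- Z.of_nat (S n))%Z)%C) N) <= rsum (fun _ => 2 * B) N)%R).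
  { eapply Rle_trans; [apply Cmod_csum|]. apply rsum_le. intros i Hi.
    eapply Rle_trans; [apply Cmod_triangle|].
    generalize (H (Z.of_nat (S i)) ltac:(lia)) (H (- Z.of_nat (S i))%Z ltac:(lia)). lra. }
  rewrite rsum_const in H1. lra.
Qed.

(** Squares are invariant under the quarter turn of the lattice that inversion induces, so their sums
    transform exactly, even in weight 2 where the double series converges only conditionally. *)
Definition square_sum (f : Z -> Z -> C) (N : nat) : C := zsum (fun m => zsum (f m) N) N.

(** The term at the origin vanishes, since the inverse of 0 is 0. *)
Definition lat (k : nat) (tau : C) (m n : Z) : C := / (IZR m * tau + IZR n) ^ k.

Lemma Cinv_0 : / RtoC 0 = 0.
Proof. apply C_ext; simpl; unfold Rdiv; ring. Qed.

Lemma lat_nz tau m n : UH tau -> (m, n) <> (0, 0)%Z -> IZR m * tau + IZR n <> 0.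
Proof.
  intros H Hmn E. apply Hmn.
  assert (I : Im (IZR m * tau + IZR n) = 0%R) by now rewrite E.
  rewrite im_plus, im_scal_l, im_RtoC, Rplus_0_r in I. unfold UH in H.
  assert (Hm : IZR m = 0%R) by (apply Rmult_integral in I; destruct I; lra).
  apply eq_IZR_R0 in Hm. subst m.
  replace (RtoC (IZR 0) * tau + IZR n) with (RtoC (IZR n)) in E by (simpl; ring).
  apply RtoC_inj, eq_IZR_R0 in E. now subst n.
Qed.

Definition inv_neg (tau : C) : C := - / tau.

Lemma UH_inv_neg tau : UH tau -> UH (inv_neg tau).
Proof.
  unfold UH. intros H. unfold inv_neg. rewrite im_opp. destruct tau as [x y]. simpl in *.
  assert (0 < x * x + y * y)%R by nra.
  replace (- (- y / (x * (x * 1) + y * (y * 1))))%R with (y / (x * x + y * y))%R by (field; nra).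
  apply Rdiv_lt_0_compat; lra.
Qed.

Lemma lat_inv_neg k tau m n : UH tau -> (1 <= k)%nat ->
  lat k (inv_neg tau) m n = tau ^ k * lat k tau n (- m).
Proof.
  intros H Hk. assert (Nt := UH_nz tau H). unfold lat.
  destruct (Z.eq_dec m 0) as [Em|Nm]; [destruct (Z.eq_dec n 0) as [En|Nn]|].
  - subst. simpl Z.opp. replace (RtoC (IZR 0) * inv_neg tau + IZR 0) with (RtoC 0) by (simpl; ring).
    replace (RtoC (IZR 0) * tau + IZR 0) with (RtoC 0) by (simpl; ring).
    replace k with (S (k - 1)) by lia. rewrite Cpow_S, Cmult_0_l, Cinv_0. ring.
  - assert (N := lat_nz tau n (- m) H ltac:(congruence)).
    replace (IZR m * inv_neg tau + IZR n) with ((IZR n * tau + IZR (- m)) * / tau).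
    2:{ unfold inv_neg. rewrite opp_IZR, RtoC_opp. field. auto. }
    rewrite Cpow_mult_l, Cpow_inv by auto. field. split; now apply Cpow_nz.
  - assert (N := lat_nz tau n (- m) H ltac:(intros X; injection X; lia)).
    replace (IZR m * inv_neg tau + IZR n) with ((IZR n * tau + IZR (- m)) * / tau).
    2:{ unfold inv_neg. rewrite opp_IZR, RtoC_opp. field. auto. }
    rewrite Cpow_mult_l, Cpow_inv by auto. field. split; now apply Cpow_nz.
Qed.

Lemma square_sum_inv_neg k tau N : UH tau -> (1 <= k)%nat ->
  square_sum (lat k (inv_neg tau)) N = tau ^ k * square_sum (lat k tau) N.
Proof.
  intros H Hk. unfold square_sum.
  rewrite (zsum_ext _ (fun m => tau ^ k * zsum (fun n => lat k tau n (- m)) N)).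
  2:{ intros m _. rewrite <- zsum_scal. apply zsum_ext. intros n _. now apply lat_inv_neg. }
  rewrite zsum_scal. f_equal.
  rewrite (zsum_reflect (fun m => zsum (fun n => lat k tau n m) N)). apply zsum_swap.
Qed.

Lemma lat_bound tau (m x : R) : UH tau -> (Rabs x * Im tau <= Cmod (m * tau + x) * Cmod tau)%R.
Proof.
  intros H. rewrite <- (Cmod_conj tau). rewrite <- Cmod_mult.
  eapply Rle_trans; [|apply im_le_Cmod].
  replace (Im ((m * tau + x) * Cconj tau)) with (- (x * Im tau))%R.
  - rewrite Rabs_Ropp, Rabs_mult, (Rabs_right (Im tau)); unfold UH in H; lra.
  - destruct tau; simpl; ring.
Qed.

Lemma lat_inv_bound tau (m x : R) : UH tau -> x <> 0%R ->
  m * tau + x <> 0 /\ (Cmod (/ (m * tau + x)) <= Cmod tau / Im tau / Rabs x)%R.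
Proof.
  intros H Hx. assert (Hr := Rabs_pos_lt x Hx). assert (B := lat_bound tau m x H).
  assert (Ht := Cmod_nz _ (UH_nz tau H)). unfold UH in H.
  assert (N : m * tau + x <> 0).
  { apply Cmod_gt_0. destruct (Rle_lt_dec (Cmod (m * tau + x)) 0) as [L|L]; auto.
    exfalso. assert (0 < Rabs x * Im tau)%R by (apply Rmult_lt_0_compat; lra).
    assert (Cmod (m * tau + x) * Cmod tau <= 0 * Cmod tau)%R by (apply Rmult_le_compat_r; lra). lra. }
  split; auto. rewrite Cmod_inv by auto. assert (Hp := Cmod_nz _ N).
  set (a := Cmod (m * tau + x)) in *.
  replace (Cmod tau / Im tau / Rabs x)%R with (/ a * (a * Cmod tau) / (Rabs x * Im tau))%R by (field; lra).
  apply Rle_div_r. apply Rmult_lt_0_compat; lra.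
  apply Rmult_le_compat_l; auto. left; now apply Rinv_0_lt_compat.
Qed.

Definition zeta_sum (k : nat) : C := CSeries (fun n => / RtoC (INR (S n)) ^ k).

Lemma zeta_sum_CS k : (2 <= k)%nat -> CS (fun n => / RtoC (INR (S n)) ^ k) (zeta_sum k).
Proof.
  intros Hk. destruct (CS_of_majorant (fun n => / RtoC (INR (S n)) ^ k) (fun n => / INR (S n) ^ 2)%R 2) as [l Hl].
  - intros n. rewrite <- RtoC_pow, <- RtoC_inv.
    2:{ apply pow_nonzero. apply not_0_INR. lia. }
    rewrite Cmod_R, Rabs_right.
    + rewrite <- !pow_inv. apply pow_ge_sq; auto. apply Rinv_INR_S_le.
    + apply Rle_ge. left. apply Rinv_0_lt_compat, pow_lt, lt_0_INR. lia.
  - exact majorant_inv_sq.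
  - unfold zeta_sum. now rewrite (CS_CSeries _ _ Hl).
Qed.

(** The sum of the full row m of the lattice, by the Lipschitz formula unless m = 0. *)
Definition lat_row (k : nat) (tau : C) (m : Z) : C :=
  if (m =? 0)%Z then 2 * zeta_sum k else lip k (IZR (Z.abs m) * tau).

Lemma pow_neg_even (z : C) k : (- z) ^ (2 * k) = z ^ (2 * k).
Proof. rewrite !Cpow_mult_r. f_equal. simpl. ring. Qed.

Lemma ZS_reflect f l : ZS f l -> ZS (fun n => f (- n)%Z) l.
Proof. apply flim_ext. apply eventually_filter. intros; now rewrite zsum_reflect. Qed.

Lemma ZS_ext f g l : (forall n, f n = g n) -> ZS f l -> ZS g l.
Proof. intros H. apply flim_ext. apply eventually_filter. intros. apply zsum_ext. auto. Qed.

Lemma ZS_lat_row k tau m : UH tau -> (1 <= k)%nat -> ZS (lat (2 * k) tau m) (lat_row (2 * k) tau m).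
Proof.
  intros H Hk. unfold lat_row. destruct (Z.eqb_spec m 0) as [->|N].
  - apply ZS_CS. 
    replace (2 * zeta_sum (2 * k) - lat (2 * k) tau 0 0) with (2 * zeta_sum (2 * k)).
    2:{ unfold lat. replace (RtoC (IZR 0) * tau + IZR 0) with (RtoC 0) by (simpl; ring).
        replace (2 * k)%nat with (S (2 * k - 1)) by lia. rewrite Cpow_S, Cmult_0_l, Cinv_0. ring. }
    eapply CS_ext; [|apply CS_scal, zeta_sum_CS; lia].
    intros n. unfold lat. rewrite IZR_of_nat_S, IZR_opp_of_nat_S, RtoC_opp.
    replace (RtoC (IZR 0) * tau + INR (S n)) with (RtoC (INR (S n))) by (simpl (IZR 0); ring).
    replace (RtoC (IZR 0) * tau + - INR (S n)) with (- RtoC (INR (S n))) by (simpl (IZR 0); ring).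
    rewrite pow_neg_even. ring.
  - destruct (Z_lt_le_dec 0 m) as [L|L].
    + rewrite Z.abs_eq by lia. apply (ZS_lipschitz (2 * k) (IZR m * tau)); [|lia].
      apply UH_mult_real; auto. now apply (IZR_lt 0).
    + rewrite Z.abs_neq by lia. 
      assert (Q : UH (IZR (- m) * tau)) by (apply UH_mult_real; auto; apply (IZR_lt 0); lia).
      eapply ZS_ext; [|apply ZS_reflect, (ZS_lipschitz (2 * k) _ Q); lia].
      intros n. unfold row, lat. rewrite <- (pow_neg_even (IZR m * tau + IZR n)). do 2 f_equal.
      rewrite !opp_IZR, !RtoC_opp. ring.
Qed.

Definition ratio (tau : C) : R := (Cmod tau / Im tau)%R.

Lemma ratio_ge_1 tau : UH tau -> (1 <= ratio tau)%R.
Proof.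
  intros H. unfold ratio, UH in *. apply Rle_div_r; auto. rewrite Rmult_1_l.
  eapply Rle_trans; [|apply im_le_Cmod]. apply Rle_abs.
Qed.

Lemma lat_term_bound k tau m n x : UH tau -> (4 <= k)%nat -> Rabs (IZR x) = INR (S n) ->
  (Cmod (lat k tau m x) <= ratio tau ^ k * (/ INR (S n) ^ 2 * / INR (S n) ^ 2))%R.
Proof.
  intros H Hk Hx. unfold lat.
  assert (P : (0 < INR (S n))%R) by (apply lt_0_INR; lia).
  assert (Nx : IZR x <> 0%R) by (intros E; rewrite E, Rabs_R0 in Hx; lra).
  destruct (lat_inv_bound tau (IZR m) (IZR x) H Nx) as [N B]. rewrite Hx in B.
  rewrite <- Cpow_inv, Cmod_pow by auto.
  assert (D := Rinv_INR_S_le n). assert (G := ratio_ge_1 tau H).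
  apply Rle_trans with ((ratio tau * / INR (S n)) ^ k)%R.
  { apply pow_incr. split; [apply Cmod_ge_0|exact B]. }
  rewrite Rpow_mult_distr. apply Rmult_le_compat_l. apply pow_le; lra.
  rewrite <- !pow_inv. replace k with (2 + (k - 2))%nat by lia. rewrite pow_add.
  apply Rmult_le_compat_l. apply pow_le; lra. apply pow_ge_sq; auto. lia.
Qed.

Lemma lat_tail k tau m N : UH tau -> (2 <= k)%nat ->
  (Cmod (lat_row (2 * k) tau m - zsum (lat (2 * k) tau m) N) <= 4 * ratio tau ^ (2 * k) * / INR (S N) ^ 2)%R.
Proof.
  intros H Hk. assert (S0 := ZS_lat_row k tau m H ltac:(lia)). apply ZS_CS in S0.
  unfold zsum. 
  replace (lat_row (2 * k) tau m - (lat (2 * k) tau m 0 + csum (fun n => lat (2 * k) tau m (Z.of_nat (S n)) + lat (2 * k) tau m (- Z.of_nat (S n))) N))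
   with ((lat_row (2 * k) tau m - lat (2 * k) tau m 0) - csum (fun n => lat (2 * k) tau m (Z.of_nat (S n)) + lat (2 * k) tau m (- Z.of_nat (S n))) N) by ring.
  apply CS_tail_bound with (2 := S0). intros p.
  assert (G := ratio_ge_1 tau H). assert (G2 : (0 <= ratio tau ^ (2 * k))%R) by (apply pow_le; lra).
  assert (PN : (0 < INR (S N))%R) by (apply lt_0_INR; lia).
  apply Rle_trans with (rsum (fun i => 2 * ratio tau ^ (2 * k) * / INR (S N) ^ 2 * / INR (S i) ^ 2) p)%R.
  - apply rsum_le. intros i _. eapply Rle_trans; [apply Cmod_triangle|].
    assert (T1 := lat_term_bound (2 * k) tau m (N + i) (Z.of_nat (S (N + i))) H ltac:(lia) ltac:(rewrite IZR_of_nat_S; apply Rabs_INR_S)).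
    assert (T2 := lat_term_bound (2 * k) tau m (N + i) (- Z.of_nat (S (N + i))) H ltac:(lia) ltac:(rewrite IZR_opp_of_nat_S, Rabs_Ropp; apply Rabs_INR_S)).
    assert (Pi : (0 < INR (S i))%R) by (apply lt_0_INR; lia).
    assert (U : (/ INR (S (N + i)) ^ 2 * / INR (S (N + i)) ^ 2 <= / INR (S N) ^ 2 * / INR (S i) ^ 2)%R).
    { apply Rmult_le_compat; try (left; apply Rinv_0_lt_compat, pow_lt, lt_0_INR; lia);
      (apply Rinv_le_contravar; [now apply pow_lt|apply pow_incr; split; [lra|apply le_INR; lia]]). }
    assert (V := Rmult_le_compat_l _ _ _ G2 U). lra.
  - rewrite rsum_scal. 
    assert (Q := proj2 majorant_inv_sq p).
    assert (0 <= 2 * ratio tau ^ (2 * k) * / INR (S N) ^ 2)%R.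
    { repeat apply Rmult_le_pos; try lra. left. apply Rinv_0_lt_compat, pow_lt; auto. }
    nra.
Qed.

Lemma Clim_of_bound (u : nat -> C) K : (forall N, Cmod (u N) <= K * / INR (S N))%R -> Clim u 0.
Proof.
  intros H e He.
  assert (HK : (0 <= K)%R). { generalize (H O) (Cmod_ge_0 (u O)). simpl. rewrite Rinv_1. lra. }
  destruct (nfloor_ex (K / e) (Rdiv_le_0_compat _ _ HK He)) as [n [_ Hn]].
  exists n. intros N HN. replace (u N - 0) with (u N) by ring.
  eapply Rle_lt_trans; [apply H|].
  assert (P : (0 < INR (S N))%R) by (apply lt_0_INR; lia).
  apply Rlt_div_l; auto.
  assert (INR n + 1 <= INR (S N))%R by (rewrite S_INR; apply Rplus_le_compat_r, le_INR; lia).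
  assert (K / e * e = K)%R by (field; lra). nra.
Qed.

(** In weight at least 4 each of the 2N + 1 truncated rows misses its full sum by O(N^-2). *)
Lemma square_sum_rows k tau : UH tau -> (2 <= k)%nat ->
  Clim (fun N => zsum (lat_row (2 * k) tau) N - square_sum (lat (2 * k) tau) N) 0.
Proof.
  intros H Hk. apply Clim_of_bound with (8 * ratio tau ^ (2 * k))%R. intros N.
  unfold square_sum. rewrite <- zsum_minus.
  eapply Rle_trans. apply Cmod_zsum. intros m _. apply lat_tail; auto.
  assert (PN : (0 < INR (S N))%R) by (apply lt_0_INR; lia).
  assert (G := ratio_ge_1 tau H). assert (G2 : (0 <= ratio tau ^ (2 * k))%R) by (apply pow_le; lra).
  assert (L : (2 * INR N + 1 <= 2 * INR (S N))%R) by (rewrite S_INR; lra).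
  apply Rle_trans with (2 * INR (S N) * (4 * ratio tau ^ (2 * k) * / INR (S N) ^ 2))%R.
  - apply Rmult_le_compat_r; auto. apply Rmult_le_pos. lra. left. apply Rinv_0_lt_compat, pow_lt; auto.
  - right. field. lra.
Qed.

(** The constant term of G_k; it is zeta(1-k)/2 by [zeta_neg], and arises here as the contribution of the
    row m = 0. *)
Definition gconst (k : nat) : C := zeta_sum k / lipc k.

Definition Gk (k : nat) (tau : C) : C := gconst k + psum (sig (k - 1)) (e2pi tau).

Lemma lipc_nz k : lipc k <> 0.
Proof.
  unfold lipc. apply Cmult_neq_0. apply Cpow_nz. intros E. apply TwoPiCi_nz.
  replace (2 * PI * Ci) with (- - (2 * PI * Ci)) by ring. rewrite E. ring.
  intros E. assert (X : RtoC (INR (fact (k - 1))) * / INR (fact (k - 1)) = 1) by (field; apply RtoC_fact_nz).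
  rewrite E in X. replace (RtoC (INR (fact (k - 1))) * 0) with (RtoC 0) in X by ring.
  apply RtoC_inj in X. lra.
Qed.

Lemma sig_swap s N : sig s N = dsum (fun _ r => RtoC (INR r) ^ s) N.
Proof. unfold sig. now rewrite dsum_swap. Qed.

(** The rows m and -m agree, and summing the Lipschitz series over m > 0 collects the divisor sums. *)
Lemma sum_lat_rows k tau : UH tau -> (1 <= k)%nat ->
  Clim (zsum (lat_row (2 * k) tau)) (2 * lipc (2 * k) * Gk (2 * k) tau).
Proof.
  intros H Hk. assert (Q := Cmod_e2pi_lt tau H).
  assert (L : CS (fun d => psum (npow (2 * k - 1)) (e2pi tau ^ S d)) (psum (sig (2 * k - 1)) (e2pi tau))).
  { replace (psum (sig (2 * k - 1)) (e2pi tau)) with (psum (dsum (fun _ r => RtoC (INR r) ^ (2 * k - 1))) (e2pi tau)).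
    2:{ unfold psum. f_equal. apply FunctionalExtensionality.functional_extensionality. intros n. now rewrite sig_swap. }
    apply lambert with (p := (0 + (2 * k - 1))%nat); auto.
    - intros d r. eapply Rle_trans; [|apply (pow_prod_bound 0)]. change (RtoC (INR (S d)) ^ 0) with (RtoC 1). rewrite Cmult_1_l. lra.
    - intros d. eapply CS_eq. eapply CS_ext; [|apply CS_S_inv, (PS_CS (npow (2 * k - 1)) (e2pi tau ^ S d))].
      + intros n. cbv beta. unfold npow. rewrite <- Cpow_mult_r. reflexivity.
      + apply PS_npow.
      + rewrite Cmod_pow. assert (Cmod (e2pi tau) ^ d <= 1)%R by (rewrite <- (pow1 d); apply pow_incr; split; [apply Cmod_ge_0|lra]).
        generalize (Cmod_ge_0 (e2pi tau)). simpl. nra.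
      + cbv beta. unfold npow. replace (2 * k - 1)%nat with (S (2 * k - 2)) by lia. rewrite !Cpow_S. simpl (INR 0). ring. }
  apply (proj2 (ZS_CS (lat_row (2 * k) tau) _)).
  unfold lat_row at 3. rewrite Z.eqb_refl.
  replace (2 * lipc (2 * k) * Gk (2 * k) tau - 2 * zeta_sum (2 * k)) with (2 * lipc (2 * k) * psum (sig (2 * k - 1)) (e2pi tau)).
  2:{ unfold Gk, gconst. field. apply lipc_nz. }
  eapply CS_ext; [|apply CS_scal, L].
  intros n. unfold lat_row. destruct (Z.eqb_spec (Z.of_nat (S n)) 0); [lia|].
  destruct (Z.eqb_spec (- Z.of_nat (S n)) 0); [lia|].
  rewrite Z.abs_opp, Z.abs_eq, IZR_of_nat_S by lia. unfold lip. rewrite e2pi_nat. ring.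
Qed.

(** Square sums have this transformation law exactly and, like the sums of full rows, converge to a multiple
    of G. *)
Theorem Gk_inv_neg k tau : UH tau -> (2 <= k)%nat ->
  Gk (2 * k) (inv_neg tau) = tau ^ (2 * k) * Gk (2 * k) tau.
Proof.
  intros H Hk.
  assert (A : forall t, UH t -> Clim (square_sum (lat (2 * k) t)) (2 * lipc (2 * k) * Gk (2 * k) t)).
  { intros t Ht. apply flim_ext with (fun N => zsum (lat_row (2 * k) t) N - (zsum (lat_row (2 * k) t) N - square_sum (lat (2 * k) t) N)).
    apply eventually_filter. intros; ring.
    replace (2 * lipc (2 * k) * Gk (2 * k) t) with (2 * lipc (2 * k) * Gk (2 * k) t - 0) by ring.
    apply flim_minus. apply eventually_filter. apply sum_lat_rows; auto; lia. now apply square_sum_rows. }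
  assert (A1 := A _ (UH_inv_neg tau H)). assert (A2 := A tau H).
  assert (A3 : Clim (square_sum (lat (2 * k) (inv_neg tau))) (tau ^ (2 * k) * (2 * lipc (2 * k) * Gk (2 * k) tau))).
  { apply flim_ext with (fun N => tau ^ (2 * k) * square_sum (lat (2 * k) tau) N).
    apply eventually_filter. intros; rewrite square_sum_inv_neg; auto; lia.
    apply flim_scal; auto. apply eventually_filter. }
  assert (E := Clim_unique _ _ _ A1 A3). assert (Nl := lipc_nz (2 * k)).
  replace (Gk (2 * k) (inv_neg tau)) with (2 * lipc (2 * k) * Gk (2 * k) (inv_neg tau) / (2 * lipc (2 * k))) by (field; auto).
  rewrite E. field. auto.
Qed.

Lemma Gk_T k tau : Gk k (tau + 1) = Gk k tau.
Proof. unfold Gk. now rewrite e2pi_add, e2pi_1, Cmult_1_r. Qed.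

(** * The anomaly in weight 2 *)

(** The half-way point beyond the last index N: with it a tail sum is approximated by an integral to one
    order more. *)
Definition nu (N : nat) : R := (INR N + 1 / 2)%R.

Lemma nu_pos N : (0 < nu N)%R.
Proof. unfold nu. generalize (pos_INR N). lra. Qed.

Lemma nu_ge N : (INR (S N) / 2 <= nu N)%R.
Proof. unfold nu. rewrite S_INR. generalize (pos_INR N). lra. Qed.

(** In weight 2 truncating the rows costs, up to o(1), twice this sum; multiplied by tau it approximates the
    integral of dz/z along an edge of the square. *)
Definition edge_sum (N : nat) (tau : C) : C := zsum (fun m => / (IZR m * tau + nu N)) N.

Lemma inv_bound_pos tau (m x y : R) : UH tau -> (0 < y <= x)%R ->
  m * tau + x <> 0 /\ (Cmod (/ (m * tau + x)) <= ratio tau * / y)%R.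
Proof.
  intros H Hx. destruct (lat_inv_bound tau m x H ltac:(lra)) as [N B]. split; auto.
  eapply Rle_trans; [exact B|]. unfold Rdiv at 1. fold (ratio tau).
  apply Rmult_le_compat_l. generalize (ratio_ge_1 tau H); lra.
  rewrite Rabs_right by lra. apply Rinv_le_contravar; lra.
Qed.

(** The midpoint rule for the integral of (m tau + x)^(-2) over an interval of length 1. *)
Lemma half_diff tau (m : R) n : UH tau ->
  (Cmod (/ (m * tau + INR (S n)) ^ 2 - (/ (m * tau + (INR (S n) - 1 / 2)%R) - / (m * tau + (INR (S n) + 1 / 2)%R)))
   <= ratio tau ^ 4 * (/ INR (S n) ^ 2 * / INR (S n) ^ 2))%R.
Proof.
  intros H. assert (P : (1 <= INR (S n))%R) by (rewrite S_INR; generalize (pos_INR n); lra).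
  set (x := INR (S n)) in *. assert (G := ratio_ge_1 tau H). set (r := ratio tau) in *.
  destruct (inv_bound_pos tau m x x H ltac:(lra)) as [N1 B1].
  destruct (inv_bound_pos tau m (x - 1/2) (x / 2) H ltac:(lra)) as [N2 B2].
  destruct (inv_bound_pos tau m (x + 1/2) x H ltac:(lra)) as [N3 B3]. fold r in B1, B2, B3.
  set (a := / (m * tau + x)) in *. set (b := / (m * tau + (x - 1/2)%R)) in *. set (c := / (m * tau + (x + 1/2)%R)) in *.
  assert (E : / (m * tau + x) ^ 2 - (b - c) = - (/ 4) * (a * a * (b * c))).
  { unfold a, b, c. set (A := m * tau + x) in *. set (D := m * tau + (x - 1/2)%R) in *. set (F := m * tau + (x + 1/2)%R) in *.
    replace (/ A ^ 2 - (/ D - / F)) with ((D * F - (F - D) * (A * A)) * (/ A * / A * (/ D * / F))) by (field; auto).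
    f_equal. unfold A, D, F. rewrite RtoC_minus, RtoC_plus, RtoC_div by lra. field. }
  rewrite E. rewrite !Cmod_mult, Cmod_opp.
  replace (Cmod (/ 4)) with (/ 4)%R by (rewrite <- RtoC_inv by lra; rewrite Cmod_R, Rabs_right; lra).
  assert (Hi : (0 < / x)%R) by (apply Rinv_0_lt_compat; lra).
  replace (/ (x / 2))%R with (2 * / x)%R in B2 by (field; lra).
  rewrite <- !pow_inv. set (y := (/ x)%R) in *.
  assert (Hry : (0 <= r * y)%R) by (apply Rmult_le_pos; lra).
  assert (X1 : (Cmod a * Cmod a <= (r * y) * (r * y))%R) by (apply Rmult_le_compat; auto using Cmod_ge_0).
  assert (X2 : (Cmod b * Cmod c <= (r * (2 * y)) * (r * y))%R) by (apply Rmult_le_compat; auto using Cmod_ge_0).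
  assert (X3 : (Cmod a * Cmod a * (Cmod b * Cmod c) <= (r * y) * (r * y) * ((r * (2 * y)) * (r * y)))%R).
  { apply Rmult_le_compat; auto; apply Rmult_le_pos; apply Cmod_ge_0. }
  assert (0 <= r ^ 4 * (y ^ 2 * y ^ 2))%R.
  { apply Rmult_le_pos; [|apply Rmult_le_pos]; apply pow_le; lra. }
  replace ((r * y) * (r * y) * ((r * (2 * y)) * (r * y)))%R with (2 * (r ^ 4 * (y ^ 2 * y ^ 2)))%R in X3 by ring.
  lra.
Qed.

Lemma edge_tail tau (m : R) N : UH tau ->
  CS (fun j => / (m * tau + (INR (S (N + j)) - 1 / 2)%R) - / (m * tau + (INR (S (N + j)) + 1 / 2)%R))
    (/ (RtoC m * tau + nu N)).
Proof.
  intros H. assert (G := ratio_ge_1 tau H).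
  set (u := fun j => / (m * tau + (nu N + INR j)%R)).
  assert (U0 : u O = / (RtoC m * tau + nu N)) by (unfold u; simpl; now rewrite Rplus_0_r).
  rewrite <- U0.
  apply flim_ext with (fun n => u O - u n). apply eventually_filter.
  { intros n. replace (u O - u n) with (- (u n - u O)) by ring. rewrite <- csum_telescope.
    rewrite <- (Cmult_1_l (csum _ n)). replace (- (1 * csum (fun i => u (S i) - u i) n)) with (- (1) * csum (fun i => u (S i) - u i) n) by ring.
    rewrite <- csum_scal. apply csum_ext. intros j _. unfold u, nu.
    rewrite !S_INR, plus_INR.
    replace (INR N + INR j + 1 - 1 / 2)%R with (INR N + 1 / 2 + INR j)%R by field.
    replace (INR N + INR j + 1 + 1 / 2)%R with (INR N + 1 / 2 + (INR j + 1))%R by field. ring. }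
  replace (u O) with (u O - 0) at 1 by ring.
  apply flim_minus. apply eventually_filter. apply flim_const, eventually_filter.
  apply Clim_of_bound with (2 * ratio tau)%R. intros j. unfold u.
  assert (Pj : (0 < INR (S j))%R) by (apply lt_0_INR; lia).
  destruct (inv_bound_pos tau m (nu N + INR j) (INR (S j) / 2) H) as [_ B].
  { rewrite S_INR in *. unfold nu. generalize (pos_INR N) (pos_INR j). lra. }
  eapply Rle_trans; [exact B|]. right. field. lra.
Qed.

(** The tails of a row telescope up to an error of fourth order. *)
Lemma lat_tail_2 tau m N : UH tau ->
  (Cmod (lat_row 2 tau m - zsum (lat 2 tau m) N - (/ (IZR m * tau + nu N) + / (IZR (- m) * tau + nu N)))
   <= 4 * ratio tau ^ 4 * / INR (S N) ^ 2)%R.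
Proof.
  intros H. assert (S0 := ZS_lat_row 1 tau m H (le_n _)). apply ZS_CS in S0. change (2 * 1)%nat with 2%nat in S0.
  apply (CS_shift _ N) in S0.
  assert (T1 := edge_tail tau (IZR m) N H). assert (T2 := edge_tail tau (IZR (- m)) N H).
  assert (D := CS_minus _ _ _ _ S0 (CS_plus _ _ _ _ T1 T2)).
  unfold zsum.
  replace (lat_row 2 tau m - (lat 2 tau m 0 + csum (fun n => lat 2 tau m (Z.of_nat (S n)) + lat 2 tau m (- Z.of_nat (S n))) N))
   with ((lat_row 2 tau m - lat 2 tau m 0) - csum (fun n => lat 2 tau m (Z.of_nat (S n)) + lat 2 tau m (- Z.of_nat (S n))) N) by ring.
  assert (G := ratio_ge_1 tau H). assert (G4 : (0 <= ratio tau ^ 4)%R) by (apply pow_le; lra).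
  assert (PN : (0 < INR (S N))%R) by (apply lt_0_INR; lia).
  apply CS_bound with (3 := D) (m := fun j => (2 * ratio tau ^ 4 * / INR (S N) ^ 2 * / INR (S j) ^ 2)%R).
  - intros j.
    assert (Pj : (0 < INR (S j))%R) by (apply lt_0_INR; lia).
    assert (B1 := half_diff tau (IZR m) (N + j) H). assert (B2 := half_diff tau (IZR (- m)) (N + j) H).
    match goal with |- (Cmod ?X <= _)%R => replace X with
     ((/ (IZR m * tau + INR (S (N + j))) ^ 2 - (/ (IZR m * tau + (INR (S (N + j)) - 1 / 2)%R) - / (IZR m * tau + (INR (S (N + j)) + 1 / 2)%R)))
     + (/ (IZR (- m) * tau + INR (S (N + j))) ^ 2 - (/ (IZR (- m) * tau + (INR (S (N + j)) - 1 / 2)%R) - / (IZR (- m) * tau + (INR (S (N + j)) + 1 / 2)%R)))) end.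
    2:{ unfold lat. rewrite IZR_of_nat_S, IZR_opp_of_nat_S.
        replace ((IZR m * tau + (- INR (S (N + j)))%R) ^ 2) with ((IZR (- m) * tau + INR (S (N + j))) ^ 2).
        2:{ rewrite opp_IZR, !RtoC_opp. simpl. ring. }
        ring. }
    eapply Rle_trans; [apply Cmod_triangle|].
    assert (U : (/ INR (S (N + j)) ^ 2 * / INR (S (N + j)) ^ 2 <= / INR (S N) ^ 2 * / INR (S j) ^ 2)%R).
    { apply Rmult_le_compat; try (left; apply Rinv_0_lt_compat, pow_lt, lt_0_INR; lia);
      (apply Rinv_le_contravar; [now apply pow_lt|apply pow_incr; split; [lra|apply le_INR; lia]]). }
    assert (V := Rmult_le_compat_l _ _ _ G4 U). lra.
  - replace (4 * ratio tau ^ 4 * / INR (S N) ^ 2)%R with (2 * ratio tau ^ 4 * / INR (S N) ^ 2 * 2)%R by ring.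
    apply majorant_scal; [|exact majorant_inv_sq].
    apply Rmult_le_pos; [lra|]. left. apply Rinv_0_lt_compat, pow_lt; auto.
Qed.

Lemma square_sum_rows_2 tau : UH tau ->
  Clim (fun N => zsum (lat_row 2 tau) N - square_sum (lat 2 tau) N - 2 * edge_sum N tau) 0.
Proof.
  intros H. apply Clim_of_bound with (8 * ratio tau ^ 4)%R. intros N.
  replace (2 * edge_sum N tau) with (zsum (fun m => / (IZR m * tau + nu N) + / (IZR (- m) * tau + nu N)) N).
  2:{ rewrite zsum_plus, (zsum_reflect (fun m => / (IZR m * tau + nu N))). unfold edge_sum. ring. }
  unfold square_sum. rewrite <- !zsum_minus.
  eapply Rle_trans. apply Cmod_zsum. intros m _. apply lat_tail_2; auto.
  assert (PN : (0 < INR (S N))%R) by (apply lt_0_INR; lia).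
  assert (G := ratio_ge_1 tau H). assert (G4 : (0 <= ratio tau ^ 4)%R) by (apply pow_le; lra).
  assert (L : (2 * INR N + 1 <= 2 * INR (S N))%R) by (rewrite S_INR; lra).
  apply Rle_trans with (2 * INR (S N) * (4 * ratio tau ^ 4 * / INR (S N) ^ 2))%R.
  - apply Rmult_le_compat_r; auto. apply Rmult_le_pos. lra. left. apply Rinv_0_lt_compat, pow_lt; auto.
  - right. field. lra.
Qed.

(** Midpoint sums for the integrals of dz/z along the edges from nu (tau - 1) to nu (tau + 1) and from nu (1
    - tau) to nu (1 + tau); their difference measures by how much G_2 fails to be modular. *)
Definition edge_diff (N : nat) (tau : C) : C :=
  zsum (fun m => / (nu N * tau + IZR m)) N - zsum (fun m => tau / (IZR m * tau + nu N)) N.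

Definition E2sum (tau : C) : C := 2 * lipc 2 * Gk 2 tau.

(** The limit of [edge_diff]. It is shown to be constant, by computing its exponential, and evaluated at tau
    = i. *)
Definition anomaly (tau : C) : C := / (2 * tau) * (E2sum (inv_neg tau) - tau ^ 2 * E2sum tau).

Lemma edge_sum_inv_neg N tau : UH tau ->
  edge_sum N (inv_neg tau) - tau ^ 2 * edge_sum N tau = tau * edge_diff N tau.
Proof.
  intros H. assert (Nt := UH_nz tau H). unfold edge_sum, edge_diff.
  rewrite <- (zsum_reflect (fun m => / (nu N * tau + IZR m))).
  replace (tau * (zsum (fun n => / (nu N * tau + IZR (- n))) N - zsum (fun m => tau / (IZR m * tau + nu N)) N))
   with (tau * zsum (fun n => / (nu N * tau + IZR (- n))) N - tau * zsum (fun m => tau / (IZR m * tau + nu N)) N) by ring.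
  rewrite <- !zsum_scal. f_equal.
  - apply zsum_ext. intros m _. unfold inv_neg. rewrite opp_IZR, RtoC_opp.
    assert (X : nu N * tau + - IZR m <> 0).
    { rewrite <- RtoC_opp. apply UH_plus_nz. apply UH_mult_real; auto. apply nu_pos. }
    replace (IZR m * - / tau + nu N) with ((nu N * tau + - IZR m) / tau) by (field; auto). field. auto.
  - apply zsum_ext. intros m _. unfold Cdiv. simpl. ring.
Qed.

Lemma edge_diff_lim tau : UH tau -> Clim (fun N => edge_diff N tau) (anomaly tau).
Proof.
  intros H. assert (Nt := UH_nz tau H). assert (FF : Filter (T := nat) eventually) by apply eventually_filter.
  assert (A : forall t, UH t -> Clim (fun N => square_sum (lat 2 t) N + 2 * edge_sum N t) (E2sum t)).
  { intros t Ht. apply flim_ext with (fun N => zsum (lat_row 2 t) N - (zsum (lat_row 2 t) N - square_sum (lat 2 t) N - 2 * edge_sum N t)); [auto|intros N; ring|].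
    replace (E2sum t) with (E2sum t - 0) by ring. apply flim_minus; auto.
    apply (sum_lat_rows 1); auto. now apply square_sum_rows_2. }
  assert (A1 := A _ (UH_inv_neg tau H)). assert (A2 := A tau H).
  unfold anomaly.
  apply flim_ext with (fun N => / (2 * tau) * ((square_sum (lat 2 (inv_neg tau)) N + 2 * edge_sum N (inv_neg tau)) - tau ^ 2 * (square_sum (lat 2 tau) N + 2 * edge_sum N tau))); auto.
  - intros N. rewrite square_sum_inv_neg by auto.
    replace (tau ^ 2 * square_sum (lat 2 tau) N + 2 * edge_sum N (inv_neg tau) - tau ^ 2 * (square_sum (lat 2 tau) N + 2 * edge_sum N tau))
    with (2 * (edge_sum N (inv_neg tau) - tau ^ 2 * edge_sum N tau)) by ring.
    rewrite edge_sum_inv_neg by auto. field. auto.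
  - apply flim_scal; auto. apply flim_minus; auto. apply flim_scal; auto.
Qed.

(** One step of the midpoint rule for log: exp of the step is the ratio of the end points up to an error of
    second order. *)
Lemma midpoint_step w : (Cmod w <= 1)%R ->
  1 + w / 2 <> 0 /\ (Cmod (Cexp w * ((1 - w / 2) / (1 + w / 2)) - 1) <= 12 * Cmod w ^ 2)%R.
Proof.
  intros Hw.
  assert (H2 : Cmod (w / 2) = (Cmod w / 2)%R).
  { rewrite Cmod_div by (intros X; apply RtoC_inj in X; lra). rewrite Cmod_R, Rabs_right; lra. }
  assert (L : (1 / 2 <= Cmod (1 + w / 2))%R).
  { generalize (Cmod_triangle_rev 1 (- (w / 2))). replace (1 - - (w / 2)) with (1 + w / 2) by ring.
    rewrite Cmod_opp, Cmod_1, H2. lra. }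
  assert (N : 1 + w / 2 <> 0) by (apply Cmod_gt_0; lra).
  split; auto.
  assert (R1 := Cexp_remainder w 2).
  replace (csum (fun n => expc n * w ^ n) 2) with (1 + w) in R1.
  2:{ cbn [csum]. unfold expc. change (INR (fact 0)) with 1%R. change (INR (fact 1)) with 1%R. simpl. field. }
  assert (X : (exp (Cmod w) <= 3)%R).
  { destruct (Req_dec (Cmod w) 1) as [->|]; [apply exp_le_3|].
    eapply Rle_trans; [|apply exp_le_3]. left. apply exp_increasing. lra. }
  replace (Cexp w * ((1 - w / 2) / (1 + w / 2)) - 1) with (((Cexp w - (1 + w)) * (1 - w / 2) - w ^ 2 / 2) / (1 + w / 2)).
  2:{ simpl. field. intros Y. apply N. replace (1 + w / 2) with ((2 + w) / 2) by field. rewrite Y. field. }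
  rewrite Cmod_div by auto. apply Rle_div_l; [lra|].
  eapply Rle_trans; [apply Cmod_minus_le|]. rewrite Cmod_mult.
  assert (Y1 : (Cmod (1 - w / 2) <= 3 / 2)%R).
  { eapply Rle_trans; [apply Cmod_minus_le|]. rewrite Cmod_1, H2. lra. }
  assert (Y2 : Cmod (w ^ 2 / 2) = (Cmod w ^ 2 / 2)%R).
  { rewrite Cmod_div by (intros Z; apply RtoC_inj in Z; lra). rewrite Cmod_pow, Cmod_R, Rabs_right; lra. }
  assert (Y3 : (0 <= Cmod w ^ 2)%R) by (apply pow_le, Cmod_ge_0).
  assert (Y4 : (Cmod (Cexp w - (1 + w)) <= Cmod w ^ 2 * 3)%R) by (eapply Rle_trans; [exact R1|]; apply Rmult_le_compat_l; auto).
  assert (Y5 : (Cmod (Cexp w - (1 + w)) * Cmod (1 - w / 2) <= Cmod w ^ 2 * 3 * (3 / 2))%R) by (apply Rmult_le_compat; auto using Cmod_ge_0).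
  rewrite Y2. nra.
Qed.

(** The steps multiply: the ratios of consecutive points telescope, and the n errors of size c add up to at
    most 2 c n. *)
Lemma midpoint_path p0 delta c n :
  (forall i, (i <= n)%nat -> p0 + INR i * delta <> 0) ->
  (forall i, (i < n)%nat -> p0 + (INR i + 1 / 2) * delta <> 0 /\
     (Cmod (delta / (p0 + (INR i + 1 / 2) * delta)) <= 1)%R /\
     (12 * Cmod (delta / (p0 + (INR i + 1 / 2) * delta)) ^ 2 <= c)%R) ->
  (0 <= c)%R -> (2 * c * INR n <= 1)%R ->
  (Cmod (Cexp (csum (fun i => (delta / (p0 + (INR i + 1 / 2) * delta))%C) n) * (p0 / (p0 + INR n * delta)) - 1) <= 2 * c * INR n)%R.
Proof.
  intros H1 H2 Hc Hn. induction n.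
  - cbn [csum]. rewrite Cexp_0. assert (X := H1 O (le_n _)).
    replace (1 * (p0 / (p0 + INR 0 * delta)) - 1) with (RtoC 0). rewrite Cmod_0. simpl; lra.
    replace (p0 + INR 0 * delta) with p0 in * by (simpl; ring). field. auto.
  - rewrite S_INR in Hn. assert (Pn := pos_INR n).
    assert (IH : (Cmod (Cexp (csum (fun i => (delta / (p0 + (INR i + 1 / 2) * delta))%C) n) * (p0 / (p0 + INR n * delta)) - 1) <= 2 * c * INR n)%R).
    { apply IHn; [| |nra]; intros i Hi; [apply H1|apply H2]; lia. }
    clear IHn. assert (Z1 := H1 n ltac:(lia)). assert (Z2 := H1 (S n) (le_n _)).
    destruct (H2 n ltac:(lia)) as [Z3 [W1 W2]].
    cbn [csum]. rewrite Cexp_add.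
    set (X := Cexp (csum (fun i => delta / (p0 + (INR i + 1 / 2) * delta)) n)) in *.
    set (mid := p0 + (INR n + 1 / 2) * delta) in *. set (w := delta / mid) in *.
    destruct (midpoint_step w W1) as [N B].
    assert (E : X * Cexp w * (p0 / (p0 + INR (S n) * delta)) = X * (p0 / (p0 + INR n * delta)) * (Cexp w * ((1 - w / 2) / (1 + w / 2)))).
    { assert (F1 : mid * (1 - w / 2) = mid - delta / 2) by (unfold w; field; auto).
      assert (F2 : mid * (1 + w / 2) = mid + delta / 2) by (unfold w; field; auto).
      assert (E1 : p0 + INR n * delta = mid * (1 - w / 2)) by (rewrite F1; unfold mid; field).
      assert (E2 : p0 + INR (S n) * delta = mid * (1 + w / 2)) by (rewrite F2, S_INR, RtoC_plus; unfold mid; field).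
      rewrite E1 in Z1. rewrite E1, E2.
      assert (N' : 1 - w / 2 <> 0) by (intros Y; apply Z1; rewrite Y; ring).
      clear - N N' Z3. set (u := 1 - w / 2) in *. set (v := 1 + w / 2) in *. clearbody u v mid.
      field. auto. }
    rewrite E. set (P := X * (p0 / (p0 + INR n * delta))) in *. set (Q := Cexp w * ((1 - w / 2) / (1 + w / 2))) in *.
    replace (P * Q - 1) with ((P - 1) + P * (Q - 1)) by ring.
    eapply Rle_trans; [apply Cmod_triangle|]. rewrite Cmod_mult.
    assert (BP : (Cmod P <= 2)%R).
    { replace P with ((P - 1) + 1) by ring. eapply Rle_trans; [apply Cmod_triangle|]. rewrite Cmod_1. nra. }
    assert (BQ : (Cmod (Q - 1) <= c)%R) by lra.
    assert (Cmod P * Cmod (Q - 1) <= 2 * c)%R by (apply Rmult_le_compat; auto using Cmod_ge_0).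
    rewrite S_INR. lra.
Qed.

Lemma zsum_as_csum f N : zsum f N = csum (fun i => f (Z.of_nat i - Z.of_nat N)%Z) (2 * N + 1).
Proof.
  induction N.
  - unfold zsum. simpl. ring.
  - rewrite zsum_S, IHN. replace (2 * S N + 1)%nat with (S (S (2 * N + 1))) by lia.
    rewrite csum_Sl. cbn [csum].
    rewrite (csum_ext (fun i => f (Z.of_nat (S i) - Z.of_nat (S N))%Z) (fun i => f (Z.of_nat i - Z.of_nat N)%Z)).
    2:{ intros i _. f_equal. lia. }
    replace (Z.of_nat 0 - Z.of_nat (S N))%Z with (- Z.of_nat (S N))%Z by lia.
    replace (Z.of_nat (S (2 * N + 1)) - Z.of_nat (S N))%Z with (Z.of_nat (S N)) by lia. ring.
Qed.

(** On 2N + 1 points at distance of order N from the origin the errors are O(N^-2) each, so the exponential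
    of the midpoint sum tends to the ratio of the end points. *)
Lemma path_lim (S p0 pn delta : nat -> C) (z : C) K :
  (0 <= K)%R -> z <> 0 ->
  (forall N, pn N = p0 N + INR (2 * N + 1) * delta N) ->
  (forall N, p0 N / pn N = / z) ->
  (forall N i, p0 N + INR i * delta N <> 0) ->
  (forall N i, p0 N + (INR i + 1 / 2) * delta N <> 0 /\
    (Cmod (delta N / (p0 N + (INR i + 1 / 2) * delta N)) <= K * / INR (Datatypes.S N))%R) ->
  (forall N, S N = csum (fun i => delta N / (p0 N + (INR i + 1 / 2) * delta N)) (2 * N + 1)) ->
  Clim (fun N => Cexp (S N)) z.
Proof.
  intros HK Hz Hpn Hq H1 H2 HS.
  assert (FF : Filter (T := nat) eventually) by apply eventually_filter.
  assert (L : Clim (fun N => Cexp (S N) * / z - 1) 0).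
  { intros e He.
    (* 48 = 2 * 12 * 2: twice the error 12 (K/x)^2 of a step, over at most 2 x steps *)
    set (K2 := (K * K * 48)%R). assert (HK2 : (0 <= K2)%R) by (unfold K2; nra).
    destruct (nfloor_ex (K2 * (/ e + 1) + K) ltac:(generalize (Rinv_0_lt_compat e He); nra)) as [n [_ Hn]].
    exists n. intros N HN. replace (Cexp (S N) * / z - 1 - 0) with (Cexp (S N) * / z - 1) by ring.
    set (x := INR (Datatypes.S N)).
    assert (Hx : (K2 * (/ e + 1) + K < x)%R).
    { eapply Rlt_le_trans; [exact Hn|]. unfold x. rewrite S_INR. apply Rplus_le_compat_r, le_INR. auto. }
    assert (Px : (0 < x)%R) by (apply lt_0_INR; lia).
    assert (Hie := Rinv_0_lt_compat e He).
    assert (Kx : (K * / x <= 1)%R) by (apply (Rle_div_l K 1 x); nra).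
    assert (Kx0 : (0 <= K * / x)%R) by (apply Rmult_le_pos; auto; left; now apply Rinv_0_lt_compat).
    assert (Hb : (2 * (12 * (K * / x) ^ 2) * INR (2 * N + 1) <= K2 * / x)%R).
    { assert (INR (2 * N + 1) <= 2 * x)%R.
      { unfold x. rewrite S_INR, plus_INR, mult_INR. simpl. lra. }
      apply Rle_trans with (2 * (12 * (K * / x) ^ 2) * (2 * x))%R.
      - apply Rmult_le_compat_l; auto. apply Rmult_le_pos. lra. apply Rmult_le_pos. lra. now apply pow_le.
      - right. unfold K2. simpl. field. lra. }
    assert (Hs : (K2 * / x < Rmin 1 e)%R).
    { apply Rmin_glb_lt; apply (Rlt_div_l K2 _ x); auto.
      - nra.
      - assert (e * / e = 1)%R by (field; lra). nra. }
    assert (M := midpoint_path (p0 N) (delta N) (12 * (K * / x) ^ 2) (2 * N + 1)).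
    rewrite <- HS, <- Hpn in M.
    replace (Cexp (S N) * / z) with (Cexp (S N) * (p0 N / pn N)) by (now rewrite Hq).
    eapply Rle_lt_trans; [apply M|].
    - intros i _. apply H1.
    - intros i _. destruct (H2 N i) as [A1 A2]. fold x in A2. split; auto. split. lra.
      apply Rmult_le_compat_l. lra. apply pow_incr. split; auto. apply Cmod_ge_0.
    - apply Rmult_le_pos. lra. now apply pow_le.
    - generalize (Rmin_l 1 e). lra.
    - generalize (Rmin_r 1 e). lra. }
  apply flim_ext with (fun N => z * ((Cexp (S N) * / z - 1) + 1)); auto.
  { intros N. field. auto. }
  replace z with (z * (0 + 1)) at 1 by ring. apply flim_scal; auto.
  apply flim_plus; auto. now apply flim_const.
Qed.

Lemma INR_2N1 N : RtoC (INR (2 * N + 1)) = 2 * nu N.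
Proof. rewrite <- RtoC_mult. f_equal. unfold nu. rewrite plus_INR, mult_INR. simpl. field. Qed.

(** The ratios of the end points along the two edges are (tau+1)/(tau-1) and (1+tau)/(1-tau). *)
Lemma exp_edge_diff tau : UH tau -> Clim (fun N => Cexp (edge_diff N tau)) (- (1)).
Proof.
  intros H. assert (Nt := UH_nz tau H). assert (Ht := Cmod_nz _ Nt).
  assert (FF : Filter (T := nat) eventually) by apply eventually_filter.
  assert (N1 : tau - 1 <> 0).
  { replace (tau - 1) with (tau + RtoC (-1)). now apply UH_plus_nz. apply C_ext; simpl; ring. }
  assert (N2 : tau + 1 <> 0) by now apply UH_plus_nz.
  assert (Nnu : forall N, RtoC (nu N) <> 0) by (intros N X; apply RtoC_inj in X; generalize (nu_pos N); lra).
  assert (Hmid : forall N i, RtoC (INR i) + 1 / 2 = RtoC (nu N) + RtoC (IZR (Z.of_nat i - Z.of_nat N))).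
  { intros N i. rewrite minus_IZR, <- !INR_IZR_INZ. unfold nu. rewrite RtoC_minus, RtoC_plus, RtoC_div by lra. ring. }
  assert (R1 := ratio_ge_1 tau H).
  set (S1 := fun N => zsum (fun m => / (nu N * tau + IZR m)) N).
  set (S2 := fun N => zsum (fun m => tau / (IZR m * tau + nu N)) N).
  assert (L1 : Clim (fun N => Cexp (S1 N)) ((tau + 1) / (tau - 1))).
  { apply path_lim with (p0 := fun N => nu N * (tau - 1)) (pn := fun N => nu N * (tau + 1)) (delta := fun _ => 1) (K := (2 / Im tau)%R).
    - unfold UH in H. apply Rdiv_le_0_compat; lra.
    - apply Cmult_neq_0; auto. intros X. apply N1. 
      replace (tau - 1) with ((tau - 1) * (tau - 1) * / (tau - 1)) by (field; auto). rewrite X. ring.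
    - intros N. rewrite INR_2N1. ring.
    - intros N. field. auto.
    - intros N i. replace (nu N * (tau - 1) + INR i * 1) with (nu N * tau + RtoC (INR i - nu N)) by (rewrite RtoC_minus; ring).
      apply UH_plus_nz, UH_mult_real; auto. apply nu_pos.
    - intros N i. rewrite (Hmid N i).
      replace (nu N * (tau - 1) + (nu N + IZR (Z.of_nat i - Z.of_nat N)) * 1) with (nu N * tau + IZR (Z.of_nat i - Z.of_nat N)) by ring.
      assert (U : UH (nu N * tau)) by (apply UH_mult_real; auto; apply nu_pos).
      assert (NN := UH_plus_nz _ (IZR (Z.of_nat i - Z.of_nat N)) U). split; auto.
      assert (B : (nu N * Im tau <= Cmod (nu N * tau + IZR (Z.of_nat i - Z.of_nat N)))%R).
      { eapply Rle_trans; [|apply im_le_Cmod]. rewrite im_plus, im_RtoC, im_scal_l, Rplus_0_r. apply Rle_abs. }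
      unfold Cdiv. rewrite Cmult_1_l, Cmod_inv by auto.
      replace (2 / Im tau * / INR (Datatypes.S N))%R with (/ (INR (Datatypes.S N) / 2 * Im tau))%R.
      2:{ field. split. apply not_0_INR; lia. unfold UH in H; lra. }
      apply Rinv_le_contravar.
      + apply Rmult_lt_0_compat; auto. apply Rdiv_lt_0_compat; [|lra]. apply lt_0_INR; lia.
      + eapply Rle_trans; [|exact B]. apply Rmult_le_compat_r. unfold UH in H; lra. apply nu_ge.
    - intros N. unfold S1. rewrite zsum_as_csum. apply csum_ext. intros i _. rewrite (Hmid N i).
      unfold Cdiv. rewrite Cmult_1_l. f_equal. ring. }
  assert (L2 : Clim (fun N => Cexp (S2 N)) ((1 + tau) / (1 - tau))).
  { assert (N3 : 1 - tau <> 0).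
    { intros X. apply N1. replace (tau - 1) with (- (1 - tau)) by ring. rewrite X. ring. }
    assert (N4 : 1 + tau <> 0) by (rewrite Cplus_comm; auto).
    apply path_lim with (p0 := fun N => nu N * (1 - tau)) (pn := fun N => nu N * (1 + tau)) (delta := fun _ => tau) (K := (2 * Cmod tau * ratio tau)%R).
    - apply Rmult_le_pos; [apply Rmult_le_pos|]; lra.
    - apply Cmult_neq_0; auto. intros X. apply N3.
      replace (1 - tau) with ((1 - tau) * (1 - tau) * / (1 - tau)) by (field; auto). rewrite X. ring.
    - intros N. rewrite INR_2N1. ring.
    - intros N. field. auto.
    - intros N i. replace (nu N * (1 - tau) + INR i * tau) with (RtoC (INR i - nu N) * tau + nu N) by (rewrite RtoC_minus; ring).
      apply (inv_bound_pos tau _ (nu N) (nu N) H). generalize (nu_pos N); lra.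
    - intros N i. rewrite (Hmid N i).
      replace (nu N * (1 - tau) + (nu N + IZR (Z.of_nat i - Z.of_nat N)) * tau) with (IZR (Z.of_nat i - Z.of_nat N) * tau + nu N) by ring.
      destruct (inv_bound_pos tau (IZR (Z.of_nat i - Z.of_nat N)) (nu N) (INR (Datatypes.S N) / 2) H) as [NN B].
      { split; [|apply nu_ge]. apply Rdiv_lt_0_compat; [|lra]. apply lt_0_INR; lia. }
      split; auto. unfold Cdiv. rewrite Cmod_mult.
      replace (2 * Cmod tau * ratio tau * / INR (Datatypes.S N))%R with (Cmod tau * (ratio tau * / (INR (Datatypes.S N) / 2)))%R.
      2:{ field. apply not_0_INR; lia. }
      apply Rmult_le_compat_l; auto. lra.
    - intros N. unfold S2. rewrite zsum_as_csum. apply csum_ext. intros i _. rewrite (Hmid N i).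
      f_equal. ring. }
  apply flim_ext with (fun N => Cexp (S1 N) * / Cexp (S2 N)); auto.
  { intros N. unfold edge_diff. fold (S1 N) (S2 N). unfold Cminus. now rewrite Cexp_add, Cexp_opp. }
  assert (N3 : 1 - tau <> 0).
  { intros X. apply N1. replace (tau - 1) with (- (1 - tau)) by ring. rewrite X. ring. }
  assert (N4 : 1 + tau <> 0) by (rewrite Cplus_comm; auto).
  replace (- (1)) with ((tau + 1) / (tau - 1) * / ((1 + tau) / (1 - tau))) by (field; repeat split; auto).
  apply flim_mult; auto. apply flim_inv; auto.
  intros X. apply N4. replace (1 + tau) with ((1 + tau) / (1 - tau) * (1 - tau)) by (field; auto). rewrite X. ring.
Qed.

Lemma Clim_Cexp u l : Clim u l -> Clim (fun n => Cexp (u n)) (Cexp l).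
Proof.
  intros H e He. destruct (proj1 (CD_eps _ _ _) (CD_Cexp l) 1%R Rlt_0_1) as [d [Hd K]].
  assert (Hp : (0 < Cmod (Cexp l) + 2)%R) by (generalize (Cmod_ge_0 (Cexp l)); lra).
  destruct (H (Rmin d (e / (Cmod (Cexp l) + 2))) ltac:(apply Rmin_pos; auto; now apply Rdiv_lt_0_compat)) as [N HN].
  exists N. intros n Hn. specialize (HN n Hn).
  assert (K1 := K (u n) (Rlt_le_trans _ _ _ HN (Rmin_l _ _))).
  assert (K2 := Rlt_le_trans _ _ _ HN (Rmin_r _ _)).
  replace (Cexp (u n) - Cexp l) with ((Cexp (u n) - Cexp l - Cexp l * (u n - l)) + Cexp l * (u n - l)) by ring.
  eapply Rle_lt_trans; [apply Cmod_triangle|]. rewrite Cmod_mult.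
  apply Rlt_div_r in K2; auto. generalize (Cmod_ge_0 (u n - l)). nra.
Qed.

Lemma exp_anomaly tau : UH tau -> Cexp (anomaly tau) = - (1).
Proof.
  intros H. apply (Clim_unique (fun N => Cexp (edge_diff N tau))).
  apply Clim_Cexp. now apply edge_diff_lim. now apply exp_edge_diff.
Qed.

Lemma CD_Gk k tau : UH tau ->
  CD (Gk k) tau (2 * PI * Ci * psum (fun n => INR n * sig (k - 1) n) (e2pi tau)).
Proof.
  intros H. assert (Q := Cmod_e2pi_lt tau H). unfold Gk. eapply CD_eq.
  - apply CD_plus. apply CD_const. apply (CD_comp (psum (sig (k - 1))) e2pi).
    apply PS_CD; auto. apply PS_sig. apply CD_e2pi.
  - replace (psum (fun n => INR n * sig (k - 1) n) (e2pi tau)) with (e2pi tau * psum (pder (sig (k - 1))) (e2pi tau)). ring.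
    symmetry. apply CS_CSeries. apply CS_S'. { change (INR 0) with 0%R. ring. }
    eapply CS_ext; [|apply CS_scal, PS_CS; [apply PS_pder, PS_sig|exact Q]].
    intros n. unfold pder. rewrite Cpow_S. ring.
Qed.

Lemma CD_inv_neg (tau : C) : tau <> 0 -> CD inv_neg tau (/ tau ^ 2).
Proof.
  intros H. unfold inv_neg. eapply CD_eq. exact (CD_opp _ _ _ (CD_inv_id tau H)). simpl. field. auto.
Qed.

Lemma ex_CD_anomaly tau : UH tau -> exists l, CD anomaly tau l.
Proof.
  intros H. assert (Nt := UH_nz tau H). unfold anomaly, E2sum. eexists.
  apply CD_mult.
  - apply (CD_inv (fun w => 2 * w)). apply Cmult_neq_0; auto. intros X; apply RtoC_inj in X; lra.
    apply CD_scal, CD_id.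
  - apply CD_minus.
    + apply CD_scal. apply (CD_comp (Gk 2) inv_neg). apply CD_Gk. now apply UH_inv_neg. now apply CD_inv_neg.
    + apply CD_mult. apply CD_pow, CD_id. apply CD_scal. now apply CD_Gk.
Qed.

(** The exponential of the anomaly is constant, so its derivative, which exists, vanishes. *)
Lemma CD_anomaly tau : UH tau -> CD anomaly tau 0.
Proof.
  intros H. destruct (ex_CD_anomaly tau H) as [l Hl].
  assert (D1 := CD_Cexp_comp _ _ _ Hl). rewrite exp_anomaly in D1 by auto.
  assert (D2 : CD (fun w => Cexp (anomaly w)) tau 0).
  { apply CD_ext_loc with (f := fun _ => - (1)) (d := (Im tau / 2)%R). unfold UH in H; lra.
    intros w Hw. symmetry. apply exp_anomaly. now apply (UH_near tau w). apply CD_const. }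
  assert (E := CD_unique _ _ _ _ D1 D2).
  replace (RtoC 0) with l; auto. replace l with (- (- (1) * l)) by ring. rewrite E. ring.
Qed.

Lemma UH_segment z w (t : R) : (0 <= t <= 1)%R -> UH z -> UH w -> UH (z + t * (w - z)).
Proof.
  unfold UH. intros Ht Hz Hw. unfold Cminus. rewrite im_plus, im_scal_l, im_plus, im_opp. nra.
Qed.

Lemma UH_const (f : C -> C) z w : (forall tau, UH tau -> CD f tau 0) -> UH z -> UH w -> f z = f w.
Proof.
  intros H Hz Hw. symmetry. apply CD_zero_segment. intros t Ht. apply H. now apply UH_segment.
Qed.

Lemma UH_Ci : UH Ci.
Proof. unfold UH. simpl. lra. Qed.

(** At tau = i the two edges are symmetric, so the sums are purely imaginary; the bounds single out one
    logarithm of -1. *)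
Lemma edge_diff_Ci N : exists y, edge_diff N Ci = - Ci * RtoC y /\ (2 <= y <= 4)%R.
Proof.
  assert (P := nu_pos N).
  set (g := fun m : Z => (2 * nu N / (IZR m ^ 2 + nu N ^ 2))%R).
  exists (rsum (fun i => g (Z.of_nat i - Z.of_nat N)%Z) (2 * N + 1)). split.
  - unfold edge_diff. rewrite <- zsum_minus, zsum_as_csum, RtoC_rsum, <- csum_scal.
    apply csum_ext. intros i _. set (m := (Z.of_nat i - Z.of_nat N)%Z).
    assert (Q : (0 < IZR m ^ 2 + nu N ^ 2)%R) by nra.
    assert (N1 : RtoC (nu N) * Ci + IZR m <> 0).
    { intros X. assert (Im (RtoC (nu N) * Ci + IZR m) = 0%R) by now rewrite X. simpl in H. lra. }
    assert (N2 : RtoC (IZR m) * Ci + nu N <> 0).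
    { intros X. assert (Re (RtoC (IZR m) * Ci + nu N) = 0%R) by now rewrite X. simpl in H. lra. }
    unfold g. rewrite RtoC_div by lra. rewrite RtoC_plus, RtoC_mult, !RtoC_pow.
    assert (N3 : RtoC (IZR m) ^ 2 + RtoC (nu N) ^ 2 <> 0).
    { rewrite <- !RtoC_pow, <- RtoC_plus. intros X. apply RtoC_inj in X. lra. }
    assert (I2 : Ci * Ci = - (1)) by (apply C_ext; simpl; ring).
    assert (F1 : / (RtoC (nu N) * Ci + IZR m) = (IZR m - RtoC (nu N) * Ci) / (RtoC (IZR m) ^ 2 + RtoC (nu N) ^ 2)).
    { replace (RtoC (IZR m) ^ 2 + RtoC (nu N) ^ 2) with ((RtoC (nu N) * Ci + IZR m) * (IZR m - RtoC (nu N) * Ci)) in *.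
      field. split; auto. intros X; apply N3; rewrite X; ring.
      transitivity (IZR m ^ 2 - nu N ^ 2 * (Ci * Ci)). simpl; ring. rewrite I2. simpl; ring. }
    assert (F2 : / (RtoC (IZR m) * Ci + nu N) = (nu N - RtoC (IZR m) * Ci) / (RtoC (IZR m) ^ 2 + RtoC (nu N) ^ 2)).
    { replace (RtoC (IZR m) ^ 2 + RtoC (nu N) ^ 2) with ((RtoC (IZR m) * Ci + nu N) * (nu N - RtoC (IZR m) * Ci)) in *.
      field. split; auto. intros X; apply N3; rewrite X; ring.
      transitivity (nu N ^ 2 - IZR m ^ 2 * (Ci * Ci)). simpl; ring. rewrite I2. simpl; ring. }
    unfold Cdiv at 1. rewrite F1, F2.
    replace (Ci * ((nu N - RtoC (IZR m) * Ci) / (RtoC (IZR m) ^ 2 + RtoC (nu N) ^ 2)))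
     with ((nu N * Ci - IZR m * (Ci * Ci)) / (RtoC (IZR m) ^ 2 + RtoC (nu N) ^ 2)) by (field; auto).
    rewrite I2. field. auto.
  - assert (G : forall i, (i < 2 * N + 1)%nat -> (/ nu N <= g (Z.of_nat i - Z.of_nat N)%Z <= 2 * / nu N)%R).
    { intros i Hi. unfold g. set (x := IZR (Z.of_nat i - Z.of_nat N)).
      assert (Hx : (- nu N <= x <= nu N)%R).
      { unfold x, nu. assert (A1 := IZR_le (- Z.of_nat N) (Z.of_nat i - Z.of_nat N) ltac:(lia)).
        assert (A2 := IZR_le (Z.of_nat i - Z.of_nat N) (Z.of_nat N) ltac:(lia)).
        rewrite opp_IZR, <- INR_IZR_INZ in A1. rewrite <- INR_IZR_INZ in A2. lra. }
      assert (Q : (0 < x ^ 2 + nu N ^ 2)%R) by nra.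
      split.
      - apply Rle_div_r; auto. apply Rmult_le_reg_l with (nu N); auto. rewrite <- Rmult_assoc, Rinv_r by lra. nra.
      - apply Rle_div_l; auto. apply Rmult_le_reg_l with (nu N); auto.
        replace (nu N * (2 * / nu N * (x ^ 2 + nu N ^ 2)))%R with (2 * (x ^ 2 + nu N ^ 2))%R by (field; lra). nra. }
    assert (E : (INR (2 * N + 1) = 2 * nu N)%R) by (generalize (INR_2N1 N); rewrite <- RtoC_mult; apply RtoC_inj).
    split.
    + apply Rle_trans with (rsum (fun _ => / nu N)%R (2 * N + 1)). rewrite rsum_const, E. right; field; lra.
      apply rsum_le. intros; now apply G.
    + apply Rle_trans with (rsum (fun _ => 2 * / nu N)%R (2 * N + 1)).
      apply rsum_le. intros; now apply G. rewrite rsum_const, E. right; field; lra.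
Qed.

(** The only y with exp(iy) = -1 in the interval [-4,-2] is -pi. *)
Lemma anomaly_Ci : anomaly Ci = - (RtoC PI * Ci).
Proof.
  assert (L := edge_diff_lim Ci UH_Ci). assert (Ex := exp_anomaly Ci UH_Ci).
  assert (R0 : Re (anomaly Ci) = 0%R /\ (-4 <= Im (anomaly Ci) <= -2)%R).
  { assert (B : forall N, Re (edge_diff N Ci) = 0%R /\ (-4 <= Im (edge_diff N Ci) <= -2)%R).
    { intros N. destruct (edge_diff_Ci N) as [y [-> Hy]]. simpl. split. ring. lra. }
    assert (B2 : forall e, (0 < e)%R -> (Rabs (Re (anomaly Ci)) < e /\ -4 - e < Im (anomaly Ci) < -2 + e)%R).
    { intros e He. destruct (L e He) as [N HN]. specialize (HN N (le_n _)). destruct (B N) as [B1 B3].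
      generalize (re_le_Cmod (edge_diff N Ci - anomaly Ci)) (im_le_Cmod (edge_diff N Ci - anomaly Ci)).
      unfold Cminus in *. rewrite re_plus, im_plus, re_opp, im_opp, B1.
      replace (0 + - Re (anomaly Ci))%R with (- Re (anomaly Ci))%R by ring. rewrite Rabs_Ropp.
      intros X1 X2. split. lra.
      assert (X3 : (Rabs (Im (edge_diff N Ci) + - Im (anomaly Ci)) < e)%R) by lra.
      apply Rabs_def2 in X3. lra. }
    split; [|split].
    - destruct (Req_dec (Re (anomaly Ci)) 0) as [|N]; auto. exfalso.
      generalize (B2 _ (Rabs_pos_lt _ N)). lra.
    - apply Rnot_lt_le. intros Hlt. generalize (B2 (-4 - Im (anomaly Ci))%R ltac:(lra)). lra.
    - apply Rnot_lt_le. intros Hlt. generalize (B2 (Im (anomaly Ci) + 2)%R ltac:(lra)). lra. }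
  destruct R0 as [R0 I0]. set (y := Im (anomaly Ci)) in *.
  unfold Cexp in Ex. rewrite R0, exp_0 in Ex. fold y in Ex.
  assert (Hc : cos y = (-1)%R).
  { assert (X : Re (RtoC 1 * (cos y, sin y)) = Re (- (1))) by now rewrite Ex. simpl in X. lra. }
  assert (Hp : cos (y + PI) = 1%R) by (rewrite neg_cos; lra).
  assert (Hs : sin ((y + PI) / 2) = 0%R).
  { replace (y + PI)%R with (2 * ((y + PI) / 2))%R in Hp by field. rewrite cos_2a_sin in Hp. nra. }
  generalize PI_4 PI2_3_2 PI_RGT_0. intros P1 P2 P3.
  assert (Hy : y = (- PI)%R).
  { destruct (Rtotal_order ((y + PI) / 2) 0) as [Hn|[Hz|Hpos]].
    - exfalso. assert (0 < sin (- ((y + PI) / 2)))%R by (apply sin_gt_0; lra). rewrite sin_neg in H. lra.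
    - lra.
    - exfalso. assert (0 < sin ((y + PI) / 2))%R by (apply sin_gt_0; lra). lra. }
  apply C_ext. rewrite R0. simpl; ring. fold y. rewrite Hy. simpl. ring.
Qed.

(** The anomaly is constant on the upper half plane, with the value found at tau = i. *)
Theorem Gk_2_inv_neg tau : UH tau -> Gk 2 (inv_neg tau) = tau ^ 2 * Gk 2 tau - tau / (4 * PI * Ci).
Proof.
  intros H. assert (Nt := UH_nz tau H).
  assert (E : anomaly tau = - (RtoC PI * Ci)).
  { rewrite <- anomaly_Ci. apply UH_const; auto. apply CD_anomaly. apply UH_Ci. }
  assert (Np : RtoC PI <> 0) by (intros X; apply RtoC_inj in X; generalize PI_RGT_0; lra).
  assert (Ni := Ci_nz).
  assert (L2 : lipc 2 = 4 * PI * PI * (Ci * Ci)).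
  { unfold lipc. simpl. field. }
  unfold anomaly, E2sum in E. rewrite L2 in E.
  replace (Gk 2 (inv_neg tau)) with
    (/ (2 * tau) * (2 * (4 * PI * PI * (Ci * Ci)) * Gk 2 (inv_neg tau) - tau ^ 2 * (2 * (4 * PI * PI * (Ci * Ci)) * Gk 2 tau))
       * (tau / (4 * PI * PI * (Ci * Ci))) + tau ^ 2 * Gk 2 tau) by (field; auto).
  rewrite E. field. auto.
Qed.

(** * Binomial coefficients *)

Fixpoint bin (v : C) (m : nat) : C :=
  match m with O => 1 | S m => bin v m * (v - INR m) / INR (S m) end.

Lemma bin_S v m : bin v (S m) = bin v m * (v - INR m) / INR (S m).
Proof. reflexivity. Qed.

Lemma bin_pascal v m : bin (v + 1) (S m) = bin v (S m) + bin v m.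
Proof.
  induction m.
  - rewrite !bin_S. simpl. field.
  - rewrite (bin_S (v + 1) (S m)), IHm, (bin_S v (S m)), (bin_S v m).
    rewrite !S_INR, !RtoC_plus. field. split.
    + rewrite <- !RtoC_plus, <- !S_INR. apply RtoC_INR_S_nz.
    + rewrite <- !RtoC_plus, <- !S_INR. apply RtoC_INR_S_nz.
Qed.

Lemma bin_zero j m : (j < m)%nat -> bin (INR j) m = 0.
Proof.
  intros H. induction H; rewrite bin_S.
  - replace (RtoC (INR j) - INR j) with (RtoC 0) by ring. field. apply RtoC_INR_S_nz.
  - rewrite IHle. field. apply RtoC_INR_S_nz.
Qed.

Lemma binomial_nat x j : (1 + x) ^ j = csum (fun i => bin (INR j) i * x ^ i) (S j).
Proof.
  induction j. { simpl. ring. }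
  rewrite csum_Sl. rewrite (csum_ext _ (fun i => bin (INR j) (S i) * x ^ S i + x * (bin (INR j) i * x ^ i))).
  2:{ intros i _. rewrite S_INR, RtoC_plus, bin_pascal, Cpow_S. ring. }
  rewrite csum_plus, csum_scal, <- IHj.
  assert (E := csum_Sl (fun i => bin (INR j) i * x ^ i) (S j)).
  assert (E2 : csum (fun i => bin (INR j) i * x ^ i) (S (S j)) = (1 + x) ^ j).
  { cbn [csum]. cbn [csum] in IHj. rewrite <- IHj, bin_zero by lia. ring. }
  rewrite E2 in E. set (X := csum (fun i => bin (INR j) (S i) * x ^ S i) (S j)) in *.
  change (bin (INR j) 0 * x ^ 0) with (RtoC 1 * 1) in E.
  change (bin (INR (S j)) 0 * x ^ 0) with (RtoC 1 * 1). rewrite Cpow_S.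
  replace X with ((1 + x) ^ j - 1 * 1) by (rewrite E; ring). ring.
Qed.

Lemma Cmod_bin_nat m i : (Cmod (bin (INR m) i) <= 2 ^ m)%R.
Proof.
  revert i. induction m; intros i.
  - destruct i. simpl. rewrite Cmod_1. lra. rewrite bin_zero by lia. rewrite Cmod_0. simpl; lra.
  - destruct i. simpl bin. rewrite Cmod_1. assert (1 <= 2 ^ m)%R by (apply pow_R1_Rle; lra). simpl; lra.
    rewrite S_INR, RtoC_plus, bin_pascal. eapply Rle_trans; [apply Cmod_triangle|].
    generalize (IHm (S i)) (IHm i). simpl. lra.
Qed.

Lemma bin_fact m i : bin (INR (i + m)) i = INR (fact (i + m)) / (INR (fact i) * INR (fact m)).
Proof.
  revert m. induction i; intros m.
  - simpl. field. apply RtoC_fact_nz.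
  - rewrite bin_S. replace (S i + m)%nat with (i + S m)%nat by lia. rewrite IHi.
    change (fact (S m)) with (S m * fact m)%nat. change (fact (S i)) with (S i * fact i)%nat.
    rewrite !mult_INR, !RtoC_mult.
    replace (RtoC (INR (i + S m)) - INR i) with (RtoC (INR (S m))) by (rewrite plus_INR, RtoC_plus; ring).
    field. repeat split; first [apply RtoC_INR_S_nz|apply RtoC_fact_nz].
Qed.

(** Falling factorials, as an intermediate step for the product formula of the binomial coefficients. *)
Fixpoint ff (v : C) (m : nat) : C := match m with O => 1 | S m => ff v m * (v - INR m) end.

Lemma bin_ff v m : bin v m = ff v m / INR (fact m).
Proof.
  induction m. { simpl. field. }
  rewrite bin_S, IHm. change (fact (S m)) with (S m * fact m)%nat. rewrite mult_INR, RtoC_mult.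
  cbn [ff]. field. split; first [apply RtoC_INR_S_nz|apply RtoC_fact_nz].
Qed.

Lemma ff_add v i l : ff v (i + l) = ff v i * ff (v - INR i) l.
Proof.
  induction l. { rewrite Nat.add_0_r. simpl. ring. }
  rewrite Nat.add_succ_r. cbn [ff]. rewrite IHl, plus_INR, RtoC_plus. ring.
Qed.

Lemma bin_mul v i l : bin v i * bin (v - INR i) l = bin v (i + l) * bin (INR (i + l)) i.
Proof.
  rewrite bin_fact, !bin_ff, ff_add. field. repeat split; apply RtoC_fact_nz.
Qed.

(** * Regularized power sums *)

(** The constant term of the sum of n^j exp(-nt) over n >= 0 as t tends to 0, where 0^0 = 1. For j >= 1
    these are the values zeta(-j), written through the constant terms of the Eisenstein series. *)
Definition ell (j : nat) : C :=
  match j with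
  | O => 1 / 2
  | S _ => if Nat.odd j then 2 * gconst (j + 1) else 0
  end.

(** The values of t, and below the corresponding points i t/(2 pi) of the upper half plane, along which t
    tends to 0. *)
Definition small (N : nat) : R := (/ INR (S N))%R.

Lemma small_pos N : (0 < small N <= 1)%R.
Proof.
  unfold small. split. apply Rinv_0_lt_compat, lt_0_INR; lia. apply (Rinv_INR_S_le N).
Qed.

Lemma small_lim : Clim (fun N => RtoC (small N)) 0.
Proof.
  apply Clim_of_bound with 1%R. intros N. rewrite Cmod_R, Rabs_right, Rmult_1_l by (generalize (small_pos N); lra).
  unfold small. lra.
Qed.

Definition small_z (N : nat) : C := RtoC (small N / (2 * PI)) * Ci.

Lemma UH_small_z N : UH (small_z N).
Proof.
  unfold UH, small_z. rewrite im_scal_l. simpl. rewrite Rmult_1_r.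
  apply Rdiv_lt_0_compat. apply small_pos. generalize PI_RGT_0; lra.
Qed.

Lemma PI_nz : RtoC PI <> 0.
Proof. intros X; apply RtoC_inj in X; generalize PI_RGT_0; lra. Qed.

Lemma Ci2 : Ci * Ci = - (1).
Proof. apply C_ext; simpl; ring. Qed.

Lemma small_z_t N : - (2 * PI * Ci) * small_z N = RtoC (small N).
Proof.
  unfold small_z. rewrite RtoC_div, RtoC_mult by (generalize PI_RGT_0; lra).
  transitivity (RtoC (small N) * (- (Ci * Ci))). field. apply PI_nz. rewrite Ci2. ring.
Qed.

Lemma e2pi_small N : e2pi (small_z N) = Cexp (- RtoC (small N)).
Proof. unfold e2pi. f_equal. rewrite <- small_z_t. ring. Qed.

Definition power_sum (j N : nat) : C := psum (npow j) (e2pi (small_z N)).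

(** As z tends to 0 the terms with n <> 0 of the Lipschitz sum tend to n^(-k). *)
Lemma row_nonzero_part_lim k : (2 <= k)%nat ->
  Clim (fun N => row_sum k (small_z N) - row k (small_z N) 0) (zeta_sum k + (- (1)) ^ k * zeta_sum k).
Proof.
  intros Hk.
  assert (FF : Filter (T := nat) eventually) by apply eventually_filter.
  assert (Hz : forall N, (Cmod (small_z N) <= 1 / 2)%R).
  { intros N. unfold small_z. rewrite Cmod_mult, Cmod_Ci, Cmod_R, Rmult_1_r.
    generalize (small_pos N) PI2_3_2. intros. rewrite Rabs_right.
    apply Rle_div_l; nra. apply Rle_ge, Rdiv_le_0_compat; lra. }
  apply tannery with (b := fun N n => row k (small_z N) (Z.of_nat (S n)) + row k (small_z N) (- Z.of_nat (S n)))
    (bl := fun n => / RtoC (INR (S n)) ^ k + (- (1)) ^ k * / RtoC (INR (S n)) ^ k)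
    (m := fun n => (2 * 2 ^ k * / INR (S n) ^ 2)%R) (B := (2 * 2 ^ k * 2)%R); auto.
  - apply majorant_scal; [|exact majorant_inv_sq]. apply Rmult_le_pos. lra. apply pow_le; lra.
  - apply filter_forall. intros N n.
    assert (P : (1 <= INR (S n))%R) by (rewrite S_INR; generalize (pos_INR n); lra).
    assert (G : forall s, Rabs (IZR s) = INR (S n) -> (Cmod (row k (small_z N) s) <= 2 ^ k * / INR (S n) ^ 2)%R).
    { intros s Hs. unfold row. assert (NN := UH_plus_nz (small_z N) (IZR s) (UH_small_z N)).
      assert (A : (INR (S n) / 2 <= Cmod (small_z N + IZR s))%R).
      { generalize (Cmod_triangle_rev (IZR s) (- small_z N)).
        replace (IZR s - - small_z N) with (small_z N + IZR s) by ring.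
        rewrite Cmod_opp, Cmod_R, Hs. specialize (Hz N). lra. }
      rewrite <- Cpow_inv, Cmod_pow, Cmod_inv by auto.
      apply Rle_trans with ((2 * / INR (S n)) ^ k)%R.
      - apply pow_incr. split. left; apply Rinv_0_lt_compat; lra.
        replace (2 * / INR (S n))%R with (/ (INR (S n) / 2))%R by (field; lra).
        apply Rinv_le_contravar; lra.
      - rewrite Rpow_mult_distr. apply Rmult_le_compat_l. apply pow_le; lra.
        rewrite <- pow_inv. apply pow_ge_sq; auto. apply Rinv_INR_S_le. }
    eapply Rle_trans; [apply Cmod_triangle|].
    assert (G1 := G (Z.of_nat (S n)) ltac:(rewrite IZR_of_nat_S; apply Rabs_INR_S)).
    assert (G2 := G (- Z.of_nat (S n))%Z ltac:(rewrite IZR_opp_of_nat_S, Rabs_Ropp; apply Rabs_INR_S)). lra.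
  - intros n.
    assert (Hs0 : Clim small_z 0).
    { unfold small_z. apply flim_ext with (fun N => RtoC (small N) * (/ (2 * PI) * Ci)); auto.
      { intros N. rewrite RtoC_div, RtoC_mult by (generalize PI_RGT_0; lra). field. apply PI_nz. }
      replace (RtoC 0) with (0 * (/ (2 * PI) * Ci)) by ring. apply flim_mult; auto. apply small_lim. now apply flim_const. }
    assert (G : forall s, IZR s <> 0%R -> Clim (fun N => row k (small_z N) s) (/ RtoC (IZR s) ^ k)).
    { intros s Hs. unfold row. assert (RtoC (IZR s) <> 0) by (intros X; now apply RtoC_inj in X).
      apply flim_inv; auto. now apply Cpow_nz.
      assert (Q : Clim (fun N => small_z N + IZR s) (IZR s)).
      { replace (RtoC (IZR s)) with (0 + IZR s) at 1 by ring. apply flim_plus; auto. now apply flim_const. }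
      clear - Q FF. induction k; simpl. now apply flim_const. apply flim_mult; auto. }
    apply flim_plus; auto.
    + rewrite <- IZR_of_nat_S. apply G. rewrite IZR_of_nat_S. apply not_0_INR. lia.
    + replace ((- (1)) ^ k * / RtoC (INR (S n)) ^ k) with (/ RtoC (IZR (- Z.of_nat (S n))) ^ k).
      apply G. rewrite IZR_opp_of_nat_S. apply Ropp_neq_0_compat, not_0_INR. lia.
      rewrite IZR_opp_of_nat_S, RtoC_opp.
      replace (- RtoC (INR (S n))) with (- (1) * RtoC (INR (S n))) by ring. rewrite Cpow_mult_l.
      assert (X : (- (1)) ^ k * (- (1)) ^ k = 1).
      { rewrite <- Cpow_mult_l. replace (- (1) * - (1)) with (RtoC 1) by ring. apply Cpow_1_l. }
      assert (Y : (- (1)) ^ k <> 0) by (intros Y; rewrite Y in X; replace (0 * 0) with (RtoC 0) in X by ring; apply RtoC_inj in X; lra).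
      assert (W := Cpow_nz _ k (RtoC_INR_S_nz n)).
      replace (/ ((- (1)) ^ k * RtoC (INR (S n)) ^ k)) with (((- (1)) ^ k * (- (1)) ^ k) * / ((- (1)) ^ k * RtoC (INR (S n)) ^ k)) by (rewrite X; ring).
      field. auto.
  - apply filter_forall. intros N. apply (proj1 (ZS_CS _ _)). apply ZS_row_sum; auto. apply UH_small_z.
  - apply CS_plus. now apply zeta_sum_CS. apply CS_scal. now apply zeta_sum_CS.
Qed.

Lemma pow_m1_even n : (- (1)) ^ (2 * n) = RtoC 1.
Proof. rewrite Cpow_mult_r. replace ((- (1)) ^ 2) with (RtoC 1) by (simpl; ring). apply Cpow_1_l. Qed.

(** For j >= 1 the Lipschitz formula at z = i t/(2 pi) makes the sum of n^j exp(-nt) a constant times the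
    sum of (z+n)^(-j-1): its term n = 0 is the polar part, and the others converge to the value recorded in
    [ell]. *)
Lemma power_sum_asymptotic j :
  Clim (fun N => power_sum j N - INR (fact j) / RtoC (small N) ^ (j + 1)) (ell j).
Proof.
  assert (FF : Filter (T := nat) eventually) by apply eventually_filter.
  destruct j as [|j].
  -
    (* geometric series: 1/(1-e^(-t)) - 1/t -> 1/2 *)
    apply flim_shift0; auto.
    apply Clim_of_bound with 18%R. intros N.
    assert (Ht := small_pos N). set (t := small N) in *.
    assert (Hq : (Cmod (e2pi (small_z N)) < 1)%R) by apply Cmod_e2pi_lt, UH_small_z.
    unfold power_sum. replace (psum (npow 0) (e2pi (small_z N))) with (psum (fun _ => 1) (e2pi (small_z N))) by reflexivity.
    rewrite psum_geom by auto. assert (NN := one_minus_nz _ Hq). rewrite e2pi_small in *. fold t in NN |- *.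
    assert (Nt : RtoC t <> 0) by (intros X; apply RtoC_inj in X; lra).
    assert (R3 := Cexp_remainder (- RtoC t) 3).
    rewrite Cmod_opp, Cmod_R, Rabs_right in R3 by lra.
    set (E := Cexp (- RtoC t)) in *.
    replace (csum (fun n => expc n * (- RtoC t) ^ n) 3) with (1 - t + t * t / 2) in R3.
    2:{ cbn [csum]. unfold expc. change (INR (fact 0)) with 1%R. change (INR (fact 1)) with 1%R.
        replace (INR (fact 2)) with 2%R by (simpl; ring). simpl. field. }
    set (rho := E - (1 - t + t * t / 2)) in *.
    assert (He : (exp t <= 3)%R).
    { destruct (Req_dec t 1) as [->|]; [apply exp_le_3|]. eapply Rle_trans; [|apply exp_le_3]. left; apply exp_increasing; lra. }
    assert (Hrho : (Cmod rho <= 3 * t ^ 3)%R).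
    { eapply Rle_trans; [exact R3|]. rewrite Rmult_comm. apply Rmult_le_compat_r; auto. apply pow_le; lra. }
    (* lower bound for 1 - E *)
    assert (HE : E = RtoC (exp (- t))) by (unfold E; rewrite <- RtoC_opp; apply Cexp_RtoC).
    assert (L : (t / 3 <= Cmod (1 - E))%R).
    { rewrite HE, <- RtoC_minus, Cmod_R.
      assert (X1 : (1 + t <= exp t)%R) by (generalize (exp_ineq1 t); lra).
      rewrite exp_Ropp. assert (X2 : (/ exp t <= / (1 + t))%R) by (apply Rinv_le_contravar; lra).
      assert (X3 : (/ (1 + t) <= 1 - t / 3)%R).
      { apply Rmult_le_reg_l with (1 + t)%R. lra. rewrite Rinv_r by lra. nra. }
      rewrite Rabs_right; lra. }
    assert (N1 : RtoC 1 - E <> 0) by exact NN.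
    replace (/ (1 - E) - INR (fact 0) / RtoC t ^ (0 + 1) - ell 0) with ((2 * rho + t * t * t / 2 + t * rho) / (2 * t * (1 - E))).
    2:{ change (RtoC t ^ (0 + 1)) with (RtoC t * 1). change (INR (fact 0)) with 1%R. simpl ell.
        replace (2 * rho + t * t * t / 2 + t * rho) with (2 * t - 2 * (1 - E) - t * (1 - E)) by (unfold rho; field).
        field. auto. }
    assert (N2 : 2 * t * (1 - E) <> 0).
    { apply Cmult_neq_0; auto. apply Cmult_neq_0; auto. intros X; apply RtoC_inj in X; lra. }
    rewrite Cmod_div by auto. rewrite !Cmod_mult, !Cmod_R, (Rabs_right t), (Rabs_right 2) by lra.
    apply Rle_div_l. { apply Rmult_lt_0_compat; lra. }
    assert (T3 : (0 <= t ^ 3)%R) by (apply pow_le; lra).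
    apply Rle_trans with (10 * t ^ 3)%R.
    { eapply Rle_trans; [apply Cmod_triangle|].
      assert (Y := Cmod_triangle (2 * rho) (t * t * t / 2)).
      rewrite !Cmod_mult, !Cmod_R, (Rabs_right 2), (Rabs_right t) in * by lra.
      assert (Z : Cmod (t * t * t / 2) = (t ^ 3 / 2)%R).
      { replace (t * t * t / 2) with (RtoC (t ^ 3 / 2)). rewrite Cmod_R, Rabs_right; lra.
        rewrite RtoC_div, RtoC_pow by lra. simpl. field. }
      rewrite Z in Y. assert (t * Cmod rho <= 1 * (3 * t ^ 3))%R by (apply Rmult_le_compat; auto using Cmod_ge_0; lra). lra. }
    fold (small N). fold t. simpl. nra.
  - set (k := S (S j)). assert (Hk : (2 <= k)%nat) by (unfold k; lia).
    assert (G := row_nonzero_part_lim k Hk). apply (flim_scal _ (/ lipc k)) in G; auto.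
    assert (NL := lipc_nz k).
    replace (ell (S j)) with (/ lipc k * (zeta_sum k + (- (1)) ^ k * zeta_sum k)).
    + eapply flim_ext; [auto| |exact G]. intros N. cbv beta.
      assert (HU := UH_small_z N). assert (Nz := UH_nz _ HU).
      rewrite lipschitz by auto. unfold lip, power_sum, row.
      replace (k - 1)%nat with (S j) by (unfold k; lia). replace (S j + 1)%nat with k by (unfold k; lia).
      rewrite <- small_z_t, Cpow_mult_l, Cplus_0_r.
      unfold lipc in *. replace (k - 1)%nat with (S j) in * by (unfold k; lia).
      assert (N2 : (- (2 * PI * Ci)) ^ k <> 0) by (intros X; apply NL; rewrite X; unfold Cdiv; ring).
      assert (N3 := Cpow_nz _ k Nz). assert (N4 := RtoC_fact_nz (S j)).
      set (c := (- (2 * PI * Ci)) ^ k) in *. set (y := small_z N ^ k) in *. set (w := RtoC (INR (fact (S j)))) in *.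
      clearbody c y w. field. auto.
    + unfold ell. replace (S j + 1)%nat with k by (unfold k; lia). unfold gconst.
      destruct (Nat.odd (S j)) eqn:O.
      * apply Nat.odd_spec in O. destruct O as [m Hm].
        replace k with (2 * (m + 1))%nat at 3 by (unfold k; lia). rewrite pow_m1_even. field. auto.
      * assert (O2 : Nat.Even (S j)) by (apply Nat.even_spec; rewrite <- Nat.negb_odd, O; auto).
        destruct O2 as [m Hm]. replace k with (S (2 * m)) at 3 by (unfold k; lia).
        rewrite Cpow_S, pow_m1_even. field. auto.
Qed.

Lemma PS_ext (a b : nat -> C) : (forall n, a n = b n) -> PS a -> PS b.
Proof. intros H Ha. assert (E : a = b) by now apply FunctionalExtensionality.functional_extensionality. now subst. Qed.

(** Multiplication by exp(t) shifts the index n by one, and (n+1)^j is expanded by the binomial theorem. *)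
Lemma power_sum_shift j N : (1 <= j)%nat ->
  (Cexp (small N) - 1) * power_sum j N = csum (fun i => bin (INR j) i * power_sum i N) j.
Proof.
  intros Hj. assert (Hq : (Cmod (e2pi (small_z N)) < 1)%R) by apply Cmod_e2pi_lt, UH_small_z.
  unfold power_sum. set (x := e2pi (small_z N)) in *.
  assert (A : CS (fun n => npow j (S n) * x ^ n) (Cexp (small N) * psum (npow j) x)).
  { assert (S1 := PS_CS _ x (PS_npow j) Hq). apply CS_S_inv in S1.
    eapply CS_eq. eapply CS_ext; [|exact (CS_scal (Cexp (small N)) _ _ S1)].
    - intros n. assert (X : Cexp (small N) * x = 1).
      { unfold x. rewrite e2pi_small, <- Cexp_add. replace (RtoC (small N) + - small N) with (RtoC 0) by ring. apply Cexp_0. }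
      cbv beta. rewrite (Cpow_S x n). transitivity ((Cexp (small N) * x) * (npow j (S n) * x ^ n)). ring. rewrite X. ring.
    - assert (Z : npow j 0 = 0) by (unfold npow; destruct j; [lia|]; change (INR 0) with 0%R; rewrite Cpow_S; ring).
      cbv beta. rewrite Z. ring. }
  assert (B : CS (fun n => npow j (S n) * x ^ n) (csum (fun i => bin (INR j) i * psum (npow i) x) (S j))).
  { apply CS_ext with (fun n => csum (fun i => bin (INR j) i * (npow i n * x ^ n)) (S j)).
    - intros n. change (npow j (S n)) with (RtoC (INR (S n)) ^ j). rewrite S_INR, RtoC_plus, (Cplus_comm (INR n) 1), binomial_nat.
      rewrite Cmult_comm, <- csum_scal. apply csum_ext. intros i _. unfold npow. ring.
    - generalize (S j). intros m. induction m; cbn [csum]. apply CS_zero. apply CS_plus; auto.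
      apply CS_scal, PS_CS; auto. apply PS_npow. }
  assert (E := CS_unique _ _ _ A B). cbn [csum] in E.
  replace (bin (INR j) j) with (RtoC 1) in E.
  2:{ assert (F := bin_fact 0 j). rewrite Nat.add_0_r in F. rewrite F.
      change (INR (fact 0)) with 1%R. field. apply RtoC_fact_nz. }
  replace ((Cexp (small N) - 1) * psum (npow j) x) with (Cexp (small N) * psum (npow j) x - psum (npow j) x) by ring.
  rewrite E. ring.
Qed.

Lemma exp_tail_lim j :
  Clim (fun N => INR (fact j) / RtoC (small N) ^ (j + 1) * (Cexp (small N) - csum (fun m => expc m * RtoC (small N) ^ m) (S j)))
    (/ (INR j + 1)).
Proof.
  assert (FF : Filter (T := nat) eventually) by apply eventually_filter.
  apply flim_shift0; auto.
  apply Clim_of_bound with (3 * INR (fact j))%R. intros N.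
  assert (Ht := small_pos N). set (t := small N) in *.
  assert (Nt : RtoC t <> 0) by (intros X; apply RtoC_inj in X; lra).
  assert (R3 := Cexp_remainder (RtoC t) (S (S j))).
  rewrite Cmod_R, Rabs_right in R3 by lra.
  assert (He : (exp t <= 3)%R).
  { destruct (Req_dec t 1) as [->|]; [apply exp_le_3|]. eapply Rle_trans; [|apply exp_le_3]. left; apply exp_increasing; lra. }
  assert (Np := Cpow_nz _ (j + 1) Nt).
  assert (Nj : RtoC (INR j) + 1 <> 0) by (rewrite <- RtoC_plus, <- S_INR; apply RtoC_INR_S_nz).
  match goal with |- (Cmod ?X <= _)%R => replace X with
    (INR (fact j) / RtoC t ^ (j + 1) * (Cexp t - csum (fun m => expc m * RtoC t ^ m) (S (S j)))) end.
  2:{ change (csum (fun m => expc m * RtoC t ^ m) (S (S j))) with (csum (fun m => expc m * RtoC t ^ m) (S j) + expc (S j) * RtoC t ^ S j).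
      unfold expc at 2. change (fact (S j)) with (S j * fact j)%nat. rewrite mult_INR, RtoC_mult, S_INR, RtoC_plus.
      replace (S j) with (j + 1)%nat by lia. set (Z := csum _ _). field. split; [|split]; auto. apply RtoC_fact_nz. }
  rewrite Cmod_mult, Cmod_div, Cmod_pow, !Cmod_R, (Rabs_right t) by (auto; lra).
  rewrite Rabs_right by (generalize (fact_pos j); lra). fold (small N). fold t.
  assert (Pt : (0 < t ^ (j + 1))%R) by (apply pow_lt; lra).
  apply Rle_trans with (INR (fact j) / t ^ (j + 1) * (t ^ S (S j) * 3))%R.
  - apply Rmult_le_compat_l. apply Rdiv_le_0_compat; auto. left; apply fact_pos.
    eapply Rle_trans; [exact R3|]. apply Rmult_le_compat_l; auto. apply pow_le; lra.
  - right. replace (S (S j)) with (S (j + 1)) by lia. simpl. field. lra.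
Qed.

(** Compare the constant terms in [power_sum_shift]; on the left-hand side only the polar part of the sum of
    exponent j contributes, through the Taylor remainder of exp. *)
Theorem ell_rec j : (1 <= j)%nat -> csum (fun i => bin (INR j) i * ell i) j = / (INR j + 1).
Proof.
  intros Hj.
  assert (FF : Filter (T := nat) eventually) by apply eventually_filter.
  set (e := fun i N => power_sum i N - INR (fact i) / RtoC (small N) ^ (i + 1)).
  assert (He : forall i, Clim (e i) (ell i)) by (intros; apply power_sum_asymptotic).
  assert (A : Clim (fun N => csum (fun i => bin (INR j) i * e i N) j) (csum (fun i => bin (INR j) i * ell i) j)).
  { generalize j at 2 4. intros m. induction m; cbn [csum]. now apply flim_const. apply flim_plus; auto. apply flim_scal; auto. apply He. }
  assert (B : Clim (fun N => csum (fun i => bin (INR j) i * e i N) j) (/ (INR j + 1) + 0 * ell j)).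
  { apply flim_ext with (fun N => INR (fact j) / RtoC (small N) ^ (j + 1) * (Cexp (small N) - csum (fun m => expc m * RtoC (small N) ^ m) (S j))
       + (Cexp (small N) - 1) * e j N); auto.
    - intros N. assert (Ht := small_pos N).
      assert (Nt : RtoC (small N) <> 0) by (intros X; apply RtoC_inj in X; lra).
      rewrite (csum_ext (fun i => bin (INR j) i * e i N) (fun i => bin (INR j) i * power_sum i N - bin (INR j) i * (INR (fact i) / RtoC (small N) ^ (i + 1)))) by (intros; unfold e; ring).
      rewrite csum_minus, <- power_sum_shift by auto.
      assert (F : csum (fun i => bin (INR j) i * (INR (fact i) / RtoC (small N) ^ (i + 1))) j
        = INR (fact j) / RtoC (small N) ^ (j + 1) * (csum (fun m => expc m * RtoC (small N) ^ m) (S j) - 1)).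
      { rewrite csum_Sl. replace (expc 0 * RtoC (small N) ^ 0) with (RtoC 1) by (unfold expc; change (INR (fact 0)) with 1%R; simpl; field).
        rewrite csum_rev.
        replace (1 + csum (fun i => expc (S i) * RtoC (small N) ^ S i) j - 1) with (csum (fun i => expc (S i) * RtoC (small N) ^ S i) j) by ring.
        rewrite <- csum_scal. apply csum_ext. intros i Hi.
        replace j with (j - 1 - i + S i)%nat at 1 by lia. rewrite bin_fact.
        replace (j - 1 - i + S i)%nat with j by lia. unfold expc.
        replace (RtoC (small N) ^ (j + 1)) with (RtoC (small N) ^ (j - 1 - i + 1) * RtoC (small N) ^ S i).
        2:{ rewrite <- Cpow_add_r. f_equal. lia. }
        assert (P1 := Cpow_nz _ (j - 1 - i + 1) Nt). assert (P2 := Cpow_nz _ (S i) Nt).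
        assert (P3 := RtoC_fact_nz (j - 1 - i)). assert (P4 := RtoC_fact_nz (S i)).
        field. auto. }
      rewrite F. unfold e. field. now apply Cpow_nz.
    - apply flim_plus; auto. apply exp_tail_lim. apply flim_mult; [auto| |exact (He j)].
      apply flim_ext with (fun N => Cexp (small N) - Cexp 0); auto. intros; rewrite Cexp_0; auto.
      apply (flim_shift0 eventually (fun N => Cexp (small N)) (Cexp 0)). auto.
      intros e' He'. destruct (proj1 (CD_eps _ _ _) CD_Cexp_0 1%R Rlt_0_1) as [d [Hd K]].
      destruct (small_lim (Rmin d (e' / 3)) ltac:(apply Rmin_pos; lra)) as [N HN].
      exists N. intros n Hn. specialize (HN n Hn).
      assert (K1 := K (RtoC (small n)) (Rlt_le_trans _ _ _ HN (Rmin_l _ _))).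
      assert (K2 := Rlt_le_trans _ _ _ HN (Rmin_r _ _)).
      replace (Cexp (small n) - Cexp 0) with ((Cexp (small n) - Cexp 0 - 1 * (RtoC (small n) - 0)) + (RtoC (small n) - 0)) by ring.
      eapply Rle_lt_trans; [apply Cmod_triangle|]. lra. }
  rewrite (Clim_unique _ _ _ A B). ring.
Qed.

(** * The binomial series *)

Lemma bin_bound v p m : (Cmod v <= INR p)%R -> (Cmod (bin v m) <= (INR m + 1) ^ p)%R.
Proof.
  intros Hv. assert (Pm := pos_INR). induction m.
  - simpl bin. rewrite Cmod_1. simpl INR. rewrite Rplus_0_l, pow1. lra.
  - rewrite bin_S, Cmod_div, Cmod_mult, Cmod_R, Rabs_INR_S by apply RtoC_INR_S_nz.
    assert (P1 : (0 < INR m + 1)%R) by (generalize (Pm m); lra).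
    rewrite S_INR. apply Rle_div_l; auto.
    assert (H1 : (Cmod (v - INR m) <= INR p + INR m)%R).
    { eapply Rle_trans; [apply Cmod_minus_le|]. rewrite Cmod_R, Rabs_right by (apply Rle_ge, Pm). lra. }
    eapply Rle_trans. apply Rmult_le_compat; [apply Cmod_ge_0|apply Cmod_ge_0|exact IHm|exact H1].
    set (x := (INR m + 1)%R) in *.
    assert (B : (1 + INR p * / x <= (1 + / x) ^ p)%R) by (apply poly; now apply Rinv_0_lt_compat).
    replace (x + 1)%R with (x * (1 + / x))%R by (field; lra). rewrite Rpow_mult_distr.
    assert (Q : (0 <= x ^ p)%R) by (apply pow_le; lra).
    apply Rle_trans with (x ^ p * (x * (1 + INR p * / x)))%R.
    + apply Rmult_le_compat_l; auto. replace (x * (1 + INR p * / x))%R with (x + INR p)%R by (field; lra). unfold x; lra.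
    + replace (x ^ p * (1 + / x) ^ p * x)%R with (x ^ p * (x * (1 + / x) ^ p))%R by ring.
      apply Rmult_le_compat_l; auto. apply Rmult_le_compat_l; lra.
Qed.

Lemma exists_nat_ge (x : R) : exists p, (x <= INR p)%R.
Proof.
  destruct (Rle_lt_dec x 0) as [H|H]. exists O. simpl; lra.
  destruct (nfloor_ex x ltac:(lra)) as [n [_ Hn]]. exists (S n). rewrite S_INR. lra.
Qed.

Lemma succ_pow_bound m p : ((INR m + 1) ^ p <= 2 ^ p * INR m ^ p + 2 ^ p)%R.
Proof.
  assert (T : (0 < 2 ^ p)%R) by (apply pow_lt; lra).
  destruct m. { simpl INR. rewrite Rplus_0_l, pow1. assert (1 <= 2 ^ p)%R by (apply pow_R1_Rle; lra).
    assert (0 <= 0 ^ p)%R by (apply pow_le; lra). nra. }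
  assert (1 <= INR (S m))%R by (rewrite S_INR; generalize (pos_INR m); lra).
  rewrite <- Rpow_mult_distr. apply Rle_trans with ((2 * INR (S m)) ^ p)%R. apply pow_incr; lra. lra.
Qed.

Lemma PS_bin v : PS (bin v).
Proof.
  destruct (exists_nat_ge (Cmod v)) as [p Hp]. apply PS_bounded with (2 ^ p)%R p.
  intros n. eapply Rle_trans; [apply bin_bound; exact Hp|]. apply succ_pow_bound.
Qed.

Definition log1p (y : C) : C := - psum linv (- y).

Lemma Cexp_log1p y : (Cmod y < 1)%R -> Cexp (log1p y) = 1 + y.
Proof. intros H. unfold log1p. rewrite Cexp_log by now rewrite Cmod_opp. ring. Qed.

Lemma one_plus_nz y : (Cmod y < 1)%R -> 1 + y <> 0.
Proof. intros H. replace (1 + y) with (1 - - y) by ring. apply one_minus_nz. now rewrite Cmod_opp. Qed.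

Lemma CD_log1p y : (Cmod y < 1)%R -> CD log1p y (/ (1 + y)).
Proof.
  intros H. assert (N := one_plus_nz y H). unfold log1p. eapply CD_eq. apply CD_opp.
  apply (CD_comp (psum linv) (fun w => - w)). apply CD_linv. now rewrite Cmod_opp. apply CD_opp, CD_id.
  replace (1 - - y) with (1 + y) by ring. field. auto.
Qed.

Lemma log1p_real (y : R) : (Rabs y < 1)%R -> log1p y = RtoC (ln (1 + y)).
Proof.
  intros Hy.
  assert (Hc : (Cmod (- RtoC y) < 1)%R) by (rewrite Cmod_opp, Cmod_R; auto).
  assert (E : psum linv (- RtoC y) = RtoC (Re (psum linv (- RtoC y)))).
  { assert (S1 := PS_CS _ _ PS_linv Hc).
    apply (Clim_real (rsum (fun n => match n with O => 0 | _ => / INR n * (- y) ^ n end)%R)).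
    eapply flim_ext; [apply eventually_filter| |exact S1]. intros n. rewrite RtoC_rsum.
    apply csum_ext. intros [|i] _. simpl; ring. unfold linv.
    rewrite RtoC_mult, RtoC_inv, RtoC_pow, RtoC_opp. auto. apply not_0_INR. lia. }
  assert (X := Cexp_log1p (RtoC y) ltac:(rewrite Cmod_R; auto)). unfold log1p in *. rewrite E in X |- *.
  rewrite <- RtoC_opp in *. rewrite Cexp_RtoC, <- RtoC_plus in X. apply RtoC_inj in X.
  f_equal. rewrite <- X. now rewrite ln_exp.
Qed.

(** Both sides, as functions f of y, satisfy (1 + y) f' = v f and f(0) = 1, so their quotient is constant. *)
Lemma binomial_series v y : (Cmod y < 1)%R -> psum (bin v) y = Cexp (v * log1p y).
Proof.
  intros Hy.
  assert (E : psum (bin v) y * Cexp (- v * log1p y) = psum (bin v) 0 * Cexp (- v * log1p 0)).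
  { apply (CD_zero_segment (fun w => psum (bin v) w * Cexp (- v * log1p w))). intros t Ht.
    assert (Hw := Cmod_segment_0 y t Ht). set (w := 0 + t * (y - 0)) in *.
    assert (Hw1 : (Cmod w < 1)%R) by lra. assert (N := one_plus_nz w Hw1).
    assert (D : (1 + w) * psum (pder (bin v)) w = v * psum (bin v) w).
    { assert (Q : PS (fun n => INR n * bin v n)) by apply PS_n, PS_bin.
      assert (F1 : CS (fun n => INR n * bin v n * w ^ n) (w * psum (pder (bin v)) w)).
      { apply CS_S'. { change (INR 0) with 0%R. ring. }
        eapply CS_ext; [|apply CS_scal, PS_CS; [apply PS_pder, PS_bin|exact Hw1]].
        intros n. unfold pder. rewrite Cpow_S. ring. }
      assert (F2 := PS_CS _ _ (PS_pder _ (PS_bin v)) Hw1).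
      assert (F3 := CS_plus _ _ _ _ F2 F1).
      assert (F4 : CS (fun n => pder (bin v) n * w ^ n + INR n * bin v n * w ^ n) (v * psum (bin v) w)).
      { eapply CS_ext; [|apply CS_scal, PS_CS; [apply PS_bin|exact Hw1]].
        intros n. unfold pder. rewrite bin_S. field. apply RtoC_INR_S_nz. }
      rewrite <- (CS_unique _ _ _ F3 F4). ring. }
    eapply CD_eq.
    - apply CD_mult. apply PS_CD; auto. apply PS_bin. apply CD_Cexp_comp. apply CD_scal. now apply CD_log1p.
    - cbv beta. 
      replace (psum (pder (bin v)) w) with (v * psum (bin v) w / (1 + w)) by (rewrite <- D; field; auto).
      field. auto. }
  rewrite psum_0 in E. change (bin v 0) with (RtoC 1) in E.
  replace (- v * log1p 0) with (RtoC 0) in E.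
  2:{ unfold log1p. replace (- 0) with (RtoC 0) by ring. rewrite psum_0. simpl. ring. }
  rewrite Cexp_0 in E. replace (- v * log1p y) with (- (v * log1p y)) in E by ring.
  rewrite Cexp_opp in E. assert (N := Cexp_nz (v * log1p y)).
  replace (psum (bin v) y) with (psum (bin v) y * / Cexp (v * log1p y) * Cexp (v * log1p y)) by (field; auto).
  rewrite E. ring.
Qed.

Definition rpow (x : R) (v : C) : C := Cexp (v * RtoC (ln x)).

Lemma rpow_add x v w : rpow x (v + w) = rpow x v * rpow x w.
Proof. unfold rpow. rewrite <- Cexp_add. f_equal. ring. Qed.

Lemma rpow_nat x n : (0 < x)%R -> rpow x (INR n) = RtoC (x ^ n).
Proof.
  intros Hx. unfold rpow. rewrite Cexp_nat, Cexp_RtoC, exp_ln by auto. now rewrite RtoC_pow.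
Qed.

Lemma rpow_opp x v : rpow x (- v) = / rpow x v.
Proof. unfold rpow. rewrite <- Cexp_opp. f_equal. ring. Qed.

Lemma rpow_sub_nat x v n : (0 < x)%R -> rpow x (v - INR n) = rpow x v * (/ RtoC x) ^ n.
Proof.
  intros Hx. unfold Cminus. rewrite rpow_add, rpow_opp, rpow_nat, RtoC_pow by auto.
  rewrite Cpow_inv. auto. intros X; apply RtoC_inj in X; lra.
Qed.

Lemma Cmod_rpow x v : (0 < x)%R -> Cmod (rpow x v) = exp (Re v * ln x).
Proof. intros Hx. unfold rpow. rewrite Cmod_Cexp, re_scal_r. auto. Qed.

Lemma rpow_succ x v : (1 < x)%R ->
  CS (fun m => bin v m * (rpow x v * (/ RtoC x) ^ m)) (rpow (x + 1) v).
Proof.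
  intros Hx. assert (Hy : (Rabs (/ x) < 1)%R).
  { rewrite Rabs_right. rewrite <- Rinv_1. apply Rinv_lt_contravar; lra. left. apply Rinv_0_lt_compat; lra. }
  assert (Hc : (Cmod (RtoC (/ x)) < 1)%R) by (rewrite Cmod_R; auto).
  assert (E : rpow (x + 1) v = rpow x v * psum (bin v) (RtoC (/ x))).
  { rewrite binomial_series, log1p_real by auto. unfold rpow. rewrite <- Cexp_add. f_equal.
    replace (x + 1)%R with (x * (1 + / x))%R by (field; lra).
    rewrite ln_mult; [|lra|]. rewrite RtoC_plus. ring.
    assert (0 < / x)%R by (apply Rinv_0_lt_compat; lra). lra. }
  rewrite E. eapply CS_ext; [|apply CS_scal, PS_CS; [apply PS_bin|exact Hc]].
  intros m. rewrite RtoC_inv by lra. ring.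
Qed.

(** * Analytic continuation of the zeta function *)

(** A solution F of F(x) - F(x+1) = x^v up to terms of order x^(v-M-2): the Euler-Maclaurin formula, with
    [ell] in place of the Bernoulli numbers. *)
Definition antidiff (M : nat) (x : R) (v : C) : C :=
  - rpow x (v + 1) / (v + 1) + csum (fun i => bin v i * ell i * rpow x (v - INR i)) (S M).

(** The coefficients of the error F(x+1) - F(x) + x^v of [antidiff], in powers of 1/x and relative to the
    binomial series of x^v. *)
Definition kappa (M m : nat) : C :=
  - / INR (S m) + csum (fun i => if (i <? m)%nat then bin (INR m) i * ell i else 0) (S M)
    + (if (m =? 0)%nat then 1 else 0).

(** This is where the recursion of [ell] is used. *)
Lemma kappa_zero M m : (m <= S M)%nat -> kappa M m = 0.
Proof.
  intros Hm. unfold kappa. destruct m.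
  - rewrite (csum_ext _ (fun _ => 0)), csum_zero. simpl. field. intros i _. reflexivity.
  - replace (S M) with (S m + (M - m))%nat by lia. rewrite csum_add.
    rewrite (csum_ext (fun i => if (S m + i <? S m)%nat then bin (INR (S m)) (S m + i) * ell (S m + i) else 0) (fun _ => 0)), csum_zero.
    2:{ intros i _. destruct (Nat.ltb_spec (S m + i) (S m)); auto. lia. }
    rewrite (csum_ext _ (fun i => bin (INR (S m)) i * ell i)).
    2:{ intros i Hi. destruct (Nat.ltb_spec i (S m)); auto. lia. }
    rewrite ell_rec by lia. rewrite (S_INR (S m)), RtoC_plus. simpl (S m =? 0)%nat. cbv iota. ring.
Qed.

Lemma kappa_bound M : exists K, (0 <= K)%R /\ forall m, (Cmod (kappa M m) <= K * 2 ^ m)%R.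
Proof.
  exists (rsum (fun i => Cmod (ell i)) (S M) + 2)%R. split.
  { assert (0 <= rsum (fun i => Cmod (ell i)) (S M))%R by (apply rsum_nonneg; intros; apply Cmod_ge_0). lra. }
  intros m. assert (T : (1 <= 2 ^ m)%R) by (apply pow_R1_Rle; lra).
  unfold kappa. eapply Rle_trans; [apply Cmod_triangle|].
  assert (A1 : (Cmod (if (m =? 0)%nat then 1 else 0) <= 1)%R).
  { destruct (m =? 0)%nat. rewrite Cmod_1; lra. rewrite Cmod_0; lra. }
  assert (A2 : (Cmod (- / INR (S m)) <= 1)%R).
  { rewrite Cmod_opp, Cmod_inv, Cmod_R, Rabs_INR_S by apply RtoC_INR_S_nz. apply Rinv_INR_S_le. }
  assert (A3 : (Cmod (csum (fun i => (if (i <? m)%nat then bin (INR m) i * ell i else 0)%C) (S M)) <= rsum (fun i => Cmod (ell i)) (S M) * 2 ^ m)%R).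
  { eapply Rle_trans; [apply Cmod_csum|]. rewrite Rmult_comm, <- rsum_scal. apply rsum_le. intros i _.
    destruct (i <? m)%nat.
    - rewrite Cmod_mult. apply Rmult_le_compat_r. apply Cmod_ge_0. apply Cmod_bin_nat.
    - rewrite Cmod_0. apply Rmult_le_pos. lra. apply Cmod_ge_0. }
  assert (A4 := Cmod_triangle (- / INR (S m)) (csum (fun i => if (i <? m)%nat then bin (INR m) i * ell i else 0) (S M))).
  nra.
Qed.

Lemma bin_absorb v m : bin (v + 1) (S m) * INR (S m) = (v + 1) * bin v m.
Proof.
  induction m. { rewrite bin_S. simpl. field. }
  rewrite bin_S. replace (bin (v + 1) (S m) * (v + 1 - INR (S m)) / INR (S (S m)) * INR (S (S m)))
    with (bin (v + 1) (S m) * INR (S m) * (v - INR m) / INR (S m)).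
  - rewrite IHm, bin_S. field. apply RtoC_INR_S_nz.
  - rewrite !(S_INR m), RtoC_plus. field.
    repeat split; first [apply RtoC_INR_S_nz|rewrite <- RtoC_plus, <- S_INR; apply RtoC_INR_S_nz].
Qed.

Lemma CS_csum (f : nat -> nat -> C) (l : nat -> C) k :
  (forall i, (i < k)%nat -> CS (f i) (l i)) -> CS (fun m => csum (fun i => f i m) k) (csum l k).
Proof.
  induction k; intros H; cbn [csum]. apply CS_zero. apply CS_plus; auto.
Qed.

Lemma rpow_1 x : (0 < x)%R -> rpow x 1 = RtoC x.
Proof. intros H. change (RtoC 1) with (RtoC (INR 1)). rewrite rpow_nat by auto. f_equal. ring. Qed.

(** The binomial series of (x+1)^w in powers of 1/x: valid for x > 1, and for all x > 0 when w is a natural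
    number, the series being finite. *)
Definition expands (x : R) (w : C) : Prop :=
  CS (fun m => bin w m * (rpow x w * (/ RtoC x) ^ m)) (rpow (x + 1) w).

Lemma expands_nat x k : (0 < x)%R -> expands x (INR k).
Proof.
  intros Hx. assert (Nx : RtoC x <> 0) by (intros X; apply RtoC_inj in X; lra).
  unfold expands. eapply CS_eq. apply (CS_finite _ (S k)).
  - intros i Hi. rewrite bin_zero by lia. ring.
  - rewrite !rpow_nat by lra.
    rewrite (csum_ext _ (fun i => RtoC (x ^ k) * (bin (INR k) i * (/ RtoC x) ^ i))) by (intros; ring).
    rewrite csum_scal, <- binomial_nat, !RtoC_pow, <- Cpow_mult_l. f_equal.
    rewrite RtoC_plus. field. auto.
Qed.

(** Expand every power of x + 1 in [antidiff] by the binomial series and collect the powers of 1/x. *)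
Lemma antidiff_step M x v : (0 < x)%R -> v + 1 <> 0 -> expands x (v + 1) ->
  (forall i, (i <= M)%nat -> bin v i = 0 \/ expands x (v - INR i)) ->
  CS (fun m => bin v m * kappa M m * (rpow x v * (/ RtoC x) ^ m))
     (antidiff M (x + 1) v - antidiff M x v + rpow x v).
Proof.
  intros Hx Hv He1 He2. assert (Nx : RtoC x <> 0) by (intros X; apply RtoC_inj in X; lra).
  set (y := / RtoC x).
  assert (P1 : CS (fun m => bin v m * - / INR (S m) * (rpow x v * y ^ m)) (- rpow (x + 1) (v + 1) / (v + 1) - - rpow x (v + 1) / (v + 1))).
  { assert (S1 := He1). apply CS_S_inv in S1.
    eapply CS_eq. eapply CS_ext; [|exact (CS_scal (- / (v + 1)) _ _ S1)].
    - intros m. cbv beta. fold y. assert (E := bin_absorb v m). assert (Nm := RtoC_INR_S_nz m).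
      rewrite rpow_add, rpow_1, Cpow_S by lra.
      replace (bin (v + 1) (S m)) with (bin (v + 1) (S m) * INR (S m) / INR (S m)) by (field; auto).
      rewrite E. transitivity (- bin v m / INR (S m) * (rpow x v * y ^ m) * (RtoC x * y)). field; auto.
      unfold y at 2. rewrite Cinv_r by auto. field. auto.
    - cbv beta. simpl bin. simpl (_ ^ 0). field. auto. }
  assert (P2 : forall i, (i < S M)%nat -> CS (fun m => bin v m * (if (i <? m)%nat then bin (INR m) i * ell i else 0) * (rpow x v * y ^ m))
    (bin v i * ell i * rpow (x + 1) (v - INR i) - bin v i * ell i * rpow x (v - INR i))).
  { intros i Hi. destruct (He2 i ltac:(lia)) as [Z0|S1].
    { rewrite Z0. eapply CS_eq. eapply CS_ext; [|exact CS_zero]. 2: ring.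
      intros m. cbv beta. destruct (Nat.ltb_spec i m); [|ring].
      replace m with (i + (m - i))%nat by lia.
      transitivity (bin v (i + (m - i)) * bin (INR (i + (m - i))) i * ell i * (rpow x v * y ^ (i + (m - i)))); [|ring].
      rewrite <- bin_mul, Z0. ring. }
    apply CS_S_inv in S1. fold y in S1.
    apply (CS_shift _ (S i)). rewrite (csum_ext _ (fun _ => 0)), csum_zero.
    2:{ intros j Hj.  destruct (Nat.ltb_spec i j); [lia|ring]. }
    eapply CS_eq. eapply CS_ext; [|exact (CS_scal (bin v i * ell i) _ _ S1)].
    - intros l. cbv beta. destruct (Nat.ltb_spec i (S i + l)); [|lia].
      rewrite rpow_sub_nat by lra. fold y.
      replace (S i + l)%nat with (i + S l)%nat by lia.
      transitivity (bin v i * bin (v - INR i) (S l) * ell i * (rpow x v * (y ^ i * y ^ S l))). ring.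
      rewrite bin_mul, <- Cpow_add_r. ring.
    - cbv beta. simpl bin. simpl (_ ^ 0). ring. }
  assert (P3 : CS (fun m => bin v m * (if (m =? 0)%nat then 1 else 0) * (rpow x v * y ^ m)) (rpow x v)).
  { eapply CS_eq. apply (CS_finite _ 1). intros m Hm. destruct m; [lia|]. simpl (S m =? 0)%nat. cbv iota. ring.
    cbn [csum]. simpl. ring. }
  assert (P := CS_plus _ _ _ _ (CS_plus _ _ _ _ P1 (CS_csum _ _ (S M) P2)) P3).
  eapply CS_eq. eapply CS_ext; [|exact P].
  - intros m. cbv beta. unfold kappa.
    replace (csum (fun i => bin v m * (if (i <? m)%nat then bin (INR m) i * ell i else 0) * (rpow x v * y ^ m)) (S M))
      with (bin v m * (rpow x v * y ^ m) * csum (fun i => if (i <? m)%nat then bin (INR m) i * ell i else 0) (S M)).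
    ring. rewrite <- csum_scal. apply csum_ext. intros; ring.
  - unfold antidiff. rewrite csum_minus. ring.
Qed.

(** * Functions with a normed power series on a disc *)

(** Analyticity with an explicit norm: the norm is submultiplicative, so that products and convergent sums
    of such functions are again analytic. *)
Definition disc_series (s0 : C) (r : R) (f : C -> C) (B : R) : Prop :=
  exists c : nat -> C, majorant (fun k => Cmod (c k) * r ^ k)%R B /\
    forall u, (Cmod u <= r)%R -> CS (fun k => c k * u ^ k) (f (s0 + u)).

Lemma disc_series_analytic s0 r f B : (0 < r)%R -> disc_series s0 r f B -> analytic_at f s0.
Proof.
  intros Hr [c [Hc HS]]. exists c, r. split; auto. intros z Hz. apply CS_is_series.
  assert (E : f z = f (s0 + (z - s0))) by (f_equal; ring). rewrite E. apply HS. lra.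
Qed.

Lemma disc_series_ext s0 r f g B : (forall u, (Cmod u <= r)%R -> f (s0 + u) = g (s0 + u)) ->
  disc_series s0 r f B -> disc_series s0 r g B.
Proof. intros H [c [Hc HS]]. exists c. split; auto. intros u Hu. rewrite <- H; auto. Qed.

Lemma disc_series_le s0 r f B B' : (B <= B')%R -> disc_series s0 r f B -> disc_series s0 r f B'.
Proof.
  intros H [c [[H1 H2] HS]]. exists c. split; auto. split; auto. intros n. eapply Rle_trans; eauto.
Qed.

Lemma disc_series_const s0 r a : (0 <= r)%R -> disc_series s0 r (fun _ => a) (Cmod a).
Proof.
  intros Hr. exists (fun k => match k with O => a | _ => 0 end). split.
  - split. intros k. apply Rmult_le_pos. apply Cmod_ge_0. now apply pow_le.
    intros n. apply Rle_trans with (match n with O => 0 | _ => Cmod a end)%R.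
    2: destruct n; [apply Cmod_ge_0|lra].
    induction n. simpl; lra. cbn [rsum]. destruct n. simpl. lra. rewrite Cmod_0. lra.
  - intros u _. eapply CS_eq. apply (CS_finite _ 1). intros [|k] Hk; [lia|ring]. simpl. ring.
Qed.

Lemma disc_series_id s0 r : (0 <= r)%R -> disc_series s0 r (fun s => s) (Cmod s0 + r).
Proof.
  intros Hr. exists (fun k => match k with O => s0 | 1%nat => 1 | _ => 0 end). split.
  - split. intros k. apply Rmult_le_pos. apply Cmod_ge_0. now apply pow_le.
    intros n. apply Rle_trans with (match n with O => 0 | 1%nat => Cmod s0 | _ => Cmod s0 + r end)%R.
    2: generalize (Cmod_ge_0 s0); destruct n as [|[|]]; lra.
    induction n. simpl; lra. cbn [rsum]. destruct n as [|[|n]].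
    simpl; lra. simpl. rewrite Cmod_1. simpl in IHn. lra. rewrite Cmod_0. lra.
  - intros u _. eapply CS_eq. apply (CS_finite _ 2). intros [|[|k]] Hk; try lia. ring. simpl. ring.
Qed.

Lemma disc_series_plus s0 r f g B B' : (0 <= r)%R -> disc_series s0 r f B -> disc_series s0 r g B' ->
  disc_series s0 r (fun s => f s + g s) (B + B').
Proof.
  intros Hr [c [Hc HS]] [c' [Hc' HS']]. exists (fun k => c k + c' k). split.
  - apply majorant_le with (2 := majorant_plus _ _ _ _ Hc Hc'). intros k.
    assert (0 <= r ^ k)%R by now apply pow_le. split.
    apply Rmult_le_pos; auto using Cmod_ge_0. generalize (Cmod_triangle (c k) (c' k)). nra.
  - intros u Hu. eapply CS_ext; [|exact (CS_plus _ _ _ _ (HS u Hu) (HS' u Hu))]. intros; cbv beta; ring.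
Qed.

Lemma disc_series_mult s0 r f g B B' : (0 <= r)%R -> disc_series s0 r f B -> disc_series s0 r g B' ->
  disc_series s0 r (fun s => f s * g s) (B * B').
Proof.
  intros Hr [c [Hc HS]] [c' [Hc' HS']]. exists (cconv c c'). split. now apply majorant_cconv.
  intros u Hu. 
  assert (G : forall d, absr d r -> exists X, majorant (fun n => Cmod (d n * u ^ n)) X) by (intros d Hd; now apply absr_pt with r).
  destruct (G c) as [X HX]. now exists B. destruct (G c') as [Y HY]. now exists B'.
  eapply CS_ext; [|exact (CS_cconv _ _ _ _ _ _ HX HY (HS u Hu) (HS' u Hu))].
  intros n. unfold cconv. rewrite Cmult_comm, <- csum_scal. apply csum_ext. intros i Hi.
  replace (u ^ n) with (u ^ i * u ^ (n - i)). ring. rewrite <- Cpow_add_r. f_equal. lia.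
Qed.

Lemma disc_series_scal s0 r a f B : (0 <= r)%R -> disc_series s0 r f B -> disc_series s0 r (fun s => a * f s) (Cmod a * B).
Proof. intros Hr H. apply disc_series_mult; auto. now apply disc_series_const. Qed.

Lemma disc_series_rpow s0 r x : (0 <= r)%R -> (1 <= x)%R ->
  disc_series s0 r (rpow x) (exp ((Cmod s0 + r) * ln x)).
Proof.
  intros Hr Hx. assert (Hl : (0 <= ln x)%R). { rewrite <- ln_1. apply ln_le; lra. }
  exists (fun k => rpow x s0 * (expc k * RtoC (ln x) ^ k)). split.
  - apply majorant_le with (fun k => Cmod (rpow x s0) * (/ INR (fact k) * (ln x * r) ^ k))%R.
    + intros k. split. apply Rmult_le_pos. apply Cmod_ge_0. now apply pow_le. right.
      rewrite !Cmod_mult, Cmod_expc, Cmod_pow, Cmod_R, Rabs_right, Rpow_mult_distr by lra. ring.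
    + destruct (majorant_scal (Cmod (rpow x s0)) _ _ (Cmod_ge_0 _) (exp_majorant (ln x * r) ltac:(nra))) as [M1 M2].
      split; auto. intros n. eapply Rle_trans; [apply M2|].
      rewrite Cmod_rpow, <- exp_plus by lra.
      assert (Re s0 * ln x + ln x * r <= (Cmod s0 + r) * ln x)%R.
      { generalize (re_le_Cmod s0) (Rle_abs (Re s0)). nra. }
      destruct (Rle_lt_or_eq_dec _ _ H) as [L|E]. left. now apply exp_increasing. rewrite E. lra.
  - intros u Hu. eapply CS_eq. eapply CS_ext; [|exact (CS_scal (rpow x s0) _ _ (CS_exp (u * ln x)))].
    + intros k. cbv beta. rewrite Cpow_mult_l. ring.
    + rewrite rpow_add. reflexivity.
Qed.

Lemma disc_series_inv s0 r : (0 <= r < Cmod s0)%R -> exists B, disc_series s0 r (fun s => / s) B.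
Proof.
  intros [Hr Hs]. assert (N : s0 <> 0) by (apply Cmod_gt_0; lra).
  set (q := (r / Cmod s0)%R). assert (Hq : (0 <= q < 1)%R).
  { unfold q. split. apply Rdiv_le_0_compat; lra. apply Rlt_div_l; lra. }
  exists (/ Cmod s0 * / (1 - q))%R. exists (fun k => / s0 * (- / s0) ^ k). split.
  - apply majorant_le with (2 := majorant_scal (/ Cmod s0) _ _ (Rlt_le _ _ (Rinv_0_lt_compat _ (Cmod_nz s0 N))) (geom_majorant q Hq)).
    intros k. split. apply Rmult_le_pos. apply Cmod_ge_0. now apply pow_le. right.
    rewrite Cmod_mult, Cmod_pow, Cmod_opp, Cmod_inv by auto. unfold q, Rdiv. rewrite Rpow_mult_distr. ring.
  - intros u Hu. assert (Hc : (Cmod (- / s0 * u) < 1)%R).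
    { rewrite Cmod_mult, Cmod_opp, Cmod_inv by auto. rewrite Rmult_comm. apply (Rlt_div_l _ 1 (Cmod s0)); lra. }
    assert (N2 := one_minus_nz _ Hc).
    assert (N3 : s0 + u <> 0).
    { intros E. apply N2. replace (1 - - / s0 * u) with ((s0 + u) / s0) by (field; auto). rewrite E. field; auto. }
    eapply CS_eq. eapply CS_ext; [|exact (CS_scal (/ s0) _ _ (CS_geom _ Hc))].
    + intros k. cbv beta. rewrite Cpow_mult_l. ring.
    + field_simplify_eq. ring. repeat split; auto.
Qed.

(** The coefficients are summed one by one; the bounds on the norms make the double series absolutely
    convergent. *)
Lemma disc_series_sum s0 r (f : nat -> C -> C) F (m : nat -> R) B : (0 <= r)%R ->
  (forall n, disc_series s0 r (f n) (m n)) -> majorant m B ->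
  (forall u, (Cmod u <= r)%R -> CS (fun n => f n (s0 + u)) (F (s0 + u))) -> disc_series s0 r F B.
Proof.
  intros Hr Hf Hm HF.
  assert (HC : exists c : nat -> nat -> C, forall n, majorant (fun k => Cmod (c n k) * r ^ k)%R (m n) /\
    forall u, (Cmod u <= r)%R -> CS (fun k => c n k * u ^ k) (f n (s0 + u))).
  { exists (fun n => proj1_sig (constructive_indefinite_description _ (Hf n))).
    intros n. exact (proj2_sig (constructive_indefinite_description _ (Hf n))). }
  destruct HC as [c Hc].
  assert (D : forall u, (Cmod u <= r)%R -> dbl_majorant (fun n k => c n k * u ^ k) B).
  { intros u Hu. apply dbl_majorant_of_rows with m; auto. intros n.
    apply majorant_le with (2 := proj1 (Hc n)). intros k. split. apply Cmod_ge_0.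
    rewrite Cmod_mult, Cmod_pow. apply Rmult_le_compat_l. apply Cmod_ge_0. apply pow_incr. split; auto. apply Cmod_ge_0. }
  set (b := fun k => CSeries (fun n => c n k)).
  assert (Hcol : forall u, (Cmod u <= r)%R -> forall k, CS (fun n => c n k * u ^ k) (b k * u ^ k)).
  { intros u Hu k. destruct (Ceq_dec (u ^ k) 0) as [E|E].
    - rewrite E. apply CS_ext with (fun _ => 0). intros; ring. replace (b k * 0) with (RtoC 0) by ring. apply CS_zero.
    - destruct (CS_of_majorant (fun n => c n k * u ^ k) (fun n => Cmod (c n k * u ^ k)) B) as [l Hl].
      + intros; lra.
      + apply (dbl_row (fun k n => c n k * u ^ k)). exact (dbl_majorant_swap _ _ (D u Hu)).
      + replace (b k * u ^ k) with l; auto. unfold b. rewrite (CS_CSeries _ (l / u ^ k)). field; auto.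
        apply CS_ext with (fun n => / u ^ k * (c n k * u ^ k)). intros; field; auto.
        unfold Cdiv. rewrite Cmult_comm. now apply CS_scal. }
  exists b. split.
  - assert (Hru : (Cmod (RtoC r) <= r)%R) by (rewrite Cmod_R, Rabs_right; lra).
    split. intros; apply Rmult_le_pos; [apply Cmod_ge_0|now apply pow_le].
    intros N. eapply Rle_trans; [|apply (rsum_limit_le (fun k n => c n k * RtoC r ^ k) N (fun k => b k * RtoC r ^ k) B)].
    + apply rsum_le. intros k _. rewrite Cmod_mult, Cmod_pow, Cmod_R, Rabs_right; lra.
    + exact (dbl_majorant_swap _ _ (D _ Hru)).
    + intros k. apply (Hcol _ Hru).
  - intros u Hu. destruct (fubini _ _ _ _ (D u Hu) (fun n => proj2 (Hc n) u Hu) (Hcol u Hu)) as [s [S1 S2]].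
    now rewrite (CS_unique _ _ _ (HF u Hu) S1).
Qed.

(** The norm of v - i is at most rho + i with rho = |v0| + r, so the norm of the binomial coefficient is at
    most its absolute value at -rho. *)
Lemma disc_series_bin v0 r m : (0 <= r)%R ->
  disc_series v0 r (fun v => bin v m) (Cmod (bin (- RtoC (Cmod v0 + r)) m)).
Proof.
  intros Hr. set (rho := (Cmod v0 + r)%R). assert (Hrho : (0 <= rho)%R) by (unfold rho; generalize (Cmod_ge_0 v0); lra).
  induction m.
  - simpl. now apply disc_series_const.
  - apply disc_series_ext with (f := fun v => bin v m * (/ INR (S m) * (v + - RtoC (INR m)))).
    { intros u _. rewrite bin_S. unfold Cdiv, Cminus. ring. }
    apply disc_series_le with (Cmod (bin (- RtoC rho) m) * (Cmod (/ INR (S m)) * (rho + Cmod (- RtoC (INR m)))))%R.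
    + right. rewrite bin_S. unfold Cdiv. rewrite !Cmod_mult. rewrite Rmult_assoc. f_equal. rewrite Rmult_comm. f_equal.
      rewrite Cmod_opp. replace (- RtoC rho - INR m) with (- RtoC (rho + INR m)) by (rewrite RtoC_plus; ring).
      assert (Pm := pos_INR m). rewrite Cmod_opp, !Cmod_R, (Rabs_right (rho + INR m)), (Rabs_right (INR m)) by lra. reflexivity.
    + apply disc_series_mult; auto. apply disc_series_scal; auto.
      apply (disc_series_plus v0 r (fun v => v) (fun _ => - RtoC (INR m))); auto. unfold rho. now apply disc_series_id. now apply disc_series_const.
Qed.

(** The errors of the Euler-Maclaurin formula from x = 4 on: there 2/x <= 1/2, which beats the factor 2^m in
    the bound for [kappa]. *)
Definition em_step (M : nat) (n : nat) (v : C) : C :=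
  antidiff M (INR (n + 4) + 1) v - antidiff M (INR (n + 4)) v + rpow (INR (n + 4)) v.

Lemma INR_4 n : (4 <= INR (n + 4))%R /\ (INR (S n) <= INR (n + 4))%R.
Proof.
  rewrite plus_INR, (S_INR n). assert (P := pos_INR n).
  replace (INR 4) with 4%R by (simpl; ring). split; lra.
Qed.

Lemma em_step_series M n v : v + 1 <> 0 ->
  CS (fun m => bin v m * kappa M m * (rpow (INR (n + 4)) v * (/ RtoC (INR (n + 4))) ^ m)) (em_step M n v).
Proof.
  intros Hv. destruct (INR_4 n). apply antidiff_step; auto. lra. apply rpow_succ; lra.
  intros i _. right. apply rpow_succ; lra.
Qed.

Lemma Cpow_RtoC_inv_mod (x : R) m : (0 < x)%R -> Cmod ((/ RtoC x) ^ m) = ((/ x) ^ m)%R.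
Proof.
  intros Hx. rewrite Cmod_pow, Cmod_inv, Cmod_R, Rabs_right. auto. lra.
  intros X. apply RtoC_inj in X. lra.
Qed.

(** The series for the error starts at m = M + 2, so the error is O(x^(-2)) uniformly on the disc as soon as
    M >= |v| there. *)
Lemma em_step_disc M v0 r : (0 <= r < Cmod (v0 + 1))%R -> (Cmod v0 + r <= INR M)%R ->
  exists K, (0 <= K)%R /\ forall n, disc_series v0 r (em_step M n) (K * / INR (S n) ^ 2).
Proof.
  intros [Hr Hr1] HM. destruct (kappa_bound M) as [K [HK0 HK]].
  set (rho := (Cmod v0 + r)%R).
  destruct (PS_bin (- RtoC rho) (1/2)%R ltac:(lra)) as [B HB].
  assert (HB0 : (0 <= B)%R) by apply (proj2 HB O).
  assert (P4 : (0 < 4 ^ (M + 2))%R) by (apply pow_lt; lra).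
  exists (K * 4 ^ (M + 2) * B)%R. split. { apply Rmult_le_pos; auto. apply Rmult_le_pos; lra. }
  intros n. destruct (INR_4 n) as [X4 XS]. set (x := INR (n + 4)) in *.
  assert (PSn : (0 < INR (S n))%R) by (apply lt_0_INR; lia).
  assert (X2 : (/ x ^ 2 <= / INR (S n) ^ 2)%R).
  { apply Rinv_le_contravar. now apply pow_lt. apply pow_incr. lra. }
  apply disc_series_le with (K * 4 ^ (M + 2) * / x ^ 2 * B)%R.
  { assert (0 <= K * 4 ^ (M + 2) * B)%R by (apply Rmult_le_pos; auto; apply Rmult_le_pos; lra). nra. }
  apply disc_series_sum with (f := fun m v => bin v m * kappa M m * (rpow x v * (/ RtoC x) ^ m))
     (m := fun m => (K * 4 ^ (M + 2) * / x ^ 2 * (Cmod (bin (- RtoC rho) m) * (1 / 2) ^ m))%R); auto.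
  - intros m. destruct (le_lt_dec m (S M)) as [Lm|Lm].
    + apply disc_series_ext with (f := fun _ => 0). { intros u _. rewrite kappa_zero by auto. ring. }
      apply disc_series_le with (Cmod 0). 2: now apply disc_series_const. rewrite Cmod_0.
      apply Rmult_le_pos. apply Rmult_le_pos. apply Rmult_le_pos; lra. left; apply Rinv_0_lt_compat, pow_lt; lra.
      apply Rmult_le_pos. apply Cmod_ge_0. apply pow_le; lra.
    + apply disc_series_ext with (f := fun v => (kappa M m * (/ RtoC x) ^ m) * (bin v m * rpow x v)). { intros u _. ring. }
      apply disc_series_le with (Cmod (kappa M m * (/ RtoC x) ^ m) * (Cmod (bin (- RtoC rho) m) * exp (rho * ln x)))%R.
      2:{ apply disc_series_scal; auto. apply disc_series_mult; auto. now apply disc_series_bin.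
          apply disc_series_rpow; auto. lra. }
      rewrite Cmod_mult, Cpow_RtoC_inv_mod by lra.
      assert (E1 : (exp (rho * ln x) <= x ^ M)%R).
      { rewrite <- Rpower_pow by lra. unfold Rpower.
        assert (L : (rho * ln x <= INR M * ln x)%R).
        { apply Rmult_le_compat_r; auto. rewrite <- ln_1. apply ln_le; lra. }
        destruct (Rle_lt_or_eq_dec _ _ L) as [L1|L1]. left; now apply exp_increasing. rewrite L1; lra. }
      set (b := Cmod (bin (- RtoC rho) m)). assert (Hb : (0 <= b)%R) by apply Cmod_ge_0.
      assert (Hi : (0 < / x)%R) by (apply Rinv_0_lt_compat; lra).
      assert (Hix : (0 <= (/ x) ^ m)%R) by (apply pow_le; lra).
      apply Rle_trans with ((K * 2 ^ m) * (/ x) ^ m * (b * x ^ M))%R.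
      { apply Rmult_le_compat. apply Rmult_le_pos; auto using Cmod_ge_0.
        apply Rmult_le_pos; auto. left; apply exp_pos.
        apply Rmult_le_compat_r; auto. apply Rmult_le_compat_l; auto. }
      (* (2/x)^m x^M <= 4^(M+2) x^-2 2^-m since x >= 4 *)
      assert (E2 : (2 ^ m * (/ x) ^ m * x ^ M <= 4 ^ (M + 2) * / x ^ 2 * (1/2) ^ m)%R).
      { replace m with ((M + 2) + (m - M - 2))%nat at 1 2 3 by lia. set (d := (m - M - 2)%nat).
        assert (F : (2 ^ (M + 2 + d) * (/ x) ^ (M + 2 + d) * x ^ M = 2 ^ (M + 2) * / x ^ 2 * (2 * / x) ^ d)%R).
        { rewrite !pow_add, Rpow_mult_distr.
          replace ((/ x) ^ M)%R with (/ x ^ M)%R by (rewrite pow_inv; auto).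
          replace ((/ x) ^ 2)%R with (/ x ^ 2)%R by (rewrite pow_inv; auto).
          field. split. lra. apply pow_nonzero; lra. }
        rewrite F, (pow_add (1/2) (M + 2) d).
        assert (G : (4 ^ (M + 2) = 2 ^ (M + 2) * 2 ^ (M + 2))%R) by (rewrite <- Rpow_mult_distr; f_equal; lra).
        assert (G2 : ((1/2) ^ (M + 2) * 2 ^ (M + 2) = 1)%R).
        { rewrite <- Rpow_mult_distr. replace (1 / 2 * 2)%R with 1%R by field. apply pow1. }
        rewrite G. replace (2 ^ (M + 2) * 2 ^ (M + 2) * / x ^ 2 * ((1 / 2) ^ (M + 2) * (1 / 2) ^ d))%R
          with (2 ^ (M + 2) * / x ^ 2 * (1 / 2) ^ d * ((1 / 2) ^ (M + 2) * 2 ^ (M + 2)))%R by ring.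
        rewrite G2, Rmult_1_r. apply Rmult_le_compat_l.
        - apply Rmult_le_pos. apply pow_le; lra. left; apply Rinv_0_lt_compat, pow_lt; lra.
        - apply pow_incr. split. nra. apply (Rle_div_l 2 (1/2) x); lra. }
      assert (0 <= K * b)%R by (apply Rmult_le_pos; auto).
      replace (K * 2 ^ m * (/ x) ^ m * (b * x ^ M))%R with (K * b * (2 ^ m * (/ x) ^ m * x ^ M))%R by ring.
      replace (K * 4 ^ (M + 2) * / x ^ 2 * (b * (1 / 2) ^ m))%R with (K * b * (4 ^ (M + 2) * / x ^ 2 * (1 / 2) ^ m))%R by ring.
      apply Rmult_le_compat_l; auto.
  - apply majorant_scal; auto. apply Rmult_le_pos. apply Rmult_le_pos; lra. left; apply Rinv_0_lt_compat, pow_lt; lra.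
  - intros u Hu. apply em_step_series. intros E.
    assert (X : (Cmod (v0 + 1) <= r)%R); [|lra]. replace (v0 + 1) with (- u). now rewrite Cmod_opp.
    replace (- u) with (v0 + 1 - (v0 + u + 1)) by ring. rewrite E. ring.
Qed.

Definition zpart (M : nat) (v : C) (N : nat) : C :=
  csum (fun n => rpow (INR (S n)) v) N + antidiff M (INR (S N)) v.

Lemma zpart_S M v N : zpart M v (S N) = zpart M v N +
  (antidiff M (INR (S N) + 1) v - antidiff M (INR (S N)) v + rpow (INR (S N)) v).
Proof. unfold zpart. cbn [csum]. rewrite (S_INR (S N)). ring. Qed.

(** The first three terms are split off, as [em_step] starts at x = 4. *)
Lemma zpart_shift M v n : zpart M v (3 + n) = zpart M v 3 + csum (fun i => em_step M i v) n.
Proof.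
  induction n. { cbn [csum]. rewrite Nat.add_0_r. ring. }
  rewrite Nat.add_succ_r, zpart_S, IHn. cbn [csum]. unfold em_step.
  replace (S (3 + n)) with (n + 4)%nat by lia. ring.
Qed.

Lemma zpart_converges M v0 r : (0 <= r < Cmod (v0 + 1))%R -> (Cmod v0 + r <= INR M)%R ->
  exists F B, disc_series v0 r F B /\ forall u, (Cmod u <= r)%R -> Clim (zpart M (v0 + u)) (zpart M (v0 + u) 3 + F (v0 + u)).
Proof.
  intros Hr HM. destruct (em_step_disc M v0 r Hr HM) as [K [HK HD]].
  assert (MM := majorant_scal K _ _ HK majorant_inv_sq).
  set (F := fun v => CSeries (fun n => em_step M n v)).
  assert (HF : forall u, (Cmod u <= r)%R -> CS (fun n => em_step M n (v0 + u)) (F (v0 + u))).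
  { intros u Hu. destruct (CS_of_majorant (fun n => em_step M n (v0 + u)) (fun n => K * / INR (S n) ^ 2)%R (K * 2)) as [l Hl]; [|exact MM|].
    - intros n. destruct (HD n) as [c [Hc HS]]. eapply CS_bound; [| |exact (HS u Hu)].
      2: exact Hc. intros k. cbv beta. rewrite Cmod_mult, Cmod_pow. apply Rmult_le_compat_l. apply Cmod_ge_0.
      apply pow_incr. split; auto. apply Cmod_ge_0.
    - unfold F. now rewrite (CS_CSeries _ _ Hl). }
  exists F, (K * 2)%R. split.
  - apply disc_series_sum with (f := em_step M) (m := fun n => (K * / INR (S n) ^ 2)%R); auto. lra.
  - intros u Hu. apply (Clim_shift _ 3).
    apply flim_ext with (fun n => zpart M (v0 + u) 3 + csum (fun i => em_step M i (v0 + u)) n).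
    apply eventually_filter. intros n. now rewrite zpart_shift.
    apply flim_plus. apply eventually_filter. apply flim_const, eventually_filter. exact (HF u Hu).
Qed.

(** Any order of at least |v| gives the same limit; this one makes the definition of [zcont] explicit. *)
Definition em_order (v : C) : nat := Z.to_nat (up (Cmod v)).

Lemma em_order_spec v : (Cmod v <= INR (em_order v) <= Cmod v + 1)%R.
Proof.
  unfold em_order. destruct (archimed (Cmod v)) as [H1 H2].
  assert (0 <= up (Cmod v))%Z. { apply le_IZR. generalize (Cmod_ge_0 v). lra. }
  rewrite INR_IZR_INZ, Z2Nat.id by auto. lra.
Qed.

(** The analytic continuation of the sum of n^v over n >= 1: partial sums corrected by the Euler-Maclaurin
    term. *)
Definition zcont (v : C) : C := CLim_seq (zpart (em_order v) v).

Lemma rpow_lim0 w : (Re w < 0)%R -> Clim (fun N => rpow (INR (S N)) w) 0.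
Proof.
  intros Hw e He.
  destruct (nfloor_ex (exp (- ln e / - Re w)) (Rlt_le _ _ (exp_pos _))) as [n [_ Hn]].
  exists n. intros N HN. assert (P : (0 < INR (S N))%R) by (apply lt_0_INR; lia).
  replace (rpow (INR (S N)) w - 0) with (rpow (INR (S N)) w) by ring. rewrite Cmod_rpow by auto.
  rewrite <- (exp_ln e) by auto. apply exp_increasing.
  assert (L : (- ln e / - Re w < ln (INR (S N)))%R).
  { rewrite <- (ln_exp (- ln e / - Re w)). apply ln_increasing. apply exp_pos.
    eapply Rlt_le_trans; [exact Hn|]. rewrite S_INR. apply Rplus_le_compat_r, le_INR. auto. }
  apply Rlt_div_l in L; lra.
Qed.

(** Raising the order adds a term that tends to 0. *)
Lemma zcont_lim M v : v + 1 <> 0 -> (em_order v <= M)%nat -> Clim (zpart M v) (zcont v).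
Proof.
  intros Hv HM. assert (Hp := Cmod_nz _ Hv). destruct (em_order_spec v) as [O1 O2].
  assert (FF : Filter (T := nat) eventually) by apply eventually_filter.
  induction HM.
  - destruct (zpart_converges (em_order v) v 0) as [F [B [_ HF]]]; try lra.
    specialize (HF 0 ltac:(rewrite Cmod_0; lra)). rewrite Cplus_0_r in HF.
    unfold zcont. now rewrite (Clim_CLim_seq _ _ HF).
  - apply flim_ext with (fun N => zpart m v N + bin v (S m) * ell (S m) * rpow (INR (S N)) (v - INR (S m))); auto.
    + intros N. unfold zpart, antidiff.
      change (csum (fun i => bin v i * ell i * rpow (INR (S N)) (v - INR i)) (S (S m)))
       with (csum (fun i => bin v i * ell i * rpow (INR (S N)) (v - INR i)) (S m) + bin v (S m) * ell (S m) * rpow (INR (S N)) (v - INR (S m))). ring.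
    + replace (zcont v) with (zcont v + bin v (S m) * ell (S m) * 0) by ring.
      apply flim_plus; auto. apply flim_scal; auto. apply rpow_lim0.
      unfold Cminus. rewrite re_plus, re_opp, re_RtoC.
      assert (INR (em_order v) < INR (S m))%R by (apply lt_INR; lia).
      generalize (re_le_Cmod v) (Rle_abs (Re v)). lra.
Qed.

Lemma disc_series_shift s0 a r f B : disc_series (s0 + a) r f B -> disc_series s0 r (fun s => f (s + a)) B.
Proof.
  intros [c [Hc HS]]. exists c. split; auto. intros u Hu. replace (s0 + u + a) with (s0 + a + u) by ring. auto.
Qed.

Lemma disc_series_opp s0 r f B : disc_series (- s0) r f B -> disc_series s0 r (fun s => f (- s)) B.
Proof.
  intros [c [Hc HS]]. exists (fun k => c k * (- (1)) ^ k). split.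
  - apply majorant_le with (2 := Hc). intros k.
    rewrite Cmod_mult, Cmod_pow, Cmod_opp, Cmod_1, pow1, Rmult_1_r. split; [|lra]. apply Hc.
  - intros u Hu. replace (- (s0 + u)) with (- s0 + - u) by ring.
    eapply CS_ext; [|apply HS; now rewrite Cmod_opp]. intros k. cbv beta.
    replace (- u) with (- (1) * u) by ring. rewrite Cpow_mult_l. ring.
Qed.

Lemma disc_series_csum s0 r (f : nat -> C -> C) n : (0 <= r)%R ->
  (forall i, exists B, disc_series s0 r (f i) B) -> exists B, disc_series s0 r (fun s => csum (fun i => f i s) n) B.
Proof.
  intros Hr H. induction n; cbn [csum].
  - exists (Cmod 0). now apply disc_series_const.
  - destruct IHn as [B HB]. destruct (H n) as [B' HB']. exists (B + B')%R. now apply disc_series_plus.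
Qed.

Lemma zpart_disc M v0 r N : (0 <= r < Cmod (v0 + 1))%R -> exists B, disc_series v0 r (fun v => zpart M v N) B.
Proof.
  intros [Hr Hr1]. unfold zpart, antidiff.
  assert (P1 : forall n, (1 <= INR (S n))%R) by (intros; rewrite S_INR; generalize (pos_INR n); lra).
  destruct (disc_series_csum v0 r (fun n v => rpow (INR (S n)) v) N Hr) as [B1 H1].
  { intros i. eexists. apply disc_series_rpow; auto. }
  destruct (disc_series_csum v0 r (fun i v => bin v i * ell i * rpow (INR (S N)) (v - INR i)) (S M) Hr) as [B2 H2].
  { intros i. eexists. apply disc_series_mult; auto. apply disc_series_mult; auto. now apply disc_series_bin. now apply disc_series_const.
    apply (disc_series_shift v0 (- INR i) r (rpow (INR (S N)))). apply disc_series_rpow; auto. }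
  destruct (disc_series_inv (v0 + 1) r ltac:(lra)) as [B3 H3]. apply disc_series_shift in H3.
  eexists. apply disc_series_plus; auto. exact H1. apply disc_series_plus; auto. 2: exact H2.
  apply disc_series_ext with (f := fun v => - (1) * (rpow (INR (S N)) (v + 1) * / (v + 1))). { intros; unfold Cdiv; ring. }
  apply disc_series_scal; auto. apply disc_series_mult; auto. 2: exact H3.
  apply (disc_series_shift v0 1). apply disc_series_rpow; auto.
Qed.

Lemma zcont_disc v0 : v0 + 1 <> 0 -> exists r B, (0 < r)%R /\ disc_series v0 r zcont B.
Proof.
  intros Hv. assert (Hp := Cmod_nz _ Hv). set (r := (Cmod (v0 + 1) / 2)%R).
  assert (Hr : (0 <= r < Cmod (v0 + 1))%R) by (unfold r; lra).
  destruct (exists_nat_ge (Cmod v0 + r + 1)) as [M HM].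
  destruct (zpart_converges M v0 r Hr ltac:(lra)) as [F [B [HF HL]]].
  destruct (zpart_disc M v0 r 3 Hr) as [B' HB'].
  exists r, (B' + B)%R. split. unfold r; lra.
  apply disc_series_ext with (f := fun v => zpart M v 3 + F v). 2: apply disc_series_plus; auto; lra.
  intros u Hu. apply (Clim_unique _ _ _ (HL u Hu)). apply zcont_lim.
  - intros E. assert (X : (Cmod (v0 + 1) <= r)%R); [|lra]. replace (v0 + 1) with (- u). now rewrite Cmod_opp.
    replace (- u) with (v0 + 1 - (v0 + u + 1)) by ring. rewrite E. ring.
  - apply INR_le. destruct (em_order_spec (v0 + u)) as [_ O2]. generalize (Cmod_triangle v0 u). lra.
Qed.

Lemma antidiff_lim0 M v : (Re v < -1)%R -> Clim (fun N => antidiff M (INR (S N)) v) 0.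
Proof.
  intros Hv. assert (FF : Filter (T := nat) eventually) by apply eventually_filter. unfold antidiff.
  replace (RtoC 0) with (- / (v + 1) * 0 + 0) by ring.
  apply flim_plus; auto.
  - apply flim_ext with (fun N => - / (v + 1) * rpow (INR (S N)) (v + 1)); auto. { intros; unfold Cdiv; ring. }
    apply flim_scal; auto. apply rpow_lim0. rewrite re_plus, re_RtoC. lra.
  - generalize (S M). intros k. induction k; cbn [csum]. now apply flim_const.
    replace (RtoC 0) with (0 + bin v k * ell k * 0) by ring. apply flim_plus; auto. apply flim_scal; auto.
    apply rpow_lim0. unfold Cminus. rewrite re_plus, re_opp, re_RtoC. generalize (pos_INR k). lra.
Qed.

Lemma zcont_dirichlet v : (Re v < -1)%R -> CS (fun n => rpow (INR (S n)) v) (zcont v).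
Proof.
  intros Hv. assert (FF : Filter (T := nat) eventually) by apply eventually_filter.
  assert (Nv : v + 1 <> 0).
  { intros E. assert (X : Re (v + 1) = 0%R) by now rewrite E. rewrite re_plus, re_RtoC in X. lra. }
  assert (L := zcont_lim _ v Nv (le_n _)).
  apply flim_ext with (fun N => zpart (em_order v) v N - antidiff (em_order v) (INR (S N)) v); auto.
  { intros N. unfold zpart. ring. }
  replace (zcont v) with (zcont v - 0) by ring. apply flim_minus; auto. now apply antidiff_lim0.
Qed.

(** For natural v = j the Euler-Maclaurin formula has no error term, so [zpart] is constant; at N = 0 the
    recursion gives its value. *)
Lemma zcont_nat j : (1 <= j)%nat -> zcont (INR j) = ell j.
Proof.
  intros Hj.
  assert (Nv : RtoC (INR j) + 1 <> 0) by (rewrite <- RtoC_plus, <- S_INR; apply RtoC_INR_S_nz).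
  set (M := max j (em_order (INR j))).
  assert (Step : forall x, (0 < x)%R -> antidiff M (x + 1) (INR j) - antidiff M x (INR j) + rpow x (INR j) = 0).
  { intros x Hx. eapply CS_unique.
    - apply antidiff_step; auto.
      + rewrite <- RtoC_plus, <- S_INR. now apply expands_nat.
      + intros i _. destruct (le_lt_dec i j) as [Li|Li]; [right|left; now apply bin_zero].
        rewrite <- RtoC_minus, <- minus_INR by auto. now apply expands_nat.
    - apply CS_ext with (fun _ => 0); [|apply CS_zero]. intros m.
      destruct (le_lt_dec m (S M)). rewrite kappa_zero by auto. ring. rewrite bin_zero by lia. ring. }
  assert (Const : forall N, zpart M (INR j) N = ell j).
  { induction N.
    - unfold zpart, antidiff. change (csum (fun n => rpow (INR (S n)) (INR j)) 0) with (RtoC 0). change (INR 1) with 1%R.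
      assert (R1 : forall w, rpow 1 w = 1). { intros w. unfold rpow. rewrite ln_1, <- Cexp_0. f_equal. ring. }
      rewrite (csum_ext _ (fun i => bin (INR j) i * ell i)) by (intros; rewrite R1; ring).
      replace (S M) with (S j + (M - j))%nat by lia. rewrite csum_add.
      rewrite (csum_ext (fun i => bin (INR j) (S j + i) * ell (S j + i)) (fun _ => 0)), csum_zero.
      2:{ intros i _. rewrite bin_zero by lia. ring. }
      cbn [csum]. rewrite ell_rec, R1 by auto.
      replace (bin (INR j) j) with (RtoC 1).
      2:{ assert (F := bin_fact 0 j). rewrite Nat.add_0_r in F. rewrite F. change (INR (fact 0)) with 1%R. field. apply RtoC_fact_nz. }
      field. auto.
    - rewrite zpart_S, IHN, Step. ring. apply lt_0_INR; lia. }
  apply (Clim_unique (zpart M (INR j))). apply zcont_lim; auto. unfold M; lia.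
  apply flim_ext with (fun _ => ell j). apply eventually_filter. intros; now rewrite Const. apply flim_const, eventually_filter.
Qed.

(** * The identity theorem along a segment *)

Lemma CS_terms_bounded a l : CS a l -> exists K, forall n, (Cmod (a n) <= K)%R.
Proof.
  intros H. destruct (H 1%R Rlt_0_1) as [N HN].
  exists (rsum (fun n => Cmod (a n)) N + 2)%R. intros n.
  assert (P : (0 <= rsum (fun n => Cmod (a n)) N)%R) by (apply rsum_nonneg; intros; apply Cmod_ge_0).
  destruct (le_lt_dec N n) as [L|L].
  - assert (H1 := HN n L). assert (H2 := HN (S n) ltac:(lia)). cbn [csum] in H2.
    replace (a n) with ((csum a n + a n - l) - (csum a n - l)) by ring.
    eapply Rle_trans; [apply Cmod_minus_le|]. lra.
  - assert (Cmod (a n) <= rsum (fun n => Cmod (a n)) N)%R; [|lra].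
    eapply Rle_trans; [|apply (rsum_mono (fun n => Cmod (a n)) (S n) N); [intros; apply Cmod_ge_0|lia]].
    cbn [rsum]. assert (0 <= rsum (fun n => Cmod (a n)) n)%R by (apply rsum_nonneg; intros; apply Cmod_ge_0). lra.
Qed.

Lemma CS_absr (a : nat -> C) (r : R) l : (0 < r)%R -> CS (fun n => a n * RtoC r ^ n) l -> absr a (r / 2).
Proof.
  intros Hr H. destruct (CS_terms_bounded _ _ H) as [K HK].
  assert (HK0 : (0 <= K)%R) by (eapply Rle_trans; [apply Cmod_ge_0|apply (HK O)]).
  exists (K * / (1 - 1 / 2))%R.
  apply majorant_le with (2 := majorant_scal K _ _ HK0 (geom_majorant (1/2) ltac:(lra))). intros n. split.
  - apply Rmult_le_pos. apply Cmod_ge_0. apply pow_le; lra.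
  - specialize (HK n). rewrite Cmod_mult, Cmod_pow, Cmod_R, Rabs_right in HK by lra.
    replace (r / 2)%R with (r * (1 / 2))%R by field. rewrite Rpow_mult_distr, <- Rmult_assoc.
    apply Rmult_le_compat_r; auto. apply pow_le; lra.
Qed.

(** The first nonzero coefficient would dominate the series near the center. *)
Lemma power_series_zero (a : nat -> C) (r : R) (g : C -> C) : (0 < r)%R ->
  (forall u, (Cmod u < r)%R -> CS (fun n => a n * u ^ n) (g u)) ->
  (forall d, (0 < d)%R -> exists u : C, u <> 0 /\ (Cmod u < d)%R /\ g u = 0) -> forall n, a n = 0.
Proof.
  intros Hr HS HZ.
  assert (HA : absr a (r / 2 / 2)).
  { eapply CS_absr. lra. apply HS. rewrite Cmod_R, Rabs_right; lra. }
  set (rho := (r / 2 / 2)%R) in *. assert (Hrho : (0 < rho < r)%R) by (unfold rho; lra).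
  destruct HA as [B HB].
  intros n. induction n as [n IH] using lt_wf_ind.
  destruct (Ceq_dec (a n) 0) as [|Na]; auto. exfalso.
  assert (Pa := Cmod_nz _ Na).
  assert (HB0 : (0 <= B)%R) by apply (proj2 HB O).
  assert (Prn : (0 < rho ^ S n)%R) by (apply pow_lt; lra).
  set (K := (B / rho ^ S n)%R). assert (HK : (0 <= K)%R) by (apply Rdiv_le_0_compat; auto).
  destruct (HZ (Rmin rho (Cmod (a n) / (K + 1)))) as [u [Nu [Hu Hg]]].
  { apply Rmin_pos; [lra|]. apply Rdiv_lt_0_compat; lra. }
  assert (Hu1 := Rlt_le_trans _ _ _ Hu (Rmin_l _ _)). assert (Hu2 := Rlt_le_trans _ _ _ Hu (Rmin_r _ _)).
  assert (Pu := Cmod_nz _ Nu).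
  assert (T : (Cmod (g u - csum (fun n => (a n * u ^ n)%C) (S n)) <= Cmod u ^ S n * K)%R).
  { apply CS_tail_bound; [|apply HS; lra]. intros k.
    apply Rle_trans with (rsum (fun i => Cmod u ^ S n / rho ^ S n * (Cmod (a (S n + i)%nat) * rho ^ (S n + i))) k)%R.
    - apply rsum_le. intros i _. rewrite Cmod_mult, Cmod_pow, !pow_add.
      assert (Q : (Cmod u ^ i <= rho ^ i)%R) by (apply pow_incr; lra).
      replace (Cmod u ^ S n / rho ^ S n * (Cmod (a (S n + i)%nat) * (rho ^ S n * rho ^ i)))%R
       with (Cmod (a (S n + i)%nat) * (Cmod u ^ S n * rho ^ i))%R by (field; lra).
      apply Rmult_le_compat_l. apply Cmod_ge_0. apply Rmult_le_compat_l; auto. apply pow_le; lra.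
    - rewrite rsum_scal. unfold K. replace (Cmod u ^ S n * (B / rho ^ S n))%R with (Cmod u ^ S n / rho ^ S n * B)%R by (field; lra).
      apply Rmult_le_compat_l. apply Rdiv_le_0_compat; auto. apply pow_le; lra.
      assert (G : forall p q, (rsum (fun i => Cmod (a (p + i)%nat) * rho ^ (p + i)) q <= rsum (fun i => Cmod (a i) * rho ^ i) (p + q))%R).
      { intros p q. induction q; cbn [rsum]. apply rsum_nonneg, HB. rewrite Nat.add_succ_r. cbn [rsum]. lra. }
      eapply Rle_trans; [apply G|]. apply HB. }
  assert (Z : csum (fun n => a n * u ^ n) n = 0).
  { rewrite (csum_ext _ (fun _ => 0)), csum_zero; auto. intros i Hi. rewrite IH by auto. ring. }
  cbn [csum] in T. rewrite Z, Hg in T. replace (0 - (0 + a n * u ^ n)) with (- (a n * u ^ n)) in T by ring.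
  rewrite Cmod_opp, Cmod_mult, Cmod_pow in T. simpl in T.
  assert (Pun : (0 < Cmod u ^ n)%R) by now apply pow_lt.
  apply Rlt_div_r in Hu2; [|lra].
  assert (Cmod (a n) * Cmod u ^ n <= (Cmod u * K) * Cmod u ^ n)%R by lra.
  apply Rmult_le_reg_r in H; auto. nra.
Qed.

(** The set of parameters up to which the function vanishes identically near the segment is closed by
    [power_series_zero] and open by convergence of the power series. *)
Lemma identity_segment (f : C -> C) (p q : C) : p <> q ->
  (forall t : R, (0 <= t <= 1)%R -> analytic_at f (p + t * (q - p))) ->
  (exists d, (0 < d)%R /\ forall z, (Cmod (z - p) < d)%R -> f z = 0) -> f q = 0.
Proof.
  intros Hpq HA H0. set (ga := fun t : R => p + t * (q - p)).
  assert (Hd : (0 < Cmod (q - p))%R) by (apply Cmod_nz, Cminus_nz; auto).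
  assert (Dist : forall s t, Cmod (ga s - ga t) = (Rabs (s - t) * Cmod (q - p))%R).
  { intros s t. unfold ga. replace (p + s * (q - p) - (p + t * (q - p))) with (RtoC (s - t) * (q - p)) by (rewrite RtoC_minus; ring).
    now rewrite Cmod_mult, Cmod_R. }
  set (nz := fun t : R => exists d, (0 < d)%R /\ forall z, (Cmod (z - ga t) < d)%R -> f z = 0).
  set (E := fun t : R => (0 <= t <= 1)%R /\ forall u, (0 <= u <= t)%R -> nz u).
  assert (E0 : E 0%R).
  { split. lra. intros u Hu. replace u with 0%R by lra. unfold nz, ga.
    replace (p + RtoC 0 * (q - p)) with p by ring. exact H0. }
  destruct (completeness E) as [s [Hs1 Hs2]].
  { exists 1%R. intros t [Ht _]. lra. } { now exists 0%R. }
  assert (S01 : (0 <= s <= 1)%R).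
  { split. apply Hs1; auto. apply Hs2. intros t [Ht _]. lra. }
  assert (Below : forall e, (0 < e)%R -> exists t, E t /\ (s - e < t <= s)%R).
  { intros e He. destruct (classic (exists t, E t /\ (s - e < t <= s)%R)) as [|No]; auto. exfalso.
    assert (s <= s - e)%R; [|lra]. apply Hs2. intros t Ht. apply Rnot_lt_le. intros L. apply No.
    exists t. split; auto. }
  destruct (HA s S01) as [a [r [Hr HS]]]. fold (ga s) in HS.
  assert (Za : forall n, a n = 0).
  { apply (power_series_zero a r (fun u => f (ga s + u)) Hr).
    - intros u Hu. apply CS_is_series. replace u with (ga s + u - ga s) at 1 by ring.
      assert (X := HS (ga s + u)). replace (ga s + u - ga s) with u in * by ring. auto.
    - intros d Hdp. destruct (Below (d / Cmod (q - p))%R ltac:(now apply Rdiv_lt_0_compat)) as [t [[Ht1 Ht2] Ht3]].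
      destruct (Ht2 t ltac:(lra)) as [d' [Hd' Hz]].
      destruct (Req_dec t s) as [->|Nts].
      + set (e := (Rmin d d' / 2)%R). assert (0 < Rmin d d')%R by now apply Rmin_pos.
        generalize (Rmin_l d d') (Rmin_r d d'). intros M1 M2.
        exists (RtoC e). split; [|split].
        * intros X. apply RtoC_inj in X. unfold e in X. lra.
        * rewrite Cmod_R, Rabs_right; unfold e; lra.
        * apply Hz. replace (ga s + e - ga s) with (RtoC e) by ring. rewrite Cmod_R, Rabs_right; unfold e; lra.
      + exists (ga t - ga s). split; [|split].
        * apply Cmod_gt_0. rewrite Dist. apply Rmult_lt_0_compat; auto. apply Rabs_pos_lt. lra.
        * rewrite Dist. rewrite Rabs_left by lra. destruct Ht3 as [Ht3 _].
          apply (Rlt_div_r _ d (Cmod (q - p))); auto. lra.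
        * replace (ga s + (ga t - ga s)) with (ga t) by ring. apply Hz.
          replace (ga t - ga t) with (RtoC 0) by ring. now rewrite Cmod_0. }
  assert (Fz : forall z, (Cmod (z - ga s) < r)%R -> f z = 0).
  { intros z Hz. specialize (HS z Hz). apply CS_is_series in HS.
    apply (CS_unique _ _ _ HS). apply CS_ext with (fun _ => 0). intros; rewrite Za; ring. apply CS_zero. }
  assert (Near : forall u, (Rabs (u - s) * Cmod (q - p) < r)%R -> nz u).
  { intros u Hu. exists (r - Rabs (u - s) * Cmod (q - p))%R. split. lra. intros z Hz. apply Fz.
    replace (z - ga s) with ((z - ga u) + (ga u - ga s)) by ring.
    eapply Rle_lt_trans; [apply Cmod_triangle|]. rewrite Dist. lra. }
  assert (s = 1%R).
  { apply Rle_antisym; [lra|]. apply Rnot_lt_le. intros L.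
    set (e := (Rmin (1 - s) (r / Cmod (q - p)) / 2)%R).
    assert (P1 : (0 < r / Cmod (q - p))%R) by now apply Rdiv_lt_0_compat.
    assert (P2 : (0 < Rmin (1 - s) (r / Cmod (q - p)))%R) by (apply Rmin_pos; lra).
    generalize (Rmin_l (1 - s) (r / Cmod (q - p))) (Rmin_r (1 - s) (r / Cmod (q - p))). intros M1 M2.
    assert (E (s + e)%R).
    { split. unfold e; lra. intros u Hu. destruct (Rlt_le_dec u s) as [Lu|Lu].
      - destruct (Below (s - u)%R ltac:(lra)) as [t [[_ Ht] Ht2]]. apply Ht. lra.
      - apply Near. rewrite Rabs_right by lra. apply (Rlt_div_r _ r (Cmod (q - p))); auto. unfold e in Hu. lra. }
    assert (X := Hs1 _ H). unfold e in X. lra. }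
  replace q with (ga 1%R) by (unfold ga; ring). subst s. apply Fz.
  replace (ga 1%R - ga 1%R) with (RtoC 0) by ring. now rewrite Cmod_0.
Qed.

Lemma analytic_minus f g z : analytic_at f z -> analytic_at g z -> analytic_at (fun w => f w - g w) z.
Proof.
  intros [a [r [Hr Ha]]] [b [r' [Hr' Hb]]]. exists (fun n => a n - b n), (Rmin r r').
  split. now apply Rmin_pos. intros w Hw. apply CS_is_series.
  assert (X := Ha w (Rlt_le_trans _ _ _ Hw (Rmin_l _ _))). assert (Y := Hb w (Rlt_le_trans _ _ _ Hw (Rmin_r _ _))).
  apply CS_is_series in X. apply CS_is_series in Y.
  eapply CS_ext; [|exact (CS_minus _ _ _ _ X Y)]. intros; cbv beta; ring.
Qed.

(** Two continuations agree where the Dirichlet series converges; the segment from 2 + i to x meets the real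
    axis only at x, so it avoids the pole at 1. *)
Lemma hurwitz_unique a Z1 Z2 (x : R) : is_hurwitz_zeta a Z1 -> is_hurwitz_zeta a Z2 -> (x < 1)%R ->
  Z1 (RtoC x) = Z2 (RtoC x).
Proof.
  intros [A1 D1] [A2 D2] Hx.
  assert (E : (fun w => Z1 w - Z2 w) (RtoC x) = 0).
  { apply (identity_segment (fun w => Z1 w - Z2 w) (2 + Ci) (RtoC x)).
    - intros X. assert (Y : Im (2 + Ci) = 0%R) by now rewrite X. rewrite im_plus, im_RtoC in Y. simpl in Y. lra.
    - intros t Ht.
      assert (N : 2 + Ci + RtoC t * (RtoC x - (2 + Ci)) <> 1).
      { intros X. assert (X1 := f_equal Im X). assert (X2 := f_equal Re X). simpl in X1, X2.
        assert (T1 : t = 1%R) by lra. rewrite T1 in X2. lra. }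
      apply analytic_minus; [apply A1|apply A2]; exact N.
    - exists 1%R. split. lra. intros z Hz.
      assert (Rz : (1 < Re z)%R).
      { generalize (re_le_Cmod (z - (2 + Ci))). unfold Cminus. rewrite re_plus, re_opp, re_plus, re_RtoC. simpl (Re Ci).
        intros G. generalize (Rle_abs (- (Re z + - (2 + 0)))). rewrite Rabs_Ropp. unfold Cminus in Hz. lra. }
      assert (X := D1 z Rz). assert (Y := D2 z Rz). apply CS_is_series in X. apply CS_is_series in Y.
      rewrite (CS_unique _ _ _ X Y). ring. }
  cbv beta in E. replace (Z1 (RtoC x)) with (Z1 (RtoC x) - Z2 (RtoC x) + Z2 (RtoC x)) by ring. rewrite E. ring.
Qed.

(** * Zeta values at negative odd integers *)

Lemma neg_s_nz (s : C) : s <> 1 -> - s + 1 <> 0.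
Proof. intros H E. apply H. replace s with (1 - (- s + 1)) by ring. rewrite E. ring. Qed.

Lemma zcont_hurwitz : is_hurwitz_zeta 1 (fun s => zcont (- s)).
Proof.
  split.
  - intros s Hs. destruct (zcont_disc (- s) (neg_s_nz s Hs)) as [r [B [Hr HD]]].
    apply disc_series_analytic with (r := r) (B := B); auto. now apply disc_series_opp.
  - intros s Hs. apply CS_is_series. eapply CS_ext; [|apply (zcont_dirichlet (- s)); rewrite re_opp; lra].
    intros n. unfold rpow. now rewrite S_INR.
Qed.

(** Splitting the sum over all n into even and odd n gives zeta(s,1/2) = (2^s - 1) zeta(s). *)
Definition zcont_half (s : C) : C := (rpow 2 s + - (1)) * zcont (- s).

Lemma zcont_half_hurwitz : is_hurwitz_zeta (1 / 2) zcont_half.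
Proof.
  split.
  - intros s Hs. destruct (zcont_disc (- s) (neg_s_nz s Hs)) as [r [B [Hr HD]]].
    eapply disc_series_analytic with (r := r); auto. unfold zcont_half.
    apply disc_series_mult; [lra| |apply disc_series_opp; exact HD].
    apply disc_series_plus; [lra| |apply disc_series_const; lra].
    apply disc_series_rpow; lra.
  - intros s Hs. apply CS_is_series. 
    assert (D := zcont_dirichlet (- s) ltac:(rewrite re_opp; lra)).
    assert (FF : Filter (T := nat) eventually) by apply eventually_filter.
    assert (N2 : rpow 2 s <> 0) by apply Cexp_nz.
    apply flim_ext with (fun N => rpow 2 s * (csum (fun n => rpow (INR (S n)) (- s)) (2 * N) - / rpow 2 s * csum (fun n => rpow (INR (S n)) (- s)) N)); auto.
    + intros N. induction N.
      * simpl. ring.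
      * cbn [csum]. rewrite <- IHN. replace (2 * S N)%nat with (S (S (2 * N))) by lia. cbn [csum].
        assert (E1 : rpow (INR (S (S (2 * N)))) (- s) = / rpow 2 s * rpow (INR (S N)) (- s)).
        { rewrite <- rpow_opp. unfold rpow. rewrite <- Cexp_add. f_equal.
          replace (INR (S (S (2 * N)))) with (2 * INR (S N))%R.
          rewrite ln_mult, RtoC_plus; [ring|lra|apply lt_0_INR; lia].
          rewrite !S_INR, mult_INR. simpl. ring. }
        assert (E2 : Cexp (- s * RtoC (ln (INR N + 1 / 2))) = rpow 2 s * rpow (INR (S (2 * N))) (- s)).
        { unfold rpow. rewrite <- Cexp_add. f_equal.
          replace (INR (S (2 * N))) with (2 * (INR N + 1 / 2))%R.
          rewrite ln_mult, RtoC_plus; [ring|lra|generalize (pos_INR N); lra].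
          rewrite S_INR, mult_INR. simpl. field. }
        rewrite E1, E2. field. auto.
    + unfold zcont_half. replace ((rpow 2 s + - (1)) * zcont (- s)) with (rpow 2 s * (zcont (- s) - / rpow 2 s * zcont (- s))) by (field; auto).
      apply flim_scal; auto. apply flim_minus; auto.
      * apply (Clim_sub (csum (fun n => rpow (INR (S n)) (- s))) _ (fun N => (2 * N)%nat)). intros; lia. exact D.
      * apply flim_scal; auto.
Qed.

Lemma hurwitz_zeta_spec a Z : is_hurwitz_zeta a Z -> is_hurwitz_zeta a (fun s => hurwitz_zeta s a).
Proof.
  intros H. unfold hurwitz_zeta. apply (epsilon_spec (inhabits (fun _ : C => RtoC 0)) (is_hurwitz_zeta a)). now exists Z.
Qed.

(** Both [zcont] and the chosen continuation continue the Dirichlet series, and [zcont] takes the value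
    [ell] at natural numbers. *)
Theorem zeta_neg l : zeta (RtoC (1 - 2 * INR (S l))) = 2 * gconst (2 * S l).
Proof.
  unfold zeta. assert (P := pos_INR l).
  rewrite (hurwitz_unique 1 (fun s => hurwitz_zeta s 1) (fun s => zcont (- s))).
  - replace (- RtoC (1 - 2 * INR (S l))) with (RtoC (INR (2 * l + 1))).
    2:{ rewrite <- RtoC_opp. f_equal. rewrite S_INR, plus_INR, mult_INR. simpl. ring. }
    rewrite zcont_nat by lia. unfold ell. rewrite Nat.add_1_r. 
    replace (Nat.odd (S (2 * l))) with true. f_equal. f_equal. lia.
    symmetry. apply Nat.odd_spec. exists l. lia.
  - apply (hurwitz_zeta_spec 1 _ zcont_hurwitz).
  - apply zcont_hurwitz.
  - rewrite S_INR. lra.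
Qed.

(** The identity zeta(s,1/2) = (2^s - 1) zeta(s) at s = 1 - 2(l+1). *)
Theorem hurwitz_half_neg l :
  hurwitz_zeta (RtoC (1 - 2 * INR (S l))) (1 / 2) = (/ 2 ^ (2 * l + 1) - 1) * (2 * gconst (2 * S l)).
Proof.
  assert (P := pos_INR l).
  rewrite (hurwitz_unique (1 / 2) (fun s => hurwitz_zeta s (1 / 2)) zcont_half).
  - unfold zcont_half. rewrite <- zeta_neg. unfold zeta.
    rewrite <- (hurwitz_unique 1 (fun s => hurwitz_zeta s 1) (fun s => zcont (- s))).
    + replace (RtoC (1 - 2 * INR (S l))) with (- RtoC (INR (2 * l + 1))) at 1.
      2:{ rewrite <- RtoC_opp. f_equal. rewrite S_INR, plus_INR, mult_INR. simpl. ring. }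
      rewrite rpow_opp, rpow_nat, RtoC_pow by lra. ring.
    + apply (hurwitz_zeta_spec 1 _ zcont_hurwitz).
    + apply zcont_hurwitz.
    + rewrite S_INR. lra.
  - apply (hurwitz_zeta_spec (1 / 2) _ zcont_half_hurwitz).
  - apply zcont_half_hurwitz.
  - rewrite S_INR. lra.
Qed.

(** * The eta function *)

Lemma psum_pder a x : PS a -> (Cmod x < 1)%R -> x * psum (pder a) x = psum (fun n => INR n * a n) x.
Proof.
  intros Ha Hx. symmetry. apply CS_CSeries. apply CS_S'. { change (INR 0) with 0%R. ring. }
  eapply CS_ext; [|apply CS_scal, PS_CS; [apply PS_pder, Ha|exact Hx]].
  intros n. unfold pder. rewrite Cpow_S. ring.
Qed.

Lemma CD_qseries a (h : C -> C) z h' : PS a -> UH (h z) -> CD h z h' ->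
  CD (fun w => psum a (e2pi (h w))) z (2 * PI * Ci * h' * psum (fun n => INR n * a n) (e2pi (h z))).
Proof.
  intros Ha Hz Hh. assert (Q := Cmod_e2pi_lt _ Hz). eapply CD_eq.
  - apply (CD_comp (psum a) (fun w => e2pi (h w))). now apply PS_CD. apply CD_e2pi_comp, Hh.
  - rewrite <- psum_pder by auto. ring.
Qed.

Lemma psum_ext (a b : nat -> C) x : (forall n, a n = b n) -> psum a x = psum b x.
Proof. intros H. replace b with a; auto. now apply functional_extensionality. Qed.

Lemma CD_div (f : C -> C) z a (c : C) : CD f z a -> CD (fun w => f w / c) z (a / c).
Proof.
  intros H. apply (CD_eq _ _ (/ c * a)). apply (CD_ext (fun w => / c * f w)).
  - intros w. unfold Cdiv. ring.
  - now apply CD_scal.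
  - unfold Cdiv. ring.
Qed.

(** The coefficients of - log of the product of 1 - x^n, obtained by regrouping the logarithms of the
    factors. *)
Definition lphi (n : nat) : C := / INR n * sig 1 n.

Lemma lphi_dsum n : lphi n = dsum (fun _ r => / INR r) n.
Proof.
  unfold lphi, sig, dsum. destruct n as [|n]. simpl; ring.
  rewrite <- csum_scal. apply csum_ext. intros i _.
  destruct (Nat.eqb_spec (S n mod S i) 0) as [E|_]; [|ring].
  assert (D := Nat.div_mod (S n) (S i) ltac:(lia)). rewrite E, Nat.add_0_r in D.
  assert (Z : (S n / S i)%nat <> O). { intros X. rewrite X in D. lia. }
  destruct (S n / S i)%nat as [|r] eqn:R; [lia|].
  rewrite D, mult_INR, RtoC_mult, Cpow_1_r. field. split; apply RtoC_INR_S_nz.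
Qed.

Lemma inv_INR_bound (d r : nat) : (Cmod (/ RtoC (INR (S r))) <= INR (S d * S r) ^ 0)%R.
Proof.
  assert (P : (0 < INR (S r))%R) by (apply lt_0_INR; lia).
  rewrite <- RtoC_inv by lra. rewrite Cmod_R, Rabs_right. apply Rinv_INR_S_le.
  apply Rle_ge, Rlt_le, Rinv_0_lt_compat, P.
Qed.

Lemma PS_lphi : PS lphi.
Proof. eapply PS_ext. intros; symmetry; apply lphi_dsum. apply (PS_dsum _ 0), inv_INR_bound. Qed.

Lemma lphi_limit x : (Cmod x < 1)%R -> CS (fun d => psum linv (x ^ S d)) (psum lphi x).
Proof.
  intros Hx. replace (psum lphi x) with (psum (dsum (fun _ r => / INR r)) x).
  2:{ apply psum_ext. intros n. now rewrite lphi_dsum. }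
  apply (lambert _ 0); auto using inv_INR_bound. intros d.
  assert (Q : (Cmod (x ^ S d) < 1)%R). { rewrite Cmod_pow. apply pow_lt_1_compat; [split; [apply Cmod_ge_0|auto]|lia]. }
  replace (psum linv (x ^ S d)) with (psum linv (x ^ S d) - linv 0 * (x ^ S d) ^ 0) by (simpl; ring).
  eapply CS_ext; [|exact (CS_S_inv _ _ (PS_CS _ _ PS_linv Q))].
  intros r. cbv beta. now rewrite <- Cpow_mult_r.
Qed.

(** The product of the factors 1 - x^n. *)
Definition Phi (x : C) : C := Cexp (- psum lphi x).

Fixpoint cprod (f : nat -> C) (n : nat) : C :=
  match n with O => 1 | S n' => cprod f n' * f n' end.

Lemma Phi_limit x : (Cmod x < 1)%R -> Clim (cprod (fun d => 1 - x ^ S d)) (Phi x).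
Proof.
  intros Hx. unfold Phi.
  apply flim_ext with (f := fun N => Cexp (- csum (fun d => psum linv (x ^ S d)) N)).
  - apply eventually_filter.
  - intros N. induction N; cbn [csum cprod]. rewrite <- Cexp_0. f_equal. ring.
    rewrite <- IHN, <- Cexp_log, <- Cexp_add. f_equal. ring.
    rewrite Cmod_pow. apply pow_lt_1_compat; [split; [apply Cmod_ge_0|auto]|lia].
  - apply Clim_Cexp. apply flim_opp. apply eventually_filter. now apply lphi_limit.
Qed.

Lemma Ci_inv : / Ci = - Ci.
Proof.
  assert (NC := UH_nz Ci UH_Ci). replace (- Ci) with (/ Ci * - (Ci * Ci)) by (field; auto). rewrite Ci2. ring.
Qed.

Definition eta (tau : C) : C := e2pi (tau / 24) * Phi (e2pi tau).

Lemma eta_nz tau : eta tau <> 0.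
Proof. apply Cmult_neq_0. apply e2pi_nz. apply Cexp_nz. Qed.

Lemma gconst_2 : gconst 2 = - (1) / 24.
Proof.
  (* The recursion for j = 2 reads 1/2 + 2 ell 1 = 1/3. *)
  assert (H := ell_rec 2 ltac:(lia)). cbn [csum] in H. unfold ell in H. cbn [Nat.odd Nat.even negb Nat.add bin] in H.
  assert (N2 : RtoC 2 <> 0) by (intros X; apply RtoC_inj in X; lra).
  assert (N3 : RtoC 3 <> 0) by (intros X; apply RtoC_inj in X; lra).
  assert (E2 : RtoC (INR 2) = 2) by (f_equal; simpl; ring).
  assert (E1 : RtoC (INR 1) = 1) by (f_equal; simpl; ring). assert (E0 : RtoC (INR 0) = 0) by reflexivity.
  rewrite E2, E1, E0 in H.
  assert (X : 4 * gconst 2 = / (2 + 1) - 1 / 2).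
  { rewrite <- H. field. }
  replace (gconst 2) with (4 * gconst 2 / 4) by field. rewrite X. field.
Qed.

Lemma CD_eta tau : UH tau -> CD eta tau (- (2 * PI * Ci) * Gk 2 tau * eta tau).
Proof.
  intros H. eapply CD_eq.
  - apply CD_mult.
    + apply (CD_e2pi_comp (fun w => w / 24)). apply CD_div, CD_id.
    + unfold Phi. apply (CD_Cexp_comp (fun w => - psum lphi (e2pi w))). apply CD_opp. apply (CD_qseries lphi (fun w => w)); auto using PS_lphi, CD_id.
  - unfold eta, Gk, Phi. rewrite gconst_2.
    replace (psum (fun n => INR n * lphi n) (e2pi tau)) with (psum (sig (2 - 1)) (e2pi tau)).
    { unfold Cdiv; ring. }
    apply psum_ext. intros n. unfold lphi.
    destruct n. simpl. unfold sig, dsum. simpl. ring. change (2 - 1)%nat with 1%nat. field. apply RtoC_INR_S_nz.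
Qed.

Lemma UH_plus_1 tau : UH tau -> UH (tau + 1).
Proof. apply UH_plus_real. Qed.

Lemma eta_T tau : eta (tau + 1) = e2pi (/ 24) * eta tau.
Proof.
  unfold eta. rewrite (e2pi_add tau 1), e2pi_1, Cmult_1_r. replace ((tau + 1) / 24) with (/ 24 + tau / 24) by (unfold Cdiv; ring).
  rewrite e2pi_add. ring.
Qed.

(** The logarithmic derivative of the quotient of the two sides vanishes, by the transformation law of G_2;
    the constant is found at the fixed point i of the inversion. *)
Lemma eta_S tau : UH tau -> eta (inv_neg tau) ^ 2 = - Ci * tau * eta tau ^ 2.
Proof.
  intros H.
  set (f := fun w => eta (inv_neg w) ^ 2 * / (w * eta w ^ 2)).
  assert (E : f tau = f Ci).
  { apply UH_const; auto using UH_Ci. intros w Hw. assert (Nw := UH_nz w Hw).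
    assert (N2 : w * eta w ^ 2 <> 0). { apply Cmult_neq_0; auto. apply Cpow_nz, eta_nz. }
    assert (N3 := eta_nz w). unfold f. eapply CD_eq.
    - apply CD_mult.
      + apply CD_pow. apply (CD_comp eta inv_neg). apply CD_eta. now apply UH_inv_neg. now apply CD_inv_neg.
      + apply (CD_inv (fun w => w * eta w ^ 2)); auto. apply CD_mult. apply CD_id. apply CD_pow. now apply CD_eta.
    - rewrite Gk_2_inv_neg by auto. replace (RtoC (INR 2)) with (RtoC 2) by (f_equal; simpl; ring). cbn [Nat.sub].
      generalize (eta (inv_neg w)) (Gk 2 w). intros x y. simpl Cpow. field. repeat split; auto using PI_nz, UH_nz, UH_Ci. }
  assert (NC := UH_nz Ci UH_Ci).
  assert (IC : inv_neg Ci = Ci) by (unfold inv_neg; rewrite Ci_inv; ring).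
  assert (N1 := UH_nz tau H). assert (N2 := Cpow_nz _ 2 (eta_nz tau)). assert (N3 := Cpow_nz _ 2 (eta_nz Ci)).
  unfold f in E. rewrite IC in E.
  replace (eta (inv_neg tau) ^ 2) with (eta (inv_neg tau) ^ 2 * / (tau * eta tau ^ 2) * (tau * eta tau ^ 2)) by (field; split; auto using eta_nz).
  rewrite E, <- Ci_inv. field. split; auto using eta_nz.
Qed.

(** * Vector-valued forms of level two *)

(** The constants allowed in a transformation law: only 1 for the Eisenstein series, the unit circle for
    powers of eta. *)
Definition const_group (K : C -> Prop) : Prop :=
  K (RtoC 1) /\ (forall a b, K a -> K b -> K (a * b)) /\ (forall a, K a -> a <> 0 /\ K (/ a)).

Definition is_one (c : C) : Prop := c = RtoC 1.
Definition is_unit (c : C) : Prop := Cmod c = 1%R.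

Lemma const_group_one : const_group is_one.
Proof.
  unfold is_one. repeat split. intros a b -> ->; ring.
  rewrite H. apply C1_nz. rewrite H. field.
Qed.

Lemma is_unit_nz c : is_unit c -> c <> 0.
Proof. intros H ->. red in H. rewrite Cmod_0 in H. lra. Qed.

Lemma const_group_unit : const_group is_unit.
Proof.
  unfold is_unit. split; [|split]. apply Cmod_1.
  - intros a b Ha Hb. now rewrite Cmod_mult, Ha, Hb, Rmult_1_r.
  - intros a Ha. assert (N := is_unit_nz a Ha). split; auto. rewrite Cmod_inv, Ha by auto. apply Rinv_1.
Qed.

Definition family := bool -> bool -> C -> C.

(** The components are indexed by row vectors modulo 2, on which the modular group acts from the right; the
    generators exchange the entries or add the second one to the first. *)
Definition cov (K : C -> Prop) (k : nat) (F : family) : Prop :=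
  forall a b,
    (exists c, K c /\ forall tau, UH tau -> F a b (inv_neg tau) = c * tau ^ k * F b a tau) /\
    (exists c, K c /\ forall tau, UH tau -> F a b (tau + 1) = c * F (xorb a b) b tau).

Definition level_one (K : C -> Prop) (k : nat) (f : C -> C) : Prop := cov K k (fun _ _ => f).

(** The index (0,0) stands for f itself; the other three functions are, up to constants, the summands of the
    Hecke operator T_2 applied to f. *)
Definition hecke (k : nat) (f : C -> C) : family := fun a b tau =>
  match a, b with
  | false, false => f tau
  | true, false => 2 ^ k * f (2 * tau)
  | false, true => f (tau / 2)
  | true, true => f ((tau + 1) / 2)
  end.

Lemma two_nz : RtoC 2 <> 0.
Proof. intros X; apply RtoC_inj in X; lra. Qed.

Lemma UH_double (tau : C) : UH tau -> UH (2 * tau).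
Proof. intros H. apply (UH_mult_real tau 2); auto. lra. Qed.

Lemma UH_minus_1 (tau : C) : UH tau -> UH (tau - 1).
Proof. intros H. unfold UH in *. unfold Cminus. rewrite im_plus, im_opp, im_RtoC. lra. Qed.

Lemma inv_neg_half (tau : C) : tau <> 0 -> inv_neg tau / 2 = inv_neg (2 * tau).
Proof. intros H. unfold inv_neg. field. auto. Qed.

(** The only case that is not immediate is (1,1) under inversion. With sigma = (tau+1)/2 the point
    (-1/tau+1)/2 is the image of sigma under the matrix (1 -1; 2 -1), which is a word in translations and
    two inversions. *)
Lemma hecke_cov K k f : const_group K -> level_one K k f -> cov K k (hecke k f).
Proof.
  intros [K1 [KM KI]] H. destruct (H true true) as [[c [Kc S]] [d [Kd T]]].
  destruct (KI d Kd) as [Nd Kd']. destruct (KI c Kc) as [Nc _].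
  assert (T' : forall tau, UH tau -> f (tau - 1) = / d * f tau).
  { intros tau Ht. replace tau with (tau - 1 + 1) at 2 by ring. rewrite T. field; auto.
    now apply UH_minus_1. }
  assert (N2 := two_nz).
  intros [] []; (split; [|]); cbn [xorb hecke].
  - exists (/ d * (/ d * / d)). split; auto. intros tau Ht.
    assert (Hs := UH_half1 tau Ht). set (s := (tau + 1) / 2) in *.
    assert (Es : tau = 2 * s - 1) by (unfold s; field; auto).
    assert (Nt := UH_nz tau Ht).
    assert (Hs1 : UH (s - 1)) by now apply UH_minus_1.
    assert (Ns1 := UH_nz _ Hs1).
    set (r := (inv_neg tau + 1) / 2).
    assert (Er : r = (s - 1) / tau). { unfold r, inv_neg. rewrite Es. rewrite Es in Nt. field. auto. }
    assert (Hr : UH r) by (unfold r; apply UH_half1, UH_inv_neg, Ht). assert (Nr := UH_nz _ Hr).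
    assert (Hi := UH_inv_neg _ Hs1).
    assert (E1 : inv_neg r = inv_neg (s - 1) - 1 - 1).
    { rewrite Er. unfold inv_neg. rewrite Es. rewrite Es in Nt. field. auto. }
    assert (Hm : UH (inv_neg (s - 1) - 1)) by now apply UH_minus_1.
    assert (X := S r Hr). rewrite E1, T', T', S, T' in X by auto.
    assert (Nk := Cpow_nz r k Nr).
    replace (f r) with (/ (c * r ^ k) * (c * r ^ k * f r)) by (field; auto). rewrite <- X.
    replace (s - 1) with (tau * r) by (rewrite Er; field; auto). rewrite Cpow_mult_l. field. auto.
  - exists d. split; auto. intros tau Ht. replace ((tau + 1 + 1) / 2) with (tau / 2 + 1) by (field; auto).
    apply T. now apply UH_half.
  - exists c. split; auto. intros tau Ht. assert (Nt := UH_nz tau Ht).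
    replace (2 * inv_neg tau) with (inv_neg (tau / 2)) by (unfold inv_neg; field; auto).
    rewrite S by now apply UH_half. assert (Et : tau ^ k = 2 ^ k * (tau / 2) ^ k) by (rewrite <- Cpow_mult_l; f_equal; field; auto).
    rewrite Et. ring.
  - exists (d * d). split; auto. intros tau Ht. replace (2 * (tau + 1)) with (2 * tau + 1 + 1) by ring.
    rewrite !T. ring. now apply UH_double. now apply UH_plus_1, UH_double.
  - exists c. split; auto. intros tau Ht. rewrite inv_neg_half by now apply UH_nz. 
    rewrite S, Cpow_mult_l by now apply UH_double. ring.
  - exists 1. split; auto. intros tau Ht. ring.
  - exists c. auto.
  - exists d. auto.
Qed.

Lemma cov_one (F : family) k : (forall a b tau, UH tau -> F a b (inv_neg tau) = tau ^ k * F b a tau) ->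
  (forall a b tau, UH tau -> F a b (tau + 1) = F (xorb a b) b tau) -> cov is_one k F.
Proof.
  intros S T a b. split; exists 1; (split; [reflexivity|]); intros tau H; [rewrite S|rewrite T]; auto; ring.
Qed.

Lemma cov_one_S F k : cov is_one k F -> forall a b tau, UH tau -> F a b (inv_neg tau) = tau ^ k * F b a tau.
Proof. intros H a b tau Ht. destruct (H a b) as [[c [-> E]] _]. rewrite E by auto. ring. Qed.

Lemma cov_one_T F k : cov is_one k F -> forall a b tau, UH tau -> F a b (tau + 1) = F (xorb a b) b tau.
Proof. intros H a b tau Ht. destruct (H a b) as [_ [c [-> E]]]. rewrite E by auto. ring. Qed.

(** * The action of the modular group *)

Section Matrices.
Local Open Scope Z_scope.

(** Euclid's algorithm on the bottom row: translations reduce d modulo c, and inversion exchanges c and d. *)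
Lemma sl2_ind (P : Z -> Z -> Z -> Z -> Prop) : P 1 0 0 1 ->
  (forall a b c d, a * d - b * c = 1 -> P a b c d -> P b (- a) d (- c)) ->
  (forall a b c d, a * d - b * c = 1 -> P a b c d -> P a (a + b) c (c + d)) ->
  (forall a b c d, a * d - b * c = 1 -> P a b c d -> P a (b - a) c (d - c)) ->
  forall a b c d, a * d - b * c = 1 -> P a b c d.
Proof.
  intros P1 PS PT PU.
  assert (Tn : forall n a b c d, a * d - b * c = 1 -> P a b c d -> P a (b + n * a) c (d + n * c)).
  { intros n. assert (X : forall m a b c d, a * d - b * c = 1 -> P a b c d ->
      P a (b + Z.of_nat m * a) c (d + Z.of_nat m * c) /\ P a (b - Z.of_nat m * a) c (d - Z.of_nat m * c)).
    { intros m. induction m as [|m IH]; intros a b c d D H.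
      - simpl. rewrite !Z.add_0_r, !Z.sub_0_r. auto.
      - destruct (IH a b c d D H) as [H1 H2]. rewrite Nat2Z.inj_succ. split.
        + apply PT in H1; [|nia]. replace (b + Z.succ (Z.of_nat m) * a) with (a + (b + Z.of_nat m * a)) by ring.
          now replace (d + Z.succ (Z.of_nat m) * c) with (c + (d + Z.of_nat m * c)) by ring.
        + apply PU in H2; [|nia]. replace (b - Z.succ (Z.of_nat m) * a) with (b - Z.of_nat m * a - a) by ring.
          now replace (d - Z.succ (Z.of_nat m) * c) with (d - Z.of_nat m * c - c) by ring. }
    intros a b c d D H. destruct (Z_le_gt_dec 0 n) as [L|L].
    - rewrite <- (Z2Nat.id n L). now apply X.
    - replace n with (- Z.of_nat (Z.to_nat (- n))) by (rewrite Z2Nat.id; lia).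
      rewrite !Z.mul_opp_l, !Z.add_opp_r. now apply X. }
  assert (S3 : forall a b c d, a * d - b * c = 1 -> P b (- a) d (- c) -> P a b c d).
  { intros a b c d D H. apply PS in H; [|nia]. apply PS in H; [|nia]. apply PS in H; [|nia].
    now rewrite !Z.opp_involutive in H. }
  assert (Main : forall n a b c d, (Z.abs_nat c < n)%nat -> a * d - b * c = 1 -> P a b c d).
  { intros n. induction n as [|n IH]; intros a b c d Hn D. lia.
    destruct (Z.eq_dec c 0) as [->|Nc].
    - assert (A : a = 1 /\ d = 1 \/ a = -1 /\ d = -1).
      { assert (AD : a * d = 1) by lia. destruct (Z.eq_mul_1 a d AD) as [-> | ->]; lia. }
      destruct A as [[-> ->]|[-> ->]].
      + assert (X := Tn b 1 0 0 1 eq_refl P1).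
        replace (0 + b * 1) with b in X by ring. now replace (1 + b * 0) with 1 in X by ring.
      + assert (M1 : P (-1) 0 0 (-1)) by exact (PS 0 (-1) 1 0 eq_refl (PS 1 0 0 1 eq_refl P1)).
        assert (X := Tn (- b) (-1) 0 0 (-1) eq_refl M1).
        replace (0 + - b * -1) with b in X by ring. now replace (-1 + - b * 0) with (-1) in X by ring.
    - assert (X : P a (b - d / c * a) c (d - d / c * c)).
      { apply S3. nia. apply IH; [|nia].
        replace (d - d / c * c) with (d mod c) by (rewrite (Z.mod_eq d c Nc); ring).
        assert (Z.abs (d mod c) < Z.abs c) by (apply Z.mod_bound_abs; auto). lia. }
      apply (Tn (d / c)) in X; [|nia].
      replace (b - d / c * a + d / c * a) with b in X by ring. now replace (d - d / c * c + d / c * c) with d in X by ring. }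
  intros a b c d D. apply (Main (S (Z.abs_nat c))); auto.
Qed.
End Matrices.

Definition den (c d : Z) (tau : C) : C := RtoC (IZR c) * tau + RtoC (IZR d).
Definition mob (a b c d : Z) (tau : C) : C := den a b tau / den c d tau.

Lemma den_nz a b c d tau : (a * d - b * c = 1)%Z -> UH tau -> den c d tau <> 0.
Proof.
  intros D H E. unfold den in E. assert (I := f_equal Im E). assert (R := f_equal Re E).
  rewrite im_plus, im_RtoC, im_scal_l, im_RtoC in I. rewrite re_plus, re_RtoC, re_scal_l, re_RtoC in R.
  red in H. assert (c = 0)%Z by (apply eq_IZR; nra). subst c. assert (d = 0)%Z by (apply eq_IZR; lra). subst d. lia.
Qed.

Lemma UH_mob a b c d tau : (a * d - b * c = 1)%Z -> UH tau -> UH (mob a b c d tau).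
Proof.
  intros D H. assert (N := den_nz a b c d tau D H). unfold mob.
  apply (f_equal IZR) in D. rewrite minus_IZR, !mult_IZR in D.
  destruct tau as [x y]. red in H. simpl in H.
  assert (E1 : den c d (x, y) = (IZR c * x + IZR d, IZR c * y)%R) by (apply C_ext; simpl; ring).
  assert (E2 : den a b (x, y) = (IZR a * x + IZR b, IZR a * y)%R) by (apply C_ext; simpl; ring).
  rewrite E1 in *. rewrite E2. set (p := (IZR c * x + IZR d)%R) in *. set (q := (IZR c * y)%R) in *.
  assert (P : (0 < p * p + q * q)%R).
  { apply Rnot_le_lt. intros L. apply N. assert (p * p = 0 /\ q * q = 0)%R as [P Q] by nra.
    apply Rsqr_0_uniq in P. apply Rsqr_0_uniq in Q. now rewrite P, Q. }
  red. simpl. replace ((IZR a * x + IZR b) * (- q / (p * (p * 1) + q * (q * 1))) + IZR a * y * (p / (p * (p * 1) + q * (q * 1))))%R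
    with ((IZR a * y * p - (IZR a * x + IZR b) * q) * / (p * p + q * q))%R by (field; lra).
  apply Rmult_lt_0_compat. 2: now apply Rinv_0_lt_compat.
  unfold p, q. replace (IZR a * y * (IZR c * x + IZR d) - (IZR a * x + IZR b) * (IZR c * y))%R with ((IZR a * IZR d - IZR b * IZR c) * y)%R by ring.
  rewrite D. lra.
Qed.

Definition par (z : Z) : bool := Z.odd z.

(** The row vector x times the matrix (a b; c d), with the order of the entries reversed to match [cov]. *)
Definition act (a b c d : Z) (x : bool * bool) : bool * bool :=
  (xorb (fst x && par d) (snd x && par b), xorb (fst x && par c) (snd x && par a)).

(** The automorphy factor is multiplicative and the action on indices is a right action, so the law
    propagates from the generators along [sl2_ind]. *)
Lemma cov_sl2 K k (F : family) : const_group K -> cov K k F ->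
  forall a b c d, (a * d - b * c = 1)%Z -> forall x, exists u, K u /\ forall tau, UH tau ->
    F (fst x) (snd x) (mob a b c d tau) =
    u * den c d tau ^ k * F (fst (act a b c d x)) (snd (act a b c d x)) tau.
Proof.
  intros [K1 [KM KI]] HF. apply (sl2_ind (fun a b c d => forall x, exists u, K u /\ forall tau, UH tau ->
    F (fst x) (snd x) (mob a b c d tau) =
    u * den c d tau ^ k * F (fst (act a b c d x)) (snd (act a b c d x)) tau)).
  - intros [x y]. exists 1. split; auto. intros tau H. unfold mob, den, act. cbn [fst snd par Z.odd].
    replace (1 * tau + 0) with tau by ring. replace (0 * tau + 1) with (RtoC 1) by ring.
    replace (tau / 1) with tau by (field). rewrite Cpow_1_l. destruct x, y; simpl; ring.
  - intros a b c d D IH [x y]. destruct (IH (x, y)) as [u [Ku Hu]]. cbn [fst snd] in *.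
    destruct (act a b c d (x, y)) as [x' y'] eqn:A. cbn [fst snd] in Hu.
    destruct (HF x' y') as [[v [Kv Hv]] _].
    exists (u * v). split; auto. intros tau H.
    replace (act b (- a) d (- c) (x, y)) with (y', x').
    2:{ unfold act in *. cbn [fst snd] in *. inversion A. unfold par. rewrite !Z.odd_opp. f_equal; apply xorb_comm. }
    assert (Nt := UH_nz _ H). assert (N := den_nz b (- a) d (- c) tau ltac:(lia) H).
    assert (E1 : den c d (inv_neg tau) * tau = den d (- c) tau).
    { unfold den, inv_neg. rewrite opp_IZR, RtoC_opp. field. auto. }
    assert (E2 : mob b (- a) d (- c) tau = mob a b c d (inv_neg tau)).
    { unfold mob. rewrite <- E1. unfold den at 1 3. unfold inv_neg at 2. rewrite opp_IZR, RtoC_opp. rewrite <- E1 in N. field.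
      repeat split; auto. intros X. apply N. rewrite X. ring. }
    rewrite E2, Hu, Hv by now try apply UH_inv_neg. rewrite <- E1, Cpow_mult_l. cbn [fst snd]. ring.
  - intros a b c d D IH [x y]. destruct (IH (x, y)) as [u [Ku Hu]]. cbn [fst snd] in *.
    destruct (act a b c d (x, y)) as [x' y'] eqn:A. cbn [fst snd] in Hu.
    destruct (HF x' y') as [_ [v [Kv Hv]]].
    exists (u * v). split; auto. intros tau H.
    replace (act a (a + b) c (c + d) (x, y)) with (xorb x' y', y').
    2:{ unfold act in *. cbn [fst snd] in *. inversion A. unfold par. rewrite !Z.odd_add.
        destruct x, y, (Z.odd a), (Z.odd b), (Z.odd c), (Z.odd d); reflexivity. }
    assert (E : forall p q, den p (p + q) tau = den p q (tau + 1)).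
    { intros p q. unfold den. rewrite plus_IZR, RtoC_plus. ring. }
    unfold mob in *. rewrite !E, Hu, Hv by now try apply UH_plus_1. cbn [fst snd]. ring.
  - intros a b c d D IH [x y]. destruct (IH (x, y)) as [u [Ku Hu]]. cbn [fst snd] in *.
    destruct (act a b c d (x, y)) as [x' y'] eqn:A. cbn [fst snd] in Hu.
    destruct (HF (xorb x' y') y') as [_ [v [Kv Hv]]]. destruct (KI v Kv) as [Nv Kv'].
    exists (u * / v). split; auto. intros tau H.
    replace (act a (b - a) c (d - c) (x, y)) with (xorb x' y', y').
    2:{ unfold act in *. cbn [fst snd] in *. inversion A. unfold par, Z.sub. rewrite !Z.odd_add, !Z.odd_opp.
        destruct x, y, (Z.odd a), (Z.odd b), (Z.odd c), (Z.odd d); reflexivity. }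
    assert (E : forall p q, den p (q - p) tau = den p q (tau - 1)).
    { intros p q. unfold den. rewrite minus_IZR, RtoC_minus. ring. }
    assert (E1 : F (xorb x' y') y' tau = v * F x' y' (tau - 1)).
    { replace tau with (tau - 1 + 1) at 1 by ring. rewrite Hv by now apply UH_minus_1. now destruct x', y'. }
    unfold mob in *. rewrite !E, Hu by now apply UH_minus_1. cbn [fst snd]. rewrite E1. field. auto.
Qed.

(** * Forms with q-expansions *)

(** Coefficients of p(x^2). *)
Definition dil (p : nat -> C) (n : nat) : C := if Nat.even n then p (Nat.div2 n) else 0.
(** Coefficients of p(-x). *)
Definition alt (p : nat -> C) (n : nat) : C := (- (1)) ^ n * p n.

Lemma dil_even p n : dil p (2 * n) = p n.
Proof. unfold dil. rewrite Nat.even_mul. simpl. f_equal. apply Nat.div2_double. Qed.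

Lemma dil_odd p n : dil p (2 * n + 1) = 0.
Proof. unfold dil. rewrite Nat.even_add, Nat.even_mul. reflexivity. Qed.

Lemma PS_dil p : PS p -> PS (dil p).
Proof.
  intros H r Hr. destruct (H (r * r)%R ltac:(nra)) as [B [HB0 HB]]. exists B.
  assert (P : forall n, (0 <= Cmod (dil p n) * r ^ n)%R).
  { intros n. apply Rmult_le_pos. apply Cmod_ge_0. apply pow_le; lra. }
  split; auto. intros n. apply Rle_trans with (rsum (fun n => Cmod (dil p n) * r ^ n)%R (2 * n)).
  { apply rsum_mono; auto. lia. }
  replace (rsum (fun n => Cmod (dil p n) * r ^ n)%R (2 * n)) with (rsum (fun n => Cmod (p n) * (r * r) ^ n)%R n); auto.
  clear HB. induction n; auto. replace (2 * S n)%nat with (S (S (2 * n))) by lia. cbn [rsum]. rewrite IHn.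
  replace (S (2 * n)) with (2 * n + 1)%nat at 1 by lia. rewrite dil_odd, dil_even, Cmod_0.
  rewrite pow_mult. replace (r ^ 2)%R with (r * r)%R by ring. ring.
Qed.

Lemma psum_dil p x : PS p -> (Cmod x < 1)%R -> psum (dil p) x = psum p (x * x).
Proof.
  intros H Hx. assert (P := Cmod_ge_0 x).
  assert (A := PS_CS _ _ (PS_dil p H) Hx).
  assert (Hxx : (Cmod (x * x) < 1)%R) by (rewrite Cmod_mult; apply Rle_lt_trans with (Cmod x * 1)%R; [apply Rmult_le_compat_l|]; lra).
  assert (B := PS_CS _ _ H Hxx).
  apply (Clim_unique (csum (fun n => p n * (x * x) ^ n))); auto.
  eapply flim_ext; [apply eventually_filter| |exact (Clim_sub _ _ (fun n => (2 * n)%nat) ltac:(intros; cbv beta; lia) A)].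
  intros n. cbv beta. induction n; auto. replace (2 * S n)%nat with (S (S (2 * n))) by lia. cbn [csum]. rewrite IHn.
  replace (S (2 * n)) with (2 * n + 1)%nat at 1 by lia. rewrite dil_odd, dil_even.
  rewrite Cpow_mult_r. replace (x ^ 2) with (x * x) by (simpl; ring). ring.
Qed.

Lemma Cmod_m1_pow n : Cmod ((- (1)) ^ n) = 1%R.
Proof. rewrite Cmod_pow, Cmod_opp, Cmod_1. apply pow1. Qed.

Lemma PS_alt p : PS p -> PS (alt p).
Proof.
  intros H r Hr. destruct (H r Hr) as [B HB]. exists B. eapply majorant_le; [|exact HB].
  intros n. unfold alt. rewrite Cmod_mult, Cmod_m1_pow, Rmult_1_l. split; [|lra].
  apply Rmult_le_pos. apply Cmod_ge_0. apply pow_le; lra.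
Qed.

Lemma psum_alt p x : PS p -> (Cmod x < 1)%R -> psum (alt p) x = psum p (- x).
Proof.
  intros H Hx. apply CS_CSeries. eapply CS_ext; [|apply PS_CS; [exact H|now rewrite Cmod_opp]].
  intros n. unfold alt. replace (- x) with (- (1) * x) by ring. rewrite Cpow_mult_l. ring.
Qed.

(** A family of forms is given by its expansions in powers of e(tau/2), in which all its members have one;
    sums, products and derivatives are then taken on coefficients. *)
Definition coeffs := bool -> bool -> nat -> C.

Definition nome (tau : C) : C := e2pi (tau / 2).

Definition Fn (p : coeffs) : family := fun a b tau => psum (p a b) (nome tau).

(** Weight 2k and level two; the q-expansions of all components express holomorphy at all cusps. *)
Definition mf (k : nat) (p : coeffs) : Prop := (forall a b, PS (p a b)) /\ cov is_one (2 * k) (Fn p).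

Lemma nome_lt tau : UH tau -> (Cmod (nome tau) < 1)%R.
Proof. intros H. apply Cmod_e2pi_lt. now apply UH_half. Qed.

Lemma nome_sq tau : nome tau * nome tau = e2pi tau.
Proof. unfold nome. rewrite <- e2pi_add. f_equal. field. Qed.

Lemma nome_4 tau : e2pi tau * e2pi tau = e2pi (2 * tau).
Proof. rewrite <- e2pi_add. f_equal. ring. Qed.

Lemma nome_neg tau : e2pi ((tau + 1) / 2) = - nome tau.
Proof. unfold nome. replace ((tau + 1) / 2) with (tau / 2 + 1 / 2) by field. rewrite e2pi_add, e2pi_half. ring. Qed.

Definition mf_zero : coeffs := fun _ _ _ => 0.
Definition mf_one : coeffs := fun _ _ n => match n with O => 1 | _ => 0 end.
Definition mf_plus (p q : coeffs) : coeffs := fun a b n => p a b n + q a b n.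
Definition mf_scal (c : C) (p : coeffs) : coeffs := fun a b n => c * p a b n.
Definition mf_mult (p q : coeffs) : coeffs := fun a b => cconv (p a b) (q a b).

Lemma Fn_plus p q a b tau : (forall a b, PS (p a b)) -> (forall a b, PS (q a b)) -> UH tau ->
  Fn (mf_plus p q) a b tau = Fn p a b tau + Fn q a b tau.
Proof. intros Hp Hq H. apply psum_plus; auto. now apply nome_lt. Qed.

Lemma Fn_scal c p a b tau : (forall a b, PS (p a b)) -> UH tau -> Fn (mf_scal c p) a b tau = c * Fn p a b tau.
Proof. intros Hp H. apply psum_scal; auto. now apply nome_lt. Qed.

Lemma Fn_mult p q a b tau : (forall a b, PS (p a b)) -> (forall a b, PS (q a b)) -> UH tau ->
  Fn (mf_mult p q) a b tau = Fn p a b tau * Fn q a b tau.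
Proof. intros Hp Hq H. apply PS_psum_cconv; auto. now apply nome_lt. Qed.

Lemma mf_intro k p : (forall a b, PS (p a b)) ->
  (forall a b tau, UH tau -> Fn p a b (inv_neg tau) = tau ^ (2 * k) * Fn p b a tau) ->
  (forall a b tau, UH tau -> Fn p a b (tau + 1) = Fn p (xorb a b) b tau) -> mf k p.
Proof. intros H S T. split; auto. now apply cov_one. Qed.

Lemma mf_plus_mf k p q : mf k p -> mf k q -> mf k (mf_plus p q).
Proof.
  intros [Hp Cp] [Hq Cq]. apply mf_intro.
  - intros a b. now apply PS_plus.
  - intros a b tau H. rewrite !Fn_plus by auto using UH_inv_neg.
    rewrite (cov_one_S _ _ Cp), (cov_one_S _ _ Cq) by auto. ring.
  - intros a b tau H. rewrite !Fn_plus by auto using UH_plus_1.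
    now rewrite (cov_one_T _ _ Cp), (cov_one_T _ _ Cq) by auto.
Qed.

Lemma mf_scal_mf k c p : mf k p -> mf k (mf_scal c p).
Proof.
  intros [Hp Cp]. apply mf_intro.
  - intros a b. now apply PS_scal.
  - intros a b tau H. rewrite !Fn_scal by auto using UH_inv_neg. rewrite (cov_one_S _ _ Cp) by auto. ring.
  - intros a b tau H. rewrite !Fn_scal by auto using UH_plus_1. now rewrite (cov_one_T _ _ Cp) by auto.
Qed.

Lemma mf_mult_mf k l p q : mf k p -> mf l q -> mf (k + l) (mf_mult p q).
Proof.
  intros [Hp Cp] [Hq Cq]. apply mf_intro.
  - intros a b. now apply PS_cconv.
  - intros a b tau H. rewrite !Fn_mult by auto using UH_inv_neg.
    rewrite (cov_one_S _ _ Cp), (cov_one_S _ _ Cq) by auto. rewrite Nat.mul_add_distr_l, Cpow_add_r. ring.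
  - intros a b tau H. rewrite !Fn_mult by auto using UH_plus_1.
    now rewrite (cov_one_T _ _ Cp), (cov_one_T _ _ Cq) by auto.
Qed.

Lemma PS_zero : PS (fun _ => 0).
Proof. apply PS_const. Qed.

Lemma Fn_zero a b tau : Fn mf_zero a b tau = 0.
Proof. apply CS_CSeries. apply CS_ext with (fun _ => 0). intros; unfold mf_zero; ring. apply CS_zero. Qed.

Lemma mf_zero_mf k : mf k mf_zero.
Proof.
  apply mf_intro. intros; apply PS_zero. all: intros; rewrite !Fn_zero; ring.
Qed.

(** All coefficients of G_k, the constant one included. *)
Definition gk (k n : nat) : C := match n with O => gconst k | _ => sig (k - 1) n end.

Lemma sig_0 s : sig s 0 = 0.
Proof. reflexivity. Qed.

Lemma PS_head c (a : nat -> C) : PS a -> PS (fun n => match n with O => c | _ => a n end).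
Proof.
  intros H r Hr. destruct (H r Hr) as [B [HB0 HB]]. exists (Cmod c + B)%R. split.
  - intros n. apply Rmult_le_pos. apply Cmod_ge_0. apply pow_le; lra.
  - intros [|n]. cbn [rsum]. assert (X := HB O). simpl in X. generalize (Cmod_ge_0 c). lra.
    eapply Rle_trans; [|apply Rplus_le_compat_l, (HB (S n))].
    induction n as [|n IH]; cbn [rsum] in *. assert (X := HB0 O). simpl in *. lra. simpl pow in *. lra.
Qed.

Lemma PS_gk k : PS (gk k).
Proof. apply PS_head, PS_sig. Qed.

Lemma psum_head c (a : nat -> C) x : PS a -> a O = 0 -> (Cmod x < 1)%R ->
  psum (fun n => match n with O => c | _ => a n end) x = c + psum a x.
Proof.
  intros H H0 Hx. apply CS_CSeries. replace (c + psum a x) with (c * x ^ 0 + psum a x) by (simpl; ring).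
  refine (CS_S (fun n => (match n with O => c | _ => a n end) * x ^ n) _ _).
  eapply CS_ext; [|replace (psum a x) with (psum a x - a O * x ^ 0) by (rewrite H0; ring); exact (CS_S_inv _ _ (PS_CS _ _ H Hx))].
  intros n. reflexivity.
Qed.

Lemma Gk_psum k tau : UH tau -> Gk k tau = psum (gk k) (e2pi tau).
Proof. intros H. symmetry. apply psum_head. apply PS_sig. apply sig_0. now apply Cmod_e2pi_lt. Qed.

(** The expansions of the members of [hecke] for a function with q-expansion p. *)
Definition hecke_coeffs (k : nat) (p : nat -> C) : coeffs := fun a b =>
  match a, b with
  | false, false => dil p
  | true, false => fun n => 2 ^ k * dil (dil p) n
  | false, true => p
  | true, true => alt p
  end.

Lemma PS_hecke k p a b : PS p -> PS (hecke_coeffs k p a b).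
Proof. intros H. destruct a, b; cbn; auto using PS_alt, PS_dil, PS_scal. Qed.

Lemma Fn_hecke k p f a b tau : PS p -> (forall tau, UH tau -> f tau = psum p (e2pi tau)) -> UH tau ->
  Fn (hecke_coeffs k p) a b tau = hecke k f a b tau.
Proof.
  intros Hp E H. assert (Q := nome_lt tau H). assert (Q1 := Cmod_e2pi_lt tau H). unfold Fn. destruct a, b; cbn [hecke hecke_coeffs].
  - rewrite psum_alt, E, nome_neg; auto. now apply UH_half1.
  - rewrite psum_scal, !psum_dil, E, nome_sq, nome_4; auto using PS_dil, UH_double. now rewrite nome_sq.
  - rewrite E; auto using UH_half.
  - rewrite psum_dil, E, nome_sq; auto.
Qed.

Lemma cov_ext K k (F G : family) : (forall a b tau, UH tau -> F a b tau = G a b tau) -> cov K k F -> cov K k G.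
Proof.
  intros E H a b. destruct (H a b) as [[c [Kc S]] [d [Kd T]]].
  split; [exists c|exists d]; (split; [auto|]); intros tau Ht; rewrite <- !E by auto using UH_inv_neg, UH_plus_1; auto.
Qed.

Lemma level_one_Gk k : (2 <= k)%nat -> level_one is_one (2 * k) (Gk (2 * k)).
Proof. intros Hk. apply cov_one; intros _ _ tau H. now apply Gk_inv_neg. now apply Gk_T. Qed.

Lemma mf_hecke_Gk k : (2 <= k)%nat -> mf k (hecke_coeffs (2 * k) (gk (2 * k))).
Proof.
  intros Hk. split. intros; apply PS_hecke, PS_gk.
  eapply cov_ext; [|apply hecke_cov; [apply const_group_one|now apply level_one_Gk]].
  intros a b tau H. symmetry. apply Fn_hecke; auto using PS_gk, Gk_psum.
Qed.

(** A form of level one, as a constant family. *)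
Definition lev1 (p : nat -> C) : coeffs := fun _ _ => dil p.

Lemma Fn_lev1 p a b tau : PS p -> UH tau -> Fn (lev1 p) a b tau = psum p (e2pi tau).
Proof. intros Hp H. unfold Fn, lev1. rewrite psum_dil, nome_sq; auto. now apply nome_lt. Qed.

Lemma mf_lev1_Gk k : (2 <= k)%nat -> mf k (lev1 (gk (2 * k))).
Proof.
  intros Hk. split. intros; apply PS_dil, PS_gk.
  eapply cov_ext; [|now apply level_one_Gk].
  intros a b tau H. cbv beta. rewrite Fn_lev1 by auto using PS_gk. now apply Gk_psum.
Qed.

(** * Quasimodular forms *)

Lemma CD_UH_ext (f g : C -> C) tau l : UH tau -> (forall w, UH w -> f w = g w) -> CD f tau l -> CD g tau l.
Proof.
  intros H E. apply CD_ext_loc with (d := (Im tau / 2)%R). red in H; lra.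
  intros w Hw. apply E. now apply (UH_near tau w).
Qed.

(** The derivation (2 pi i)^(-1) d/dtau in terms of the variable e(tau/2). *)
Definition mf_D (p : coeffs) : coeffs := fun a b n => / 2 * (INR n * p a b n).

Lemma PS_D p : (forall a b, PS (p a b)) -> forall a b, PS (mf_D p a b).
Proof. intros H a b. apply PS_scal, PS_n, H. Qed.

Lemma CD_Fn p a b tau : (forall a b, PS (p a b)) -> UH tau ->
  CD (Fn p a b) tau (2 * PI * Ci * Fn (mf_D p) a b tau).
Proof.
  intros Hp H. eapply CD_eq.
  - apply (CD_qseries (p a b) (fun w => w / 2)). auto. now apply UH_half. apply CD_div, CD_id.
  - unfold Fn, mf_D. rewrite psum_scal by auto using PS_n, nome_lt. unfold nome, Cdiv. ring.
Qed.

(** Differentiate the transformation law under inversion. *)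
Lemma Fn_D_inv_neg p a b tau (f : C -> C) f' : (forall a b, PS (p a b)) -> UH tau ->
  (forall w, UH w -> Fn p a b (inv_neg w) = f w) -> CD f tau (2 * PI * Ci * f') ->
  Fn (mf_D p) a b (inv_neg tau) = tau ^ 2 * f'.
Proof.
  intros Hp H E D. assert (Nt := UH_nz tau H). assert (H' := UH_inv_neg tau H).
  assert (D1 := CD_comp _ _ _ _ _ (CD_Fn p a b _ Hp H') (CD_inv_neg tau Nt)).
  apply (CD_UH_ext _ f) in D1; auto. assert (X := CD_unique _ _ _ _ D D1).
  assert (N2 := TwoPiCi_nz). set (t := 2 * PI * Ci) in *. assert (N3 := Cpow_nz _ 2 Nt).
  replace f' with (t * f' * / t) by (field; auto). rewrite X. field. auto.
Qed.

Lemma Fn_D_T p a b tau : (forall a b, PS (p a b)) -> UH tau ->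
  (forall w, UH w -> Fn p a b (w + 1) = Fn p (xorb a b) b w) ->
  Fn (mf_D p) a b (tau + 1) = Fn (mf_D p) (xorb a b) b tau.
Proof.
  intros Hp H E.
  assert (D1 := CD_comp _ (fun w => w + 1) _ _ _ (CD_Fn p a b _ Hp (UH_plus_1 tau H)) (CD_plus _ _ _ _ _ (CD_id tau) (CD_const 1 tau))).
  apply (CD_UH_ext _ (Fn p (xorb a b) b)) in D1; auto. assert (X := CD_unique _ _ _ _ D1 (CD_Fn p (xorb a b) b tau Hp H)).
  assert (N2 := TwoPiCi_nz). set (t := 2 * PI * Ci) in *.
  replace (Fn (mf_D p) (xorb a b) b tau) with (t * Fn (mf_D p) (xorb a b) b tau * / t) by (field; auto). rewrite <- X. field. auto.
Qed.

Definition g2 : coeffs := lev1 (gk 2).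

Lemma PS_g2 a b : PS (g2 a b).
Proof. apply PS_dil, PS_gk. Qed.

Lemma Fn_g2 a b tau : UH tau -> Fn g2 a b tau = Gk 2 tau.
Proof. intros H. unfold g2. rewrite Fn_lev1 by auto using PS_gk. symmetry. now apply Gk_psum. Qed.

Lemma four_nz : RtoC 4 <> 0.
Proof. intros X; apply RtoC_inj in X; lra. Qed.

Lemma Fn_D_g2 a b tau : UH tau -> Fn (mf_D g2) a b (inv_neg tau) =
  tau ^ 4 * Fn (mf_D g2) a b tau + tau ^ 3 / (PI * Ci) * Gk 2 tau - tau ^ 2 / (8 * (PI * Ci) ^ 2).
Proof.
  intros H. assert (NP := PI_nz). assert (NC := UH_nz Ci UH_Ci). assert (N4 := four_nz).
  assert (N8 : RtoC 8 <> 0) by (intros X; apply RtoC_inj in X; lra).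
  erewrite (Fn_D_inv_neg g2 a b tau (fun w => w ^ 2 * Fn g2 a b w - w / (4 * PI * Ci))).
  - instantiate (1 := tau ^ 2 * Fn (mf_D g2) a b tau + tau / (PI * Ci) * Gk 2 tau - 1 / (8 * (PI * Ci) ^ 2)).
    field. auto.
  - apply PS_g2.
  - auto.
  - intros w Hw. rewrite !Fn_g2 by auto using UH_inv_neg. now apply Gk_2_inv_neg.
  - eapply CD_eq. apply CD_minus. apply CD_mult. apply CD_pow, CD_id. apply CD_Fn; auto using PS_g2.
    apply CD_div, CD_id. rewrite Fn_g2 by auto. replace (RtoC (INR 2)) with (RtoC 2) by (f_equal; simpl; ring).
    cbn [Nat.sub]. simpl Cpow. field. auto.
Qed.

(** The combination of the derivative and the square of G_2 in which the anomalies cancel (a multiple of the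
    Eisenstein series of weight 4, by Ramanujan's identity). *)
Definition e4 : coeffs := mf_plus (mf_D g2) (mf_scal 2 (mf_mult g2 g2)).

Lemma Fn_e4 a b tau : UH tau -> Fn e4 a b tau = Fn (mf_D g2) a b tau + 2 * (Gk 2 tau * Gk 2 tau).
Proof.
  intros H. unfold e4. assert (Hm : forall a b, PS (mf_mult g2 g2 a b)) by (intros; apply PS_cconv; apply PS_g2).
  rewrite Fn_plus; auto using PS_D, PS_g2. rewrite Fn_scal, Fn_mult, !Fn_g2; auto using PS_g2.
  intros; apply PS_scal, Hm.
Qed.

Lemma mf_e4 : mf 2 e4.
Proof.
  apply mf_intro.
  - intros a b. apply PS_plus. apply PS_D, PS_g2. apply PS_scal, PS_cconv; apply PS_g2.
  - intros a b tau H. assert (NP := PI_nz). assert (NC := UH_nz Ci UH_Ci). assert (N4 := four_nz).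
    assert (N8 : RtoC 8 <> 0) by (intros X; apply RtoC_inj in X; lra).
    rewrite !Fn_e4 by auto using UH_inv_neg. rewrite Fn_D_g2, Gk_2_inv_neg by auto.
    unfold mf_D at 2, g2 at 2, lev1. fold (mf_D g2). 
    change (Fn (fun _ _ n => / 2 * (INR n * dil (gk 2) n)) b a tau) with (Fn (mf_D g2) a b tau).
    simpl Nat.mul. simpl Cpow. field. auto.
  - intros a b tau H. rewrite !Fn_e4 by auto using UH_plus_1. rewrite Gk_T. f_equal.
    apply Fn_D_T; auto using PS_g2. intros w Hw. rewrite !Fn_g2 by auto using UH_plus_1. apply Gk_T.
Qed.

(** Serre's derivation: adding 2w G_2 f to the derivative of a form f of weight w = 2k cancels the failure
    of modularity. *)
Definition serre (k : nat) (p : coeffs) : coeffs := mf_plus (mf_D p) (mf_scal (4 * INR k) (mf_mult g2 p)).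

Lemma Fn_serre k p a b tau : (forall a b, PS (p a b)) -> UH tau ->
  Fn (serre k p) a b tau = Fn (mf_D p) a b tau + 4 * INR k * (Gk 2 tau * Fn p a b tau).
Proof.
  intros Hp H. unfold serre. assert (Hm : forall a b, PS (mf_mult g2 p a b)) by (intros; apply PS_cconv; auto using PS_g2).
  rewrite Fn_plus; auto using PS_D, PS_g2. rewrite Fn_scal, Fn_mult, !Fn_g2; auto using PS_g2.
  intros; apply PS_scal, Hm.
Qed.

Lemma mf_serre k p : mf k p -> mf (S k) (serre k p).
Proof.
  intros [Hp Cp]. apply mf_intro.
  - intros a b. apply PS_plus. apply PS_D, Hp. apply PS_scal, PS_cconv; auto using PS_g2.
  - intros a b tau H. assert (NP := PI_nz). assert (NC := UH_nz Ci UH_Ci). assert (N4 := four_nz).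
    assert (Nt := UH_nz tau H).
    rewrite !Fn_serre by auto using UH_inv_neg. rewrite Gk_2_inv_neg, (cov_one_S _ _ Cp) by auto.
    erewrite (Fn_D_inv_neg p a b tau (fun w => w ^ (2 * k) * Fn p b a w)); auto.
    2: now apply (cov_one_S _ _ Cp).
    2:{ instantiate (1 := INR (2 * k) * tau ^ (2 * k - 1) / (2 * PI * Ci) * Fn p b a tau + tau ^ (2 * k) * Fn (mf_D p) b a tau).
        eapply CD_eq. apply CD_mult. apply CD_pow, CD_id. now apply CD_Fn. assert (N2 := two_nz). cbv beta. field. auto. }
    replace (2 * S k)%nat with (S (S (2 * k))) by lia. rewrite !Cpow_S.
    destruct k as [|k].
    + change (INR 0) with 0%R. change (INR (2 * 0)) with 0%R. simpl Cpow. assert (N2 := two_nz). field. auto.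
    + replace (2 * S k - 1)%nat with (2 * k + 1)%nat by lia. replace (2 * S k)%nat with (S (2 * k + 1))%nat by lia. rewrite !Cpow_S.
      replace (INR (S (2 * k + 1))) with (2 * INR (S k))%R by (rewrite !S_INR, plus_INR, mult_INR; simpl; ring).
      rewrite RtoC_mult. field. auto.
  - intros a b tau H. rewrite !Fn_serre by auto using UH_plus_1. rewrite Gk_T, (cov_one_T _ _ Cp) by auto. f_equal.
    apply Fn_D_T; auto. now apply (cov_one_T _ _ Cp).
Qed.

(** Quasimodular forms of weight 2k, as polynomials in G_2 over the modular forms; only the component (1,1)
    of the families enters. The generation by cases suits the proofs of closure, [qm_normal] gives the
    polynomial. *)
Inductive qm : nat -> (C -> C) -> Prop :=
| qm_mf k p f : mf k p -> (forall tau, UH tau -> f tau = Fn p true true tau) -> qm k f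
| qm_G2 k f g : qm k f -> (forall tau, UH tau -> g tau = Gk 2 tau * f tau) -> qm (S k) g
| qm_plus k f g h : qm k f -> qm k g -> (forall tau, UH tau -> h tau = f tau + g tau) -> qm k h.

Lemma qm_ext k f g : qm k f -> (forall tau, UH tau -> g tau = f tau) -> qm k g.
Proof.
  intros H. revert g. induction H as [k p f Hp E|k f h Hf IH E|k f1 f2 h H1 IH1 H2 IH2 E]; intros g Eg.
  - apply (qm_mf k p); auto. intros. rewrite Eg; auto.
  - apply (qm_G2 k f); auto. intros. rewrite Eg; auto.
  - apply (qm_plus k f1 f2); auto. intros. rewrite Eg; auto.
Qed.

Lemma qm_zero k : qm k (fun _ => 0).
Proof. apply (qm_mf k mf_zero). apply mf_zero_mf. intros; symmetry; apply Fn_zero. Qed.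

Lemma qm_scal k c f : qm k f -> qm k (fun tau => c * f tau).
Proof.
  intros H. induction H as [k p f Hp E|k f h Hf IH E|k f1 f2 h H1 IH1 H2 IH2 E].
  - apply (qm_mf k (mf_scal c p)). now apply mf_scal_mf. intros. rewrite Fn_scal, E; auto. apply Hp.
  - eapply qm_G2. exact IH. intros. cbv beta. rewrite E by auto. ring.
  - eapply qm_plus. exact IH1. exact IH2. intros. cbv beta. rewrite E by auto. ring.
Qed.

Lemma qm_mult k l f g : qm k f -> qm l g -> qm (k + l) (fun tau => f tau * g tau).
Proof.
  intros H Hg. induction H as [k p f Hp E|k f h Hf IH E|k f1 f2 h H1 IH1 H2 IH2 E].
  - induction Hg as [l q g Hq Eg|l g h Hg IH Eg|l g1 g2 h H1 IH1 H2 IH2 Eg].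
    + apply (qm_mf _ (mf_mult p q)). now apply mf_mult_mf.
      intros. rewrite Fn_mult, E, Eg; auto. apply Hp. apply Hq.
    + rewrite Nat.add_succ_r. eapply qm_G2. exact IH. intros. cbv beta. rewrite Eg by auto. ring.
    + eapply qm_plus. exact IH1. exact IH2. intros. cbv beta. rewrite Eg by auto. ring.
  - cbn [Nat.add]. eapply qm_G2. exact IH. intros. cbv beta. rewrite E by auto. ring.
  - eapply qm_plus. exact IH1. exact IH2. intros. cbv beta. rewrite E by auto. ring.
Qed.

Lemma CD_Gk2 tau : UH tau -> CD (Gk 2) tau (2 * PI * Ci * Fn (mf_D g2) true true tau).
Proof. intros H. apply (CD_UH_ext (Fn g2 true true)); auto using Fn_g2. apply CD_Fn; auto using PS_g2. Qed.

(** On modular forms by Serre's derivation, on G_2 by [e4], and on polynomials by the product rule. *)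
Lemma qm_D k f : qm k f -> exists g, qm (S k) g /\ forall tau, UH tau -> CD f tau (2 * PI * Ci * g tau).
Proof.
  intros H. induction H as [k p f Hp E|k f h Hf IH E|k f1 f2 h H1 IH1 H2 IH2 E].
  - exists (fun tau => Fn (serre k p) true true tau + - (4 * INR k) * (Gk 2 tau * Fn p true true tau)). split.
    + eapply qm_plus. eapply qm_mf. apply mf_serre, Hp. reflexivity.
      apply qm_scal. eapply qm_G2. eapply qm_mf. exact Hp. reflexivity. reflexivity. reflexivity.
    + intros tau H. destruct Hp as [Hp _]. rewrite Fn_serre by auto. eapply CD_eq.
      apply (CD_UH_ext (Fn p true true)); auto. intros; symmetry; auto. now apply CD_Fn. ring.
  - destruct IH as [g [Hg D]].
    exists (fun tau => (Fn e4 true true tau * f tau + (- (2)) * (Gk 2 tau * (Gk 2 tau * f tau))) + Gk 2 tau * g tau). split.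
    + eapply qm_plus. eapply qm_plus. apply (qm_mult 2 k (Fn e4 true true) f); auto. eapply qm_mf. apply mf_e4. reflexivity.
      apply (qm_scal (2 + k)). eapply qm_G2. eapply qm_G2. exact Hf. reflexivity. reflexivity. reflexivity.
      eapply qm_G2. exact Hg. reflexivity. reflexivity.
    + intros tau H. rewrite Fn_e4 by auto. eapply CD_eq.
      apply (CD_UH_ext (fun w => Gk 2 w * f w)); auto. intros; symmetry; auto. apply CD_mult. now apply CD_Gk2. now apply D. ring.
  - destruct IH1 as [g1 [Hg1 D1]], IH2 as [g2 [Hg2 D2]]. exists (fun tau => g1 tau + g2 tau). split.
    + eapply qm_plus. exact Hg1. exact Hg2. reflexivity.
    + intros tau H. eapply CD_eq. apply (CD_UH_ext (fun w => f1 w + f2 w)); auto. intros; symmetry; auto.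
      apply CD_plus; auto. ring.
Qed.

Lemma qm_normal k f : qm k f -> exists Hs : nat -> coeffs,
  (forall j, (j <= k)%nat -> mf (k - j) (Hs j)) /\
  forall tau, UH tau -> f tau = csum (fun j => Fn (Hs j) true true tau * Gk 2 tau ^ j) (S k).
Proof.
  intros H. induction H as [k p f Hp E|k f h Hf IH E|k f1 f2 h H1 IH1 H2 IH2 E].
  - exists (fun j => match j with O => p | _ => mf_zero end). split.
    + intros [|j] Hj. now rewrite Nat.sub_0_r. apply mf_zero_mf.
    + intros tau H. rewrite csum_Sl, (csum_ext _ (fun _ => 0)), csum_zero. rewrite E by auto. simpl. ring.
      intros i _. rewrite Fn_zero. ring.
  - destruct IH as [Hs [Hm Hf']]. exists (fun j => match j with O => mf_zero | S j => Hs j end). split.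
    + intros [|j] Hj. apply mf_zero_mf. simpl. apply Hm. lia.
    + intros tau H. rewrite csum_Sl, Fn_zero, E, Hf' by auto. rewrite <- csum_scal.
      rewrite (csum_ext (fun i => Gk 2 tau * (Fn (Hs i) true true tau * Gk 2 tau ^ i)) (fun i => Fn (Hs i) true true tau * Gk 2 tau ^ S i)). ring.
      intros i _. rewrite Cpow_S. ring.
  - destruct IH1 as [A [Am Af]], IH2 as [B [Bm Bf]]. exists (fun j => mf_plus (A j) (B j)). split.
    + intros j Hj. apply mf_plus_mf; auto.
    + intros tau H. rewrite E, Af, Bf by auto. rewrite <- csum_plus. apply csum_ext. intros j Hj.
      rewrite Fn_plus; auto. ring. apply Am; lia. apply Bm; lia.
Qed.

(** * Real powers of complex numbers *)

Lemma polar_mult (x y : R) : (cos x, sin x) * (cos y, sin y) = (cos (x + y), sin (x + y)).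
Proof. rewrite cos_plus, sin_plus. apply C_ext; simpl; ring. Qed.

Lemma Crpow_plus z (a b : R) : Crpow z (a + b) = Crpow z a * Crpow z b.
Proof.
  unfold Crpow. rewrite Rpower_plus, RtoC_mult. replace ((a + b) * Carg z)%R with (a * Carg z + b * Carg z)%R by ring.
  rewrite <- polar_mult. ring.
Qed.

Lemma Crpow_0 z : Crpow z 0 = 1.
Proof.
  unfold Crpow, Rpower. rewrite !Rmult_0_l, exp_0, cos_0, sin_0. apply C_ext; simpl; ring.
Qed.

Lemma Crpow_inv z k : Crpow z (- k) * Crpow z k = 1.
Proof. rewrite <- Crpow_plus, Rplus_opp_l. apply Crpow_0. Qed.

Lemma Crpow_nz z k : Crpow z k <> 0.
Proof. intros E. assert (X := Crpow_inv z k). rewrite E, Cmult_0_r in X. symmetry in X. apply RtoC_inj in X. lra. Qed.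

Lemma Crpow_opp z k : Crpow z (- k) = / Crpow z k.
Proof. rewrite <- (Cmult_1_r (Crpow z (- k))), <- (Cinv_r (Crpow z k) (Crpow_nz z k)), Cmult_assoc, Crpow_inv. ring. Qed.

Lemma Re_bound (z : C) : z <> 0 -> (-1 <= Re z / Cmod z <= 1)%R.
Proof.
  intros N. apply Cmod_nz in N. assert (H := re_le_Cmod z). apply Rabs_le_between in H.
  split. apply Rle_div_r; auto. lra. apply Rle_div_l; auto. lra.
Qed.

Lemma Cmod_sq z : (Cmod z * Cmod z = Re z * Re z + Im z * Im z)%R.
Proof.
  unfold Cmod. rewrite sqrt_sqrt. destruct z; simpl; ring. destruct z as [x y]; simpl. nra.
Qed.

Lemma polar_Carg (z : C) : z <> 0 -> RtoC (Cmod z) * (cos (Carg z), sin (Carg z)) = z.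
Proof.
  intros N. assert (P := Cmod_nz z N). assert (B := Re_bound z N). assert (S := Cmod_sq z).
  assert (Sq : (Cmod z * sqrt (1 - (Re z / Cmod z)²) = Rabs (Im z))%R).
  { rewrite <- (Rabs_right (Cmod z)) at 1 by lra. rewrite <- sqrt_Rsqr_abs, <- sqrt_mult.
    rewrite <- sqrt_Rsqr_abs. f_equal. unfold Rsqr. field_simplify; [|lra]. nra.
    apply Rle_0_sqr. unfold Rsqr. nra. }
  unfold Carg. destruct (Rle_dec 0 (Im z)) as [L|L].
  - rewrite cos_acos, sin_acos by lra. apply C_ext; simpl.
    + field. lra.
    + rewrite Sq, Rabs_right by lra. ring.
  - rewrite cos_neg, sin_neg, cos_acos, sin_acos by lra. apply C_ext; simpl.
    + field. lra.
    + rewrite Rabs_left in Sq by lra. lra.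
Qed.

Lemma Crpow_1 (z : C) : z <> 0 -> Crpow z 1 = z.
Proof.
  intros N. unfold Crpow. rewrite Rpower_1, Rmult_1_l by now apply Cmod_nz. now apply polar_Carg.
Qed.

Lemma Crpow_nat (z : C) n : z <> 0 -> Crpow z (INR n) = z ^ n.
Proof.
  intros N. induction n. apply Crpow_0. rewrite S_INR, Crpow_plus, IHn, Crpow_1, Cpow_S by auto. ring.
Qed.

Lemma Cmod_Crpow z k : Cmod (Crpow z k) = Rpower (Cmod z) k.
Proof.
  unfold Crpow. rewrite Cmod_mult, Cmod_R, Rabs_right by (apply Rle_ge, Rlt_le, exp_pos).
  replace (Cmod (cos (k * Carg z), sin (k * Carg z))) with 1%R. ring.
  unfold Cmod. simpl fst; simpl snd. rewrite <- sqrt_1 at 1. f_equal. rewrite <- (sin2_cos2 (k * Carg z)). unfold Rsqr. ring.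
Qed.

Lemma unit_sqrt u : is_unit u -> exists s, is_unit s /\ s * s = u.
Proof.
  intros H. exists (Crpow u (1 / 2)). split.
  - red. rewrite Cmod_Crpow, H. unfold Rpower. rewrite ln_1, Rmult_0_r. apply exp_0.
  - rewrite <- Crpow_plus. replace (1 / 2 + 1 / 2)%R with 1%R by field. apply Crpow_1. now apply is_unit_nz.
Qed.

(** Halving an argument in the open interval (-pi, pi) leads to the right half plane. *)
Lemma Crpow_half_pos z : Im z <> 0%R -> (0 < Re (Crpow z (- (1 / 2))))%R.
Proof.
  intros I. assert (N : z <> 0). { intros E. apply I. now rewrite E. }
  assert (P := Cmod_nz z N). assert (S := Cmod_sq z).
  assert (B : (-1 < Re z / Cmod z < 1)%R).
  { assert (Re z * Re z < Cmod z * Cmod z)%R by nra.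
    split. apply Rlt_div_r; auto. nra. apply Rlt_div_l; auto. nra. }
  apply acos_bound_lt in B. assert (P2 := PI_RGT_0).
  unfold Crpow. rewrite re_scal_l. apply Rmult_lt_0_compat. apply exp_pos. simpl.
  apply cos_gt_0; unfold Carg; destruct (Rle_dec 0 (Im z)); lra.
Qed.

(** * Continuous square roots are unique up to a global sign *)

(** The intermediate value theorem along a segment. *)
Lemma IVT_UH (r : C -> R) z0 z1 : UH z0 -> UH z1 ->
  (forall z, UH z -> forall e, (0 < e)%R -> exists d, (0 < d)%R /\ forall w, (Cmod (w - z) < d)%R -> (Rabs (r w - r z) < e)%R) ->
  (0 < r z0)%R -> (r z1 < 0)%R -> exists z, UH z /\ r z = 0%R.
Proof.
  intros H0 H1 Hc P0 P1. set (ga := fun t : R => z0 + t * (z1 - z0)).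
  destruct (Ranalysis5.IVT_interv (fun t => (- r (ga t))%R) 0 1) as [t [Ht Et]].
  - intros t Ht. assert (U := UH_segment z0 z1 t Ht H0 H1).
    intros e He. destruct (Hc _ U e He) as [d [Hd Hw]].
    exists (d / (Cmod (z1 - z0) + 1))%R. assert (Q := Cmod_ge_0 (z1 - z0)). split.
    apply Rdiv_lt_0_compat; lra. intros x [_ Hx]. simpl in *. unfold Rdist in *.
    replace (- r (ga x) - - r (ga t))%R with (- (r (ga x) - r (ga t)))%R by ring. rewrite Rabs_Ropp. apply Hw.
    unfold ga. replace (z0 + x * (z1 - z0) - (z0 + t * (z1 - z0))) with (RtoC (x - t) * (z1 - z0)) by (rewrite RtoC_minus; ring).
    rewrite Cmod_mult, Cmod_R. apply Rlt_div_r in Hx; [|lra]. assert (Q2 := Rabs_pos (x - t)). nra.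
  - lra.
  - unfold ga. replace (z0 + RtoC 0 * (z1 - z0)) with z0 by ring. lra.
  - unfold ga. replace (z0 + RtoC 1 * (z1 - z0)) with z1 by ring. lra.
  - exists (ga t). split. now apply UH_segment. lra.
Qed.

(** The quotient of B and Q takes only the values 1 and -1. If it changed sign, the real part of w B would
    vanish somewhere on a segment, but there it is plus or minus the real part of w Q. *)
Lemma sign_const (B Q : C -> C) w : (forall z, UH z -> exists l, CD B z l) ->
  (forall z, UH z -> B z * B z = Q z * Q z) -> (forall z, UH z -> (0 < Re (w * Q z))%R) ->
  exists e, is_unit e /\ forall z, UH z -> B z = e * Q z.
Proof.
  intros HB E Hw.
  assert (Pm : forall z, UH z -> B z = Q z \/ B z = - Q z).
  { intros z H. destruct (Ceq_dec (B z) (Q z)) as [|N]; auto. right. apply Cminus_nz in N.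
    replace (B z) with ((B z * B z - Q z * Q z) / (B z - Q z) - Q z) by (field; auto). rewrite E by auto.
    unfold Cdiv. ring. }
  assert (Main : forall e : C, e = 1 \/ e = - (1) -> B Ci = e * Q Ci -> forall z, UH z -> B z = e * Q z).
  { intros e He E0 z H. destruct (Ceq_dec (B z) (e * Q z)) as [|N]; auto. exfalso.
    assert (Ee : e * e = 1) by (destruct He as [-> | ->]; ring).
    assert (B1 : B z = - (e * Q z)).
    { destruct He as [-> | ->], (Pm z H) as [X|X]; rewrite X in *; try ring; exfalso; apply N; ring. }
    destruct (IVT_UH (fun z => Re (w * (e * B z))) Ci z UH_Ci H) as [x [Hx Ex]].
    - intros x Hx eps Heps. destruct (HB x Hx) as [l Hl]. apply CD_flim in Hl.
      set (K := Cmod (w * e)). assert (HK := Cmod_ge_0 (w * e)). fold K in HK.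
      destruct (Hl (eps / (K + 1))%R ltac:(apply Rdiv_lt_0_compat; lra)) as [d [Hd Hy]].
      exists d. split; auto. intros y Hyd.
      destruct (Ceq_dec y x) as [->|Ny].
      + unfold Rminus. rewrite Rplus_opp_r, Rabs_R0. auto.
      + replace (Re (w * (e * B y)) - Re (w * (e * B x)))%R with (Re ((w * e) * (B y - B x))).
        eapply Rle_lt_trans. apply re_le_Cmod. rewrite Cmod_mult. fold K.
        assert (Y : (Cmod (B y - B x) < eps / (K + 1))%R) by (apply Hy; auto).
        apply Rlt_div_r in Y; [|lra]. assert (Q2 := Cmod_ge_0 (B y - B x)). nra.
        unfold Rminus. rewrite <- re_opp, <- re_plus. f_equal. ring.
    - rewrite E0. replace (w * (e * (e * Q Ci))) with (e * e * (w * Q Ci)) by ring. rewrite Ee, Cmult_1_l. apply Hw, UH_Ci.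
    - rewrite B1. replace (w * (e * - (e * Q z))) with (- (e * e * (w * Q z))) by ring. rewrite Ee, Cmult_1_l, re_opp.
      specialize (Hw z H). lra.
    - assert (X := Hw x Hx). destruct He as [-> | ->], (Pm x Hx) as [Y|Y]; rewrite Y in Ex.
      1: replace (w * (1 * Q x)) with (w * Q x) in Ex by ring.
      2: replace (w * (1 * - Q x)) with (- (w * Q x)) in Ex by ring.
      3: replace (w * (- (1) * Q x)) with (- (w * Q x)) in Ex by ring.
      4: replace (w * (- (1) * - Q x)) with (w * Q x) in Ex by ring.
      all: rewrite ?re_opp in Ex; lra. }
  destruct (Pm Ci UH_Ci) as [X|X].
  - exists 1. split. apply Cmod_1. apply Main; auto. rewrite X. ring.
  - exists (- (1)). split. red. rewrite Cmod_opp. apply Cmod_1. apply Main; auto. rewrite X. ring.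
Qed.

(** * The forms of weight -1/2 *)

Definition hpt (a b : bool) (tau : C) : C :=
  match a, b with
  | false, false => tau | true, false => 2 * tau | false, true => tau / 2 | true, true => (tau + 1) / 2
  end.

(** With these factors the squares of [mhalf] transform with constants of modulus 1. *)
Definition hnorm (a b : bool) : C := match a, b with true, false => RtoC (sqrt 2) | _, _ => 1 end.

(** For the index (1,1) this is, up to a constant, the coefficient of W at the zero multi-index. *)
Definition mhalf (a b : bool) (tau : C) : C := hnorm a b * eta (hpt a b tau) / eta tau ^ 2.

Lemma sqrt2_sq : RtoC (sqrt 2) * RtoC (sqrt 2) = 2.
Proof. rewrite <- RtoC_mult, sqrt_sqrt. auto. lra. Qed.

Lemma hnorm_nz a b : hnorm a b <> 0.
Proof.
  destruct a, b; cbn; try apply C1_nz. intros E. assert (X := sqrt2_sq). rewrite E in X.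
  apply two_nz. rewrite <- X. ring.
Qed.

Lemma mhalf_nz a b tau : mhalf a b tau <> 0.
Proof.
  assert (N := Cpow_nz _ 2 (eta_nz tau)). intros E.
  apply (Cmult_neq_0 _ _ (hnorm_nz a b) (eta_nz (hpt a b tau))).
  replace (hnorm a b * eta (hpt a b tau)) with (mhalf a b tau * eta tau ^ 2) by (unfold mhalf; field; auto using eta_nz).
  rewrite E. ring.
Qed.

Lemma UH_hpt a b tau : UH tau -> UH (hpt a b tau).
Proof. destruct a, b; cbn; auto using UH_half1, UH_double, UH_half. Qed.

Lemma CD_hpt a b tau : exists l, CD (hpt a b) tau l.
Proof.
  destruct a, b; eexists; cbn.
  - apply CD_div. apply CD_plus. apply CD_id. apply CD_const.
  - apply CD_scal, CD_id.
  - apply CD_div, CD_id.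
  - apply CD_id.
Qed.

Lemma CD_mhalf a b tau : UH tau -> exists l, CD (mhalf a b) tau l.
Proof.
  intros H. destruct (CD_hpt a b tau) as [l Hl]. eexists. unfold mhalf, Cdiv. apply CD_mult.
  - apply CD_scal. apply (CD_comp eta (hpt a b)). now apply CD_eta, UH_hpt. exact Hl.
  - apply (CD_inv (fun w => eta w ^ 2)). apply Cpow_nz, eta_nz. apply CD_pow. now apply CD_eta.
Qed.

Lemma mhalf_sq a b tau : mhalf a b tau * mhalf a b tau = hecke 1 (fun z => eta z ^ 2) a b tau / (eta tau ^ 2) ^ 2.
Proof.
  assert (N := eta_nz tau). unfold mhalf. destruct a, b; cbn [hecke hpt hnorm].
  2: replace (2 ^ 1) with (RtoC (sqrt 2) * RtoC (sqrt 2)) by (rewrite sqrt2_sq; simpl; ring).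
  all: simpl Cpow; field; auto.
Qed.

Lemma level_one_eta2 : level_one is_unit 1 (fun z => eta z ^ 2).
Proof.
  intros _ _. split.
  - exists (- Ci). split. red. rewrite Cmod_opp. unfold Cmod. simpl. transitivity (sqrt 1); [f_equal; ring|apply sqrt_1].
    intros tau H. rewrite eta_S by auto. simpl. ring.
  - exists (e2pi (/ 24) ^ 2). split. red. rewrite Cmod_pow, Cmod_e2pi.
    replace (Im (/ 24)) with 0%R by (rewrite <- RtoC_inv by lra; reflexivity). rewrite Rmult_0_r, exp_0. apply pow1.
    intros tau H. now rewrite eta_T, Cpow_mult_l.
Qed.

Lemma CD_mob a b c d tau : (a * d - b * c = 1)%Z -> UH tau -> exists l, CD (mob a b c d) tau l.
Proof.
  intros D H. assert (X : forall p q, CD (den p q) tau (RtoC (IZR p) * 1 + 0)).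
  { intros p q. apply CD_plus. apply CD_scal, CD_id. apply CD_const. }
  eexists. unfold mob, Cdiv. apply CD_mult. apply X. apply (CD_inv (den c d)). now apply (den_nz a b). apply X.
Qed.

(** The squares are covariant of weight -1, so after division by the transformed function and a constant the
    left-hand side is a continuous square root of 1/(c tau + d), like the principal branch. *)
Lemma mhalf_sl2 a b c d x : (a * d - b * c = 1)%Z -> exists u, is_unit u /\ forall tau, UH tau ->
  mhalf (fst x) (snd x) (mob a b c d tau) =
  u * Crpow (den c d tau) (- (1 / 2)) * mhalf (fst (act a b c d x)) (snd (act a b c d x)) tau.
Proof.
  intros D.
  destruct (cov_sl2 _ _ _ const_group_unit (hecke_cov _ _ _ const_group_unit level_one_eta2) a b c d D x) as [u1 [Hu1 E1]].
  destruct (cov_sl2 _ _ _ const_group_unit level_one_eta2 a b c d D x) as [u2 [Hu2 E2]].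
  set (y := act a b c d x) in *.
  destruct const_group_unit as [_ [KM KI]]. destruct (KI _ Hu2) as [N2 Hu2'].
  destruct (unit_sqrt (u1 * (/ u2 * / u2))) as [s [Hs Es]]; auto. destruct (KI _ Hs) as [Ns Hs'].
  set (B := fun tau => mhalf (fst x) (snd x) (mob a b c d tau) * / (s * mhalf (fst y) (snd y) tau)).
  assert (Nm : forall tau, s * mhalf (fst y) (snd y) tau <> 0) by (intros; apply Cmult_neq_0; auto using mhalf_nz).
  (* If c = 0 then c tau + d is a constant, possibly negative, and w turns its root to 1; otherwise
     c tau + d is never real and its root has positive real part. *)
  destruct (sign_const B (fun tau => Crpow (den c d tau) (- (1 / 2)))
    (if Z.eq_dec c 0 then / Crpow (den c d Ci) (- (1 / 2)) else 1)) as [e [He Ee]].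
  - intros tau H. destruct (CD_mob a b c d tau D H) as [l1 D1].
    destruct (CD_mhalf (fst x) (snd x) _ (UH_mob a b c d tau D H)) as [l2 D2].
    destruct (CD_mhalf (fst y) (snd y) tau H) as [l3 D3].
    eexists. unfold B. apply CD_mult. apply (CD_comp (mhalf (fst x) (snd x)) (mob a b c d)). exact D2. exact D1.
    apply (CD_inv (fun w => s * mhalf (fst y) (snd y) w)); auto. apply CD_scal. exact D3.
  - intros tau H. assert (Nd := den_nz a b c d tau D H). rewrite <- Crpow_plus.
    replace (- (1 / 2) + - (1 / 2))%R with (- (1))%R by field. rewrite Crpow_opp, Crpow_1 by auto.
    unfold B. transitivity (mhalf (fst x) (snd x) (mob a b c d tau) * mhalf (fst x) (snd x) (mob a b c d tau)
       * / (s * s * (mhalf (fst y) (snd y) tau * mhalf (fst y) (snd y) tau))).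
    field. auto using mhalf_nz. 
    rewrite !mhalf_sq, Es, E1, E2 by auto.
    assert (Z : hecke 1 (fun z => eta z ^ 2) (fst y) (snd y) tau <> 0).
    { intros X. assert (Y := mhalf_sq (fst y) (snd y) tau). rewrite X in Y. unfold Cdiv in Y. rewrite Cmult_0_l in Y.
      revert Y. apply Cmult_neq_0; apply mhalf_nz. }
    set (h := hecke 1 (fun z => eta z ^ 2) (fst y) (snd y) tau) in *. clearbody h.
    assert (Nu := is_unit_nz _ Hu1). simpl Cpow. field. repeat split; auto using eta_nz.
  - intros tau H. destruct (Z.eq_dec c 0) as [->|Nc].
    + replace (den 0 d Ci) with (den 0 d tau) by (unfold den; ring).
      rewrite Cmult_comm, Cinv_r by apply Crpow_nz. simpl. lra.
    + rewrite Cmult_1_l. apply Crpow_half_pos. unfold den. rewrite im_plus, im_scal_l, im_RtoC.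
      red in H. assert (IZR c <> 0)%R by (now apply not_0_IZR). nra.
  - exists (e * s). split; auto. intros tau H. replace (mhalf (fst x) (snd x) (mob a b c d tau)) with
      (B tau * (s * mhalf (fst y) (snd y) tau)). rewrite Ee by auto. ring. unfold B. field. split; auto using mhalf_nz.
Qed.

(** An eta quotient is a fractional power of q times the exponential of a power series. *)
Lemma mhalf_expansion a b : exists (kappa : R) p, PS p /\ forall tau, UH tau ->
  mhalf a b tau = e2pi (kappa * tau) * psum p (nome tau).
Proof.
  set (E := mf_plus (mf_scal (- (1)) (hecke_coeffs 0 lphi)) (mf_scal 2 (lev1 lphi))).
  assert (P1 : forall a b, PS (hecke_coeffs 0 lphi a b)) by (intros; apply PS_hecke, PS_lphi).
  assert (P2 : forall a b, PS (lev1 lphi a b)) by (intros; apply PS_dil, PS_lphi).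
  assert (PE : forall a b, PS (E a b)) by (intros; apply PS_plus; apply PS_scal; auto).
  assert (X : exists (kappa : R) (c : C), forall tau, hpt a b tau / 24 = kappa * tau + c + tau / 24 + tau / 24).
  { destruct a, b; cbn.
    - exists (- (1 / 16))%R, (/ RtoC 48). intros. rewrite RtoC_opp, RtoC_div by lra. field.
    - exists 0%R, (RtoC 0). intros. field.
    - exists (- (1 / 16))%R, (RtoC 0). intros. rewrite RtoC_opp, RtoC_div by lra. field.
    - exists (- (1 / 24))%R, (RtoC 0). intros. rewrite RtoC_opp, RtoC_div by lra. field. }
  destruct X as [kappa [c Hc]].
  exists kappa, (fun n => hnorm a b * e2pi c * pexp (E a b) n). split. now apply PS_scal, PS_pexp.
  intros tau H. rewrite psum_scal, psum_pexp by auto using PS_pexp, nome_lt.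
  change (psum (E a b) (nome tau)) with (Fn E a b tau). unfold E.
  rewrite Fn_plus by (auto; intros; now apply PS_scal). rewrite !Fn_scal by auto. rewrite Fn_lev1 by auto using PS_lphi.
  rewrite (Fn_hecke 0 lphi (fun z => psum lphi (e2pi z))) by auto using PS_lphi.
  replace (hecke 0 (fun z => psum lphi (e2pi z)) a b tau) with (psum lphi (e2pi (hpt a b tau))) by (destruct a, b; cbn; ring).
  unfold mhalf, eta, Phi. rewrite Hc, !e2pi_add. 
  replace (- (1) * psum lphi (e2pi (hpt a b tau)) + 2 * psum lphi (e2pi tau)) with
    (- psum lphi (e2pi (hpt a b tau)) + - (- psum lphi (e2pi tau)) + - (- psum lphi (e2pi tau))) by ring.
  rewrite !Cexp_add, !(Cexp_opp (- _)). simpl Cpow. field. split. apply Cexp_nz. apply e2pi_nz.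
Qed.

(** * Quasimodular forms of half-integral weight for Gamma(4) *)

(** The constant in the transformation law of [mhalf] under g, read off at tau = i. *)
Definition eta_mult (g : SL2Z) : C :=
  mhalf true true (moebius g Ci) * / (Crpow (denom g Ci) (- (1 / 2)) * mhalf true true Ci).

(** The entries of g are odd on the diagonal and even off it. *)
Lemma Gamma4_act g : Gamma 4 g -> act (sa g) (sb g) (sc g) (sd g) (true, true) = (true, true).
Proof.
  intros [[a Ha] [[b Hb] [[c Hc] [d Hd]]]]. unfold act, par.
  replace (Z.odd (sa g)) with true by (replace (sa g) with (1 + 2 * (2 * a))%Z by lia; now rewrite Z.odd_add_mul_2).
  replace (Z.odd (sd g)) with true by (replace (sd g) with (1 + 2 * (2 * d))%Z by lia; now rewrite Z.odd_add_mul_2).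
  replace (Z.odd (sb g)) with false by (replace (sb g) with (0 + 2 * (2 * b))%Z by lia; now rewrite Z.odd_add_mul_2).
  replace (Z.odd (sc g)) with false by (replace (sc g) with (0 + 2 * (2 * c))%Z by lia; now rewrite Z.odd_add_mul_2).
  reflexivity.
Qed.

Lemma eta_mult_spec g : Gamma 4 g -> is_unit (eta_mult g) /\ forall tau, UH tau ->
  mhalf true true (moebius g tau) = eta_mult g * Crpow (denom g tau) (- (1 / 2)) * mhalf true true tau.
Proof.
  intros H. destruct (mhalf_sl2 _ _ _ _ (true, true) (sdet g)) as [u [Hu E]]. rewrite Gamma4_act in E by auto.
  cbn [fst snd] in E. replace (eta_mult g) with u. split; auto.
  unfold eta_mult. change (moebius g Ci) with (mob (sa g) (sb g) (sc g) (sd g) Ci). rewrite E by apply UH_Ci.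
  change (denom g Ci) with (den (sc g) (sd g) Ci). field. split. apply mhalf_nz. apply Crpow_nz.
Qed.

Lemma denom_nz g tau : UH tau -> denom g tau <> 0.
Proof. apply (den_nz _ _ _ _ _ (sdet g)). Qed.

Lemma UH_moebius g tau : UH tau -> UH (moebius g tau).
Proof. apply (UH_mob _ _ _ _ _ (sdet g)). Qed.

Lemma moebius_mul g h tau : UH tau ->
  denom (SL2Z_mul g h) tau = denom g (moebius h tau) * denom h tau /\
  moebius (SL2Z_mul g h) tau = moebius g (moebius h tau).
Proof.
  intros H. assert (N := denom_nz h tau H).
  assert (X : forall p q, (RtoC (IZR p) * moebius h tau + RtoC (IZR q)) * denom h tau =
    RtoC (IZR (p * sa h + q * sc h)) * tau + RtoC (IZR (p * sb h + q * sd h))).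
  { intros p q. rewrite !plus_IZR, !mult_IZR, !RtoC_plus, !RtoC_mult. unfold moebius, denom in *.
    revert N. generalize (RtoC (IZR p)) (RtoC (IZR q)) (RtoC (IZR (sa h))) (RtoC (IZR (sb h))) (RtoC (IZR (sc h))) (RtoC (IZR (sd h))).
    intros x1 x2 x3 x4 x5 x6 N. field. auto. }
  assert (E : denom (SL2Z_mul g h) tau = denom g (moebius h tau) * denom h tau) by (unfold denom at 2; now rewrite X).
  split; auto. assert (N2 := denom_nz g _ (UH_moebius h tau H)).
  transitivity ((RtoC (IZR (sa (SL2Z_mul g h))) * tau + RtoC (IZR (sb (SL2Z_mul g h)))) / denom (SL2Z_mul g h) tau). reflexivity.
  rewrite E. cbn [sa sb SL2Z_mul]. rewrite <- X.
  transitivity ((RtoC (IZR (sa g)) * moebius h tau + RtoC (IZR (sb g))) / denom g (moebius h tau)). 2: reflexivity.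
  field. auto.
Qed.

Lemma Crpow_weight (z : C) n : z <> 0 -> Crpow z (- (1 / 2) + INR (2 * n)) = Crpow z (- (1 / 2)) * z ^ (2 * n).
Proof. intros N. now rewrite Crpow_plus, Crpow_nat. Qed.

(** Applying the transformation law of a nowhere vanishing function under g h in two ways gives the cocycle
    relation in weight -1/2; the factor of even integral weight is an honest cocycle. *)
Lemma eta_mult_system n : multiplier_system (Gamma 4) (- (1 / 2) + INR (2 * n)) eta_mult.
Proof.
  split. intros g H. now apply eta_mult_spec.
  intros g h tau Hg Hh H. destruct (moebius_mul g h tau H) as [Ed Em].
  assert (H' := UH_moebius h tau H). assert (Nh := denom_nz h tau H). assert (Ng := denom_nz g _ H').
  assert (Hgh : Gamma 4 (SL2Z_mul g h)).
  { destruct Hg as [[a Ha] [[b Hb] [[c Hc] [d Hd]]]], Hh as [[a' Ha'] [[b' Hb'] [[c' Hc'] [d' Hd']]]].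
    repeat split; cbn [sa sb sc sd SL2Z_mul].
    - exists (4 * a * a' + a + a' + b * sc h)%Z. replace (sa g) with (4 * a + 1)%Z by lia. replace (sa h) with (4 * a' + 1)%Z by lia. rewrite Hb. ring.
    - exists (sa g * b' + b * sd h)%Z. rewrite Hb, Hb'. ring.
    - exists (c * sa h + sd g * c')%Z. rewrite Hc, Hc'. ring.
    - exists (c * sb h + 4 * d * d' + d + d')%Z. replace (sd g) with (4 * d + 1)%Z by lia. replace (sd h) with (4 * d' + 1)%Z by lia. rewrite Hc. ring. }
  destruct (eta_mult_spec g Hg) as [_ Eg]. destruct (eta_mult_spec h Hh) as [_ Eh].
  destruct (eta_mult_spec _ Hgh) as [_ Egh]. specialize (Egh tau H). rewrite Em, Eg, Eh in Egh by auto.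
  assert (Nm := mhalf_nz true true tau).
  rewrite !Crpow_weight by (try apply denom_nz; auto). rewrite Ed in *.
  assert (X : eta_mult (SL2Z_mul g h) * Crpow (denom g (moebius h tau) * denom h tau) (- (1 / 2)) =
    eta_mult g * eta_mult h * Crpow (denom g (moebius h tau)) (- (1 / 2)) * Crpow (denom h tau) (- (1 / 2))).
  { transitivity (eta_mult (SL2Z_mul g h) * Crpow (denom g (moebius h tau) * denom h tau) (- (1 / 2)) * mhalf true true tau * / mhalf true true tau).
    field; auto. rewrite <- Egh. field; auto. }
  rewrite Cmult_assoc, X, Cpow_mult_l. ring.
Qed.

Lemma Fn_sl2 n p g a b tau : mf n p -> UH tau -> 
  let y := act (sa g) (sb g) (sc g) (sd g) (a, b) in
  Fn p a b (moebius g tau) = denom g tau ^ (2 * n) * Fn p (fst y) (snd y) tau.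
Proof.
  intros [Hp Cp] H y. destruct (cov_sl2 _ _ _ const_group_one Cp _ _ _ _ (sdet g) (a, b)) as [u [-> E]].
  cbn [fst snd] in E. change (moebius g tau) with (mob (sa g) (sb g) (sc g) (sd g) tau). rewrite E by auto.
  rewrite Cmult_1_l. reflexivity.
Qed.

Lemma modular_form_mhalf n p c : mf n p ->
  modular_form (Gamma 4) (- (1 / 2) + INR (2 * n)) eta_mult (fun tau => c * mhalf true true tau * Fn p true true tau).
Proof.
  intros Hm. assert (Hp := proj1 Hm). split; [|split].
  - intros tau H. destruct (CD_mhalf true true tau H) as [l Hl]. eexists.
    apply (CD_mult (fun tau => c * mhalf true true tau)). apply CD_scal. exact Hl. now apply CD_Fn.
  - intros g tau Hg H. assert (E := Fn_sl2 n p g true true tau Hm H). cbv zeta in E. rewrite Gamma4_act in E by auto.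
    cbn [fst snd] in E. rewrite E, (proj2 (eta_mult_spec g Hg)), Crpow_weight by auto using denom_nz. ring.
  - intros g. destruct (mhalf_sl2 _ _ _ _ (true, true) (sdet g)) as [u [_ Eu]].
    set (y := act (sa g) (sb g) (sc g) (sd g) (true, true)) in *.
    destruct (mhalf_expansion (fst y) (snd y)) as [kappa [q [Hq Eq]]].
    exists 2%nat, (2 * kappa)%R, (fun i => c * u * cconv q (p (fst y) (snd y)) i). split. lia.
    intros tau H. apply CS_is_series. assert (Nd := denom_nz g tau H).
    replace (slash (fun tau => c * mhalf true true tau * Fn p true true tau) (- (1 / 2) + INR (2 * n)) g tau)
      with (c * u * e2pi (kappa * tau) * psum (cconv q (p (fst y) (snd y))) (nome tau)).
    + eapply CS_ext; [|apply CS_scal, PS_CS; [apply PS_cconv; auto|now apply nome_lt]].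
      intros i. cbv beta. replace (RtoC ((INR i + 2 * kappa) / INR 2) * tau) with (kappa * tau + INR i * (tau / 2)).
      rewrite e2pi_add, e2pi_nat. unfold nome. ring.
      replace (INR 2) with 2%R by (simpl; ring). rewrite RtoC_div, RtoC_plus, RtoC_mult by lra. field.
    + rewrite PS_psum_cconv by auto using nome_lt. unfold slash.
      assert (E := Fn_sl2 n p g true true tau Hm H). cbv zeta in E. fold y in E. rewrite E.
      change (mhalf true true (moebius g tau)) with (mhalf (fst (true, true)) (snd (true, true)) (mob (sa g) (sb g) (sc g) (sd g) tau)).
      rewrite Eu, Eq by auto. fold (denom g tau). change (den (sc g) (sd g) tau) with (denom g tau).
      rewrite Crpow_opp, Crpow_weight by auto. unfold Fn.
      assert (N1 := Crpow_nz (denom g tau) (- (1 / 2))). assert (N2 := Cpow_nz _ (2 * n) Nd). field. auto.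
Qed.

(** The polynomial in G_2 of [qm_normal], with coefficients multiplied by the form of weight -1/2. *)
Lemma quasimodular_mhalf n f c : qm n f ->
  quasimodular_form (Gamma 4) (- (1 / 2) + INR (2 * n)) (fun tau => c * mhalf true true tau * f tau).
Proof.
  intros H. destruct (qm_normal n f H) as [Hs [Hm E]].
  exists eta_mult, n, (fun j tau => c * mhalf true true tau * Fn (Hs j) true true tau). split; [|split].
  - apply eta_mult_system.
  - intros j Hj. replace (- (1 / 2) + INR (2 * n) - 2 * INR j)%R with (- (1 / 2) + INR (2 * (n - j)))%R.
    now apply modular_form_mhalf, Hm.
    rewrite !mult_INR, minus_INR by auto. simpl. ring.
  - intros tau Ht. rewrite E by auto. rewrite <- csum_scal, csum_sum_n. apply sum_n_ext. intros j.
    replace (G2 tau) with (Gk 2 tau). apply Cmult_assoc.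
    unfold G2, Gk. f_equal.
    + replace (RtoC (-1)) with (RtoC (1 - 2 * INR 1)) by (f_equal; simpl; ring). rewrite (zeta_neg 0). change (2 * 1)%nat with 2%nat. field.
    + unfold psum. f_equal. apply functional_extensionality. intros i. rewrite sigma1_sig, e2pi_nat. reflexivity.
Qed.

Lemma quasimodular_form_ext G k f g : (forall tau, UH tau -> g tau = f tau) -> quasimodular_form G k f -> quasimodular_form G k g.
Proof.
  intros E [v [d [F [Hv [HF Hf]]]]]. exists v, d, F. repeat split; try apply Hv; try apply HF; auto.
  intros tau H. rewrite E by auto. now apply Hf.
Qed.

(** * Formal power series in infinitely many variables *)

Definition lsum (l : list C) : C := fold_right Cplus 0 l.

Lemma lsum_app l l' : lsum (l ++ l') = lsum l + lsum l'.
Proof. induction l; simpl. ring. unfold lsum in *. simpl. rewrite IHl. ring. Qed.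

(** The coefficient of the j-th power of the first variable, as a series in the others. Multiplication is
    the Cauchy product with respect to it, which reduces the ring laws to sums over one index. *)
Definition slice (f : mps) (j : nat) : mps := fun J => f (j :: J).

Lemma mps_mul_nil f g : mps_mul f g [] = f [] * g [].
Proof. unfold mps_mul. simpl. ring. Qed.

Lemma mps_mul_cons f g a I : mps_mul f g (a :: I) = csum (fun j => mps_mul (slice f j) (slice g (a - j)) I) (S a).
Proof.
  assert (X : forall n, lsum (map (fun p => f (fst p) * g (snd p)) (flat_map (fun j =>
      map (fun p => (j :: fst p, (a - j)%nat :: snd p)) (mi_splits I)) (seq 0 n))) =
    csum (fun j => mps_mul (slice f j) (slice g (a - j)) I) n).
  { intros n. induction n as [|n IH]. reflexivity.
    rewrite seq_S, flat_map_app, map_app, lsum_app. etransitivity; [exact (f_equal2 Cplus IH eq_refl)|].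
    cbn [csum flat_map]. rewrite app_nil_r, map_map. reflexivity. }
  exact (X (S a)).
Qed.

Lemma mi_splits_in I J K : In (J, K) (mi_splits I) ->
  (mi_size J + mi_size K = mi_size I)%nat /\
  (forall i, (mi_wt_from i J + mi_wt_from i K = mi_wt_from i I)%nat) /\ (mi_is_zero I = true -> J = I /\ K = I).
Proof.
  revert J K. induction I as [|a I IH]; intros J K H.
  - destruct H as [H|[]]. inversion H. auto.
  - cbn [mi_splits] in H. apply in_flat_map in H. destruct H as [j [Hj H]]. apply in_seq in Hj.
    apply in_map_iff in H. destruct H as [[J' K'] [E H]]. cbn [fst snd] in E. inversion E. subst.
    destruct (IH J' K' H) as [E1 [E2 E3]]. unfold mi_size in *. cbn [list_sum fold_right] in *. unfold list_sum in *. split; [|split].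
    + lia.
    + intros i. cbn [mi_wt_from]. rewrite <- (E2 (i + 2)%nat). nia.
    + unfold mi_is_zero in *. cbn [forallb]. intros X. apply andb_prop in X. destruct X as [X1 X2]. apply Nat.eqb_eq in X1. subst a.
      destruct (E3 X2) as [-> ->]. split; f_equal; lia.
Qed.

Lemma mps_mul_ext f g f' g' I : (forall J K, In (J, K) (mi_splits I) -> f J * g K = f' J * g' K) ->
  mps_mul f g I = mps_mul f' g' I.
Proof. intros H. unfold mps_mul. f_equal. apply map_ext_in. intros [J K] HI. now apply H. Qed.

Lemma mi_size_zero I : mi_size I = O <-> mi_is_zero I = true.
Proof.
  unfold mi_size, mi_is_zero. induction I as [|a I IH]; cbn [list_sum fold_right forallb] in *. tauto.
  unfold list_sum in *. rewrite Bool.andb_true_iff, <- IH, Nat.eqb_eq. lia.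
Qed.

Definition mps_zero : mps := fun _ => 0.
Definition mps_opp (f : mps) : mps := fun I => - f I.

Lemma mps_mul_comm f g : mps_mul f g = mps_mul g f.
Proof.
  apply functional_extensionality. intros I. revert f g. induction I as [|a I IH]; intros f g.
  - rewrite !mps_mul_nil. ring.
  - rewrite !mps_mul_cons, csum_rev. apply csum_ext. intros j Hj. rewrite IH.
    replace (a - (S a - 1 - j))%nat with j by lia. now replace (S a - 1 - j)%nat with (a - j)%nat by lia.
Qed.

Lemma mps_mul_plus_l f f' g : mps_mul (mps_add f f') g = mps_add (mps_mul f g) (mps_mul f' g).
Proof.
  apply functional_extensionality. intros I. unfold mps_mul, mps_add.
  induction (mi_splits I) as [|p l IH]; simpl. ring. rewrite IH. ring.
Qed.

Lemma mps_mul_scale_l c f g : mps_mul (mps_scale c f) g = mps_scale c (mps_mul f g).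
Proof.
  apply functional_extensionality. intros I. unfold mps_mul, mps_scale.
  induction (mi_splits I) as [|p l IH]; simpl. ring. rewrite IH. ring.
Qed.

Lemma mps_mul_zero_l g : mps_mul mps_zero g = mps_zero.
Proof.
  apply functional_extensionality. intros I. unfold mps_mul, mps_zero.
  induction (mi_splits I) as [|p l IH]; simpl. ring. rewrite IH. ring.
Qed.

Lemma mps_mul_csum_l (f : nat -> mps) g n I :
  mps_mul (fun J => csum (fun i => f i J) n) g I = csum (fun i => mps_mul (f i) g I) n.
Proof.
  induction n as [|n IH]; cbn [csum]. apply (f_equal (fun h => h I) (mps_mul_zero_l g)).
  rewrite <- IH. apply (f_equal (fun h => h I) (mps_mul_plus_l _ (f n) g)).
Qed.

Lemma csum_triangle (F : nat -> nat -> nat -> C) a :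
  csum (fun k => csum (fun j => F j (k - j)%nat (a - k)%nat) (S k)) (S a) =
  csum (fun j => csum (fun i => F j i (a - j - i)%nat) (S (a - j))) (S a).
Proof.
  revert F. induction a as [|a IH]; intros F. reflexivity.
  rewrite (csum_Sl (fun j => csum _ (S (S a - j)))).
  rewrite (csum_ext (fun i => csum _ (S (S a - S i))) (fun j => csum (fun i => F (S j) i (a - j - i)%nat) (S (a - j)))) by reflexivity.
  rewrite <- (IH (fun j => F (S j))).
  transitivity (F O O (S a) + csum (fun k => F O (S k) (a - k)%nat + csum (fun j => F (S j) (k - j)%nat (a - k)%nat) (S k)) (S a)).
  - rewrite csum_Sl. f_equal. cbn [csum Nat.sub]. ring. apply csum_ext. intros k _.
    exact (csum_Sl (fun j => F j (S k - j)%nat (S a - S k)%nat) (S k)).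
  - rewrite csum_plus. rewrite Cplus_assoc. f_equal. symmetry. exact (csum_Sl (fun i => F O i (S a - 0 - i)%nat) (S a)).
Qed.

Lemma mps_mul_assoc f g h : mps_mul f (mps_mul g h) = mps_mul (mps_mul f g) h.
Proof.
  apply functional_extensionality. intros I. revert f g h. induction I as [|a I IH]; intros f g h.
  - rewrite !mps_mul_nil. ring.
  - rewrite !mps_mul_cons.
    rewrite (csum_ext (fun j => mps_mul (slice (mps_mul f g) j) _ I) (fun k => csum (fun j => mps_mul (mps_mul (slice f j) (slice g (k - j))) (slice h (a - k)) I) (S k))).
    2:{ intros k _. rewrite <- mps_mul_csum_l. f_equal. apply functional_extensionality. intros J. apply mps_mul_cons. }
    rewrite (csum_triangle (fun j i l => mps_mul (mps_mul (slice f j) (slice g i)) (slice h l) I)).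
    apply csum_ext. intros j Hj. rewrite mps_mul_comm.
    replace (slice (mps_mul g h) (a - j)) with (fun J => csum (fun i => mps_mul (slice g i) (slice h (a - j - i)) J) (S (a - j))).
    2:{ apply functional_extensionality. intros J. symmetry. apply mps_mul_cons. }
    rewrite mps_mul_csum_l. apply csum_ext. intros i _. rewrite mps_mul_comm. apply IH.
Qed.

Lemma slice_one j : slice mps_one j = match j with O => mps_one | _ => mps_zero end.
Proof. apply functional_extensionality. intros J. destruct j; reflexivity. Qed.

Lemma mps_mul_1_l f : mps_mul mps_one f = f.
Proof.
  apply functional_extensionality. intros I. revert f. induction I as [|a I IH]; intros f.
  - rewrite mps_mul_nil. unfold mps_one. simpl. ring.
  - rewrite mps_mul_cons, csum_Sl, (csum_ext _ (fun _ => 0)), csum_zero.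
    rewrite slice_one, IH, Nat.sub_0_r. unfold slice. ring.
    intros j _. now rewrite slice_one, mps_mul_zero_l.
Qed.

Lemma mps_ring : ring_theory mps_zero mps_one mps_add mps_mul mps_sub mps_opp eq.
Proof.
  split; intros; try (apply functional_extensionality; intros I; unfold mps_add, mps_sub, mps_opp, mps_zero; ring).
  - apply mps_mul_1_l.
  - apply mps_mul_comm.
  - apply mps_mul_assoc.
  - apply mps_mul_plus_l.
Qed.

Add Ring mps_ring_inst : mps_ring.

Lemma mps_mul_at_zero f g I : mi_is_zero I = true -> mps_mul f g I = f I * g I.
Proof.
  revert f g. induction I as [|a I IH]; intros f g H. apply mps_mul_nil.
  unfold mi_is_zero in H. cbn [forallb] in H. apply andb_prop in H. destruct H as [H1 H2]. apply Nat.eqb_eq in H1. subst a.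
  rewrite mps_mul_cons. cbn [csum]. rewrite IH by auto. unfold slice. simpl. ring.
Qed.

(** The Euler derivation, multiplying a term by its total degree. A single derivation that sees every
    variable suffices for a recursion. *)
Definition th (f : mps) : mps := fun I => INR (mi_size I) * f I.

Lemma slice_th f j : slice (th f) j = mps_add (mps_scale (INR j) (slice f j)) (th (slice f j)).
Proof.
  apply functional_extensionality. intros J. unfold slice, th, mps_add, mps_scale, mi_size. cbn [list_sum fold_right].
  rewrite plus_INR, RtoC_plus. unfold list_sum. ring.
Qed.

Lemma th_mul f g : th (mps_mul f g) = mps_add (mps_mul (th f) g) (mps_mul f (th g)).
Proof.
  apply functional_extensionality. intros I. revert f g. induction I as [|a I IH]; intros f g.
  - unfold th, mps_add. rewrite !mps_mul_nil. simpl. ring.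
  - unfold th at 1, mps_add. rewrite !mps_mul_cons, <- csum_scal, <- csum_plus. apply csum_ext. intros j Hj.
    rewrite !slice_th, !(mps_mul_comm (slice f j) (mps_add _ _)), !mps_mul_plus_l, !mps_mul_scale_l.
    specialize (IH (slice f j) (slice g (a - j))). unfold th at 1, mps_add in IH. unfold mps_add, mps_scale.
    rewrite !(mps_mul_comm _ (slice f j)). unfold mi_size in *. cbn [list_sum fold_right]. unfold list_sum in *.
    replace (RtoC (INR (a + fold_right Nat.add 0%nat I))) with (INR j + INR (a - j) + INR (fold_right Nat.add 0%nat I)).
    rewrite Cmult_plus_distr_r, IH. ring.
    rewrite plus_INR, minus_INR by lia. rewrite !RtoC_plus, RtoC_minus. ring.
Qed.

(** A solution of theta X = X L is determined by its constant term: at I the equation expresses |I| times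
    the coefficient by those of lower degree. *)
Lemma th_unique X Y Lam : th X = mps_mul X Lam -> th Y = mps_mul Y Lam ->
  (forall I, mi_is_zero I = true -> Lam I = 0) -> (forall I, mi_is_zero I = true -> X I = Y I) -> X = Y.
Proof.
  intros HX HY HL H0. apply functional_extensionality. intros I.
  remember (mi_size I) as n eqn:Hn. revert I Hn. induction n as [n IH] using lt_wf_ind. intros I Hn.
  destruct (Nat.eq_dec n 0) as [->|N]. apply H0, mi_size_zero. auto.
  assert (E : th X I = th Y I).
  { rewrite HX, HY. apply mps_mul_ext. intros J K HJK. destruct (mi_splits_in _ _ _ HJK) as [E _].
    destruct (Nat.eq_dec (mi_size K) 0) as [Z|Z].
    - rewrite HL by now apply mi_size_zero. ring.
    - rewrite (IH (mi_size J)) by lia. reflexivity. }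
  unfold th in E. rewrite <- Hn in E. assert (Nn : RtoC (INR n) <> 0) by (intros Q; apply RtoC_inj in Q; now apply not_0_INR in Q).
  replace (X I) with (/ INR n * (INR n * X I)) by (field; auto). rewrite E. field. auto.
Qed.

(** * Inverses of formal series *)

Lemma mps_pow_low (v : mps) k I : (forall J, mi_is_zero J = true -> v J = 0) -> (mi_size I < k)%nat -> mps_pow v k I = 0.
Proof.
  intros Hv. revert I. induction k as [|k IH]; intros I H. lia. cbn [mps_pow].
  rewrite (mps_mul_ext _ _ mps_zero mps_zero), mps_mul_zero_l; auto. intros J K HJK.
  destruct (mi_splits_in _ _ _ HJK) as [E _]. unfold mps_zero.
  destruct (Nat.eq_dec (mi_size J) 0) as [Z|Z].
  - rewrite Hv by now apply mi_size_zero. ring.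
  - rewrite IH by lia. ring.
Qed.

(** Partial sums of the geometric series. The inverse at I is built from the one with |I| terms, so products
    involve different truncations, which agree by [geom_stable]. *)
Fixpoint geom (v : mps) (n : nat) : mps :=
  match n with O => mps_one | S n' => mps_add (geom v n') (mps_pow v n) end.

Lemma geom_sum v n I : sum_n (fun k => mps_pow v k I : C) n = geom v n I.
Proof. induction n. apply sum_O. rewrite sum_Sn, IHn. reflexivity. Qed.

Lemma geom_mul v n : mps_mul (mps_sub mps_one v) (geom v n) = mps_sub mps_one (mps_pow v (S n)).
Proof.
  induction n as [|n IH]. cbn [geom mps_pow]. ring.
  cbn [geom]. replace (mps_mul (mps_sub mps_one v) (mps_add (geom v n) (mps_pow v (S n)))) with
    (mps_add (mps_mul (mps_sub mps_one v) (geom v n)) (mps_mul (mps_sub mps_one v) (mps_pow v (S n)))) by ring.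
  rewrite IH. cbn [mps_pow]. ring.
Qed.

Lemma geom_stable (v : mps) m n I : (forall J, mi_is_zero J = true -> v J = 0) -> (mi_size I <= m <= n)%nat -> geom v n I = geom v m I.
Proof.
  intros Hv H. induction n as [|n IH]. now replace m with O by lia.
  destruct (Nat.eq_dec m (S n)) as [->|N]; auto. cbn [geom]. unfold mps_add. rewrite mps_pow_low, IH by (auto; lia). ring.
Qed.

Lemma mps_inv_spec (f : mps) : f [] <> 0 -> (forall I, mi_is_zero I = true -> f I = f []) -> mps_mul f (mps_inv f) = mps_one.
Proof.
  intros N Hf. apply functional_extensionality. intros I.
  set (v := mps_sub mps_one (mps_scale (/ f []) f)).
  assert (Hv : forall J, mi_is_zero J = true -> v J = 0).
  { intros J HJ. unfold v, mps_sub, mps_scale, mps_one. rewrite HJ, (Hf J HJ). field. exact N. }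
  transitivity (mps_mul (mps_scale (/ f []) f) (geom v (mi_size I)) I).
  - replace (mps_mul (mps_scale (/ f []) f) (geom v (mi_size I))) with (mps_mul f (mps_scale (/ f []) (geom v (mi_size I)))).
    2:{ now rewrite (mps_mul_comm f), !mps_mul_scale_l, (mps_mul_comm f). }
    apply mps_mul_ext. intros J K HJK. destruct (mi_splits_in _ _ _ HJK) as [E _].
    unfold mps_inv. fold v. rewrite geom_sum. unfold mps_scale. rewrite (geom_stable v (mi_size K) (mi_size I)) by (auto; lia). ring.
  - replace (mps_scale (/ f []) f) with (mps_sub mps_one v) by (unfold v; ring).
    rewrite geom_mul. unfold mps_sub. rewrite mps_pow_low by (auto; lia). ring.
Qed.

(** * Exponentials of linear forms *)

(** The linear form in the exponent of [exp_coeff c]. *)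
Definition lin (c : nat -> C) : mps := fun I => if Nat.eqb (mi_size I) 1 then exp_coeff c I else 0.

Lemma exp_coeff_zero c I : mi_is_zero I = true -> exp_coeff c I = 1.
Proof.
  revert c. induction I as [|a I IH]; intros c H. reflexivity.
  unfold mi_is_zero in H. cbn [forallb] in H. apply andb_prop in H. destruct H as [H1 H2]. apply Nat.eqb_eq in H1. subst a.
  cbn [exp_coeff]. rewrite IH by auto. simpl. field.
Qed.

Lemma exp_coeff_scal (r : C) c I : exp_coeff (fun l => r * c l) I = r ^ mi_size I * exp_coeff c I.
Proof.
  revert c. induction I as [|a I IH]; intros c. simpl; ring.
  cbn [exp_coeff]. rewrite IH. unfold mi_size. cbn [list_sum fold_right].
  rewrite Cpow_add_r. replace (2 * PI * Ci * (r * c O)) with (r * (2 * PI * Ci * c O)) by ring.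
  rewrite Cpow_mult_l. unfold list_sum, Cdiv. ring.
Qed.

Lemma lin_scal r c I : lin (fun l => r * c l) I = r * lin c I.
Proof.
  unfold lin. destruct (Nat.eqb_spec (mi_size I) 1) as [E|_]; [|ring].
  rewrite exp_coeff_scal, E. simpl. ring.
Qed.

Lemma lin_zero c I : mi_is_zero I = true -> lin c I = 0.
Proof. intros H. apply mi_size_zero in H. unfold lin. now rewrite H. Qed.

Lemma slice_exp_coeff c j : slice (exp_coeff c) j =
  mps_scale ((2 * PI * Ci * c O) ^ j / INR (fact j)) (exp_coeff (fun l => c (S l))).
Proof. reflexivity. Qed.

Lemma slice_lin c j : slice (lin c) j =
  match j with O => lin (fun l => c (S l)) | 1%nat => mps_scale (2 * PI * Ci * c O) mps_one | _ => mps_zero end.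
Proof.
  apply functional_extensionality. intros J. unfold slice, lin, mi_size. cbn [list_sum fold_right exp_coeff].
  destruct j as [|[|j]].
  - cbn [Nat.add]. destruct (Nat.eqb_spec (list_sum J) 1) as [E|E]; unfold list_sum in *.
    + rewrite E. cbn [Nat.eqb]. simpl. field.
    + destruct (Nat.eqb_spec (fold_right Nat.add O J) 1); [contradiction|auto].
  - cbn [Nat.add Nat.eqb]. unfold mps_scale, mps_one. destruct (Nat.eqb_spec (fold_right Nat.add O J) 0) as [E|E].
    + apply mi_size_zero in E. rewrite E, exp_coeff_zero by auto. simpl. field.
    + destruct (mi_is_zero J) eqn:Z; [|ring]. apply mi_size_zero in Z. contradiction.
  - reflexivity.
Qed.

(** The exponential satisfies theta exp(L) = exp(L) L. *)
Lemma th_exp_coeff c : th (exp_coeff c) = mps_mul (exp_coeff c) (lin c).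
Proof.
  apply functional_extensionality. intros I. revert c. induction I as [|a I IH]; intros c.
  - rewrite mps_mul_nil. unfold th, lin. simpl. ring.
  - rewrite mps_mul_cons. set (c' := fun l => c (S l)). set (x := 2 * PI * Ci * c O).
    assert (E0 : mps_mul (slice (exp_coeff c) a) (slice (lin c) 0) I = x ^ a / INR (fact a) * (INR (mi_size I) * exp_coeff c' I)).
    { rewrite slice_exp_coeff, slice_lin, mps_mul_scale_l. unfold mps_scale. now rewrite <- IH. }
    destruct a as [|b].
    + cbn [csum Nat.sub]. rewrite E0. unfold th, mi_size. cbn [list_sum fold_right exp_coeff Nat.add]. fold c' x. unfold list_sum. cbn [Nat.add]. ring.
    + cbn [csum]. rewrite Nat.sub_diag, E0. replace (S b - b)%nat with 1%nat by lia.
      rewrite (csum_ext _ (fun _ => 0)), csum_zero.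
      2:{ intros j Hj. rewrite slice_lin. replace (S b - j)%nat with (S (S (b - S j))) by lia.
          now rewrite mps_mul_comm, mps_mul_zero_l. }
      rewrite slice_exp_coeff, slice_lin. fold c' x. rewrite (mps_mul_comm _ (mps_scale x mps_one)), mps_mul_scale_l, mps_mul_1_l.
      unfold mps_scale, th, mi_size. cbn [list_sum fold_right exp_coeff]. fold c' x. rewrite plus_INR, RtoC_plus.
      rewrite fact_simpl, mult_INR, RtoC_mult, Cpow_S. unfold list_sum. field.
      split; [apply RtoC_fact_nz|apply RtoC_INR_S_nz].
Qed.

(** * Logarithmic derivatives of the factors *)

Definition mono (x : C) (c : nat -> C) : mps := mps_scale x (exp_coeff c).

Lemma th_scale x f : th (mps_scale x f) = mps_scale x (th f).
Proof. apply functional_extensionality. intros I. unfold th, mps_scale. ring. Qed.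

Lemma th_mono x c : th (mono x c) = mps_mul (mono x c) (lin c).
Proof. unfold mono. now rewrite th_scale, th_exp_coeff, mps_mul_scale_l. Qed.

Lemma th_one : th mps_one = mps_zero.
Proof.
  apply functional_extensionality. intros I. unfold th, mps_one, mps_zero.
  destruct (mi_is_zero I) eqn:Z; [|ring]. apply mi_size_zero in Z. rewrite Z. simpl. ring.
Qed.

Lemma th_sub f g : th (mps_sub f g) = mps_sub (th f) (th g).
Proof. apply functional_extensionality. intros I. unfold th, mps_sub. ring. Qed.

Lemma th_pow_mono x c r : th (mps_pow (mono x c) r) = mps_mul (mps_pow (mono x c) r) (lin (fun l => INR r * c l)).
Proof.
  induction r as [|r IH].
  - cbn [mps_pow]. rewrite th_one, mps_mul_1_l. apply functional_extensionality. intros I. rewrite lin_scal. simpl. unfold mps_zero. ring.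
  - cbn [mps_pow]. rewrite th_mul, IH, th_mono.
    replace (lin (fun l => INR (S r) * c l)) with (mps_add (lin c) (lin (fun l => INR r * c l))). ring.
    apply functional_extensionality. intros I. unfold mps_add. rewrite !lin_scal, S_INR, RtoC_plus. ring.
Qed.

(** Both sides solve the same equation theta X = X L. *)
Lemma pow_mono x c r : mps_pow (mono x c) r = mono (x ^ r) (fun l => INR r * c l).
Proof.
  apply (th_unique _ _ (lin (fun l => INR r * c l))).
  - apply th_pow_mono.
  - apply th_mono.
  - intros. now apply lin_zero.
  - intros I H. unfold mono at 2, mps_scale. rewrite exp_coeff_zero by auto.
    induction r as [|r IH]; cbn [mps_pow]. unfold mps_one. rewrite H. simpl. ring.
    rewrite mps_mul_at_zero, IH by auto. unfold mono, mps_scale. rewrite exp_coeff_zero by auto. simpl. ring.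
Qed.

(** Starts at r = 1: the value at r = 0 is 0 even for t = 0. *)
Definition npos (t r : nat) : C := match r with O => 0 | _ => INR r ^ t end.

Lemma PS_npos t : PS (npos t).
Proof. apply PS_head, PS_npow. Qed.

Lemma CS_npos t x : (Cmod x < 1)%R -> CS (fun r => INR (S r) ^ t * x ^ S r) (psum (npos t) x).
Proof.
  intros H. replace (psum (npos t) x) with (psum (npos t) x - npos t 0 * x ^ 0) by (simpl; ring).
  exact (CS_S_inv _ _ (PS_CS _ _ (PS_npos t) H)).
Qed.

(** The series theta(-log(1 - M)) for M = [mono x c], as the sum of theta(M^r)/r over r >= 1. *)
Definition dlog (x : C) (c : nat -> C) : mps := fun K =>
  INR (mi_size K) * exp_coeff c K * psum (npos (mi_size K - 1)) x.

(** By the product rule M^r theta(M) = theta(M^(r+1))/(r+1). *)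
Lemma dlog_terms x c K : (Cmod x < 1)%R ->
  CS (fun r => mps_mul (mps_pow (mono x c) r) (th (mono x c)) K) (dlog x c K).
Proof.
  intros Hx. unfold dlog.
  apply CS_ext with (fun r => INR (mi_size K) * exp_coeff c K * (INR (S r) ^ (mi_size K - 1) * x ^ S r)).
  2: now apply CS_scal, CS_npos.
  intros r. assert (N := RtoC_INR_S_nz r).
  assert (E : INR (S r) * mps_mul (mps_pow (mono x c) r) (th (mono x c)) K = th (mps_pow (mono x c) (S r)) K).
  { rewrite th_pow_mono. cbn [mps_pow]. rewrite th_mono.
    replace (lin (fun l => INR (S r) * c l)) with (mps_scale (INR (S r)) (lin c)).
    2:{ apply functional_extensionality. intros I. now rewrite lin_scal. }
    rewrite (mps_mul_comm _ (mps_scale _ _)), mps_mul_scale_l. unfold mps_scale at 1. f_equal.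
    apply (f_equal (fun f : mps => f K)). ring. }
  replace (mps_mul (mps_pow (mono x c) r) (th (mono x c)) K) with (/ INR (S r) * (INR (S r) * mps_mul (mps_pow (mono x c) r) (th (mono x c)) K)) by (field; auto).
  rewrite E, pow_mono. unfold th, mono, mps_scale. rewrite exp_coeff_scal.
  destruct (mi_size K) as [|t]. simpl. ring. cbn [Nat.sub]. rewrite Nat.sub_0_r, (Cpow_S (INR (S r)) t). field. auto.
Qed.

Lemma mps_mul_CS f (g : nat -> mps) G K : (forall K, CS (fun r => g r K) (G K)) -> CS (fun r => mps_mul f (g r) K) (mps_mul f G K).
Proof.
  intros H. unfold mps_mul. induction (mi_splits K) as [|p l IH]; simpl. apply CS_zero.
  apply (CS_plus (fun r => f (fst p) * g r (snd p))). now apply CS_scal. exact IH.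
Qed.

(** Multiplying the geometric series M^r theta(M) by M shifts it by one term. *)
Lemma dlog_spec x c : (Cmod x < 1)%R ->
  mps_mul (mps_sub mps_one (mono x c)) (dlog x c) = th (mono x c).
Proof.
  intros Hx. set (M := mono x c).
  replace (mps_mul (mps_sub mps_one M) (dlog x c)) with (mps_sub (dlog x c) (mps_mul M (dlog x c))) by ring.
  apply functional_extensionality. intros K. unfold mps_sub.
  assert (H1 := mps_mul_CS M _ _ K (fun K => dlog_terms x c K Hx)). fold M in H1.
  assert (H2 : CS (fun r => mps_mul (mps_pow M r) (th M) K) (mps_mul (mps_pow M 0) (th M) K + mps_mul M (dlog x c) K)).
  { apply (CS_S (fun r => mps_mul (mps_pow M r) (th M) K)). eapply CS_ext; [|exact H1].
    intros r. cbn [mps_pow]. now rewrite mps_mul_assoc. }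
  rewrite (CS_unique _ _ _ (dlog_terms x c K Hx) H2). cbn [mps_pow]. rewrite mps_mul_1_l. ring.
Qed.

Lemma th_one_minus x c : (Cmod x < 1)%R ->
  th (mps_sub mps_one (mono x c)) = mps_mul (mps_sub mps_one (mono x c)) (mps_opp (dlog x c)).
Proof.
  intros Hx. rewrite th_sub, th_one, <- (dlog_spec x c Hx). ring.
Qed.

Lemma one_minus_zero x c I : mi_is_zero I = true -> mps_sub mps_one (mono x c) I = 1 - x.
Proof. intros H. unfold mps_sub, mono, mps_one, mps_scale. rewrite H, exp_coeff_zero by auto. ring. Qed.

Lemma inv_one_minus x c : (Cmod x < 1)%R ->
  mps_mul (mps_sub mps_one (mono x c)) (mps_inv (mps_sub mps_one (mono x c))) = mps_one.
Proof.
  intros Hx. apply mps_inv_spec. rewrite one_minus_zero by reflexivity. now apply one_minus_nz.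
  intros I H. now rewrite !one_minus_zero.
Qed.

Lemma th_inv_one_minus x c : (Cmod x < 1)%R ->
  th (mps_inv (mps_sub mps_one (mono x c))) = mps_mul (mps_inv (mps_sub mps_one (mono x c))) (dlog x c).
Proof.
  intros Hx. assert (E := inv_one_minus x c Hx). assert (D := th_one_minus x c Hx).
  set (X := mps_sub mps_one (mono x c)) in *. set (Y := mps_inv X) in *.
  assert (E2 := f_equal th E). rewrite th_one, th_mul, D in E2.
  transitivity (mps_mul (mps_mul X Y) (th Y)). rewrite E. ring.
  transitivity (mps_mul Y (mps_add (mps_add (mps_mul (mps_mul X (mps_opp (dlog x c))) Y) (mps_mul X (th Y)))
    (mps_mul (mps_mul X (dlog x c)) Y))). ring.
  rewrite E2. transitivity (mps_mul (mps_mul X Y) (mps_mul Y (dlog x c))). ring. rewrite E. ring.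
Qed.

(** * The partial products *)

(** The square root of q in which the numerator becomes a product of factors 1 - y^(odd): the sign of the
    numerator is absorbed by the shift of tau. *)
Definition yh (tau : C) : C := e2pi ((tau + 1) / 2).

(** The exponents of q_3, q_5, ... in the denominator. *)
Definition cN (n : nat) (l : nat) : C := odd_powers (INR (S n)) (S l).
(** The exponents of q_3, q_5, ... in the numerator. *)
Definition cH (n : nat) (l : nat) : C := odd_powers (INR (S n) - 1 / 2) (S l).

Lemma yh_sq tau : yh tau * yh tau = e2pi tau.
Proof.
  unfold yh. rewrite <- e2pi_add. replace ((tau + 1) / 2 + (tau + 1) / 2) with (tau + 1) by field.
  rewrite e2pi_add, e2pi_1. ring.
Qed.

Lemma yh_odd n tau : yh tau ^ (2 * n + 1) = - e2pi (RtoC (INR (S n) - 1 / 2) * tau).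
Proof.
  unfold yh. rewrite <- e2pi_nat.
  replace (INR (2 * n + 1) * ((tau + 1) / 2)) with (RtoC (INR (S n) - 1 / 2) * tau + (INR n * 1 + 1 / 2)).
  - rewrite !e2pi_add, e2pi_nat, e2pi_1, e2pi_half, Cpow_1_l. ring.
  - replace (INR (2 * n + 1)) with (2 * INR n + 1)%R by (rewrite plus_INR, mult_INR; simpl; ring).
    rewrite S_INR, RtoC_minus, !RtoC_plus, RtoC_mult, RtoC_div by lra. field.
Qed.

Lemma yh_lt tau : UH tau -> (Cmod (yh tau) < 1)%R.
Proof. intros H. apply Cmod_e2pi_lt. now apply UH_half1. Qed.

Lemma Cmod_pow_lt (x : C) n : (Cmod x < 1)%R -> (Cmod (x ^ S n) < 1)%R.
Proof. intros H. rewrite Cmod_pow. apply pow_lt_1_compat; [split; [apply Cmod_ge_0|auto]|lia]. Qed.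

Lemma odd_powers_0 y : odd_powers y 0 = RtoC y.
Proof. unfold odd_powers. f_equal. simpl. ring. Qed.

Lemma character_factor_mono n tau : character_factor (S n) tau =
  mps_mul (mps_sub mps_one (mono (yh tau ^ (2 * n + 1)) (cH n))) (mps_inv (mps_sub mps_one (mono (e2pi tau ^ S n) (cN n)))).
Proof.
  unfold character_factor. f_equal.
  - apply functional_extensionality. intros I. unfold mps_add, mps_sub, mono, mps_scale. rewrite yh_odd.
    unfold q_monomial. rewrite odd_powers_0. unfold cH. ring.
  - f_equal. f_equal. apply functional_extensionality. intros I. unfold q_monomial, mono, mps_scale.
    rewrite odd_powers_0, e2pi_nat. reflexivity.
Qed.

Definition dfac (n : nat) (tau : C) : mps := mps_sub (dlog (e2pi tau ^ S n) (cN n)) (dlog (yh tau ^ (2 * n + 1)) (cH n)).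

(** The series theta(log P) for the N-th partial product P. *)
Fixpoint Lam (N : nat) (tau : C) : mps :=
  match N with O => lin (fun l => vacuum_exponents (S l)) | S n => mps_add (Lam n tau) (dfac n tau) end.

Lemma th_character_partial N tau : UH tau ->
  th (character_partial N tau) = mps_mul (character_partial N tau) (Lam N tau).
Proof.
  intros H. induction N as [|n IH].
  - exact (th_mono (e2pi (vacuum_exponents 0 * tau)) (fun l => vacuum_exponents (S l))).
  - cbn [character_partial Lam]. rewrite character_factor_mono.
    assert (Hq := Cmod_pow_lt _ n (Cmod_e2pi_lt tau H)).
    assert (Hy : (Cmod (yh tau ^ (2 * n + 1)) < 1)%R) by (rewrite Nat.add_1_r; apply Cmod_pow_lt, yh_lt, H).
    rewrite th_mul, IH, th_mul, th_one_minus, th_inv_one_minus by auto. unfold dfac. ring.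
Qed.

(** The factors 1 - y^(odd) are those of all y^j without those of the even ones, y^(2n) = q^n. *)
Lemma character_partial_zero N tau I : UH tau -> mi_is_zero I = true ->
  character_partial N tau I = e2pi (vacuum_exponents 0 * tau) * cprod (fun d => 1 - yh tau ^ S d) (2 * N) * / cprod (fun d => 1 - e2pi tau ^ S d) N ^ 2.
Proof.
  intros H HI. assert (Hq := fun n => Cmod_pow_lt _ n (Cmod_e2pi_lt tau H)).
  assert (Np : forall n, cprod (fun d => 1 - e2pi tau ^ S d) n <> 0).
  { intros n. induction n; cbn [cprod]. apply C1_nz. apply Cmult_neq_0; auto. now apply one_minus_nz. }
  induction N as [|n IH].
  - unfold character_partial, q_monomial. rewrite exp_coeff_zero by auto. simpl. field.
  - cbn [character_partial]. rewrite mps_mul_at_zero, IH, character_factor_mono, mps_mul_at_zero by auto.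
    replace (2 * S n)%nat with (S (S (2 * n))) by lia. cbn [cprod].
    assert (E : mps_inv (mps_sub mps_one (mono (e2pi tau ^ S n) (cN n))) I = / (1 - e2pi tau ^ S n)).
    { assert (X := f_equal (fun f : mps => f I) (inv_one_minus _ (cN n) (Hq n))). cbv beta in X.
      replace (mps_one I) with (RtoC 1) in X by (unfold mps_one; now rewrite HI).
      rewrite mps_mul_at_zero, one_minus_zero in X by auto. assert (N1 := one_minus_nz _ (Hq n)).
      match type of X with _ * ?y = _ => transitivity (/ (1 - e2pi tau ^ S n) * ((1 - e2pi tau ^ S n) * y)) end.
      field; auto. rewrite X. ring. }
    rewrite E, one_minus_zero by auto.
    replace (yh tau ^ S (S (2 * n))) with (e2pi tau ^ S n).
    2:{ rewrite <- yh_sq. replace (S (S (2 * n))) with (2 * S n)%nat by lia. rewrite Cpow_mult_r. f_equal. simpl. ring. }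
    replace (2 * n + 1)%nat with (S (2 * n)) by lia. assert (N1 := one_minus_nz _ (Hq n)). specialize (Np n).
    set (a := e2pi tau ^ S n) in *. set (b := yh tau ^ S (2 * n)). clearbody a b. set (c := cprod (fun d => 1 - e2pi tau ^ S d) n) in *. clearbody c.
    simpl Cpow. field. auto.
Qed.

Lemma gconst_nat w : vacuum_exponents w = gconst (2 * S w) * (2 - / 2 ^ (2 * w + 1)).
Proof.
  unfold vacuum_exponents. cbv zeta. rewrite zeta_neg, hurwitz_half_neg. assert (N := Cpow_nz 2 (2 * w + 1) two_nz). field. auto.
Qed.

(** The coefficient at the zero multi-index; the constant is e(-1/48) as [mhalf] contains e((tau+1)/48). *)
Definition m0 (tau : C) : C := e2pi (- (1) / 48) * mhalf true true tau.

Lemma character_zero_limit tau I : UH tau -> mi_is_zero I = true -> Clim (fun N => character_partial N tau I) (m0 tau).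
Proof.
  intros H HI. assert (FF : Filter (T := nat) eventually) by apply eventually_filter.
  assert (Nq : Phi (e2pi tau) <> 0) by apply Cexp_nz.
  apply flim_ext with (fun N => e2pi (vacuum_exponents 0 * tau) * cprod (fun d => 1 - yh tau ^ S d) (2 * N) * / (cprod (fun d => 1 - e2pi tau ^ S d) N * cprod (fun d => 1 - e2pi tau ^ S d) N)); auto.
  { intros N. rewrite character_partial_zero by auto. now replace (cprod (fun d => 1 - e2pi tau ^ S d) N ^ 2) with (cprod (fun d => 1 - e2pi tau ^ S d) N * cprod (fun d => 1 - e2pi tau ^ S d) N) by (simpl; ring). }
  replace (m0 tau) with (e2pi (vacuum_exponents 0 * tau) * Phi (yh tau) * / (Phi (e2pi tau) * Phi (e2pi tau))).
  - apply flim_mult; auto. apply flim_scal; auto.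
    + apply (Clim_sub (cprod (fun d => 1 - yh tau ^ S d)) _ (fun N => (2 * N)%nat)). intros; lia. apply Phi_limit. now apply yh_lt.
    + apply flim_inv; auto. now apply Cmult_neq_0. apply flim_mult; auto; apply Phi_limit; now apply Cmod_e2pi_lt.
  - unfold m0, mhalf. cbn [hpt hnorm]. unfold eta. rewrite gconst_nat. change (2 * 1)%nat with 2%nat. rewrite gconst_2.
    fold (yh tau). assert (N1 := e2pi_nz (tau / 24)).
    (* The exponent of the prefactor is -1/16 = 1/48 - 2/24, for eta((tau+1)/2) and eta(tau)^2. *)
    replace (- (1) / 24 * (2 - / 2 ^ (2 * 0 + 1)) * tau) with (- (1) / 48 + (tau + 1) / 2 / 24 + - (tau / 24) + - (tau / 24)).
    2:{ simpl. field. }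
    assert (Ne : e2pi (- (tau / 24)) = / e2pi (tau / 24)).
    { unfold e2pi. rewrite <- Cexp_opp. f_equal. ring. }
    rewrite !e2pi_add, Ne. simpl Cpow. field. auto.
Qed.

(** * Limits of the logarithmic derivatives *)

(** With the entries of K numbered from 1, the Eisenstein series at K has weight 2 (1 + iw 1 K). *)
Fixpoint iw (i : nat) (K : multi_index) : nat :=
  match K with [] => 0 | a :: K' => i * a + iw (S i) K' end.

(** The constant (2 pi i)^|K| / K!. *)
Fixpoint kc (K : multi_index) : C :=
  match K with [] => 1 | a :: K' => (2 * PI * Ci) ^ a / INR (fact a) * kc K' end.

Lemma mi_size_cons a I : mi_size (a :: I) = (a + mi_size I)%nat.
Proof. reflexivity. Qed.

Lemma mi_wt_iw i K : mi_wt_from (2 * i + 1) K = (2 * (iw i K + mi_size K))%nat.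
Proof.
  revert i. induction K as [|a K IH]; intros i. reflexivity.
  rewrite mi_size_cons. cbn [mi_wt_from iw]. replace (2 * i + 1 + 2)%nat with (2 * S i + 1)%nat by lia. rewrite IH. lia.
Qed.

Lemma iw_ge i K : (1 <= i)%nat -> (mi_size K <= iw i K)%nat.
Proof.
  revert i. induction K as [|a K IH]; intros i H. apply Nat.le_0_l.
  rewrite mi_size_cons. cbn [iw]. specialize (IH (S i) ltac:(lia)). nia.
Qed.

Lemma iw_zero i K : mi_is_zero K = true -> iw i K = O /\ kc K = 1.
Proof.
  revert i. induction K as [|a K IH]; intros i H. auto.
  unfold mi_is_zero in H. cbn [forallb] in H. apply andb_prop in H. destruct H as [H1 H2]. apply Nat.eqb_eq in H1. subst a.
  destruct (IH (S i) H2) as [E1 E2]. cbn [iw kc]. rewrite E1, E2. split. lia. simpl. field.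
Qed.

Lemma exp_coeff_odd y i K : exp_coeff (fun l => odd_powers y (i + l)) K = kc K * RtoC y ^ (mi_size K + 2 * iw i K).
Proof.
  revert i. induction K as [|a K IH]; intros i. simpl; ring.
  rewrite mi_size_cons. cbn [exp_coeff kc iw].
  replace (fun l => odd_powers y (i + S l)) with (fun l => odd_powers y (S i + l)).
  2:{ apply functional_extensionality. intros l. f_equal. lia. }
  rewrite IH, Nat.add_0_r. unfold odd_powers. rewrite Cpow_mult_l, RtoC_pow, <- Cpow_mult_r.
  replace (a + mi_size K + 2 * (i * a + iw (S i) K))%nat with ((2 * i + 1) * a + (mi_size K + 2 * iw (S i) K))%nat by lia.
  rewrite (Cpow_add_r (RtoC y) ((2 * i + 1) * a)). unfold Cdiv. ring.
Qed.

(** A multi-index of size 1 has a single entry, whose position is its [iw]. *)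
Lemma exp_coeff_unit f i K : mi_size K = 1%nat -> exp_coeff (fun l => f (i + l)%nat) K = kc K * f (iw i K).
Proof.
  revert i. induction K as [|a K IH]; intros i H. discriminate.
  rewrite mi_size_cons in H. cbn [exp_coeff kc iw].
  replace (fun l => f (i + S l)%nat) with (fun l => f (S i + l)%nat) by (apply functional_extensionality; intros l; f_equal; lia).
  destruct a as [|a].
  - rewrite IH by lia. rewrite Nat.mul_0_r. simpl. field.
  - replace a with O in * by lia. assert (Z : mi_is_zero K = true) by (apply mi_size_zero; lia).
    destruct (iw_zero (S i) K Z) as [E1 E2]. rewrite exp_coeff_zero, E1, E2 by auto.
    rewrite Nat.mul_1_r, !Nat.add_0_r. simpl. field.
Qed.

Lemma divisor_series s t x : (Cmod x < 1)%R ->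
  CS (fun n => INR (S n) ^ (s + t) * psum (npos t) (x ^ S n)) (psum (fun N => INR N ^ t * sig s N) x).
Proof.
  intros H. rewrite <- (psum_ext _ _ x (dsum_powers s t)).
  apply (lambert _ (s + t)); auto.
  - intros d r. rewrite Cmod_mult, !Cmod_pow, !Cmod_R, !Rabs_right by (apply Rle_ge, pos_INR).
    rewrite mult_INR, Rpow_mult_distr. apply Rmult_le_compat_l. apply pow_le, pos_INR.
    apply Rle_pow. rewrite S_INR. generalize (pos_INR r). lra. lia.
  - intros d. eapply CS_ext; [|apply CS_scal, CS_npos, (Cmod_pow_lt x d H)].
    intros r. cbv beta. rewrite Cpow_mult_r. ring.
Qed.

Lemma csum_even_odd (T : nat -> C) N : csum T (2 * N) = csum (fun n => T (2 * n)%nat) N + csum (fun n => T (2 * n + 1)%nat) N.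
Proof.
  induction N. simpl; ring. replace (2 * S N)%nat with (S (S (2 * N))) by lia. cbn [csum]. rewrite IHN.
  replace (2 * N + 1)%nat with (S (2 * N)) by lia. ring.
Qed.

(** The sum over odd integers is the sum over all integers without that over the even ones, where y^2 = q. *)
Lemma divisor_series_odd s t tau : UH tau ->
  CS (fun n => INR (S (2 * n)) ^ (s + t) * psum (npos t) (yh tau ^ (2 * n + 1)))
   (psum (fun N => INR N ^ t * sig s N) (yh tau) - 2 ^ (s + t) * psum (fun N => INR N ^ t * sig s N) (e2pi tau)).
Proof.
  intros H. assert (FF : Filter (T := nat) eventually) by apply eventually_filter.
  assert (D1 := divisor_series s t _ (yh_lt tau H)). assert (D2 := divisor_series s t _ (Cmod_e2pi_lt tau H)).
  assert (D3 := Clim_sub _ _ (fun n => (2 * n)%nat) ltac:(intros; cbv beta; lia) D1).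
  apply (CS_scal (2 ^ (s + t))) in D2.
  eapply flim_ext; [auto| |exact (flim_minus _ _ _ _ _ D3 D2)].
  intros N. cbv beta. rewrite csum_even_odd.
  rewrite (csum_ext (fun n => INR (S (2 * n + 1)) ^ (s + t) * psum (npos t) (yh tau ^ S (2 * n + 1)))
    (fun n => 2 ^ (s + t) * (INR (S n) ^ (s + t) * psum (npos t) (e2pi tau ^ S n)))).
  - rewrite (csum_ext (fun n => INR (S (2 * n)) ^ (s + t) * psum (npos t) (yh tau ^ S (2 * n)))
      (fun n => INR (S (2 * n)) ^ (s + t) * psum (npos t) (yh tau ^ (2 * n + 1)))). ring.
    intros n _. now rewrite Nat.add_1_r.
  - intros n _. replace (S (2 * n + 1)) with (2 * S n)%nat by lia. rewrite mult_INR, RtoC_mult, Cpow_mult_l.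
    rewrite (Cpow_mult_r (yh tau)). replace (yh tau ^ 2) with (e2pi tau) by (rewrite <- yh_sq; simpl; ring).
    replace (RtoC (INR 2)) with (RtoC 2) by (f_equal; simpl; ring). ring.
Qed.

(** The t-th derivative of G_k; the constant term survives for t = 0 only, since 0^0 = 1. *)
Definition Dgk (k t : nat) (x : C) : C := psum (fun N => INR N ^ t * gk k N) x.

Lemma PS_pow_n t a : PS a -> PS (fun N => INR N ^ t * a N).
Proof.
  intros H. induction t as [|t IH]. eapply PS_ext; [|exact H]. intros; simpl; ring.
  eapply PS_ext; [|apply PS_n, IH]. intros n. cbv beta. rewrite Cpow_S. ring.
Qed.

Lemma Dgk_sig k t x : (Cmod x < 1)%R -> Dgk k t x = psum (fun N => INR N ^ t * sig (k - 1) N) x + (if Nat.eqb t 0 then gconst k else 0).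
Proof.
  intros H. unfold Dgk. destruct t as [|t]; cbn [Nat.eqb].
  - rewrite (psum_ext (fun N => INR N ^ 0 * gk k N) (gk k)) by (intros; simpl; ring).
    rewrite (psum_ext (fun N => INR N ^ 0 * sig (k - 1) N) (sig (k - 1))) by (intros; simpl; ring).
    unfold gk. rewrite psum_head; auto using PS_sig, sig_0. ring.
  - rewrite Cplus_0_r. apply psum_ext.
    intros [|n]; auto. change (INR 0) with 0%R. rewrite Cpow_S. ring.
Qed.

(** The limit of the coefficients of [Lam] at K. *)
Definition lam (K : multi_index) (tau : C) : C :=
  let t := (mi_size K - 1)%nat in let w := iw 1 K in
  INR (mi_size K) * kc K * (2 * Dgk (2 * S w) t (e2pi tau) + - / 2 ^ (2 * w + 1 + t) * Dgk (2 * S w) t (yh tau)).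

Lemma Lam_csum N tau K : Lam N tau K = lin (fun l => vacuum_exponents (S l)) K + csum (fun n => dfac n tau K) N.
Proof. induction N; cbn [Lam csum]. ring. unfold mps_add. rewrite IHN. ring. Qed.

Lemma Lam_zero N tau K : mi_size K = O -> Lam N tau K = 0.
Proof.
  intros H. rewrite Lam_csum, lin_zero by now apply mi_size_zero.
  rewrite (csum_ext _ (fun _ => 0)), csum_zero. ring.
  intros n _. unfold dfac, mps_sub, dlog. rewrite H. simpl. ring.
Qed.

(** The part linear in the prefactor contributes for |K| = 1 only, and equals the constant terms of the
    Eisenstein series: its exponents are half the difference of zeta(-s) and zeta(-s,1/2), that is (2 -
    2^(-s)) times the constant term of G_(s+1). *)
Lemma Lam_limit tau K : UH tau -> mi_size K <> O -> Clim (fun N => Lam N tau K) (lam K tau).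
Proof.
  intros H HK. assert (FF : Filter (T := nat) eventually) by apply eventually_filter.
  destruct (mi_size K) as [|t] eqn:Et; [contradiction|]. clear HK.
  set (w := iw 1 K). set (s := (2 * w + 1)%nat).
  assert (N2 := Cpow_nz 2 (s + t) two_nz). assert (N2' := Cpow_nz 2 (2 * w + 1) two_nz).
  assert (Ey : forall (z : R), exp_coeff (fun l => odd_powers z (S l)) K = kc K * z ^ (s + t)).
  { intros z. etransitivity; [exact (exp_coeff_odd z 1 K)|]. rewrite Et. do 2 f_equal. unfold s, w. lia. }
  assert (D1 := divisor_series s t _ (Cmod_e2pi_lt tau H)).
  assert (D2 := CS_scal (/ 2 ^ (s + t)) _ _ (divisor_series_odd s t tau H)).
  assert (D3 := CS_scal (INR (S t) * kc K) _ _ (CS_minus _ _ _ _ D1 D2)).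
  apply flim_ext with (fun N => lin (fun l => vacuum_exponents (S l)) K + csum (fun n => INR (S t) * kc K *
     (INR (S n) ^ (s + t) * psum (npos t) (e2pi tau ^ S n) - / 2 ^ (s + t) * (INR (S (2 * n)) ^ (s + t) * psum (npos t) (yh tau ^ (2 * n + 1))))) N); auto.
  { intros N. rewrite Lam_csum. f_equal. apply csum_ext. intros n _. unfold dfac, mps_sub, dlog, cN, cH.
    rewrite !Ey, Et. cbn [Nat.sub]. rewrite Nat.sub_0_r.
    replace (RtoC (INR (S n) - 1 / 2)) with (/ 2 * INR (S (2 * n))).
    rewrite (Cpow_mult_l (/ 2)), Cpow_inv by apply two_nz. ring.
    rewrite !S_INR, mult_INR. rewrite RtoC_minus, !RtoC_plus, RtoC_mult, RtoC_div by lra.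
    replace (RtoC (INR 2)) with (RtoC 2) by (f_equal; simpl; ring). field. }
  replace (lam K tau) with (lin (fun l => vacuum_exponents (S l)) K + INR (S t) * kc K *
    (psum (fun N => INR N ^ t * sig s N) (e2pi tau) - / 2 ^ (s + t) * (psum (fun N => INR N ^ t * sig s N) (yh tau) - 2 ^ (s + t) * psum (fun N => INR N ^ t * sig s N) (e2pi tau)))).
  - apply flim_plus; [auto|now apply flim_const|exact D3].
  - unfold lam. cbv zeta. fold w. rewrite Et. cbn [Nat.sub]. rewrite Nat.sub_0_r.
    rewrite !Dgk_sig by auto using Cmod_e2pi_lt, yh_lt. fold s. replace (2 * S w - 1)%nat with s by (unfold s; lia).
    unfold lin. rewrite Et. destruct t as [|t].
    + cbn [Nat.eqb]. change (fun l => vacuum_exponents (S l)) with (fun l => vacuum_exponents (1 + l)).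
      rewrite (exp_coeff_unit vacuum_exponents 1 K Et), gconst_nat. fold w. fold s. rewrite Nat.add_0_r in *.
      change (INR 1) with 1%R. field. auto.
    + cbn [Nat.eqb]. field. auto.
Qed.

(** * Quasimodularity of the coefficients *)

(** Differentiating in tau multiplies the N-th coefficient by N in a series in q and by N/2 in a series in
    y. *)
Lemma qm_Dgk m t a b : (2 <= m)%nat -> qm (m + t) (fun tau => a * Dgk (2 * m) t (e2pi tau) + b * Dgk (2 * m) t (yh tau)).
Proof.
  intros Hm. revert b. induction t as [|t IH]; intros b.
  - rewrite Nat.add_0_r. apply (qm_mf m (mf_plus (mf_scal a (lev1 (gk (2 * m)))) (mf_scal b (hecke_coeffs (2 * m) (gk (2 * m)))))).
    + apply mf_plus_mf; apply mf_scal_mf. now apply mf_lev1_Gk. now apply mf_hecke_Gk.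
    + intros tau H. assert (P1 : forall a b, PS (lev1 (gk (2 * m)) a b)) by (intros; apply PS_dil, PS_gk).
      assert (P2 : forall a b, PS (hecke_coeffs (2 * m) (gk (2 * m)) a b)) by (intros; apply PS_hecke, PS_gk).
      rewrite Fn_plus by (auto; intros; now apply PS_scal). rewrite !Fn_scal by auto.
      rewrite Fn_lev1 by auto using PS_gk. unfold Fn. cbn [hecke_coeffs]. rewrite psum_alt, <- nome_neg by auto using PS_gk, nome_lt.
      unfold Dgk. rewrite !(psum_ext (fun N => INR N ^ 0 * gk (2 * m) N) (gk (2 * m))) by (intros; simpl; ring). reflexivity.
  - destruct (qm_D _ _ (IH (2 * b))) as [g [Hg D]]. rewrite Nat.add_succ_r.
    apply (qm_ext _ g); auto. intros tau H. specialize (D tau H).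
    assert (E : CD (fun tau => a * Dgk (2 * m) t (e2pi tau) + 2 * b * Dgk (2 * m) t (yh tau)) tau
      (2 * PI * Ci * (a * Dgk (2 * m) (S t) (e2pi tau) + b * Dgk (2 * m) (S t) (yh tau)))).
    { assert (Pg := PS_pow_n t _ (PS_gk (2 * m))).
      eapply CD_eq. apply CD_plus; apply CD_scal.
      apply (CD_qseries _ (fun w => w) tau 1 Pg H (CD_id tau)).
      apply (CD_qseries _ (fun w => (w + 1) / 2) tau ((1 + 0) / 2) Pg (UH_half1 tau H)).
      apply CD_div, CD_plus. apply CD_id. apply CD_const.
      assert (Ex : forall x, psum (fun n => INR n * (INR n ^ t * gk (2 * m) n)) x = Dgk (2 * m) (S t) x).
      { intros x. apply psum_ext. intros n. rewrite Cpow_S. ring. }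
      rewrite !Ex. unfold yh. field. }
    assert (X := CD_unique _ _ _ _ D E). assert (N := TwoPiCi_nz).
    replace (g tau) with (/ (2 * PI * Ci) * (2 * PI * Ci * g tau)) by (field; split; [apply (UH_nz Ci UH_Ci)|apply PI_nz]).
    rewrite X. field. split; [apply (UH_nz Ci UH_Ci)|apply PI_nz].
Qed.

Lemma qm_lam K : mi_size K <> O -> qm (iw 1 K + mi_size K) (lam K).
Proof.
  intros H. assert (G := iw_ge 1 K ltac:(lia)). unfold lam. cbv zeta.
  replace (iw 1 K + mi_size K)%nat with (S (iw 1 K) + (mi_size K - 1))%nat by lia.
  apply qm_scal, qm_Dgk. lia.
Qed.

Lemma mf_one_mf : mf 0 mf_one.
Proof.
  assert (E : forall a b tau, UH tau -> Fn mf_one a b tau = 1).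
  { intros a b tau H. unfold Fn, mf_one. rewrite (psum_head 1 (fun _ => 0)); auto using PS_zero, nome_lt.
    change (psum (fun _ => 0) (nome tau)) with (Fn mf_zero a b tau). rewrite Fn_zero. ring. }
  apply mf_intro.
  - intros a b. apply (PS_head 1 (fun _ => 0)), PS_zero.
  - intros a b tau H. rewrite !E by auto using UH_inv_neg. simpl. ring.
  - intros a b tau H. now rewrite !E by auto using UH_plus_1.
Qed.

Lemma qm_one : qm 0 (fun _ => 1).
Proof.
  apply (qm_mf 0 mf_one). apply mf_one_mf. intros tau H. unfold Fn, mf_one.
  rewrite (psum_head 1 (fun _ => 0)); auto using PS_zero, nome_lt.
  change (psum (fun _ => 0) (nome tau)) with (Fn mf_zero true true tau). rewrite Fn_zero. ring.
Qed.

Lemma splits_limit w (l : list (multi_index * multi_index)) :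
  (forall J K, In (J, K) l -> exists f, qm w f /\ forall tau, UH tau ->
     Clim (fun N => character_partial N tau J * Lam N tau K) (m0 tau * f tau)) ->
  exists f, qm w f /\ forall tau, UH tau ->
     Clim (fun N => lsum (map (fun p => character_partial N tau (fst p) * Lam N tau (snd p)) l)) (m0 tau * f tau).
Proof.
  assert (FF : Filter (T := nat) eventually) by apply eventually_filter.
  intros H. induction l as [|[J K] l IH].
  - exists (fun _ => 0). split. apply qm_zero. intros tau _. rewrite Cmult_0_r. exact (flim_const eventually (RtoC 0)).
  - destruct IH as [f [Hf Lf]]. { intros J' K' HI. apply H. now right. }
    destruct (H J K (or_introl eq_refl)) as [g [Hg Lg]].
    exists (fun tau => g tau + f tau). split. eapply qm_plus; [exact Hg|exact Hf|reflexivity].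
    intros tau Ht. rewrite Cmult_plus_distr_l. exact (flim_plus _ _ _ _ _ (Lg tau Ht) (Lf tau Ht)).
Qed.

(** Induction on the degree: theta P = P Lam expresses |I| times the coefficient of the partial product at I
    by coefficients of lower degree, and the weights add up. *)
Lemma coefficient_limit I : exists f, qm (iw 1 I + mi_size I) f /\ forall tau, UH tau ->
  Clim (fun N => character_partial N tau I) (m0 tau * f tau).
Proof.
  assert (FF : Filter (T := nat) eventually) by apply eventually_filter.
  remember (mi_size I) as n eqn:Hn. revert I Hn. induction n as [n IH] using lt_wf_ind. intros I Hn.
  destruct (Nat.eq_dec n 0) as [->|N].
  - assert (Z : mi_is_zero I = true) by now apply mi_size_zero. destruct (iw_zero 1 I Z) as [-> _].
    exists (fun _ => 1). split. apply qm_one. intros tau H. rewrite Cmult_1_r. now apply character_zero_limit.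
  - destruct (splits_limit (iw 1 I + n) (mi_splits I)) as [f [Hf Lf]].
    + intros J K HI. destruct (mi_splits_in _ _ _ HI) as [E1 [E2 _]]. specialize (E2 (2 * 1 + 1)%nat). rewrite !mi_wt_iw in E2.
      destruct (Nat.eq_dec (mi_size K) 0) as [ZK|NK].
      * exists (fun _ => 0). split. apply qm_zero. intros tau H. rewrite Cmult_0_r.
        apply flim_ext with (fun _ => 0); auto. intros; rewrite Lam_zero by auto; ring. now apply flim_const.
      * destruct (IH (mi_size J) ltac:(lia) J eq_refl) as [g [Hg Lg]].
        exists (fun tau => g tau * lam K tau). split.
        replace (iw 1 I + n)%nat with ((iw 1 J + mi_size J) + (iw 1 K + mi_size K))%nat by lia.
        apply qm_mult; auto using qm_lam.
        intros tau H. rewrite Cmult_assoc. apply flim_mult; [auto|now apply Lg|now apply Lam_limit].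
    + exists (fun tau => / INR n * f tau). split. now apply qm_scal.
      assert (Nn : RtoC (INR n) <> 0) by (intros Q; apply RtoC_inj in Q; now apply not_0_INR in Q).
      intros tau H. replace (m0 tau * (/ INR n * f tau)) with (/ INR n * (m0 tau * f tau)) by ring.
      apply flim_ext with (fun N => / INR n * lsum (map (fun p => character_partial N tau (fst p) * Lam N tau (snd p)) (mi_splits I))); auto.
      2:{ apply flim_scal; [auto|now apply Lf]. }
      intros M. assert (X := f_equal (fun h : mps => h I) (th_character_partial M tau H)). cbv beta in X.
      unfold th in X. rewrite <- Hn in X. unfold mps_mul in X. fold (lsum (map (fun p => character_partial M tau (fst p) * Lam M tau (snd p)) (mi_splits I))) in X.
      rewrite <- X. field. auto.
Qed.

Theorem theorem5p1 :
  quasimodular_series (Gamma 4) (- (1 / 2))%R character_coeff.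
Proof.
  intros I. destruct (coefficient_limit I) as [f [Hf Lf]].
  unfold mi_wt. change 3%nat with (2 * 1 + 1)%nat. rewrite mi_wt_iw.
  apply (quasimodular_form_ext _ _ (fun tau => RtoC (INR (fact (mi_size I))) * e2pi (- (1) / 48) * mhalf true true tau * f tau)).
  - intros tau H. unfold character_coeff, generalized_character. rewrite (Clim_CLim_seq _ _ (Lf tau H)). unfold m0. ring.
  - now apply quasimodular_mhalf.
Qed.
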